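(* Let $d\in\{2,3\}$ and $k>0$, let $D\subset\mathbb{R}^d$ and the nonlinear contrast $q$ (with linear part $q_0$, exponent $\alpha>0$, and lower bound $q_{0,\min}>0$ of $q_0$ on $\overline D$) satisfy the assumptions listed in the context, let $\delta>0$ be admissible, and let $F$ be the associated nonlinear far field operator. Let $B\subseteq\mathbb{R}^d$ be open and bounded, and let \[ \rho:=\min\Bigl\{\frac{\delta}{\omega_{d-1}^{1/2}},\ \frac{1}{\omega_{d-1}^{1/2}}\Bigl(\frac{k^2q_{0,\min}}{2C}\Bigr)^{1/\alpha}\Bigr\}, \] where $C>0$ is a constant such that $\|T(f)-T_0f\|_{L^2(D)}\le C\|f\|_{L^\infty(D)}^\alpha\|f\|_{L^2(D)}$ for all $f\in\mathcal{D}(T)$ (such a constant exists). Then for any $0<\tilde\rho\le\rho$ the following characterization of $D$ holds. (a) If $B\subseteq D$, then there exists a finite dimensional subspace $\mathcal{V}\subseteq L^2(S^{d-1})$ such that, for all $\beta\le\frac{q_{0,\min}}{2}$, \[ \beta\,\langle P_Bg,g\rangle_{L^2(S^{d-1})}\ \le\ \operatorname{Re}\bigl(\langle F(g),g\rangle_{L^2(S^{d-1})}\bigr)\quad\text{for all } g\in\mathcal{V}^\perp \text{ with } \|g\|_{L^2(S^{d-1})}=\tilde\rho. \] (b) If $B\not\subseteq D$, then there is no finite dimensional subspace $\mathcal{V}\subseteq L^2(S^{d-1})$ and no $\beta>0$ such that \[ \beta\,\langle P_Bg,g\rangle_{L^2(S^{d-1})}\ \le\ \operatorname{Re}\bigl(\langle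 F(g),g\rangle_{L^2(S^{d-1})}\bigr)\quad\text{for all } g\in\mathcal{V}^\perp \text{ with } \|g\|_{L^2(S^{d-1})}=\tilde\rho. \]
   Context: Assumptions on $D$ and $q$. $D\subset\mathbb{R}^d$ is a bounded open set with Lipschitz boundary such that $\mathbb{R}^d\setminus\overline D$ is connected. The contrast $q\in L^\infty(\mathbb{R}^d\times\mathbb{R})$ is real-valued and satisfies: (1) $\operatorname{supp}(q)\subseteq\overline D\times\mathbb{R}$; (2) $q(x,0)=0$ for a.e. $x\in\mathbb{R}^d$; (3) there are $q_0\in L^\infty(\mathbb{R}^d)$ with $\operatorname{ess\,inf}q_0>-1$ and $\operatorname{supp}(q_0)=\overline D$, a parameter $\alpha>0$ and a constant $C_q>0$ such that for any $z_1,z_2\in\mathbb{C}$ with $|z_1|,|z_2|\le1$, $\|q(\cdot,|z_1|)z_1-q(\cdot,|z_2|)z_2-q_0(z_1-z_2)\|_{L^\infty(\mathbb{R}^d)}\le C_q(|z_1|^\alpha+|z_2|^\alpha)|z_1-z_2|$; (4) $0<q_{0,\min}\le q_0\le q_{0,\max}<\infty$ a.e. in $\overline D$ for some constants $q_{0,\min},q_{0,\max}>0$. Notation. $\Phi_k(x)=\frac{\mathrm{i}}{4}H_0^{(1)}(k|x|)$ if $d=2$, $\Phi_k(x)=e^{\mathrm{i}k|x|}/(4\pi|x|)$ if $d=3$. For a function $h$ on $D$, $(\Phi_k\ast h)(x):=\int_D\Phi_k(x-y)h(y)\,dy$. $S^{d-1}$ is the unit sphere with area $\omega_{d-1}$.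 $L^2$ spaces are complex with inner product $\langle a,b\rangle=\int a\overline b$. $U_\delta:=\{v\in L^\infty(D):\|v\|_{L^\infty(D)}\le\delta\}$. Linear solution operator. $I-k^2\Phi_k\ast(q_0\,\cdot)$ is an isomorphism on $L^2(D)$ and on $L^\infty(D)$; $V_0f:=(I-k^2\Phi_k\ast(q_0\,\cdot))^{-1}(k^2\Phi_k\ast(q_0f))$. Nonlinear solution operator. $\delta>0$ is admissible if for every $f\in U_\delta$ the equation $v(x)=k^2\int_D\Phi_k(x-y)q(y,|v(y)+f(y)|)(v(y)+f(y))\,dy$, $x\in D$, has a unique solution $v=:V(f)\in L^\infty(D)$ with $v-V_0f\in U_\delta$, and for some $C'>0$ and all $f\in U_\delta$: $\|V(f)\|_{L^\infty(D)}\le C'\|f\|_{L^\infty(D)}$, $\|V(f)\|_{L^2(D)}\le C'\|f\|_{L^2(D)}$, $\|V(f)-V_0f\|_{L^\infty(D)}\le C'\|f\|_{L^\infty(D)}^{1+\alpha}$, $\|V(f)-V_0f\|_{L^2(D)}\le C'\|f\|^\alpha_{L^\infty(D)}\|f\|_{L^2(D)}$. (Sufficiently small $\delta$ are admissible.) Operators. For an open bounded set $B$, $H_B:L^2(S^{d-1})\to L^2(B)$, $(H_B\psi)(x):=\int_{S^{d-1}}\psi(\theta)e^{\mathrm{i}kx\cdot\theta}\,ds(\theta)$, with adjoint $(H_B^*\phi)(\hat x)=\int_B\phi(y)e^{-\mathrm{i}k\hat x\cdot y}\,dy$; $H:=H_D$, which satisfies $\|H\psi\|_{L^\infty(D)}\le\omega_{d-1}^{1/2}\|\psi\|_{L^2(S^{d-1})}$.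 The probing operator is $P_B:=k^2H_B^*H_B$. $\mathcal{D}(F):=\{g\in L^2(S^{d-1}):\|g\|_{L^2(S^{d-1})}\le\delta/\omega_{d-1}^{1/2}\}$, $\mathcal{D}(T):=\overline{H(\mathcal{D}(F))}$ (closure in $L^2(D)$). $T(f):=k^2q(\cdot,|V(f)+f|)(V(f)+f)$ for $f\in\mathcal{D}(T)$ and $T_0f:=k^2q_0(f+V_0f)$, as functions on $D$. The nonlinear far field operator $F:\mathcal{D}(F)\to L^2(S^{d-1})$ maps $g$ to the far field pattern of $V(Hg)$, i.e. $F(g)=H^*T(Hg)$. $\mathcal{V}^\perp$ is the orthogonal complement in $L^2(S^{d-1})$. *)

(* Defs.v *)
From HB Require Import structures.
From mathcomp Require Import all_boot all_order all_algebra.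
From mathcomp Require Import all_classical all_reals all_analysis.
From mathcomp Require Import measurable_realfun ess_sup_inf hoelder complex.
Set Implicit Arguments. Unset Strict Implicit. Unset Printing Implicit Defensive.
Import Order.TTheory GRing.Theory Num.Theory.
Import numFieldNormedType.Exports.
Local Open Scope classical_set_scope. Local Open Scope ring_scope.

Section measurable_rV.
Context (R : realType) (n : nat).

Let coord (i : 'I_n) (x : 'rV[R]_n) : R := x 0 i.

Let rV_set0 : g_sigma_preimage coord set0.
Proof. exact: sigma_algebra0. Qed.

Let rV_setC A : g_sigma_preimage coord A -> g_sigma_preimage coord (~` A).
Proof. exact: sigma_algebraC. Qed.

Let rV_bigcup (F : _^nat) : (forall i, g_sigma_preimage coord (F i)) ->
  g_sigma_preimage coord (\bigcup_i (F i)).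
Proof. exact: sigma_algebra_bigcup. Qed.

HB.instance Definition _ := @isMeasurable.Build default_measure_display
  'rV[R]_n (g_sigma_preimage coord) rV_set0 rV_setC rV_bigcup.
End measurable_rV.

Section measurable_rV_fun.
Context (R : realType) d (T : measurableType d).

Lemma measurable_coord n (i : 'I_n) :
  measurable_fun [set: 'rV[R]_n] (fun x : 'rV[R]_n => x 0 i).
Proof.
move=> _ Y mY; rewrite setTI; apply: sub_sigma_algebra => /=.
rewrite -bigcup_seq/=; exists i => /=; first by rewrite mem_index_enum.
by exists Y => //; rewrite setTI.
Qed.

Lemma measurable_fun_rVP n (f : T -> 'rV[R]_n) :
  measurable_fun [set: T] f <->
  forall i, measurable_fun [set: T] (fun x => f x 0 i).
Proof.
apply: (@iff_trans _ (g_sigma_preimage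
    (fun i x => f x 0 i) `<=` measurable)).
  rewrite (@g_sigma_preimage_comp _ _ _ _ (fun i (x : 'rV[R]_n) => x 0 i)).
  split=> [mf A [/= C preC <-]|prefS].
    exact: mf.
  by move=> _ A mA; apply: prefS; exists A.
split=> [tnthfS i|mf].
- move=> _ A mA.
  apply: tnthfS; apply: sub_sigma_algebra.
  case: n i => [[] []//|n i] in f *.
  rewrite -bigcup_mkord_ord.
  exists i; first exact: ltn_ord.
  by exists A => //; rewrite inord_val.
- apply: smallest_sub; first exact: sigma_algebra_measurable.
  case: n => [|n] in f mf *; first by rewrite big_ord0.
  rewrite -bigcup_mkord_ord; apply: bigcup_sub => i Ii.
  by move=> A [B mB <-]; exact: mf.
Qed.
End measurable_rV_fun.

Definition pushforward_measure d1 d2 (T1 : measurableType d1)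
    (T2 : measurableType d2) (R : realType) (m : {measure set T1 -> \bar R})
    (f : T1 -> T2) (mf : measurable_fun setT f) : {measure set T2 -> \bar R} :=
  measure_function_pushforward__canonical__measure_function_Measure m mf.

Section lebesgue_rV.
Context (R : realType).

Definition cons_rV n (p : measurableTypeR R * 'rV[R]_n) : 'rV[R]_n.+1 :=
  \row_j oapp (p.2 0) p.1 (unlift ord0 j).

Definition uncons_rV n (x : 'rV[R]_n.+1) : measurableTypeR R * 'rV[R]_n :=
  (x 0 ord0, col' ord0 x).

Lemma cons_rVK n : cancel (@cons_rV n) (@uncons_rV n).
Proof.
move=> [a x]; congr pair; first by rewrite mxE unlift_none.
by apply/rowP => j; rewrite !mxE liftK.
Qed.

Lemma measurable_cons_rV n : measurable_fun setT (@cons_rV n).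
Proof.
apply/measurable_fun_rVP => i; case: (unliftP ord0 i) => [j ->|->].
  rewrite (_ : (fun _ => _) = (fun x : 'rV[R]_n => x 0 j) \o snd).
    by apply: measurableT_comp => //; exact: measurable_coord.
  by apply/funext => -[a x] /=; rewrite mxE liftK.
rewrite (_ : (fun _ => _) = fst) //.
by apply/funext => -[a x] /=; rewrite mxE unlift_none.
Qed.

Lemma measurable_uncons_rV n : measurable_fun setT (@uncons_rV n).
Proof.
apply: measurable_fun_pair; first exact: measurable_coord.
apply/measurable_fun_rVP => i.
rewrite (_ : (fun _ => _) = fun x : 'rV[R]_n.+1 => x 0 (lift ord0 i)).
  exact: measurable_coord.
by apply/funext => x; rewrite mxE.
Qed.

Section step.
Variables (n : nat) (mu : {sigma_finite_measure set 'rV[R]_n -> \bar R}).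

Definition lebesgue_rVS :=
  pushforward ((@lebesgue_measure R) \x mu)%E (@cons_rV n).

Let lebesgue_rVS0 : lebesgue_rVS set0 = 0%E.
Proof. exact: (measure0 (pushforward_measure _ (@measurable_cons_rV n))). Qed.

Let lebesgue_rVS_ge0 A : (0 <= lebesgue_rVS A)%E.
Proof. exact: (measure_ge0 (pushforward_measure _ (@measurable_cons_rV n))). Qed.

Let lebesgue_rVS_sigma_additive : semi_sigma_additive lebesgue_rVS.
Proof.
exact: (@measure_semi_sigma_additive _ _ _
  (pushforward_measure _ (@measurable_cons_rV n))).
Qed.

HB.instance Definition _ := isMeasure.Build _ _ _ lebesgue_rVS
  lebesgue_rVS0 lebesgue_rVS_ge0 lebesgue_rVS_sigma_additive.

Let lebesgue_rVS_sigma_finite : sigma_finite setT lebesgue_rVS.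
Proof.
have /sigma_finiteP[F [FT ndF Foo]] := sigma_finiteT (@lebesgue_measure R).
have /sigma_finiteP[G [GT ndG Goo]] := sigma_finiteT mu.
exists (fun i => @uncons_rV n @^-1` (F i `*` G i)).
  apply/seteqP; split=> x //= _.
  have [i _ Fi] : (\bigcup_i F i) (x 0 ord0) by rewrite -FT.
  have [j _ Gj] : (\bigcup_i G i) (col' ord0 x) by rewrite -GT.
  exists (maxn i j) => //; split=> /=.
  - by move: Fi; exact/subsetPset/ndF/leq_maxl.
  - by move: Gj; exact/subsetPset/ndG/leq_maxr.
move=> i; have [mF Fi] := Foo i; have [mG Gi] := Goo i; split.
  rewrite -[X in measurable X]setTI; apply: measurable_uncons_rV => //.
  exact: measurableX.
rewrite /lebesgue_rVS /pushforward -comp_preimage.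
rewrite (_ : _ \o _ = id); last by apply/funext => p; exact: cons_rVK.
rewrite preimage_id product_measure1E//.
by rewrite lte_mul_pinfty// ge0_fin_numE.
Qed.

HB.instance Definition _ := Measure_isSigmaFinite.Build _ _ _ lebesgue_rVS
  lebesgue_rVS_sigma_finite.
End step.

Fixpoint lebesgue_rV n : {sigma_finite_measure set 'rV[R]_n -> \bar R} :=
  if n is n'.+1 then lebesgue_rVS (lebesgue_rV n') else \d_(0 : 'rV[R]_0).

Lemma lebesgue_rV_box n (A : 'I_n -> set R) :
  (forall i, measurable (A i)) ->
  lebesgue_rV n [set x | forall i, A i (x 0 i)] =
  (\prod_(i < n) (@lebesgue_measure R) (A i))%E.
Proof.
elim: n A => [|n IH] A mA.
  by rewrite big_ord0 /= diracE mem_set// => -[].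
have mB : measurable [set x : 'rV[R]_n | forall i, A (lift ord0 i) (x 0 i)].
  rewrite (_ : [set x : 'rV[R]_n | forall i, A (lift ord0 i) (x 0 i)] =
      \bigcap_(i in [set: 'I_n]) [set x | A (lift ord0 i) (x 0 i)]).
    apply: fin_bigcap_measurable; first exact: finite_finset.
    by move=> i _; rewrite -[X in measurable X]setTI; exact: measurable_coord.
  by apply/seteqP; split=> x /= H i; [move=> _; exact: H|exact: H].
rewrite big_ord_recl /= -IH // /lebesgue_rVS/= /pushforward -product_measure1E//.
congr (product_measure1 _ _ _); apply/seteqP; split=> -[a x] /=.
  move=> H; split=> [|i].
    by have := H ord0; rewrite /= mxE unlift_none.
  by have := H (lift ord0 i); rewrite /= mxE liftK.
by move=> [H0 H] i; rewrite mxE; case: unliftP => [j ->|->] //=.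
Unshelve. exact: mA.
Qed.

End lebesgue_rV.

Section euclidean.
Context (R : realType) (d : nat).
Implicit Types x y : 'rV[R]_d.

Definition dotv x y : R := \sum_(i < d) x 0 i * y 0 i.

Definition enorm x : R := Num.sqrt (dotv x x).

Lemma measurable_enorm : measurable_fun setT enorm.
Proof.
rewrite (_ : enorm = fun x => powR (dotv x x) 2^-1).
  apply: (measurableT_comp (measurable_powR _)).
  apply: measurable_sum => i.
  by apply: measurable_funM; exact: measurable_coord.
apply/funext => x; rewrite powR12_sqrt// sumr_ge0// => i _.
by rewrite -expr2 sqr_ge0.
Qed.

Definition unit_sphere : set 'rV[R]_d := [set x | enorm x = 1].

Definition unit_ball : set 'rV[R]_d := [set x | enorm x <= 1].

Lemma measurable_unit_ball : measurable unit_ball.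
Proof.
rewrite (_ : unit_ball = setT `&` enorm @^-1` `]-oo, 1]).
  by apply: measurable_enorm.
by rewrite setTI; apply/seteqP; split=> x; rewrite /= in_itv.
Qed.

Definition normalize x : 'rV[R]_d := (enorm x)^-1 *: x.

Lemma measurable_normalize : measurable_fun setT normalize.
Proof.
apply/measurable_fun_rVP => i.
rewrite (_ : (fun _ => _) = fun x => powR (enorm x) (-1) * x 0 i).
  apply: measurable_funM; last exact: measurable_coord.
  exact: (measurableT_comp (measurable_powR _) measurable_enorm).
by apply/funext => x; rewrite mxE powR_inv1// sqrtr_ge0.
Qed.

(* Surface measure of the unit sphere through polar coordinates:
   |E| = d * Lebesgue {x | 0 < |x| <= 1, x / |x| \in E} for E in the sphere.
   The origin, where normalize takes the junk value 0, contributes only off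
   the sphere; integrals below are taken over unit_sphere. *)
Definition sphere_measure : {measure set 'rV[R]_d -> \bar R} :=
  mscale d%:R%:nng
   (pushforward_measure (mrestr (lebesgue_rV R d) measurable_unit_ball)
     measurable_normalize).

Definition sphere_area : R := fine (sphere_measure unit_sphere).

End euclidean.
Arguments unit_sphere {R d}.
Arguments sphere_measure {R d}.

(* "D is, near each boundary point and up to a rigid motion, the region above
   the graph of a Lipschitz function of d - 1 of the coordinates" *)
Definition lipschitz_boundary (R : realType) d (D : set 'rV[R]_d) : Prop :=
  forall x, (closure D `\` interior D) x ->
  exists (Q : 'M[R]_d) (i : 'I_d) (phi : 'rV[R]_d.-1 -> R) (r : R),
    [/\ Q *m Q^T = 1%:M, [lipschitz phi y | y in [set: 'rV[R]_d.-1]], 0 < r &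
     forall y, enorm (y - x) < r ->
       let z := (y - x) *m Q in D y <-> phi (col' i z) < z 0 i].

(* The support of an L^oo function: complement of the largest open set (w.r.t.
   the topology tau) on which it vanishes almost everywhere. *)
Definition ess_supp d (T : measurableType d) (R : realType)
    (mu : {measure set T -> \bar R}) (tau : set (set T)) (f : T -> R) : set T :=
  ~` \bigcup_(U in [set U | tau U /\ \forall x \ae mu, U x -> f x = 0]) U.

Section complex_Lp.
Context d (T : measurableType d) (R : realType).
Variables (mu : {measure set T -> \bar R}) (A : set T).
Implicit Types f g : T -> R[i].

Definition cmeasurable f : Prop :=
  measurable_fun A (fun x => complex.Re (f x)) /\ measurable_fun A (fun x => complex.Im (f x)).

Definition cintegral f : R[i] :=
  Complex (\int[mu]_(x in A) complex.Re (f x)) (\int[mu]_(x in A) complex.Im (f x)).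

(* norm of L^p(A); for p = +oo it is 0 when mu is the zero measure *)
Definition cLnorm (p : \bar R) f : \bar R :=
  'N[mu]_p[(fun x => (Normc.normc (f x))%:E) \_ A]%E.

(* membership in L^p(A); elements of L^p(A) are represented by functions,
   considered up to equality almost everywhere on A *)
Definition cLspace (p : \bar R) : set (T -> R[i]) :=
  [set f | cmeasurable f /\ (cLnorm p f < +oo)%E].

Definition cinner f g : R[i] := cintegral (fun x => f x * conjc (g x)).

Definition fin_dim_subspace (V : set (T -> R[i])) : Prop :=
  exists (m : nat) (w : 'I_m -> T -> R[i]),
    (forall i, cLspace 2%:E (w i)) /\
    V = [set v | cLspace 2%:E v /\ exists c : 'I_m -> R[i],
          \forall x \ae mu, A x -> v x = \sum_(i < m) c i * w i x].

Definition L2_ortho (V : set (T -> R[i])) : set (T -> R[i]) :=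
  [set g | cLspace 2%:E g /\ forall v, V v -> cinner g v = 0].

End complex_Lp.

Section fundamental_solution.
Context (R : realType).

Definition cis (t : R) : R[i] := Complex (cos t) (sin t).

Definition euler_gamma : R :=
  limn (fun n => series harmonic n - ln n%:R : R).

Definition besselJ0 (t : R) : R :=
  limn (series (fun m => (-1) ^+ m / (m`!%:R ^+ 2) * (t / 2) ^+ (2 * m))).

(* DLMF 10.8.2 at order 0; series harmonic m = 1 + 1/2 + ... + 1/m *)
Definition besselY0 (t : R) : R :=
  2 / pi * ((ln (t / 2) + euler_gamma) * besselJ0 t +
    limn (series (fun m => (-1) ^+ m.+1 * series harmonic m / (m`!%:R ^+ 2)
                            * (t / 2) ^+ (2 * m)))).

Definition hankel0 (t : R) : R[i] := Complex (besselJ0 t) (besselY0 t).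

(* meaningful for d = 2 and d = 3 only *)
Definition fund_sol d (k : R) (x : 'rV[R]_d) : R[i] :=
  if d == 2%N then Complex 0 (4^-1) * hankel0 (k * enorm x)
  else ((4 * pi * enorm x)^-1)%:C%C * cis (k * enorm x).

End fundamental_solution.

Section assumptions.
Context (R : realType) (d : nat).

Let mu := lebesgue_rV R d.
Let mu1 := (mu \x (@lebesgue_measure R))%E.

Definition scatterer (D : set 'rV[R]_d) : Prop :=
  [/\ open D, bounded_set D, lipschitz_boundary D & connected (~` closure D)].

Definition contrast (D : set 'rV[R]_d) (q : 'rV[R]_d * R -> R)
    (q0 : 'rV[R]_d -> R) (alpha q0min : R) : Prop :=
  [/\ measurable_fun setT q /\ ('N[mu1]_+oo[EFin \o q] < +oo)%E,
      ess_supp mu1 (open : set (set ('rV[R]_d * R))) q `<=` closure D `*` setT,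
      \forall x \ae mu, q (x, 0) = 0,
      [/\ measurable_fun setT q0 /\ ('N[mu]_+oo[EFin \o q0] < +oo)%E,
          ((-1)%:E < ess_inf mu (EFin \o q0))%E,
          ess_supp mu open q0 = closure D,
          0 < alpha &
          exists2 Cq : R, 0 < Cq & forall z1 z2 : R[i],
            Normc.normc z1 <= 1 -> Normc.normc z2 <= 1 ->
            (cLnorm mu setT +oo (fun x =>
               ((q (x, Normc.normc z1))%:C%C * z1
               - (q (x, Normc.normc z2))%:C%C * z2
               - (q0 x)%:C%C * (z1 - z2))%R)
             <= (Cq * (Normc.normc z1 `^ alpha + Normc.normc z2 `^ alpha)
                 * Normc.normc (z1 - z2))%R%:E)%E] &
      0 < q0min /\ exists q0max : R,
        \forall x \ae mu, closure D x -> q0min <= q0 x <= q0max].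

End assumptions.

Section scattering.
Context (R : realType) (d : nat) (k : R).
Context (D : set 'rV[R]_d) (q : 'rV[R]_d * R -> R) (q0 : 'rV[R]_d -> R).
Context (alpha delta : R).
Implicit Types (f v g : 'rV[R]_d -> R[i]) (B : set 'rV[R]_d).

Let mu := lebesgue_rV R d.
Let k2 : R[i] := (k ^+ 2)%:C%C.
Let L2 f := cLnorm mu D 2%:E f.
Let Loo f := cLnorm mu D +oo f.

Definition volume_potential h (x : 'rV[R]_d) : R[i] :=
  cintegral mu D (fun y => fund_sol k (x - y) * h y).

(* the solution v of v - k^2 Phi_k * (q0 v) = k^2 Phi_k * (q0 f) in L^2(D),
   unique almost everywhere in D since I - k^2 Phi_k * (q0 .) is invertible *)
Definition op_V0 f : 'rV[R]_d -> R[i] :=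
  xget (cst 0) [set v | cLspace mu D 2%:E v /\
    \forall x \ae mu, D x ->
      v x - k2 * volume_potential (fun y => (q0 y)%:C%C * v y) x
      = k2 * volume_potential (fun y => (q0 y)%:C%C * f y) x].

Definition Udelta : set ('rV[R]_d -> R[i]) :=
  [set v | cLspace mu D +oo v /\ (Loo v <= delta%:E)%E].

Definition nonlinear_source f v (y : 'rV[R]_d) : R[i] :=
  (q (y, Normc.normc (v y + f y)))%:C%C * (v y + f y).

Definition nonlinear_solution f : set ('rV[R]_d -> R[i]) :=
  [set v | [/\ cLspace mu D +oo v,
    \forall x \ae mu, D x ->
      v x = k2 * volume_potential (nonlinear_source f v) x &
    Udelta (fun x => v x - op_V0 f x)]].

Definition op_V f : 'rV[R]_d -> R[i] := xget (cst 0) (nonlinear_solution f).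

Definition admissible : Prop :=
  [/\ 0 < delta,
      forall f, Udelta f ->
        nonlinear_solution f !=set0 /\
        forall v w, nonlinear_solution f v -> nonlinear_solution f w ->
          \forall x \ae mu, D x -> v x = w x &
      exists2 C' : R, 0 < C' & forall f, Udelta f ->
        [/\ (Loo (op_V f) <= C'%:E * Loo f)%E,
            (L2 (op_V f) <= C'%:E * L2 f)%E,
            (Loo (fun x => (op_V f x - op_V0 f x)%R) <= C'%:E * Loo f `^ (1 + alpha))%E &
            (L2 (fun x => (op_V f x - op_V0 f x)%R)
               <= C'%:E * Loo f `^ alpha * L2 f)%E]].

(* H_B psi is the restriction to B of herglotz psi *)
Definition herglotz (psi : 'rV[R]_d -> R[i]) (x : 'rV[R]_d) : R[i] :=
  cintegral sphere_measure unit_sphere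
    (fun theta => psi theta * cis (k * dotv x theta)).

(* H_B^* *)
Definition herglotz_adj B (phi : 'rV[R]_d -> R[i]) (xhat : 'rV[R]_d) : R[i] :=
  cintegral mu B (fun y => phi y * cis (- (k * dotv xhat y))).

Definition probing B g (xhat : 'rV[R]_d) : R[i] :=
  k2 * herglotz_adj B (herglotz g) xhat.

Definition dom_F : set ('rV[R]_d -> R[i]) :=
  [set g | cLspace sphere_measure unit_sphere 2%:E g /\
    (cLnorm sphere_measure unit_sphere 2%:E g
      <= (delta / Num.sqrt (sphere_area R d))%:E)%E].

Definition dom_T : set ('rV[R]_d -> R[i]) :=
  [set f | cLspace mu D 2%:E f /\
    forall eps : R, 0 < eps -> exists2 g, dom_F g &
      (L2 (fun x => (f x - herglotz g x)%R) < eps%:E)%E].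

Definition op_T f (x : 'rV[R]_d) : R[i] := k2 * nonlinear_source f (op_V f) x.

Definition op_T0 f (x : 'rV[R]_d) : R[i] := k2 * (q0 x)%:C%C * (f x + op_V0 f x).

(* the far field pattern of op_V (H g) = Phi_k * T (H g) *)
Definition far_field g : 'rV[R]_d -> R[i] := herglotz_adj D (op_T (herglotz g)).

End scattering.

(* Main.v *)
Require Import Defs.
From HB Require Import structures.
From mathcomp Require Import all_boot all_order all_algebra.
From mathcomp Require Import all_classical all_reals all_analysis.
From mathcomp Require Import measurable_realfun ess_sup_inf hoelder complex.
From mathcomp Require Import zify ring lra.
Set Implicit Arguments. Unset Strict Implicit. Unset Printing Implicit Defensive.
Import Order.TTheory GRing.Theory Num.Theory.
Import numFieldNormedType.Exports.
Local Open Scope classical_set_scope. Local Open Scope ring_scope.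

(* (a) Put f = H g.  Then Re <F g, g> = Re <T f, f>_D, and T f differs from
   T0 f = k^2 q0 (f + V0 f) by at most C |f|_oo^alpha |f|_2.  Since Phi_k is
   locally square integrable, x |-> Phi_k (x - .) is uniformly continuous into
   L^2(D), so that V0 f = k^2 Phi_k * (q0 (f + V0 f)) is constant on each cell
   D_j of a fine partition of D, up to a small multiple of |f|_2.  Let V be
   spanned by the waves exp (- i k x_j . theta), with x_j in D_j, and by
   H^* (q0 1_{D_j}).  If g is orthogonal to V, then f vanishes at every x_j,
   hence is uniformly small on D, and is orthogonal to q0 times any cellwise
   constant function; what is left is k^2 <q0 f, f> >= k^2 q0min |f|^2.

   (b) Here Re <F g, g> <= K |H g|_D^2, so it suffices to find g in V^perp for
   which |H g|_B^2 is much larger than |H g|_D^2.  As D is Lipschitz, B contains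
   a ball off the closure of D.  Choose more than dim V small disjoint cubes in
   it, and next to each a pole: the second directional derivative of the radial
   solution of the Helmholtz equation with this pole is huge on its cube and
   small on D and on the other cubes.  These functions are uniform limits of
   Herglotz waves on D and the cubes: a radial solution with a distant pole is a
   limit of superpositions of plane waves, and Taylor expansion in the pole moves
   it through the connected complement.  Some combination of these waves lies in
   V^perp, and its largest coefficient makes it large on one of the cubes. *)

(** * Taylor coefficients and uniform limits *)

(** Why a second derivative in (b): a function of size e^(-m) on a cube of side e has square
    integral of order e^(d-2m). For d = 2 this stays bounded when m = 1, so a pole and its first
    derivatives do not separate the cube from [D]; the second derivatives, with m = d, do so in both
    dimensions. One principle carries all the approximations. A set of functions closed under real
    linear combinations and uniform limits contains the Taylor coefficients of every analytic family
    that it contains, and the sum of every power series whose coefficients it contains, provided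
    that the remainders decay geometrically and uniformly. It moves a pole, differentiates in the
    pole, and turns plane waves into monomials along an axis. In (a) a quantitative modulus of
    continuity plays the part of compactness. The superlinear part of [op_T] and the cellwise
    approximation may each cost k^2 (q0min / 4) |f|^2, which leaves the factor q0min / 2. All L^2
    estimates use the real form Re <f, g>; a complex orthogonality is two real ones. *)

Section real_derivatives.
Context (R : realType).
Implicit Types (f g : R -> R) (x a b : R).

Lemma dvD f g x a b : is_derive x 1 f a -> is_derive x 1 g b ->
  is_derive x 1 (fun u => f u + g u) (a + b).
Proof. by move=> fa gb; exact: is_deriveD. Qed.

Lemma dvB f g x a b : is_derive x 1 f a -> is_derive x 1 g b ->
  is_derive x 1 (fun u => f u - g u) (a - b).
Proof. by move=> fa gb; exact: is_deriveB. Qed.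

Lemma dvN f x a : is_derive x 1 f a -> is_derive x 1 (fun u => - f u) (- a).
Proof. by move=> fa; exact: is_deriveN. Qed.

Lemma dvM f g x a b : is_derive x 1 f a -> is_derive x 1 g b ->
  is_derive x 1 (fun u => f u * g u) (a * g x + f x * b).
Proof.
move=> fa gb; have h := @is_deriveM _ _ f g x 1 a b fa gb.
apply: (is_derive_eq h); rewrite addrC; congr (_ + _); exact: mulrC.
Qed.

Lemma dvC x (c : R) : is_derive x 1 (fun _ : R => c) 0.
Proof. exact: is_derive_cst. Qed.

Lemma dv_id x : is_derive x 1 (fun u : R => u) 1.
Proof. exact: is_derive_id. Qed.

Lemma dv_eq f x a b : is_derive x 1 f a -> a = b -> is_derive x 1 f b.
Proof. by move=> fa <-. Qed.

Lemma dvZ f (c : R) x a : is_derive x 1 f a -> is_derive x 1 (fun u => c * f u) (c * a).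
Proof. by move=> fa; apply: dv_eq (dvM (dvC x c) fa) _; rewrite mul0r add0r. Qed.

Lemma dvX f n x a : is_derive x 1 f a ->
  is_derive x 1 (fun u => f u ^+ n) (n%:R * f x ^+ n.-1 * a).
Proof.
move=> fa; elim: n => [|n IH].
  by apply: (dv_eq (dvC x 1)); rewrite !mul0r.
have := dvM fa IH; rewrite (_ : (fun u => _) = fun u => f u ^+ n.+1).
  move=> /dv_eq; apply; case: n {IH} => [|n] /=; first by rewrite !expr0; ring.
  by rewrite !exprS -[in RHS]natr1 -[in LHS]natr1; ring.
by apply/funext => u; rewrite exprS.
Qed.

Lemma dv_comp f g x a b : is_derive (g x) 1 f a -> is_derive x 1 g b ->
  is_derive x 1 (fun u => f (g u)) (a * b).
Proof. by move=> fa gb; exact: is_derive1_comp. Qed.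

Lemma dv_ext f g x a : (\forall u \near x, f u = g u) ->
  is_derive x 1 f a -> is_derive x 1 g a.
Proof. exact: near_eq_is_derive. Qed.

Lemma dv_fun f g x a : f =1 g -> is_derive x 1 f a -> is_derive x 1 g a.
Proof. by move=> /funext ->. Qed.

Lemma dv_continuous f x a : is_derive x 1 f a -> {for x, continuous f}.
Proof. by move=> [fx _]; apply: differentiable_continuous; exact/derivable1_diffP. Qed.

Lemma dv_unique f x a b : is_derive x 1 f a -> is_derive x 1 f b -> a = b.
Proof. by move=> [_ <-] [_ <-]. Qed.

Lemma MVT_bound f df (a b C : R) :
  (forall u, Num.min a b <= u <= Num.max a b -> is_derive u 1 f (df u)) ->
  (forall u, Num.min a b <= u <= Num.max a b -> `|df u| <= C) ->
  `|f b - f a| <= C * `|b - a|.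
Proof.
wlog ab : a b / a <= b.
  move=> H fd dC; have [/H|/ltW ba] := leP a b; first exact.
  rewrite distrC [`|b - a|]distrC; apply: H => //.
    by rewrite minC maxC.
  by rewrite minC maxC.
rewrite (min_idPl ab) (max_idPr ab) => fd dC.
have fd' u : u \in `]a, b[ -> is_derive u 1 f (df u).
  by rewrite in_itv/= => /andP[au ub]; apply: fd; rewrite !ltW.
have [|c cab ->] := MVT_segment ab fd'.
  apply: derivable_within_continuous => u; rewrite in_itv/= => uab.
  by have [] := fd u uab.
rewrite normrM ler_wpM2r// dC//.
Qed.

End real_derivatives.

(* A sequence [f n] in which [f n] plays the role of the n-th derivative of
   [f 0] divided by n!. *)
Definition tower (R : realType) (I : set R) (f : nat -> R -> R) : Prop :=
  forall n x, I x -> is_derive x 1 (f n) (n.+1%:R * f n.+1 x).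

Section towers.
Context (R : realType).
Implicit Types (I : set R) (f : nat -> R -> R).

(** The Taylor polynomial at x, seen as a function of its base point u, has a derivative in which
    all terms cancel except N f_N(u) (x - u)^(N-1); the mean value inequality concludes. The loss of
    the factor [N.+1] is harmless against geometric decay. *)
Lemma tower_taylor I f N (x0 x C : R) : tower I f ->
  (forall u, Num.min x0 x <= u <= Num.max x0 x -> I u) ->
  (forall u, Num.min x0 x <= u <= Num.max x0 x -> `|f N u| <= C) ->
  `|f 0%N x - \sum_(n < N) f n x0 * (x - x0) ^+ n|
    <= N.+1%:R * C * `|x - x0| ^+ N.
Proof.
move=> tf xI fC.
have x0m : Num.min x0 x <= x0 <= Num.max x0 x by rewrite ge_min lexx le_max lexx.
have xm : Num.min x0 x <= x <= Num.max x0 x.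
  by rewrite ge_min lexx orbT le_max lexx orbT.
case: N fC => [|N] fC.
  by rewrite big_ord0 subr0 expr0 mulr1 mul1r fC.
have C0 : 0 <= C by exact: le_trans (fC _ xm).
pose g u := \sum_(n < N.+1) f n u * (x - u) ^+ n.
have gx : g x = f 0%N x.
  rewrite /g big_ord_recl subrr expr0 mulr1 big1 ?addr0// => i _.
  by rewrite expr0n mulr0.
have dg u : Num.min x0 x <= u <= Num.max x0 x ->
    is_derive u 1 g (N.+1%:R * f N.+1 u * (x - u) ^+ N).
  move=> /xI uI; rewrite /g; elim: N {fC gx g} => [|N IH].
    apply: (@dv_fun _ (f 0%N) _ u).
      by move=> v; rewrite big_ord1 expr0 mulr1.
    by apply: dv_eq (tf _ _ uI) _; rewrite expr0 mulr1.
  apply: (@dv_fun _ (fun v => \sum_(n < N.+1) f n v * (x - v) ^+ n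
                      + f N.+1 v * (x - v) ^+ N.+1) _ u).
    by move=> v; rewrite [RHS]big_ord_recr.
  apply: dv_eq (dvD IH (dvM (tf _ _ uI) (dvX N.+1 (dvB (dvC u x) (dv_id u))))) _.
  by rewrite /= exprS; ring.
rewrite -gx -/(g x0).
apply: le_trans (MVT_bound dg (C := N.+1%:R * C * `|x - x0| ^+ N) _) _.
  move=> u um; rewrite !normrM normrX ger0_norm// !ler_pM ?mulr_ge0 ?exprn_ge0//.
    exact: fC.
  rewrite lerXn2r ?nnegrE//.
  move: um; have [h|/ltW h] := leP x0 x.
    move=> /andP[h1 h2].
    by rewrite !ger0_norm ?subr_ge0// lerB.
  move=> /andP[h1 h2].
  by rewrite !ler0_norm ?subr_le0// !opprB lerB.
by rewrite -mulrA -exprSr ler_wpM2r ?exprn_ge0// ler_wpM2r// ler_nat.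
Qed.

(** Reduces an identity between Taylor coefficients of all orders to its case of order 0. *)
Lemma tower_unique I f g : open I -> tower I f -> tower I g ->
  {in I, f 0%N =1 g 0%N} -> forall n, {in I, f n =1 g n}.
Proof.
move=> oI tf tg fg; elim=> // n IH x xI.
have := tf n x (set_mem xI); have := tg n x (set_mem xI).
move=> gx fx; have {}gx : is_derive x 1 (f n) (n.+1%:R * g n.+1 x).
  apply: dv_ext gx; have : \near x, I x by exact: open_nbhs_nbhs (conj oI (set_mem xI)).
  by apply: filterS => u uI; rewrite IH ?inE.
by apply: (mulfI _ (dv_unique fx gx)); rewrite pnatr_eq0.
Qed.

End towers.

(** A closed linear subspace for the sup norm on [E], whose members need not be bounded. Only values
    on [E] matter, as [ucl_ext] shows. *)
Definition uniformly_closed (R : realType) X (E : set X) (S : set (X -> R)) : Prop :=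
  (forall f g (a b : R), S f -> S g -> S (fun x => a * f x + b * g x)) /\
  (forall f, (forall e : R, 0 < e -> exists2 g, S g & forall x, E x -> `|f x - g x| <= e) ->
     S f).

Section uniformly_closed.
Context (R : realType) (X : Type) (E : set X) (S : set (X -> R)).
Hypothesis SE : uniformly_closed E S.

Lemma ucl_ext f g : S f -> (forall x, E x -> f x = g x) -> S g.
Proof.
move=> Sf fg; apply SE.2 => e e0; exists f => // x Ex.
by rewrite fg// subrr normr0 ltW.
Qed.

Lemma ucl_sum (f0 : X -> R) : S f0 -> forall N (a : nat -> R) (f : nat -> X -> R),
  (forall n, (n < N)%N -> S (f n)) -> S (fun x => \sum_(n < N) a n * f n x).
Proof.
move=> Sf0; elim=> [|N IH] a f Sf.
  apply: (ucl_ext (SE.1 f0 f0 0 0 Sf0 Sf0)) => x _.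
  by rewrite big_ord0 !mul0r addr0.
have SN : S (fun x => \sum_(n < N) a n * f n x).
  by apply: IH => n nN; apply: Sf; rewrite ltnW.
apply: (ucl_ext (SE.1 _ _ 1 (a N) SN (Sf N (ltnSn N)))) => x _.
by rewrite big_ord_recr /= mul1r.
Qed.

Lemma geometric_small (r e : R) : 0 <= r < 1 -> 0 < e -> exists N, r ^+ N < e.
Proof.
move=> /andP[r0 r1] e0.
have : (fun n => r ^+ n) @ \oo --> 0 by apply: cvg_expr; rewrite ger0_norm.
by move=> /cvgrPdist_lt/(_ _ e0)[N _ /(_ N (leqnn N))]; rewrite sub0r normrN
  ger0_norm ?exprn_ge0// => h; exists N.
Qed.

Variables (c : nat -> X -> R) (f : R -> X -> R) (r C : R).
Hypotheses (r0 : 0 < r) (C0 : 0 <= C).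

(** By induction: [c m.+1] is the uniform limit, as t tends to 0, of the divided remainder (f t -
    sum_(n <= m) c n t^n) / t^(m+1), which is a combination of members of [S]. *)
Lemma power_series_coef (t0 : R) : 0 < t0 ->
  (forall N (t : R) x, E x -> 0 < t < t0 ->
     `|f t x - \sum_(n < N) c n x * t ^+ n| <= C * (t / r) ^+ N) ->
  (forall t : R, 0 < t < t0 -> S (f t)) -> forall n, S (c n).
Proof.
move=> t00 fc Sf n; elim: n {-2}n (leqnn n) => [|m IHm] n.
  rewrite leqn0 => /eqP ->; apply SE.2 => e e0.
  pose t := Num.min (t0 / 2) (e * r / (C + 1)).
  have t_gt0 : 0 < t by rewrite lt_min !divr_gt0// ?mulr_gt0// ltr_wpDl.
  have tt0 : t < t0 by rewrite gt_min ltr_pdivrMr// ltr_pMr// ltr1n.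
  exists (f t) => [|x Ex]; first by apply: Sf; rewrite t_gt0.
  have := fc 1%N t x Ex; rewrite t_gt0 tt0 => /(_ isT).
  rewrite big_ord1 expr0 mulr1 expr1 distrC => /le_trans; apply.
  rewrite mulrA ler_pdivrMr//.
  apply: (@le_trans _ _ ((C + 1) * t)); first by rewrite ler_wpM2r ?lerDl// ltW.
  by rewrite mulrC -ler_pdivlMr ?ltr_wpDl// ge_min lexx orbT.
rewrite leq_eqVlt ltnS => /predU1P[->|/IHm //].
apply SE.2 => e e0.
(* The divided remainder differs from [c m.+1] by at most C t / r^(m+2); [C + 1] avoids a division
   by zero. *)
pose t := Num.min (t0 / 2) (e * r ^+ m.+2 / (C + 1)).
have C1 : 0 < C + 1 by rewrite ltr_wpDl.
have t_gt0 : 0 < t by rewrite lt_min divr_gt0//= divr_gt0// mulr_gt0// exprn_gt0.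
have tt0 : t < t0 by rewrite gt_min ltr_pdivrMr// ltr_pMr// ltr1n.
have tI : 0 < t < t0 by rewrite t_gt0.
have tm0 : 0 < t ^+ m.+1 by rewrite exprn_gt0.
exists (fun x => (t ^+ m.+1)^-1 * f t x
   + (- (t ^+ m.+1)^-1) * \sum_(n < m.+1) t ^+ n * c n x).
  apply SE.1; first exact: Sf.
  by apply: (ucl_sum (Sf _ tI)) => k km; apply: IHm.
move=> x Ex.
have -> : c m.+1 x - (t ^- m.+1 * f t x + - t ^- m.+1 * \sum_(n < m.+1) t ^+ n * c n x)
   = - t ^- m.+1 * (f t x - \sum_(n < m.+2) c n x * t ^+ n).
  have -> : \sum_(n < m.+1) t ^+ n * c n x = \sum_(n < m.+1) c n x * t ^+ n.
    by apply: eq_bigr => i _; rewrite mulrC.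
  rewrite [X in _ = _ * (_ - X)]big_ord_recr /=.
  set s := \sum_(n < m.+1) _; set u := t ^+ m.+1.
  by field; exact: lt0r_neq0.
rewrite normrM normrN normfV (gtr0_norm tm0) mulrC ler_pdivrMr//.
apply: le_trans (fc _ _ _ Ex tI) _.
rewrite expr_div_n [leLHS]mulrA ler_pdivrMr ?exprn_gt0//.
rewrite exprS [leLHS]mulrA [leRHS]mulrAC.
apply: ler_wpM2r; first exact: ltW.
apply: (@le_trans _ _ ((C + 1) * t)); first by rewrite ler_wpM2r ?lerDl// ltW.
by rewrite mulrC -ler_pdivlMr// ge_min lexx orbT.
Qed.

Lemma power_series_sum (t : R) : (forall n, S (c n)) -> 0 <= t < r ->
  (forall N x, E x -> `|f t x - \sum_(n < N) c n x * t ^+ n| <= C * (t / r) ^+ N) ->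
  S (f t).
Proof.
move=> Sc /andP[t_ge0 tr] fc; apply SE.2 => e e0.
have [||N hN] := @geometric_small (t / r) (e / (C + 1)).
- by rewrite divr_ge0 ?(ltW r0)//= ltr_pdivrMr// mul1r.
- by rewrite divr_gt0// ltr_wpDl.
exists (fun x => \sum_(n < N) t ^+ n * c n x); first exact: (ucl_sum (Sc 0%N)).
move=> x Ex; under eq_bigr do rewrite mulrC.
apply: le_trans (fc _ _ Ex) _.
move: hN; rewrite ltr_pdivlMr ?ltr_wpDl// mulrC => /ltW; apply: le_trans.
by rewrite ler_wpM2r ?exprn_ge0 ?divr_ge0 ?(ltW r0)// lerDl.
Qed.

End uniformly_closed.

(** * Radial solutions of the Helmholtz equation *)

Ltac field_side := repeat (apply/andP; split); first [done | apply: lt0r_neq0; lra].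

Section radial_tower.
Context (R : realType) (d : nat) (k : R) (F0 F1 : R -> R).

(* The Taylor coefficients at [q] of a solution [F] of
   [4 q F'' + 2 d F' + k^2 F = 0], the equation satisfied by [F] when
   [F (|x|^2)] solves the Helmholtz equation in dimension [d]. *)
Fixpoint radial m (q : R) : R :=
  match m with
  | 0 => F0 q
  | m'.+1 => match m' with
    | 0 => F1 q
    | m''.+1 => - ((2 * d + 4 * m'')%:R * m'%:R * radial m' q
                   + k ^+ 2 * radial m'' q) / (4 * q * m'.+1%:R * m'%:R)
    end
  end.

Lemma radialSS m q : radial m.+2 q =
  - ((2 * d + 4 * m)%:R * m.+1%:R * radial m.+1 q + k ^+ 2 * radial m q)
    / (4 * q * m.+2%:R * m.+1%:R).
Proof. by []. Qed.

Arguments radial : simpl never.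

Definition radial_solution : Prop := forall q : R, 0 < q ->
  is_derive q 1 F0 (F1 q) /\ is_derive q 1 F1 (2 * radial 2 q).

Hypothesis F01 : radial_solution.

Lemma radial_tower : tower [set q | 0 < q] radial.
Proof.
move=> n q /= q0; have [dF0 dF1] := F01 q0.
suff [] : is_derive q 1 (radial n) (n.+1%:R * radial n.+1 q) /\
  is_derive q 1 (radial n.+1) (n.+2%:R * radial n.+2 q) by [].
elim: n => [|n [IH1 IH2]]; first by split; rewrite ?mul1r.
split; first exact: IH2.
have qn0 : q != 0 by rewrite gt_eqF.
have dinv : is_derive q 1 (fun u : R => u^-1) (- q ^- 2).
  by apply: (dv_eq (is_deriveV _ _)) => //; rewrite scaler1.
have := dvZ (- (4 * n.+2%:R * n.+1%:R)^-1) (dvM (dvD (dvZ ((2 * d + 4 * n)%:R * n.+1%:R) IH2)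
  (dvZ (k ^+ 2) IH1)) dinv).
move=> /(dv_fun (g := radial n.+2)) h.
apply: (dv_eq (h _)) => [u|] /=; rewrite !radialSS.
  have [->|u0] := eqVneq u 0; first by rewrite !invr0 !mulr0 !mul0r invr0 !mulr0.
  by have n0 := ler0n R n; field; field_side.
by have n0 := ler0n R n; field; field_side.
Qed.

(** For u_i = |radial i q| q^i the recursion gives u_(i+2) <= u_(i+1) + K / ((i+2)(i+1)) u_i,
    because 2d + 4i <= 4(i+2) when d <= 4. The increments are summable, so the Taylor series at q
    converges up to the singularity at 0. *)
Lemma radial_bound (q : R) m : (d <= 4)%N -> 0 < q ->
  `|radial m q| * q ^+ m <=
    expR (k ^+ 2 * q / 4) * Num.max `|F0 q| (`|F1 q| * q).
Proof.
move=> d4 q0; set K := k ^+ 2 * q / 4; set M := Num.max _ _.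
have K0 : 0 <= K by rewrite divr_ge0// mulr_ge0// ?sqr_ge0// ltW.
have M0 : 0 <= M by rewrite le_max normr_ge0.
pose u i := `|radial i q| * q ^+ i.
(* The exponent grows by K (1/(i+1) - 1/(i+2)) = K / ((i+1)(i+2)) at each step, which pays for the
   factor 1 + K / ((i+1)(i+2)). *)
suff h : forall i, u i <= expR (K * (1 - i.+1%:R^-1)) * M /\
    u i.+1 <= expR (K * (1 - i.+1%:R^-1)) * M.
  have [h1 _] := h m; apply: le_trans h1 _.
  rewrite ler_wpM2r// ler_expR ler_piMr// lerBlDr lerDl invr_ge0//.
have us i : u i.+2 <= u i.+1 + K / (i.+2%:R * i.+1%:R) * u i.
  rewrite /u radialSS normrM normrN normfV.
  rewrite [`|4 * q * _ * _|]ger0_norm ?mulr_ge0// ?(ltW q0)//.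
  apply: (@le_trans _ _ (((2 * d + 4 * i)%:R * i.+1%:R * `|radial i.+1 q| + k ^+ 2 * `|radial i q|)
     / (4 * q * i.+2%:R * i.+1%:R) * q ^+ i.+2)).
    apply: ler_wpM2r; first by rewrite exprn_ge0// ltW.
    apply: ler_wpM2r; first by rewrite invr_ge0 ?mulr_ge0// ?(ltW q0)//.
    apply: le_trans (ler_normD _ _) _.
    by rewrite [`|k ^+ 2 * _|]normrM (ger0_norm (sqr_ge0 k)) 2!normrM !normr_nat.
  have -> : ((2 * d + 4 * i)%:R * i.+1%:R * `|radial i.+1 q| + k ^+ 2 * `|radial i q|)
     / (4 * q * i.+2%:R * i.+1%:R) * q ^+ i.+2 =
     (2 * d + 4 * i)%:R / (4 * i.+2%:R) * (`|radial i.+1 q| * q ^+ i.+1) +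
     K / (i.+2%:R * i.+1%:R) * (`|radial i q| * q ^+ i).
    by have i0 := ler0n R i; rewrite /K !exprS; field; field_side.
  rewrite lerD2r ler_piMl// ?mulr_ge0 ?exprn_ge0 ?(ltW q0)//.
  rewrite ler_pdivrMr ?mulr_gt0// mul1r -natrM ler_nat.
  by lia.
elim=> [|i [IH1 IH2]].
  rewrite invr1 subrr mulr0 expR0 mul1r /u expr0 mulr1 expr1 /M.
  by rewrite !le_max lexx lexx orbT.
have step : expR (K * (1 - i.+1%:R^-1)) * M * (1 + K / (i.+2%:R * i.+1%:R))
    <= expR (K * (1 - i.+2%:R^-1)) * M.
  rewrite mulrAC ler_wpM2r//.
  rewrite (_ : K * (1 - i.+2%:R^-1) = K * (1 - i.+1%:R^-1) + K / (i.+2%:R * i.+1%:R)); last first.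
    by have i0 := ler0n R i; field; field_side.
  by rewrite expRD ler_wpM2l ?expR_ge0// expR_ge1Dx.
have X0 : 0 <= expR (K * (1 - i.+1%:R^-1)) * M by rewrite mulr_ge0 ?expR_ge0.
have Y0 : 0 <= K / (i.+2%:R * i.+1%:R) by rewrite divr_ge0// mulr_ge0.
split.
  apply: le_trans step; apply: le_trans IH2 _.
  by rewrite ler_peMr// lerDl.
apply: le_trans (us i) _; apply: le_trans step.
by rewrite mulrDr mulr1 lerD// mulrC ler_wpM2r.
Qed.

Lemma radial_bound_on (q1 Q : R) : (d <= 4)%N -> 0 < q1 ->
  exists2 C : R, 0 <= C & forall q m, q1 <= q <= Q -> `|radial m q| <= C / q ^+ m.
Proof.
move=> d4 q1_gt0; have [Qq|q1Q] := ltP Q q1.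
  by exists 0 => // q m /andP[/le_trans h /h]; rewrite leNgt Qq.
have bnd (f df : R -> R) : (forall q : R, 0 < q -> is_derive q 1 f (df q)) ->
    exists M : R, forall q, q1 <= q <= Q -> `|f q| <= M.
  move=> fd; have [||c _ hc] := @EVT_max R (fun q => `|f q|) q1 Q => //.
    apply: continuous_in_subspaceT => q; rewrite inE /= in_itv/= => /andP[q1q _].
    apply: continuous_comp; last exact: norm_continuous.
    by apply: dv_continuous (fd q _); exact: lt_le_trans q1q.
  by exists `|f c| => q qI; apply: hc; rewrite in_itv.
have [M0 hM0] := bnd _ _ (fun q q0 => (F01 q0).1).
have [M1 hM1] := bnd _ _ (fun q q0 => (F01 q0).2).
have M00 : 0 <= M0 by apply: le_trans (hM0 q1 _); rewrite ?lexx.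
have M10 : 0 <= M1 by apply: le_trans (hM1 q1 _); rewrite ?lexx.
have Q0 : 0 <= Q by rewrite (le_trans _ q1Q)// ltW.
exists (expR (k ^+ 2 * Q / 4) * (M0 + M1 * Q)).
  by rewrite mulr_ge0 ?expR_ge0// addr_ge0// mulr_ge0.
move=> q m qI; have /andP[q1q qQ] := qI.
have q0 : 0 < q by exact: lt_le_trans q1q.
rewrite ler_pdivlMr ?exprn_gt0//; apply: le_trans (radial_bound m d4 q0) _.
rewrite ler_pM ?expR_ge0 ?le_max ?normr_ge0//.
  by rewrite ler_expR ler_wpM2r// ler_wpM2l// sqr_ge0.
rewrite ge_max; apply/andP; split.
  by rewrite -[leLHS]addr0 lerD ?hM0// mulr_ge0.
by rewrite -[leLHS]add0r lerD// ler_pM ?hM1// ltW.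
Qed.

End radial_tower.

Lemma bin_le_exp2 n m : ('C(n, m) <= 2 ^ n)%N.
Proof.
elim: n m => [|n IH] [|m] //; first by rewrite bin0 expn_gt0.
by rewrite binS expnS mul2n -addnn leq_add.
Qed.

Section quadratic_composition.
Context (R : realType) (f : nat -> R -> R) (q0 b0 : R).

Let q (u : R) := q0 + b0 * u + u ^+ 2.
Let b (u : R) := b0 + 2 * u.

(* Taylor coefficients of [f 0 (q0 + b0 u + u^2)], by the binomial expansion
   of [(b h + h^2)^m]. *)
Definition quad_comp n u : R :=
  \sum_(m < n.+1) f m (q u) * 'C(m, n - m)%:R * b u ^+ (2 * m - n).

Lemma quad_comp_bin (n m : nat) : (m <= n.+1)%N ->
  (m * 'C(m.-1, n.+1 - m) + 2 * (2 * m - n) * 'C(m, n - m) * (m <= n)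
    = n.+1 * 'C(m, n.+1 - m))%N.
Proof.
move=> mn; have [j nj] : exists j, n.+1 = (m + j)%N.
  by exists (n.+1 - m)%N; rewrite subnKC.
rewrite nj addKn; case: j nj => [|j] nj.
  rewrite addn0 in nj; rewrite -nj ltnn muln0 !addn0 !bin0.
  by [].
have nE : n = (m + j)%N by apply/succn_inj; rewrite nj addnS.
rewrite nE addKn leq_addr muln1 mul_bin_down.
have -> : (2 * m - (m + j) = m - j)%N by lia.
have [mj|jm] := ltnP m j.+1.
  rewrite (bin_small mj) !muln0 (_ : m - j = 0)%N ?mul0n ?muln0//.
  by apply/eqP; rewrite subn_eq0 -ltnS.
have := mul_bin_left m j.
set c := 'C(_, _); set c' := 'C(_, _) => h.
rewrite -(mulnA 2) -h mulnA -mulnDl; congr (_ * _)%N; lia.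
Qed.

Lemma quad_comp_tower : tower [set x | 0 < x] f ->
  tower [set u | 0 < q u] quad_comp.
Proof.
move=> tf n u /= qu.
have dq : is_derive u 1 q (b u).
  apply: dv_eq (dvD (dvD (dvC u q0) (dvZ b0 (dv_id u))) (dvX 2 (dv_id u))) _.
  by rewrite /b; ring.
have db : is_derive u 1 b 2.
  by apply: dv_eq (dvD (dvC u b0) (dvZ 2 (dv_id u))) _; ring.
have dterm m : is_derive u 1 (fun u => f m (q u) * 'C(m, n - m)%:R * b u ^+ (2 * m - n))
    ((m.+1%:R * f m.+1 (q u) * b u) * 'C(m, n - m)%:R * b u ^+ (2 * m - n)
     + f m (q u) * 'C(m, n - m)%:R * ((2 * m - n)%:R * b u ^+ (2 * m - n).-1 * 2)).
  apply: dv_eq (dvM (dvM (dv_comp (tf m _ qu) dq) (dvC u _)) (dvX _ db)) _.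
  by rewrite mulr0 addr0.
have dsum N : is_derive u 1 (fun u => \sum_(m < N) f m (q u) * 'C(m, n - m)%:R * b u ^+ (2 * m - n))
    (\sum_(m < N) ((m.+1%:R * f m.+1 (q u) * b u) * 'C(m, n - m)%:R * b u ^+ (2 * m - n)
     + f m (q u) * 'C(m, n - m)%:R * ((2 * m - n)%:R * b u ^+ (2 * m - n).-1 * 2))).
  elim: N => [|N IH].
    rewrite big_ord0; apply: dv_fun (dvC u 0) => v; by rewrite big_ord0.
  rewrite big_ord_recr /=; apply: dv_fun (dvD IH (dterm N)) => v.
  by rewrite [RHS]big_ord_recr.
apply: dv_eq (dsum n.+1) _.
rewrite big_split /= /quad_comp mulr_sumr.
pose A m := (m%:R * f m (q u) * b u) * 'C(m.-1, n.+1 - m)%:R * b u ^+ (2 * m.-1 - n).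
pose B m := f m (q u) * 'C(m, n - m)%:R * ((2 * m - n)%:R * b u ^+ (2 * m - n).-1 * 2) * (m <= n)%:R.
transitivity (\sum_(m < n.+2) A m + \sum_(m < n.+2) B m).
  congr (_ + _).
    rewrite [RHS]big_ord_recl {1}/A /= !mul0r add0r; apply: eq_bigr => m _.
    by rewrite /A /bump /= add1n subSS.
  rewrite [RHS]big_ord_recr /= {2}/B ltnn mulr0 addr0.
  by apply: eq_bigr => m _; rewrite /B -ltnS ltn_ord mulr1.
rewrite -big_split /=; apply: eq_bigr => m _.
have mn : (m <= n.+1)%N by rewrite -ltnS.
have AE : A m = (m * 'C(m.-1, n.+1 - m))%:R * f m (q u) * b u ^+ (2 * m - n.+1).
  rewrite /A natrM; case: (nat_of_ord m) mn => [|i] in_; first by rewrite !mul0r.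
  have [h|h] := leqP (n - i)%N i.
    have -> : (2 * i.+1 - n.+1 = (2 * i - n).+1)%N by lia.
    by rewrite /= exprS; ring.
  by rewrite /= subSS bin_small//; ring.
have BE : B m = (2 * (2 * m - n) * 'C(m, n - m) * (m <= n))%:R * f m (q u) * b u ^+ (2 * m - n.+1).
  by rewrite /B !natrM subnS; ring.
by rewrite AE BE -!mulrDl -natrD (quad_comp_bin mn) natrM; ring.
Qed.

(** The discriminant condition holds for a squared distance and amounts to |b u| <= 2 sqrt (q u).
    Each of the n + 1 <= 2^n terms is then at most C (4 / sqrt (q u))^n. *)
Lemma quad_comp_bound n u (C : R) : b0 ^+ 2 <= 4 * q0 -> 0 < q u -> 0 <= C ->
  (forall m, `|f m (q u)| <= C / q u ^+ m) ->
  `|quad_comp n u| <= C * (8 / Num.sqrt (q u)) ^+ n.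
Proof.
move=> bq qu C0 fC; set s := Num.sqrt (q u).
have s0 : 0 < s by rewrite sqrtr_gt0.
have qs : q u = s ^+ 2 by rewrite sqr_sqrtr// ltW.
have bs : `|b u| <= 2 * s.
  rewrite -ler_sqr ?nnegrE ?mulr_ge0 ?(ltW s0)// real_normK ?num_real// exprMn -qs.
  by rewrite /b /q; move: bq; lra.
apply: le_trans (ler_norm_sum _ _ _) _.
apply: (@le_trans _ _ (\sum_(m < n.+1) C * (4 / s) ^+ n)).
  apply: ler_sum => m _; have mn : (m <= n)%N by rewrite -ltnS.
  rewrite !normrM normrX [`|_%:R|]ger0_norm//.
  (* When n > 2m the exponent [2 * m - n] is truncated to 0, but then n - m > m and the binomial
     vanishes. *)
  have [h|h] := leqP n (2 * m)%N; last first.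
    rewrite bin_small; last lia.
    by rewrite mulr0 mul0r mulr_ge0// exprn_ge0// divr_ge0// ltW.
  apply: (@le_trans _ _ (C / q u ^+ m * 2 ^+ m * (2 * s) ^+ (2 * m - n))).
    rewrite ler_pM ?mulr_ge0//.
      rewrite ler_pM//.
      by rewrite -natrX ler_nat bin_le_exp2.
    by rewrite lerXn2r ?nnegrE ?mulr_ge0 ?(ltW s0).
  rewrite qs -exprM exprMn expr_div_n.
  have -> : s ^+ (2 * m - n) = s ^+ (2 * m) / s ^+ n.
    by rewrite -expfB_cond// gt_eqF.
  have -> : C / s ^+ (2 * m) * 2 ^+ m * (2 ^+ (2 * m - n) * (s ^+ (2 * m) / s ^+ n)) =
    C * ((2 ^+ m * 2 ^+ (2 * m - n)) / s ^+ n).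
    by field; rewrite !expf_eq0 !gt_eqF// !andbF.
  rewrite ler_wpM2l//; apply: ler_wpM2r; first by rewrite invr_ge0 exprn_ge0// ltW.
  rewrite -exprD; have -> : (4 : R) = 2 ^+ 2 by ring.
  rewrite -exprM; apply: ler_weXn2l; first by rewrite ler1n.
  by lia.
rewrite sumr_const card_ord -[leLHS]mulr_natr -mulrA ler_wpM2l//.
have -> : 8 / s = (4 / s) * 2 by field; rewrite gt_eqF.
rewrite [X in _ <= X]exprMn ler_wpM2l ?exprn_ge0 ?divr_ge0 ?(ltW s0)//.
by rewrite -natrX ler_nat ltn_expl.
Qed.

End quadratic_composition.

Section entire_series.
Context (R : realType).
Implicit Types (a b : nat -> R) (x : R).

Definition entire_coef a : Prop :=
  exists C M : R, 0 <= M /\ forall m, `|a m| <= C * M ^+ m / m`!%:R.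

Definition psum a x : R := limn (pseries a x).

Lemma entire_cvg a : entire_coef a -> forall x, cvgn (pseries a x).
Proof.
move=> [C [M [M0 aM]]] x; apply: normed_cvg.
apply: (@series_le_cvg _ _ (fun m => C * exp_coeff (M * `|x|) m)).
- by move=> n; rewrite normr_ge0.
- move=> n; apply: le_trans (normr_ge0 (a n * x ^+ n)) _.
  rewrite normrM normrX /exp_coeff /= exprMn; apply: le_trans (ler_wpM2r _ (aM n)) _ => //.
  by rewrite le_eqVlt; apply/orP; left; apply/eqP; ring.
- move=> n /=; rewrite normrM normrX /exp_coeff /= exprMn.
  apply: le_trans (ler_wpM2r _ (aM n)) _ => //.
  by rewrite le_eqVlt; apply/orP; left; apply/eqP; ring.
- exact/is_cvg_seriesZ/is_cvg_series_exp_coeff.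
Qed.

Lemma entire_diffs a : entire_coef a -> entire_coef (pseries_diffs a).
Proof.
move=> [C [M [M0 aM]]]; exists (C * M), M; split=> // m.
rewrite /pseries_diffs normrM normr_nat; apply: le_trans (ler_wpM2l _ (aM m.+1)) _ => //.
rewrite factS natrM exprS; have := fact_gt0 m; rewrite -(ltr_nat R) => m0.
have n0 := ler0n R m.
by rewrite le_eqVlt; apply/orP; left; apply/eqP; field; rewrite gt_eqF //=; field_side.
Qed.

(** The slack 2^m covers both the factors m produced by q d/dq and the harmonic numbers of the
    logarithmic solution. *)
Lemma entire_le a b (C : R) : (forall m, `|b m| <= C * 2 ^+ m * `|a m|) ->
  entire_coef a -> entire_coef b.
Proof.
move=> ba [C' [M [M0 aM]]]; exists (`|C| * C'), (2 * M); split; first by rewrite mulr_ge0.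
move=> m; apply: le_trans (ba m) _.
apply: (@le_trans _ _ (`|C| * 2 ^+ m * `|a m|)).
  by rewrite !ler_wpM2r ?exprn_ge0// ler_norm.
apply: le_trans (ler_wpM2l _ (aM m)) _; first by rewrite mulr_ge0 ?exprn_ge0.
by rewrite le_eqVlt; apply/orP; left; apply/eqP; rewrite exprMn; ring.
Qed.

Lemma entire_muln a : entire_coef a -> entire_coef (fun m => m%:R * a m).
Proof.
apply: (@entire_le _ _ 1) => m; rewrite mul1r normrM normr_nat ler_wpM2r//.
by rewrite -natrX ler_nat ltnW// ltn_expl.
Qed.

Lemma psum_derive a x : entire_coef a ->
  is_derive x 1 (psum a) (psum (pseries_diffs a) x).
Proof.
move=> ea; apply: (@pseries_snd_diffs _ _ (`|x| + 1)).
- exact: entire_cvg.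
- exact/entire_cvg/entire_diffs.
- exact/entire_cvg/entire_diffs/entire_diffs.
- by rewrite [ltRHS]ger0_norm ?addr_ge0// ltrDl.
Qed.

Lemma psum_muln a x : entire_coef a ->
  psum (fun m => m%:R * a m) x = x * psum (pseries_diffs a) x.
Proof.
move=> ea; apply/cvg_lim => //.
have := pseries_diffs_equiv (@entire_cvg _ (entire_diffs ea) x).
move=> /(cvgMl_tmp (a := x)) /=.
rewrite /psum; apply: cvg_trans; apply: near_eq_cvg; apply: nearW => n /=.
rewrite /pseries /series /= mulr_sumr; apply: eq_bigr => -[|i] _ /=.
  by rewrite !mul0r mulr0.
by rewrite exprS; ring.
Qed.

Lemma psumZD a b c x : entire_coef a -> entire_coef b ->
  psum (fun m => c * a m + b m) x = c * psum a x + psum b x.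
Proof.
move=> /entire_cvg/(_ x) ea /entire_cvg/(_ x) eb.
apply/cvg_lim => //.
have /= := cvgD (cvgMl_tmp (a := c) ea) eb => /(_ _ _).
rewrite /psum; apply: cvg_trans; apply: near_eq_cvg; apply: nearW => n /=.
rewrite fctE /pseries /series /= mulr_sumr -big_split /=; apply: eq_bigr => i _ /=.
by ring.
Qed.

Lemma psumZ a c x : entire_coef a -> psum (fun m => c * a m) x = c * psum a x.
Proof.
move=> ea; rewrite (_ : (fun m => _) = fun m => (c - 1) * a m + a m).
  by rewrite psumZD//; ring.
by apply/funext => m; ring.
Qed.

Lemma psum0 a : psum a 0 = a 0%N.
Proof.
apply/cvg_lim => //; apply: cvg_near_cst; exists 1%N => // n /= n0.
rewrite /pseries /series /= -(prednK n0) big_nat_recl// expr0 mulr1 big1 ?addr0// => i _.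
by rewrite expr0n mulr0.
Qed.

Lemma psum_bounded a (L : R) : entire_coef a ->
  exists2 M : R, 0 <= M & forall x, 0 <= x <= L -> `|psum a x| <= M.
Proof.
move=> ea; have [L0|L0] := ltP L 0.
  by exists 0 => // x /andP[/le_trans h /h]; rewrite leNgt L0.
have [||c _ hc] := @EVT_max R (fun q => `|psum a q|) 0 L => //.
  apply: continuous_in_subspaceT => q _.
  apply: continuous_comp; last exact: norm_continuous.
  exact: dv_continuous (psum_derive q ea).
by exists `|psum a c| => // q qI; apply: hc; rewrite in_itv.
Qed.

End entire_series.

Section helmholtz_2d.
Context (R : realType) (k : R).

(** Coefficients, in powers of q = r^2, of J_0(k r); [y0coef] gives the regular part of the
    logarithmic solution, as in the method of Frobenius. *)
Definition j0coef m : R := (- (k ^+ 2 / 4)) ^+ m / (m`!%:R ^+ 2).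
Definition y0coef m : R := - 2 * series harmonic m * j0coef m.

Let c : R := k ^+ 2 / 4.

Lemma j0coefS m : m.+1%:R ^+ 2 * j0coef m.+1 = - c * j0coef m.
Proof.
rewrite /j0coef factS natrM [_ ^+ m.+1]exprS; have := fact_gt0 m; rewrite -(ltr_nat R) => m0.
by rewrite /c; have n0 := ler0n R m; field; rewrite gt_eqF //=; field_side.
Qed.

Lemma entire_j0coef : entire_coef j0coef.
Proof.
exists 1, c; split; first by rewrite divr_ge0 ?sqr_ge0.
move=> m; rewrite mul1r /j0coef normrM normrX normrN ger0_norm ?divr_ge0 ?sqr_ge0//.
rewrite (@ger0_norm _ (k ^+ 2 / 4)) ?divr_ge0 ?sqr_ge0// ler_wpM2l ?exprn_ge0 ?divr_ge0 ?sqr_ge0//.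
have := fact_gt0 m; rewrite -(ltr_nat R) => m0.
by rewrite lef_pV2 ?posrE ?exprn_gt0// expr2 ler_peMl ?(ltW m0)// ler1n fact_gt0.
Qed.

Lemma entire_y0coef : entire_coef y0coef.
Proof.
apply: (@entire_le _ j0coef _ 2) entire_j0coef => m.
rewrite /y0coef normrM ler_wpM2r// normrM normrN normr_nat ler_wpM2l//.
apply: le_trans (ler_norm_sum _ _ _) _.
apply: (@le_trans _ _ (\sum_(0 <= i < m) 1)).
  by apply: ler_sum => i _; rewrite /= ger0_norm ?invr_ge0// invf_le1// ler1n.
by rewrite sumr_const_nat subn0 -natrX ler_nat ltnW// ltn_expl.
Qed.

Let J := psum j0coef.
Let J' := psum (pseries_diffs j0coef).
Let P := psum (fun m => m%:R * j0coef m).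
Let Y := psum y0coef.
Let Y' := psum (pseries_diffs y0coef).
Let PY := psum (fun m => m%:R * y0coef m).

(** Bessel's equation in the variable q reads (q J')' = - c J, and P = q J'. The next fact is its
    inhomogeneous form (q Y')' = - c Y - 2 J', in which the source cancels the terms created by ln
    q. *)
Let dP (q : R) : is_derive q 1 P (- c * J q).
Proof.
apply: dv_eq (psum_derive q (entire_muln entire_j0coef)) _.
rewrite (_ : pseries_diffs _ = fun m => - c * j0coef m).
  by rewrite psumZ//; exact: entire_j0coef.
apply/funext => m; rewrite /pseries_diffs mulrA -expr2 j0coefS; ring.
Qed.

Let dPY (q : R) : is_derive q 1 PY (- c * Y q - 2 * J' q).
Proof.
apply: dv_eq (psum_derive q (entire_muln entire_y0coef)) _.
have ed := entire_diffs entire_j0coef.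
rewrite (_ : pseries_diffs _ = fun m => - c * y0coef m + - 2 * pseries_diffs j0coef m).
  rewrite psumZD; [|exact: entire_y0coef|].
    by rewrite psumZ// /Y /J'; ring.
  apply: (@entire_le _ (pseries_diffs j0coef) _ 2) ed => m.
  by rewrite normrM normrN normr_nat ler_wpM2r// ler_peMr// exprn_ege1// ler1n.
apply/funext => m; rewrite /pseries_diffs /y0coef mulrA -expr2.
have -> : series harmonic m.+1 = series harmonic m + m.+1%:R^-1 :> R.
  by rewrite /series /= big_nat_recr.
have -> : m.+1%:R ^+ 2 * (-2 * (series harmonic m + m.+1%:R^-1) * j0coef m.+1) =
  -2 * series harmonic m * (m.+1%:R ^+ 2 * j0coef m.+1) - 2 * m.+1%:R * j0coef m.+1.
  by have n0 := ler0n R m; field; field_side.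
by rewrite j0coefS; ring.
Qed.

(** With q = r^2 this is pi Y_0(k r) minus a constant multiple of J_0(k r). The derivative is
    written through q J' and q Y', whose own derivatives the equation provides. *)
Definition radial2 q : R := ln q * psum j0coef q + psum y0coef q.
Definition radial2' q : R := (psum j0coef q + ln q * psum (fun m => m%:R * j0coef m) q
  + psum (fun m => m%:R * y0coef m) q) / q.

Lemma radial2_solution : radial_solution 2 k radial2 radial2'.
Proof.
move=> q q0; have qn0 : q != 0 by rewrite gt_eqF.
have PE : P q = q * J' q by rewrite /P psum_muln//; exact: entire_j0coef.
have PYE : PY q = q * Y' q by rewrite /PY psum_muln//; exact: entire_y0coef.
have dJ : is_derive q 1 J (J' q) := psum_derive q entire_j0coef.
have dY : is_derive q 1 Y (Y' q) := psum_derive q entire_y0coef.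
have dln := is_derive1_ln q0.
have dinv : is_derive q 1 (fun u : R => u^-1) (- q ^- 2).
  by apply: (dv_eq (is_deriveV _ _)) => //; rewrite scaler1.
split.
  apply: dv_eq (dvD (dvM dln dJ) dY) _.
  by rewrite /radial2' -/(J q) -/(P q) -/(PY q) PE PYE; field.
apply: dv_eq (dvM (dvD (dvD dJ (dvM dln (dP q))) (dPY q)) dinv) _.
rewrite radialSS /= /radial2 /radial2' -/(J q) -/(P q) -/(PY q) -/(Y q) PE PYE /c.
by field.
Qed.

(* Near its singularity, the second directional derivative of the radial
   solution is governed by [F1 ~ q^(-d/2)]. *)
Definition singular_at0 (d : nat) (F0 F1 : R -> R) : Prop :=
  exists eta c : R, [/\ 0 < eta, 0 < c & forall q, 0 < q < eta ->
    c <= `|F1 q| * Num.sqrt q ^+ d /\ k ^+ 2 * `|F0 q| <= `|F1 q| / 8].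

Lemma ln_sqrt_bound (q : R) : 0 < q <= 1 -> `|ln q| <= 2 / Num.sqrt q.
Proof.
move=> /andP[q0 q1]; have s0 : 0 < Num.sqrt q by rewrite sqrtr_gt0.
rewrite ler0_norm; last by rewrite ln_le0.
rewrite -[X in - ln X](sqr_sqrtr (ltW q0)) lnXn// -mulNrn -lnV ?posrE//.
rewrite -[X in X <= _]mulr_natl; apply: ler_wpM2l => //.
have : 0 < (Num.sqrt q)^-1 by rewrite invr_gt0.
by move=> /ln_sublinear /ltW.
Qed.

(** q F1 = J + ln q (q J') + q Y' tends to J(0) = 1, because sqrt q ln q is bounded, while q F0
    tends to 0. [N] dominates every constant, so that smallness of s N^2 with s = sqrt q settles all
    the comparisons. *)
Lemma radial2_singular : singular_at0 2 radial2 radial2'.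
Proof.
have [MJ MJ0 hMJ] := psum_bounded 1 entire_j0coef.
have [MJ' MJ'0 hMJ'] := psum_bounded 1 (entire_diffs entire_j0coef).
have [MY MY0 hMY] := psum_bounded 1 entire_y0coef.
have [MY' MY'0 hMY'] := psum_bounded 1 (entire_diffs entire_y0coef).
pose N := 1 + MJ + MJ' + MY + MY' + k ^+ 2.
have k20 : 0 <= k ^+ 2 := sqr_ge0 k.
have [N1 MJN0 MJN MYN0 [MYN kN]] :
    [/\ 1 <= N, MJ <= N, MJ' <= N, MY <= N & MY' <= N /\ k ^+ 2 <= N].
  by rewrite /N; do !split; lra.
clearbody N.
pose s1 := (200 * N ^+ 2)^-1.
have N2 : 1 <= N ^+ 2 by rewrite exprn_ege1.
have s10 : 0 < s1 by rewrite invr_gt0; nra.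
exists (s1 ^+ 2), (1 / 2); split; [by rewrite exprn_gt0|by []|].
move=> q /andP[q0 qs]; set s := Num.sqrt q.
have s0 : 0 < s by rewrite sqrtr_gt0.
have sq : s ^+ 2 = q by rewrite sqr_sqrtr// ltW.
have ss1 : s < s1 by rewrite -ltr_sqr ?nnegrE ?ltW// sq.
have sN : s * N ^+ 2 <= 1 / 200.
  apply: le_trans (ler_wpM2r _ (ltW ss1)) _; first by lra.
  by rewrite /s1 invfM -mulrA mulVf ?mulr1 ?mul1r// gt_eqF//; lra.
have sNN : s * N <= 1 / 200 by apply: le_trans sN; rewrite ler_wpM2l ?(ltW s0)//; nra.
have s1' : s <= 1 / 200 by nra.
have q1 : q <= 1 by rewrite -sq; nra.
have qI : 0 <= q <= 1 by rewrite (ltW q0).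
have lnb : `|ln q| <= 2 / s by apply: ln_sqrt_bound; rewrite q0.
have PE : P q = q * J' q by rewrite /P psum_muln//; exact: entire_j0coef.
have PYE : PY q = q * Y' q by rewrite /PY psum_muln//; exact: entire_y0coef.
have J1 : `|J q - 1| <= MJ' * q.
  have := @MVT_bound R J J' 0 q MJ'.
  rewrite /J psum0 /j0coef expr0 fact0 expr1n divr1 subr0 (ger0_norm (ltW q0)).
  apply; rewrite (min_idPl (ltW q0)) (max_idPr (ltW q0)) => u /andP[u0 uq].
    exact: psum_derive entire_j0coef.
  by apply: hMJ'; rewrite u0 (le_trans uq).
have qs' : q = s * s by rewrite -sq expr2.
have lnP : `|ln q * P q| <= 2 * s * MJ'.
  rewrite PE normrM normrM (ger0_norm (ltW q0)).
  apply: (@le_trans _ _ (2 / s * (q * MJ'))).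
    by rewrite ler_pM ?mulr_ge0 ?(ltW q0)// ler_wpM2l ?(ltW q0)// hMJ'.
  by rewrite qs' le_eqVlt; apply/orP; left; apply/eqP; field; rewrite gt_eqF.
have bPY : `|PY q| <= q * MY'.
  by rewrite PYE normrM (ger0_norm (ltW q0)) ler_wpM2l ?(ltW q0)// hMY'.
pose w := J q + ln q * P q + PY q.
have qsN (M : R) : 0 <= M -> M <= N -> q * M <= 1 / 200.
  move=> M0 MN; rewrite qs'; apply: le_trans sNN.
  by rewrite -mulrA ler_wpM2l ?(ltW s0)//; nra.
have wb : 9 / 10 <= `|w|.
  have h1 : MJ' * q <= 1 / 200 by rewrite mulrC qsN.
  have h2 : 2 * s * MJ' <= 1 / 100.
    have : s * MJ' <= s * N by rewrite ler_wpM2l ?(ltW s0).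
    by lra.
  have h3 : q * MY' <= 1 / 200 by exact: qsN.
  rewrite ler_normr; apply/orP; left; rewrite /w.
  move: J1 lnP bPY; rewrite !ler_norml => /andP[h4 _] /andP[h5 _] /andP[h6 _].
  by lra.
have F1E : `|radial2' q| = `|w| / q.
  by rewrite /radial2' -/(J q) -/(P q) -/(PY q) normrM normfV (ger0_norm (ltW q0)).
rewrite F1E; split.
  by rewrite sq -mulrA mulVf ?gt_eqF// mulr1; lra.
have F0b : `|radial2 q| <= 2 / s * N + N.
  apply: le_trans (ler_normD _ _) _; rewrite lerD//.
    by rewrite normrM ler_pM//; apply: le_trans (hMJ _ qI) _.
  by apply: le_trans (hMY _ qI) _.
apply: (@le_trans _ _ (N * (2 / s * N + N))); first by rewrite ler_pM.
have -> : `|w| / q / 8 = `|w| / (q * 8) by field; rewrite gt_eqF.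
rewrite ler_pdivlMr ?mulr_gt0//.
have -> : N * (2 / s * N + N) * (q * 8) = 16 * (s * N ^+ 2) + 8 * (s * N ^+ 2) * s.
  by rewrite qs'; field; rewrite gt_eqF.
have : s * N ^+ 2 * s <= 1 / 200 * 1.
  apply: ler_pM; [by rewrite mulr_ge0 ?(ltW s0)// (le_trans _ N2)|exact: ltW|exact: sN|].
  by lra.
by lra.
Qed.

End helmholtz_2d.

Section helmholtz_3d.
Context (R : realType) (k : R).

Definition radial3 q : R := cos (k * Num.sqrt q) / Num.sqrt q.
Definition radial3' q : R :=
  - (k * sin (k * Num.sqrt q) / (2 * q)) - cos (k * Num.sqrt q) / (2 * q * Num.sqrt q).

Lemma radial3_solution : radial_solution 3 k radial3 radial3'.
Proof.
move=> q q0; set s := Num.sqrt q.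
have s0 : 0 < s by rewrite sqrtr_gt0.
have qs : q = s ^+ 2 by rewrite sqr_sqrtr// ltW.
have sn0 : s != 0 by rewrite gt_eqF.
have dsqrt : is_derive q 1 Num.sqrt (2 * s)^-1 by exact: is_derive1_sqrt.
have dcos : is_derive q 1 (fun u => cos (k * Num.sqrt u)) (- sin (k * s) * (k * (2 * s)^-1)).
  exact: dv_comp (is_derive_cos _) (dvZ k dsqrt).
have dsin : is_derive q 1 (fun u => sin (k * Num.sqrt u)) (cos (k * s) * (k * (2 * s)^-1)).
  exact: dv_comp (is_derive_sin _) (dvZ k dsqrt).
have dV (f : R -> R) a : f q != 0 -> is_derive q 1 f a -> is_derive q 1 (fun u : R => (f u)^-1) (- (f q) ^- 2 * a).
  by move=> fq0 fa; apply: (dv_eq (is_deriveV _ _)).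
have dq2 : is_derive q 1 (fun u : R => 2 * u) 2.
  by apply: dv_eq (dvZ 2 (dv_id q)) _; rewrite mulr1.
have dq3 : is_derive q 1 (fun u : R => 2 * u * Num.sqrt u) (2 * s + 2 * q * (2 * s)^-1).
  by apply: dv_eq (dvM dq2 dsqrt) _.
split.
  apply: dv_eq (dvM dcos (dV Num.sqrt _ sn0 dsqrt)) _.
  by rewrite /radial3' -/s qs; field.
have q2n : 2 * q != 0 by rewrite gt_eqF// mulr_gt0.
have q3n : 2 * q * Num.sqrt q != 0 by rewrite gt_eqF// mulr_gt0// mulr_gt0.
apply: dv_eq (dvB (dvN (dvM (dvZ k dsin) (dV _ _ q2n dq2))) (dvM dcos (dV _ _ q3n dq3))) _.
rewrite radialSS /= /radial3 /radial3' -/s qs.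
by field.
Qed.

Lemma radial3_singular : singular_at0 k 3 radial3 radial3'.
Proof.
pose N := 1 + `|k| + k ^+ 2.
have k20 : 0 <= k ^+ 2 := sqr_ge0 k.
have k0 : 0 <= `|k| := normr_ge0 k.
have N1 : 1 <= N by rewrite /N; lra.
have kk : k ^+ 2 = `|k| * `|k| by rewrite -expr2 real_normK ?num_real.
pose s1 := (100 * N)^-1.
have s10 : 0 < s1 by rewrite invr_gt0; lra.
exists (s1 ^+ 2), (1 / 4); split; [by rewrite exprn_gt0|by []|].
move=> q /andP[q0 qs]; rewrite /radial3 /radial3'; set s := Num.sqrt q.
have s0 : 0 < s by rewrite sqrtr_gt0.
have sq : q = s ^+ 2 by rewrite sqr_sqrtr// ltW.
have ss1 : s < s1 by rewrite -ltr_sqr ?nnegrE ?ltW// -sq.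
have sN : s * N <= 1 / 100.
  apply: le_trans (ler_wpM2r _ (ltW ss1)) _; first by lra.
  by rewrite /s1 invfM -mulrA mulVf ?mulr1 ?mul1r// gt_eqF//; lra.
have ks : `|k * s| <= 1 / 100.
  rewrite normrM (ger0_norm (ltW s0)) mulrC; apply: le_trans sN.
  by rewrite ler_wpM2l ?(ltW s0)// /N; lra.
have k2s : k ^+ 2 * s <= 1 / 100.
  by rewrite mulrC; apply: le_trans sN; rewrite ler_wpM2l ?(ltW s0)// /N; lra.
have sinb : `|sin (k * s)| <= 1 by rewrite ler_norml sin_geN1 sin_le1.
have cosb : 9 / 10 <= cos (k * s).
  have := @MVT_bound R cos (fun u => - sin u) 0 (k * s) 1 (fun u _ => is_derive_cos u).
  have sb u : `|- sin u| <= 1 :> R by rewrite normrN ler_norml sin_geN1 sin_le1.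
  move=> /(_ (fun u _ => sb u)); rewrite cos0 subr0 mul1r => /le_trans/(_ ks); rewrite ler_norml => /andP[h _]; lra.
have cos1 : `|cos (k * s)| <= 1 by rewrite ler_norml cos_geN1 cos_le1.
set w := k * s * sin (k * s) + cos (k * s).
have wb : 8 / 10 <= `|w|.
  have : `|k * s * sin (k * s)| <= 1 / 100.
    by rewrite normrM; apply: le_trans (ler_pM _ _ ks sinb) _; rewrite ?mulr1.
  rewrite ler_norml => /andP[h _]; rewrite ler_normr; apply/orP; left; rewrite /w; lra.
have F1E : `|- (k * sin (k * s) / (2 * q)) - cos (k * s) / (2 * q * s)| = `|w| / (2 * s ^+ 3).
  have -> : - (k * sin (k * s) / (2 * q)) - cos (k * s) / (2 * q * s) = - (w / (2 * s ^+ 3)).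
    by rewrite sq /w; field; rewrite gt_eqF.
  by rewrite normrN normrM normfV (ger0_norm (_ : 0 <= 2 * s ^+ 3))// mulr_ge0// exprn_ge0// ltW.
have s30 : 0 < s ^+ 3 by rewrite exprn_gt0.
rewrite F1E; split.
  have -> : `|w| / (2 * s ^+ 3) * s ^+ 3 = `|w| / 2 by field; rewrite gt_eqF.
  lra.
rewrite normrM normfV (ger0_norm (ltW s0)).
apply: (@le_trans _ _ (k ^+ 2 * s^-1)).
  by rewrite ler_wpM2l// ler_piMl// invr_ge0 ltW.
have -> : `|w| / (2 * s ^+ 3) / 8 = `|w| / 16 / s ^+ 2 / s by field; rewrite gt_eqF.
rewrite ler_wpM2r ?invr_ge0 ?(ltW s0)// ler_pdivlMr ?exprn_gt0//.
have : k ^+ 2 * s ^+ 2 <= 1 / 100 * 1 / 100.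
  have s1' : s <= 1 / 100.
    have : s * 1 <= s * N by rewrite ler_wpM2l ?(ltW s0).
    lra.
  rewrite [s ^+ 2]expr2 mulrA -[leRHS]mulrA; apply: ler_pM => //.
    by rewrite mulr_ge0// ltW.
  exact: ltW.
lra.
Qed.

End helmholtz_3d.

(** * The Euclidean norm and expansions in the pole *)

Section euclidean_norm.
Context (R : realType) (d : nat).
Implicit Types (x y z : 'rV[R]_d) (a : R).

Lemma dotvC x y : dotv x y = dotv y x.
Proof. by apply: eq_bigr => i _; rewrite mulrC. Qed.

Lemma dotvDl x y z : dotv (x + y) z = dotv x z + dotv y z.
Proof. by rewrite -big_split; apply: eq_bigr => i _; rewrite mxE mulrDl. Qed.

Lemma dotvZl a x y : dotv (a *: x) y = a * dotv x y.
Proof. by rewrite mulr_sumr; apply: eq_bigr => i _; rewrite mxE mulrA. Qed.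

Lemma dotvNl x y : dotv (- x) y = - dotv x y.
Proof. by rewrite -scaleN1r dotvZl mulN1r. Qed.

Lemma dotvBl x y z : dotv (x - y) z = dotv x z - dotv y z.
Proof. by rewrite dotvDl dotvNl. Qed.

Lemma dotvDr x y z : dotv x (y + z) = dotv x y + dotv x z.
Proof. by rewrite dotvC dotvDl !(dotvC x). Qed.

Lemma dotvZr a x y : dotv x (a *: y) = a * dotv x y.
Proof. by rewrite dotvC dotvZl dotvC. Qed.

Lemma dotvNr x y : dotv x (- y) = - dotv x y.
Proof. by rewrite dotvC dotvNl dotvC. Qed.

Lemma dotvBr x y z : dotv x (y - z) = dotv x y - dotv x z.
Proof. by rewrite dotvDr dotvNr. Qed.

Lemma dotv_ge0 x : 0 <= dotv x x.
Proof. by apply: sumr_ge0 => i _; rewrite -expr2 sqr_ge0. Qed.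

Lemma enorm_ge0 x : 0 <= enorm x.
Proof. exact: sqrtr_ge0. Qed.

Lemma enorm_sq x : enorm x ^+ 2 = dotv x x.
Proof. by rewrite sqr_sqrtr// dotv_ge0. Qed.

Lemma enormN x : enorm (- x) = enorm x.
Proof. by rewrite /enorm dotvNl dotvNr opprK. Qed.

Lemma enormB x y : enorm (x - y) = enorm (y - x).
Proof. by rewrite -opprB enormN. Qed.

Lemma enormZ a x : enorm (a *: x) = `|a| * enorm x.
Proof.
by rewrite /enorm dotvZl dotvZr mulrA -expr2 sqrtrM ?sqr_ge0// sqrtr_sqr.
Qed.

Lemma enorm0 : enorm (0 : 'rV[R]_d) = 0.
Proof. by rewrite -(scale0r 0) enormZ normr0 mul0r. Qed.

Lemma coord_le_enorm x i : `|x 0 i| <= enorm x.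
Proof.
rewrite -sqrtr_sqr ler_wsqrtr// expr2 [leRHS](bigD1 i)//= lerDl.
by apply: sumr_ge0 => j _; rewrite -expr2 sqr_ge0.
Qed.

Lemma enorm_eq0 x : enorm x = 0 -> x = 0.
Proof.
move=> x0; apply/rowP => i; rewrite mxE; apply/eqP.
by rewrite -normr_le0 -x0 coord_le_enorm.
Qed.

Lemma dotv_CS x y : `|dotv x y| <= enorm x * enorm y.
Proof.
rewrite -ler_sqr ?nnegrE ?mulr_ge0 ?enorm_ge0// real_normK ?num_real//.
rewrite exprMn !enorm_sq.
have [y0|y0] := eqVneq (dotv y y) 0.
  have -> : y = 0 by apply: enorm_eq0; rewrite /enorm y0 sqrtr0.
  by rewrite -(scale0r y) !dotvZr !mul0r expr0n mulr0.
have yp : 0 < dotv y y by rewrite lt_def y0 dotv_ge0.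
have := dotv_ge0 (x - (dotv x y / dotv y y) *: y).
rewrite !(dotvBl, dotvBr, dotvZl, dotvZr) (dotvC y x).
move=> /(mulr_ge0 (ltW yp)); rewrite mulrC.
set a := dotv x x; set b := dotv x y; set c := dotv y y.
have -> : (a - b / c * b - (b / c * (b - b / c * c))) * c = a * c - b ^+ 2.
  by field.
by rewrite subr_ge0.
Qed.

Lemma enormD x y : enorm (x + y) <= enorm x + enorm y.
Proof.
rewrite -ler_sqr ?nnegrE ?addr_ge0 ?enorm_ge0// enorm_sq sqrrD !enorm_sq.
rewrite !(dotvDl, dotvDr) (dotvC y x) -!addrA lerD2l !addrA lerD2r -mulr2n ler_pMn2r//.
exact: le_trans (ler_norm _) (dotv_CS _ _).
Qed.

Lemma enorm_dist x y : enorm x - enorm y <= enorm (x - y).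
Proof. by rewrite lerBlDr -[in leLHS](subrK y x) enormD. Qed.

Lemma norm_le_enorm x : `|x| <= enorm x.
Proof.
rewrite /Num.Def.normr /= mx_normrE; apply: bigmax_le => [|[i j] _]; first exact: enorm_ge0.
by rewrite (ord1 i) coord_le_enorm.
Qed.

Lemma coord_le_norm x i : `|x 0 i| <= `|x|.
Proof.
rewrite [leRHS]/Num.Def.normr /= mx_normrE.
exact: (le_bigmax _ (fun ij => `|x ij.1 ij.2|) (0, i)).
Qed.

Lemma enorm_le_sum x : enorm x <= \sum_(i < d) `|x 0 i|.
Proof.
have h0 : 0 <= \sum_(i < d) `|x 0 i| by apply: sumr_ge0.
rewrite -ler_sqr ?nnegrE ?enorm_ge0// enorm_sq expr2 mulr_suml.
apply: ler_sum => i _; rewrite -expr2 -[leLHS](real_normK (num_real _)) expr2 ler_wpM2l//.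
by rewrite (bigD1 i)//= lerDl sumr_ge0.
Qed.

Lemma enorm_le_norm x : enorm x <= d%:R * `|x|.
Proof.
apply: le_trans (enorm_le_sum x) _.
apply: (@le_trans _ _ (\sum_(i < d) `|x|)).
  by apply: ler_sum => i _; exact: coord_le_norm.
by rewrite sumr_const card_ord mulr_natl.
Qed.

End euclidean_norm.

Section poles.
Context (R : realType) (d : nat) (k : R) (F0 F1 : R -> R).
Hypothesis F01 : radial_solution d k F0 F1.
Hypothesis d4 : (d <= 4)%N.
Variables (E : set 'rV[R]_d) (Q : R) (S : set ('rV[R]_d -> R)).
Hypothesis EQ : forall x, E x -> enorm x <= Q.
Hypothesis SE : uniformly_closed E S.

Definition pole (y x : 'rV[R]_d) : R := F0 (dotv (x - y) (x - y)).

(** For a unit vector [v], |x - y - t v|^2 = q0 + b0 t + t^2, so this is the n-th Taylor coefficient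
    at t = 0 of the pole moved along [v]. *)
Definition pole_coef (y v : 'rV[R]_d) n (x : 'rV[R]_d) : R :=
  quad_comp (radial d k F0 F1) (dotv (x - y) (x - y)) (- 2 * dotv (x - y) v) n 0.

(** An open condition, because Taylor coefficients in the pole are extracted from poles near [y]. *)
Definition good y : Prop :=
  exists2 r, 0 < r & forall y', enorm (y' - y) < r -> S (pole y').

(** For t <= s / 2 the moved pole stays at distance s / 2 from [E], where [quad_comp_bound] gives
    coefficients of size (16 / s)^N. The factor [N.+1] of the remainder costs a further 2^N, hence
    the radius s / 32. *)
Lemma pole_expansion (y v : 'rV[R]_d) (s : R) : 0 < s -> dotv v v = 1 ->
  (forall x, E x -> s <= enorm (x - y)) ->
  exists2 C : R, 0 <= C & forall N (t : R) x, E x -> 0 <= t <= s / 2 ->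
    `|pole (y + t *: v) x - \sum_(n < N) pole_coef y v n x * t ^+ n|
      <= C * (t / (s / 32)) ^+ N.
Proof.
move=> s0 v1 Es.
have s40 : 0 < s ^+ 2 / 4 by rewrite divr_gt0// exprn_gt0.
have [C C0 hC] := radial_bound_on F01 ((Q + enorm y + s) ^+ 2) d4 s40.
exists C => // N t x Ex /andP[t0 ts].
set q0 := dotv (x - y) (x - y); set b0 := - 2 * dotv (x - y) v.
pose q u := q0 + b0 * u + u ^+ 2.
have qE u : q u = enorm (x - (y + u *: v)) ^+ 2.
  rewrite enorm_sq opprD addrA [in RHS]dotvBl ![dotv _ (_ - _ - _)]dotvBr !dotvZr !dotvZl v1 (dotvC v).
  by rewrite /q /q0 /b0; ring.
have qs u : 0 <= u <= t -> s ^+ 2 / 4 <= q u.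
  move=> /andP[u0 ut]; rewrite qE.
  have -> : s ^+ 2 / 4 = (s / 2) ^+ 2 by field.
  rewrite lerXn2r ?nnegrE ?enorm_ge0 ?divr_ge0 ?(ltW s0)//.
  have := enorm_dist (x - y) (u *: v); rewrite enormZ (ger0_norm u0).
  have -> : enorm v = 1 by rewrite /enorm v1 sqrtr1.
  rewrite opprD addrA mulr1 => h; apply: le_trans h.
  have := Es x Ex; lra.
have qQ u : 0 <= u <= t -> q u <= (Q + enorm y + s) ^+ 2.
  move=> /andP[u0 ut]; rewrite qE.
  have h : enorm (x - (y + u *: v)) <= Q + enorm y + s.
    apply: le_trans (enormD _ _) _; rewrite enormN -addrA lerD ?EQ//.
    apply: le_trans (enormD _ _) _; rewrite lerD2l enormZ (ger0_norm u0).
    have -> : enorm v = 1 by rewrite /enorm v1 sqrtr1.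
    rewrite mulr1; lra.
  by rewrite lerXn2r ?nnegrE ?enorm_ge0// (le_trans (enorm_ge0 _) h).
have bq : b0 ^+ 2 <= 4 * q0.
  have := dotv_CS (x - y) v; rewrite -ler_sqr ?nnegrE ?mulr_ge0 ?enorm_ge0//.
  rewrite real_normK ?num_real// exprMn !enorm_sq v1 mulr1 /b0 /q0; lra.
have q_gt0 u : 0 <= u <= t -> 0 < q u by move=> /qs; exact: lt_le_trans.
have T := @quad_comp_tower R _ q0 b0 (radial_tower F01).
have := @tower_taylor R _ _ N 0 t (C * (16 / s) ^+ N) T.
rewrite (min_idPl t0) (max_idPr t0) subr0.
have -> : quad_comp (radial d k F0 F1) q0 b0 0 t = pole (y + t *: v) x.
  rewrite /quad_comp big_ord1 muln0 subn0 bin0 expr0 !mulr1 /pole -enorm_sq -qE.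
  by [].
move=> h; apply: le_trans (h _ _) _.
- by move=> u ut; exact: q_gt0.
- move=> u ut; have fC m : `|radial d k F0 F1 m (q u)| <= C / q u ^+ m.
    by apply: hC; rewrite qs// qQ.
  apply: le_trans (@quad_comp_bound R _ q0 b0 N u C bq (q_gt0 u ut) C0 fC) _.
  rewrite ler_wpM2l// lerXn2r ?nnegrE ?divr_ge0 ?sqrtr_ge0 ?(ltW s0)//.
  have sq : s / 2 <= Num.sqrt (q u).
    rewrite -[leLHS]ger0_norm ?divr_ge0 ?(ltW s0)// -sqrtr_sqr ler_wsqrtr//.
    by apply: le_trans (qs u ut); rewrite le_eqVlt; apply/orP; left; apply/eqP; field.
  have s2 : 0 < s / 2 by rewrite divr_gt0.
  have sq0 := lt_le_trans s2 sq.
  rewrite ler_pdivrMr// mulrAC ler_pdivlMr//; lra.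
rewrite (ger0_norm t0) -mulrA -[_ * _ * t ^+ N]mulrA -exprMn mulrCA ler_wpM2l//.
have -> : t / (s / 32) = 2 * (16 / s * t) by field; rewrite gt_eqF.
rewrite [leRHS]exprMn ler_wpM2r ?exprn_ge0 ?mulr_ge0 ?invr_ge0 ?(ltW s0)//.
by rewrite -natrX ler_nat ltn_expl.
Qed.

Lemma good_coef (y v : 'rV[R]_d) (s : R) : 0 < s -> dotv v v = 1 ->
  (forall x, E x -> s <= enorm (x - y)) -> good y -> forall n, S (pole_coef y v n).
Proof.
move=> s0 v1 Es [r r0 gy]; have [C C0 hC] := pole_expansion s0 v1 Es.
have v1' : enorm v = 1 by rewrite /enorm v1 sqrtr1.
have r32 : 0 < s / 32 by rewrite divr_gt0.
have t00 : 0 < Num.min r (s / 2) by rewrite lt_min r0 divr_gt0.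
apply: (@power_series_coef _ _ E S SE (pole_coef y v) (fun t => pole (y + t *: v))
  (s / 32) C r32 C0 _ t00).
- move=> N t x Ex /andP[t0]; rewrite lt_min => /andP[_ ts].
  by apply: hC; rewrite // (ltW t0) ltW.
- move=> t /andP[t0]; rewrite lt_min => /andP[tr _]; apply: gy.
  by rewrite addrC addKr enormZ v1' mulr1 ger0_norm// ltW.
Qed.

Lemma good_ball (y : 'rV[R]_d) (s : R) : 0 < s ->
  (forall x, E x -> s <= enorm (x - y)) -> good y ->
  forall y', enorm (y' - y) < s / 32 -> S (pole y').
Proof.
move=> s0 Es gy y' ys.
have [yy|yy] := eqVneq (enorm (y' - y)) 0.
  have [r r0 hr] := gy; apply: hr; by rewrite yy.
pose v := (enorm (y' - y))^-1 *: (y' - y).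
have v1 : dotv v v = 1.
  by rewrite dotvZl dotvZr -enorm_sq expr2; field.
have [C C0 hC] := pole_expansion s0 v1 Es.
have yv : y' = y + enorm (y' - y) *: v by rewrite scalerA divff// scale1r addrC subrK.
have r32 : 0 < s / 32 by rewrite divr_gt0.
rewrite yv; apply: (@power_series_sum _ _ E S SE (pole_coef y v) (fun t => pole (y + t *: v))
  (s / 32) C r32 C0).
- exact: (@good_coef y v s).
- by rewrite enorm_ge0.
- move=> N x Ex; apply: hC => //; rewrite enorm_ge0/=; lra.
Qed.

Lemma good_near (y y' : 'rV[R]_d) (s : R) : 0 < s ->
  (forall x, E x -> s <= enorm (x - y)) -> good y ->
  enorm (y' - y) < s / 32 -> good y'.
Proof.
move=> s0 Es gy yy'; exists (s / 32 - enorm (y' - y)); first by rewrite subr_gt0.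
move=> z zy; apply: (good_ball s0 Es gy).
have := enormD (z - y') (y' - y); rewrite addrA subrK => /le_lt_trans; apply.
by rewrite -ltrBrDr.
Qed.

Lemma good_segment (y0 y1 : 'rV[R]_d) (s : R) : 0 < s -> good y0 ->
  (forall t x, 0 <= t <= 1 -> E x -> s <= enorm (x - (y0 + t *: (y1 - y0)))) ->
  good y1.
Proof.
move=> s0 g0 Es.
pose M := Num.trunc (enorm (y1 - y0) / (s / 32)).
have hM : enorm (y1 - y0) / M.+1%:R < s / 32.
  rewrite ltr_pdivrMr// mulrC -ltr_pdivrMr ?divr_gt0//.
  exact: truncnS_gt.
have : forall i, (i <= M.+1)%N -> good (y0 + (i%:R / M.+1%:R) *: (y1 - y0)).
  elim=> [|i IH] iM; first by rewrite mul0r scale0r addr0.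
  apply: (@good_near (y0 + (i%:R / M.+1%:R) *: (y1 - y0)) _ s) => //.
  - move=> x Ex; apply: Es => //.
    by rewrite divr_ge0//= ler_pdivrMr// mul1r ler_nat ltnW.
  - exact/IH/ltnW.
  - rewrite opprD addrACA subrr add0r -scalerBl -mulrBl -natrB// subSnn.
    by rewrite enormZ ger0_norm ?divr_ge0// mul1r mulrC.
by move=> /(_ M.+1 (leqnn _)); rewrite divff ?pnatr_eq0// scale1r addrC subrK.
Qed.

End poles.

(** * Radial solutions with a distant pole as limits of plane waves *)

Lemma telescoping_prod_bound (R : realType) (K : R) m : 0 <= K ->
  \prod_(i < m) (1 + K / (i.+1%:R * i.+2%:R)) <= expR K.
Proof.
move=> K0; suff h : \prod_(i < m) (1 + K / (i.+1%:R * i.+2%:R)) <= expR (K * (1 - m.+1%:R^-1)).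
  apply: le_trans h _; rewrite ler_expR ler_piMr// lerBlDr lerDl invr_ge0//.
elim: m => [|m IH]; first by rewrite big_ord0 invr1 subrr mulr0 expR0.
rewrite big_ord_recr /=.
have -> : K * (1 - m.+2%:R^-1) = K * (1 - m.+1%:R^-1) + K / (m.+1%:R * m.+2%:R).
  by have n0 := ler0n R m; field; field_side.
have Y0 : 0 <= K / (m.+1%:R * m.+2%:R) by rewrite divr_ge0// mulr_ge0.
rewrite expRD ler_pM ?expR_ge1Dx// ?addr_ge0//.
by apply: prodr_ge0 => i _; rewrite addr_ge0// divr_ge0// mulr_ge0.
Qed.

Lemma succn_le_exp2 (R : realType) n : n.+1%:R <= 2 ^+ n :> R.
Proof. by rewrite -natrX ler_nat ltn_expl. Qed.

Section axial_operator.
Context (R : realType) (k : R).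
Implicit Types (phi psi : nat -> R).

(* The action of [d^2/ds^2 + k^2] on Taylor coefficients. *)
Definition axial_op phi n : R := (n.+2 * n.+1)%:R * phi n.+2 + k ^+ 2 * phi n.

Lemma axial_op_lin phi psi a b m n :
  iter m axial_op (fun n => a * phi n + b * psi n) n =
  a * iter m axial_op phi n + b * iter m axial_op psi n.
Proof. by elim: m n => [|m IH] n //=; rewrite /axial_op !IH; ring. Qed.

Lemma axial_op_ext phi psi : phi =1 psi -> forall m n,
  iter m axial_op phi n = iter m axial_op psi n.
Proof. by move=> pp; elim=> [|m IH] n //=; rewrite /axial_op !IH. Qed.

(** Two derivatives cost r^-2 times a factorial growth. The term k^2 is charged relative to that
    growth, so that its total contribution becomes a convergent product. *)
Lemma axial_op_bound phi (e r : R) : 0 <= e -> 0 < r -> (forall n, `|phi n| <= e / r ^+ n) ->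
  forall m n, `|iter m axial_op phi n| <= e / r ^+ n * ((n + 2 * m)`!%:R / n`!%:R) *
     \prod_(i < m) (r ^- 2 + k ^+ 2 / ((2 * i).+1%:R * (2 * i).+2%:R)).
Proof.
move=> e0 r0 phir; elim=> [|m IH] n.
  rewrite /= muln0 addn0 big_ord0 mulr1 divff ?mulr1; first exact: phir.
  by rewrite pnatr_eq0 -lt0n fact_gt0.
set Pm := \prod_(i < m) _ in IH.
have Pm0 : 0 <= Pm.
  by apply: prodr_ge0 => i _; rewrite addr_ge0 ?invr_ge0 ?exprn_ge0 ?divr_ge0 ?sqr_ge0 ?mulr_ge0 ?ltW.
rewrite iterS {1}/axial_op; apply: le_trans (ler_normD _ _) _.
rewrite [`|k ^+ 2 * _|]normrM (ger0_norm (sqr_ge0 k)) normrM normr_nat.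
apply: le_trans (lerD (ler_wpM2l _ (IH n.+2)) (ler_wpM2l _ (IH n))) _ => //; first exact: sqr_ge0.
rewrite big_ord_recr /= -/Pm.
have nm0 : 0 < (n + 2 * m)`!%:R :> R by rewrite ltr0n fact_gt0.
have n0 : 0 < n`!%:R :> R by rewrite ltr0n fact_gt0.
have -> : (n.+2 + 2 * m = (n + 2 * m).+2)%N by lia.
have -> : (n + 2 * m.+1 = (n + 2 * m).+2)%N by lia.
rewrite !factS !natrM.
set A := (n + 2 * m)`!%:R; set B := n`!%:R.
have E1 : n.+2%:R * n.+1%:R * (e / r ^+ n.+2 * ((n + 2 * m).+2%:R * ((n + 2 * m).+1%:R * A) / (n.+2%:R * (n.+1%:R * B))) * Pm)
   = e / r ^+ n * ((n + 2 * m).+2%:R * ((n + 2 * m).+1%:R * A) / B) * Pm * r ^- 2.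
  have h0 := ler0n R n; rewrite !exprS; field.
  by rewrite !gt_eqF ?exprn_gt0// /=; field_side.
have E2 : k ^+ 2 * (e / r ^+ n * (A / B) * Pm) =
   e / r ^+ n * ((n + 2 * m).+2%:R * ((n + 2 * m).+1%:R * A) / B) * Pm *
    (k ^+ 2 / ((n + 2 * m).+1%:R * (n + 2 * m).+2%:R)).
  have h0 := ler0n R (n + 2 * m); field.
  by rewrite !gt_eqF ?exprn_gt0// /=; field_side.
rewrite E1 E2 -mulrDr [leRHS]mulrA ler_wpM2l//.
  by rewrite mulr_ge0// mulr_ge0 ?divr_ge0 ?mulr_ge0 ?exprn_ge0 ?(ltW r0).
rewrite lerD2l ler_wpM2l ?sqr_ge0// lef_pV2 ?posrE ?mulr_gt0// -!natrM ler_nat.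
by rewrite leq_mul// ltnS ?leq_addl// ltnS leq_addl.
Qed.

End axial_operator.

Section axial_coefficients.
Context (R : realType) (d : nat).
Hypothesis d2 : (2 <= d)%N.

(* [sum_m (-1)^m axial_coef m (lambda rho)^(2 m)] is cos (lambda rho) for d = 2
   and J_0 (lambda rho) for d = 3, the average of cos (lambda omega . z) over
   the unit vectors omega orthogonal to the axis. *)
Fixpoint axial_coef m : R :=
  if m is m'.+1 then axial_coef m' / (2 * m'.+1%:R * (2 * m' + d.-1)%:R) else 1.

Lemma axial_coef_gt0 m : 0 < axial_coef m.
Proof.
elim: m => [|m IH] //=; rewrite divr_gt0// !mulr_gt0// ltr0n; lia.
Qed.

Lemma axial_coef_le m : axial_coef m * (2 * m)`!%:R <= 1.
Proof.
elim: m => [|m IH] /=; first by rewrite muln0 mulr1.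
have -> : (2 * m.+1 = (2 * m).+2)%N by lia.
rewrite !factS !natrM.
have d0 : 0 < (2 * m + d.-1)%:R :> R by rewrite ltr0n; lia.
have n0 := ler0n R m.
have -> : axial_coef m / (2 * m.+1%:R * (2 * m + d.-1)%:R) *
    ((2 * m).+2%:R * ((2 * m).+1%:R * (2 * m)`!%:R)) =
   (axial_coef m * (2 * m)`!%:R) * ((2 * m).+1%:R / (2 * m + d.-1)%:R).
  have -> : (2 * m).+2%:R = 2 * m.+1%:R :> R by rewrite -natrM mulnS.
  move: (2 * m + d.-1)%:R d0 => D d0.
  by field; rewrite (gt_eqF d0)/=; field_side.
rewrite -[leRHS]mulr1 ler_pM ?mulr_ge0 ?divr_ge0 ?(ltW (axial_coef_gt0 _))//.
by rewrite ler_pdivrMr// mul1r ler_nat; lia.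
Qed.

(** A solution of the Helmholtz equation that is symmetric about an axis is determined by its trace
    on the axis. This is its expansion in the squared distance [h] to the axis, where [phi] lists
    the Taylor coefficients of the trace. The transverse Laplacian sends rho^(2m+2) to
    2(m+1)(2m+d-1) rho^(2m), which dictates [axial_coef]. *)
Definition axial_sum (k : R) (phi : nat -> R) (h : R) M : R :=
  \sum_(m < M) (-1) ^+ m * axial_coef m * h ^+ m * iter m (axial_op k) phi 0%N.

(** The weight (2P)^n against h <= P^2 leaves a ratio 1/4 from one term to the next. The bound is
    uniform in [M], so uniform limits of weighted traces pass through the expansion. *)
Lemma axial_sum_bound (k : R) (phi : nat -> R) (h e P : R) M :
  0 <= e -> 0 < P -> 0 <= h <= P ^+ 2 -> (forall n, `|phi n| <= e / (2 * P) ^+ n) ->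
  `|axial_sum k phi h M| <= e * (2 * expR (4 * (k * P) ^+ 2)).
Proof.
move=> e0 P0 /andP[h0 hP] phiP; apply: le_trans (ler_norm_sum _ _ _) _.
apply: (@le_trans _ _ (\sum_(m < M) e * expR (4 * (k * P) ^+ 2) * 4^-1 ^+ m)); last first.
  rewrite -mulr_sumr -mulrA ler_wpM2l// [leRHS]mulrC ler_wpM2l ?expR_ge0//.
  have : (1 - 4^-1 : R) * \sum_(m < M) 4^-1 ^+ m <= 1.
    have := subrX1 (4^-1 : R) M => h1.
    have -> : (1 - 4^-1 : R) * \sum_(m < M) 4^-1 ^+ m = 1 - 4^-1 ^+ M.
      by rewrite -[RHS]opprB h1 -mulNr opprB.
    by rewrite lerBlDr lerDl exprn_ge0.
  lra.
apply: ler_sum => m _; rewrite !normrM normrX normrN1 expr1n mul1r.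
rewrite (ger0_norm (ltW (axial_coef_gt0 m))) normrX (ger0_norm h0).
have P20 : 0 < 2 * P by rewrite mulr_gt0.
have := @axial_op_bound R k phi e (2 * P) e0 P20 phiP m 0.
rewrite expr0 divr1 fact0 divr1 add0n; set Pm := \prod_(i < m) _ => hb.
have Pm0 : 0 <= Pm.
  by apply: prodr_ge0 => i _; rewrite addr_ge0 ?invr_ge0 ?exprn_ge0 ?divr_ge0 ?sqr_ge0 ?mulr_ge0 ?ltW.
apply: (@le_trans _ _ (axial_coef m * (P ^+ 2) ^+ m * (e * (2 * m)`!%:R * Pm))).
  apply: ler_pM => //.
  - by rewrite mulr_ge0 ?exprn_ge0// ltW// axial_coef_gt0.
  - by rewrite ler_wpM2l ?(ltW (axial_coef_gt0 _))// lerXn2r ?nnegrE// exprn_ge0// ltW.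
have -> : axial_coef m * (P ^+ 2) ^+ m * (e * (2 * m)`!%:R * Pm) =
  e * ((P ^+ 2) ^+ m * Pm) * (axial_coef m * (2 * m)`!%:R) by ring.
have PP : (P ^+ 2) ^+ m * Pm <= expR (4 * (k * P) ^+ 2) * 4^-1 ^+ m.
  have -> : (P ^+ 2) ^+ m * Pm = \prod_(i < m) (P ^+ 2 * ((2 * P) ^- 2 + k ^+ 2 / ((2 * i).+1%:R * (2 * i).+2%:R))).
    by rewrite big_split /= prodr_const card_ord.
  apply: (@le_trans _ _ (\prod_(i < m) (4^-1 * (1 + 4 * (k * P) ^+ 2 / (i.+1%:R * i.+2%:R))))).
    apply: ler_prod => i _; apply/andP; split.
      by rewrite mulr_ge0 ?sqr_ge0// addr_ge0 ?invr_ge0 ?exprn_ge0 ?divr_ge0 ?sqr_ge0 ?mulr_ge0 ?ltW.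
    have -> : P ^+ 2 * ((2 * P) ^- 2 + k ^+ 2 / ((2 * i).+1%:R * (2 * i).+2%:R)) =
        4^-1 + (k * P) ^+ 2 / ((2 * i).+1%:R * (2 * i).+2%:R).
      have i0 := ler0n R i; have i2 := ler0n R (2 * i).
      by field; rewrite gt_eqF//=; field_side.
    have -> : 4^-1 * (1 + 4 * (k * P) ^+ 2 / (i.+1%:R * i.+2%:R)) =
        4^-1 + (k * P) ^+ 2 / (i.+1%:R * i.+2%:R).
      by have i0 := ler0n R i; field; field_side.
    rewrite lerD2l ler_wpM2l ?sqr_ge0//.
    by rewrite lef_pV2 ?posrE ?mulr_gt0// -!natrM ler_nat; nia.
  rewrite big_split /= prodr_const card_ord mulrC ler_wpM2r ?exprn_ge0//.
  by apply: telescoping_prod_bound; rewrite mulr_ge0// sqr_ge0.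
rewrite -[leRHS]mulr1 ler_pM ?axial_coef_le//.
- by rewrite mulr_ge0// mulr_ge0// exprn_ge0// sqr_ge0.
- by rewrite mulr_ge0// ltW// axial_coef_gt0.
- by rewrite -mulrA ler_wpM2l.
Qed.

End axial_coefficients.

Section cos_taylor.
Context (R : realType).

Let qpi : R := pi / 2.

Lemma cosD2qpi (u : R) n : cos (u + n.+2%:R * qpi) = - cos (u + n%:R * qpi).
Proof. by rewrite -cosDpi; congr cos; rewrite /qpi -[n.+2]addn2 natrD; field. Qed.

Lemma cosDqpi (u : R) n : cos (u + n.+1%:R * qpi) = - sin (u + n%:R * qpi).
Proof.
by rewrite -cosDpihalf; congr cos; rewrite /qpi -[n.+1]addn1 natrD; field.
Qed.

Lemma cos_tower (c : R) :
  tower [set: R] (fun n u => n`!%:R^-1 * cos (u + c + n%:R * qpi)).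
Proof.
move=> n u _.
have := dvZ (n`!%:R^-1) (@dv_comp _ _ (fun u => u + c + n%:R * qpi) _ _ _
  (is_derive_cos (u + c + n%:R * qpi)) (dvD (dvD (dv_id u) (dvC u c)) (dvC u (n%:R * qpi)))).
move=> /dv_eq; apply; rewrite cosDqpi factS natrM.
have n0 : 0 < n`!%:R :> R by rewrite ltr0n fact_gt0.
have m0 := ler0n R n.
by field; rewrite gt_eqF//=; field_side.
Qed.

Lemma cos_taylor (c v : R) J :
  `|cos (v + c) - \sum_(j < J) j`!%:R^-1 * cos (c + j%:R * qpi) * v ^+ j|
    <= J.+1%:R / J`!%:R * `|v| ^+ J.
Proof.
have := @tower_taylor R _ _ J 0 v (J`!%:R^-1) (cos_tower c) _ _.
rewrite subr0 fact0 invr1 mul1r mul0r addr0.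
under [X in _ - X]eq_bigr do rewrite add0r.
by apply=> // u _; rewrite normrM ger0_norm ?invr_ge0// ler_piMr ?invr_ge0// ler_norml cos_geN1 cos_le1.
Qed.

Lemma cos_taylor_even (v : R) M :
  `|cos v - \sum_(m < M) (-1) ^+ m / (2 * m)`!%:R * v ^+ (2 * m)|
    <= (2 * M).+1%:R / (2 * M)`!%:R * `|v| ^+ (2 * M).
Proof.
have := cos_taylor 0 v (2 * M); rewrite addr0.
suff -> : \sum_(j < 2 * M) j`!%:R^-1 * cos (0 + j%:R * qpi) * v ^+ j =
  \sum_(m < M) (-1) ^+ m / (2 * m)`!%:R * v ^+ (2 * m) by [].
have c0 m : cos (0 + (2 * m)%:R * qpi) = (-1) ^+ m.
  elim: m => [|m IH]; first by rewrite muln0 mul0r addr0 cos0.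
  by rewrite mulnS add2n cosD2qpi IH exprS mulN1r.
have c1 m : cos (0 + (2 * m).+1%:R * qpi) = 0.
  elim: m => [|m IH]; first by rewrite muln0 mul1r add0r /qpi cos_pihalf.
  by rewrite mulnS !addSn cosD2qpi IH oppr0.
elim: M => [|M IH]; first by rewrite muln0 !big_ord0.
rewrite [RHS]big_ord_recr /= -IH.
have -> : (2 * M.+1 = (2 * M).+2)%N by lia.
by rewrite !big_ord_recr /= c0 c1 mulr0 mul0r addr0; congr (_ + _); ring.
Qed.

Lemma fact_small (a e : R) : 0 <= a -> 0 < e ->
  exists N, forall n, (N <= n)%N -> n.+1%:R / n`!%:R * a ^+ n <= e.
Proof.
move=> a0 e0.
have : exp_coeff (2 * a) @ \oo --> 0 by apply: cvg_exp_coeff.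
move=> /cvgrPdist_le/(_ _ e0)[N _ hN]; exists N => n /hN.
rewrite sub0r normrN /exp_coeff /= exprMn ger0_norm; last first.
  by rewrite divr_ge0// mulr_ge0// exprn_ge0.
apply: le_trans; rewrite mulrAC ler_wpM2r ?invr_ge0// ler_wpM2r ?exprn_ge0//.
exact: succn_le_exp2.
Qed.

End cos_taylor.

(** This is the tower of [f m], the m-th derivative divided by m!. *)
Lemma shifted_tower (R : realType) I (f : nat -> R -> R) m : tower I f ->
  tower I (fun j q => 'C(m + j, m)%:R * f (m + j)%N q).
Proof.
move=> tf j q Iq; apply: dv_eq (dvZ _ (tf (m + j)%N q Iq)) _.
rewrite addnS mulrA [RHS]mulrA -!natrM; congr (_%:R * _).
by rewrite mulnC mul_bin_down; congr (_ * _)%N; lia.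
Qed.

Section axial_equation.
Context (R : realType) (d : nat) (k : R) (F0 F1 : R -> R) (Y : R).
Hypothesis F01 : radial_solution d k F0 F1.
Hypothesis d2 : (2 <= d)%N.

Let f := radial d k F0 F1.
Let g m j q := 'C(m + j, m)%:R * f (m + j)%N q.

Definition axial_pole m n u := quad_comp (g m) (Y ^+ 2) (- 2 * Y) n u.

Let qE (u : R) : Y ^+ 2 + - 2 * Y * u + u ^+ 2 = (Y - u) ^+ 2.
Proof. by ring. Qed.

Lemma axial_pole_tower m : tower [set u | u < Y] (axial_pole m).
Proof.
have := @quad_comp_tower R (g m) (Y ^+ 2) (- 2 * Y) (shifted_tower m (radial_tower F01)).
by move=> h n u /= uY; apply: h; rewrite /= qE exprn_gt0// subr_gt0.
Qed.

(** [tower_unique] leaves only order 0 to check, where this is the radial equation at q = (Y - u)^2.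
    Iterated, it turns the m-th term of the axial expansion into [radial m q] times h^m. *)
Lemma axial_pole_step m n u : u < Y ->
  axial_op k (fun n => axial_pole m n u) n =
  - (2 * m.+1%:R * (2 * m + d.-1)%:R) * axial_pole m.+1 n u.
Proof.
pose I := [set u | u < Y].
have oI : open I by exact: open_lt.
pose p n u := axial_op k (fun n => axial_pole m n u) n.
pose p' n u := - (2 * m.+1%:R * (2 * m + d.-1)%:R) * axial_pole m.+1 n u.
have tp : tower I p.
  move=> j v Iv; have T := axial_pole_tower.
  apply: dv_eq (dvD (dvZ _ (T m j.+2 v Iv)) (dvZ _ (T m j v Iv))) _.
  by rewrite /p /axial_op !natrM; have j0 := ler0n R j; ring.
have tp' : tower I p'.
  move=> j v Iv; apply: dv_eq (dvZ _ (axial_pole_tower m.+1 j Iv)) _.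
  by rewrite /p'; ring.
move=> uY; apply: (tower_unique oI tp tp') => [v|]; last by rewrite inE.
rewrite inE /= => vY; rewrite /p /p' /axial_op /axial_pole /quad_comp.
rewrite !big_ord_recr !big_ord0 /= !add0r !qE !binn !bin0 !muln0 !expr0 !mulr1.
rewrite (_ : 'C(0, 2 - 0) = 0%N)// mulr0 add0r /g !addn0 addn1 addn2 !binn !mul1r.
have Yv : 0 < Y - v by rewrite subr_gt0.
set q := (Y - v) ^+ 2; have q0 : q != 0 by rewrite gt_eqF// exprn_gt0.
have -> : (-2 * Y + 2 * v) ^+ (2 * 2 - 2) = 4 * q by rewrite /q; ring.
have -> : 'C(m.+1, m)%:R = m.+1%:R :> R by rewrite binSn.
have -> : 'C(m.+2, m)%:R = m.+2%:R * m.+1%:R / 2 :> R.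
  have := mul_bin_down m.+2 m; rewrite /= binSn.
  have -> : (m.+2 - m = 2)%N by lia.
  move=> /(congr1 (fun i => i%:R : R)); rewrite !natrM => ->.
  by rewrite mulrC mulKf.
rewrite /f radialSS; have m0 := ler0n R m.
have dE : (2 * m + d.-1)%:R = 2 * m%:R + d%:R - 1 :> R.
  by rewrite -subn1 natrD natrB ?natrM; [ring|lia].
rewrite dE natrM natrD !natrM.
by field; rewrite q0 /=; field_side.
Qed.

Lemma axial_pole_iter m n u : u < Y ->
  iter m (axial_op k) (fun n => axial_pole 0 n u) n =
  (-1) ^+ m / axial_coef R d m * axial_pole m n u.
Proof.
move=> uY; elim: m n => [|m IH] n; first by rewrite expr0 divr1 mul1r.
rewrite iterS.
have -> : axial_op k (iter m (axial_op k) (fun n => axial_pole 0 n u)) n =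
  (-1) ^+ m / axial_coef R d m * axial_op k (fun n => axial_pole m n u) n.
  by rewrite /axial_op !IH; ring.
rewrite axial_pole_step//= exprS invfM invrK.
have := axial_coef_gt0 R d2 m; move: (axial_coef _ _ _) => a a0.
have d0 : 0 < (2 * m + d.-1)%:R :> R by rewrite ltr0n; lia.
by field; rewrite gt_eqF.
Qed.

Lemma axial_pole00 m u : axial_pole m 0 u = f m ((Y - u) ^+ 2).
Proof.
by rewrite /axial_pole /quad_comp big_ord1 muln0 subn0 bin0 expr0 !mulr1 qE /g addn0 binn mul1r.
Qed.

End axial_equation.

Section far_pole.
Context (R : realType) (d : nat) (k : R) (F0 F1 : R -> R).
Hypothesis F01 : radial_solution d k F0 F1.
Hypothesis k0 : 0 < k.
Hypothesis d2 : (2 <= d)%N.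
Hypothesis d4 : (d <= 4)%N.
Variables (E : set 'rV[R]_d) (S : set ('rV[R]_d -> R)) (e y : 'rV[R]_d) (P : R).
Hypothesis SE : uniformly_closed E S.
Hypothesis S_plane_wave : forall (theta : 'rV[R]_d) (c : R), dotv theta theta = 1 ->
  S (fun x => cos (k * dotv theta x + c)).

(* Finitely many unit vectors orthogonal to the axis [e], with the same moments
   up to order 2 M as the uniform distribution. *)
Definition transverse_design : Prop := forall M, exists N (om : 'I_N.+1 -> 'rV[R]_d),
  (forall j, dotv (om j) (om j) = 1 /\ dotv (om j) e = 0) /\
  forall z m, (m < M)%N -> N.+1%:R^-1 * \sum_j dotv (om j) z ^+ (2 * m) =
    axial_coef R d m * (2 * m)`!%:R * (dotv z z - dotv z e ^+ 2) ^+ m.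

Hypothesis AVG : transverse_design.
Hypothesis e1 : dotv e e = 1.
Hypothesis P0 : 0 < P.

Let s (x : 'rV[R]_d) : R := dotv x e.
Let Y := s y.
Let h (x : 'rV[R]_d) : R := dotv (x - y) (x - y) - dotv (x - y) e ^+ 2.
Hypothesis EsP : forall x, E x -> `|s x| <= P.
Hypothesis EhP : forall x, E x -> h x <= P ^+ 2.

Let hE x : h x = dotv (x - y - dotv (x - y) e *: e) (x - y - dotv (x - y) e *: e).
Proof.
rewrite /h; move: (x - y) => z.
by rewrite !(dotvBl, dotvBr, dotvZl, dotvZr) e1 (dotvC e); ring.
Qed.

Let h_ge0 x : 0 <= h x.
Proof. by rewrite hE dotv_ge0. Qed.

Let P2n n : (2 * P) ^+ n != 0.
Proof. by rewrite expf_neq0// gt_eqF// mulr_gt0. Qed.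

(** [Psi (n, x)] stands for (2P)^n times the n-th Taylor coefficient at [s x] of a function on the
    axis; with this weight the sup norm of [Psi] controls the expansion. *)
Let wsum (Psi : nat * 'rV[R]_d -> R) M x :=
  axial_sum d k (fun n => Psi (n, x) / (2 * P) ^+ n) (h x) M.

(** The traces whose symmetric extension is approximable in [S]. The approximant may depend on [M],
    because a finite design reproduces only finitely many moments. The set is uniformly closed in
    its turn, so the power series lemmas apply to traces. *)
Let S2 : set (nat * 'rV[R]_d -> R) := [set Psi | forall eps : R, 0 < eps ->
  exists M0, forall M, (M0 <= M)%N ->
    exists2 g, S g & forall x, E x -> `|g x - wsum Psi M x| <= eps].

Let E2 : set (nat * 'rV[R]_d) := [set p | E p.2].

Let wsum_lin (Psi1 Psi2 : nat * 'rV[R]_d -> R) a b M x :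
  wsum (fun p => a * Psi1 p + b * Psi2 p) M x = a * wsum Psi1 M x + b * wsum Psi2 M x.
Proof.
rewrite /wsum /axial_sum !mulr_sumr -big_split /=; apply: eq_bigr => m _.
rewrite (@axial_op_ext _ k _ (fun n => a * (Psi1 (n, x) / (2 * P) ^+ n) + b * (Psi2 (n, x) / (2 * P) ^+ n))).
  by rewrite axial_op_lin; ring.
by move=> n /=; rewrite mulrDl !mulrA.
Qed.

Let S2_closed : uniformly_closed E2 S2.
Proof.
split=> [f g a b Sf Sg eps eps0|f Hf eps eps0].
  have D0 : 0 < `|a| + `|b| + 1 by rewrite ltr_wpDl// addr_ge0.
  have [|Mf hf] := Sf (eps / (`|a| + `|b| + 1)); first by rewrite divr_gt0.
  have [|Mg hg] := Sg (eps / (`|a| + `|b| + 1)); first by rewrite divr_gt0.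
  exists (maxn Mf Mg) => M; rewrite geq_max => /andP[/hf[f' Sf' ff'] /hg[g' Sg' gg']].
  exists (fun x => a * f' x + b * g' x); first exact: SE.1.
  move=> x Ex; rewrite wsum_lin.
  have -> : a * f' x + b * g' x - (a * wsum f M x + b * wsum g M x) =
    a * (f' x - wsum f M x) + b * (g' x - wsum g M x) by ring.
  apply: le_trans (ler_normD _ _) _; rewrite !normrM.
  apply: le_trans (lerD (ler_wpM2l _ (ff' x Ex)) (ler_wpM2l _ (gg' x Ex))) _ => //.
  rewrite -mulrDl mulrA ler_pdivrMr// mulrC ler_wpM2l ?(ltW eps0)// lerDl//.
set B := 2 * expR (4 * (k * P) ^+ 2).
have B0 : 0 < B by rewrite mulr_gt0 ?expR_gt0.
have [|f' Sf' ff'] := Hf (eps / 2 / B); first by rewrite !divr_gt0.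
have [|M0 hM0] := Sf' (eps / 2); first by rewrite divr_gt0.
exists M0 => M /hM0[g Sg hg]; exists g => // x Ex.
have -> : g x - wsum f M x = (g x - wsum f' M x) - (1 * wsum f M x + (-1) * wsum f' M x) by ring.
apply: le_trans (ler_normB _ _) _; rewrite [leRHS](splitr eps) lerD ?hg//.
rewrite -wsum_lin /wsum.
have -> : eps / 2 = eps / 2 / B * B by rewrite mulfVK// gt_eqF.
apply: axial_sum_bound => //; [by rewrite !divr_ge0// ltW|by rewrite h_ge0 EhP|].
move=> n; rewrite normrM normfV [`|(2 * P) ^+ n|]ger0_norm ?exprn_ge0 ?mulr_ge0 ?(ltW P0)//.
rewrite ler_wpM2r ?invr_ge0 ?exprn_ge0 ?mulr_ge0 ?(ltW P0)//.
by rewrite mul1r mulN1r ff'.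
Qed.

Let qpi : R := pi / 2.
Let wave xi c (p : nat * 'rV[R]_d) : R :=
  (2 * P) ^+ p.1 * (xi ^+ p.1 / p.1`!%:R * cos (xi * s p.2 + c + p.1%:R * qpi)).

Let wave_iter xi c u m n :
  iter m (axial_op k) (fun n => xi ^+ n / n`!%:R * cos (u + c + n%:R * qpi)) n =
  (k ^+ 2 - xi ^+ 2) ^+ m * (xi ^+ n / n`!%:R * cos (u + c + n%:R * qpi)).
Proof.
elim: m n => [|m IH] n; first by rewrite expr0 mul1r.
rewrite iterS /axial_op !IH cosD2qpi !factS !natrM !exprS.
have n0 : 0 < n`!%:R :> R by rewrite ltr0n fact_gt0.
have m0 := ler0n R n.
by field; rewrite (gt_eqF n0)/=; field_side.
Qed.

(** With la^2 = k^2 - xi^2, the symmetric solution of trace cos (xi s + c) is the average of cos (xi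
    s + c) cos (la omega . (x - y)) over the unit vectors omega orthogonal to [e]. Each product is
    the half sum of two plane waves with the unit directions (xi e + la omega) / k and (xi e - la
    omega) / k. A design gives a finite average with the same Taylor polynomial of degree below
    2M. *)
Let wave_S2 xi c : 0 < xi <= k -> S2 (wave xi c).
Proof.
move=> /andP[xi0 xik] eps eps0.
have L0 : 0 <= k ^+ 2 - xi ^+ 2 by rewrite subr_ge0 lerXn2r ?nnegrE ?(ltW xi0) ?(ltW k0).
set la := Num.sqrt (k ^+ 2 - xi ^+ 2).
have la0 : 0 <= la by exact: sqrtr_ge0.
have laE : la ^+ 2 = k ^+ 2 - xi ^+ 2 by rewrite sqr_sqrtr.
have [|N0 hN0] := @fact_small R (la * P) eps _ eps0; first by rewrite mulr_ge0// ltW.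
exists N0 => M N0M; have [N [om [om1 om2]]] := AVG M.
exists (fun x => \sum_(j < N.+1) N.+1%:R^-1 * (cos (xi * s x + c) * cos (la * dotv (om j) (x - y)))).
  pose W j x : R := cos (xi * s x + c) * cos (la * dotv (om j) (x - y)).
  have SW j : S (W j).
    pose th1 := (xi / k) *: e + (la / k) *: om j.
    pose th2 := (xi / k) *: e - (la / k) *: om j.
    have [a1 a2] := om1 j.
    have t1 : dotv th1 th1 = 1.
      rewrite /th1 !(dotvDl, dotvDr, dotvZl, dotvZr) e1 a1 (dotvC e) a2.
      have -> : xi / k * (xi / k * 1) + xi / k * (la / k * 0) +
        (la / k * (xi / k * 0) + la / k * (la / k * 1)) = (xi ^+ 2 + la ^+ 2) / k ^+ 2.
        by field; rewrite gt_eqF.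
      by rewrite laE addrC subrK divff// gt_eqF// exprn_gt0.
    have t2 : dotv th2 th2 = 1.
      rewrite /th2 !(dotvBl, dotvBr, dotvZl, dotvZr) e1 a1 (dotvC e) a2.
      have -> : xi / k * (xi / k * 1) - xi / k * (la / k * 0) -
        (la / k * (xi / k * 0) - la / k * (la / k * 1)) = (xi ^+ 2 + la ^+ 2) / k ^+ 2.
        by field; rewrite gt_eqF.
      by rewrite laE addrC subrK divff// gt_eqF// exprn_gt0.
    apply: (ucl_ext SE (SE.1 _ _ 2^-1 2^-1 (S_plane_wave (c - la * dotv (om j) y) t1)
      (S_plane_wave (c + la * dotv (om j) y) t2))) => x _ /=.
    rewrite /W /th1 /th2 dotvDl dotvBl !dotvZl dotvBr (dotvC e).
    have -> : k * (xi / k * dotv x e + la / k * dotv (om j) x) + (c - la * dotv (om j) y) =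
      (xi * s x + c) + la * (dotv (om j) x - dotv (om j) y).
      by rewrite /s; field; rewrite gt_eqF.
    have -> : k * (xi / k * dotv x e - la / k * dotv (om j) x) + (c + la * dotv (om j) y) =
      (xi * s x + c) - la * (dotv (om j) x - dotv (om j) y).
      by rewrite /s; field; rewrite gt_eqF.
    by rewrite cosD cosB; field.
  have S0 := SW ord0.
  have := @ucl_sum _ _ E S SE _ S0 N.+1 (fun _ => N.+1%:R^-1) (fun j => W (inord j)) (fun j _ => SW _).
  by move=> /(ucl_ext SE); apply => x _; apply: eq_bigr => j _; rewrite inord_val.
move=> x Ex.
pose v j := la * dotv (om j) (x - y).
have wE : wsum (wave xi c) M x =
    \sum_(j < N.+1) N.+1%:R^-1 * (cos (xi * s x + c) * \sum_(m < M) (-1) ^+ m / (2 * m)`!%:R * v j ^+ (2 * m)).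
  rewrite /wsum /axial_sum.
  transitivity (\sum_(m < M) cos (xi * s x + c) * ((-1) ^+ m / (2 * m)`!%:R * la ^+ (2 * m)) *
    (N.+1%:R^-1 * \sum_j dotv (om j) (x - y) ^+ (2 * m))).
    apply: eq_bigr => m _; rewrite om2//.
    rewrite (@axial_op_ext _ k _ (fun n => xi ^+ n / n`!%:R * cos (xi * s x + c + n%:R * qpi))); last first.
      by move=> n; rewrite /wave /= mulrAC divff// mul1r.
    rewrite wave_iter expr0 fact0 divr1 mul1r mul0r addr0 exprM laE -/(h x).
    have : 0 < (2 * m)`!%:R :> R by rewrite ltr0n fact_gt0.
    move: ((2 * m)`!%:R) => F F0'; by field; rewrite gt_eqF.
  under [RHS]eq_bigr do rewrite mulrA mulr_sumr.
  rewrite exchange_big /=; apply: eq_bigr => m _.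
  rewrite !mulr_sumr; apply: eq_bigr => j _.
  by rewrite /v exprMn; ring.
rewrite wE -sumrB; apply: le_trans (ler_norm_sum _ _ _) _.
apply: (@le_trans _ _ (\sum_(j < N.+1) N.+1%:R^-1 * eps)); last first.
  by rewrite -mulr_suml sumr_const card_ord -[_ *+ N.+1]mulr_natl divff ?mul1r// pnatr_eq0.
apply: ler_sum => j _; rewrite -mulrBr normrM ger0_norm ?invr_ge0// ler_wpM2l ?invr_ge0//.
rewrite -mulrBr normrM -[leRHS]mul1r ler_pM//; first by rewrite ler_norml cos_geN1 cos_le1.
apply: le_trans (cos_taylor_even _ _) _; apply: le_trans (hN0 (2 * M)%N _); last by lia.
rewrite ler_wpM2l ?divr_ge0// lerXn2r ?nnegrE ?mulr_ge0 ?(ltW P0)//.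
rewrite /v normrM (ger0_norm la0) ler_wpM2l//.
have [a1 a2] := om1 j.
have -> : dotv (om j) (x - y) = dotv (om j) (x - y - dotv (x - y) e *: e).
  by rewrite [RHS]dotvBr dotvZr a2 mulr0 subr0.
apply: le_trans (dotv_CS _ _) _; rewrite {1}/enorm a1 sqrtr1 mul1r.
rewrite -(ger0_norm (ltW P0)) -sqrtr_sqr /enorm ler_wsqrtr// -hE EhP//.
Qed.

Let mono N (p : nat * 'rV[R]_d) : R :=
  (2 * P) ^+ p.1 * ((p.1 <= N)%N%:R * 'C(N, p.1)%:R * s p.2 ^+ (N - p.1)).

Let wave_coef c N (p : nat * 'rV[R]_d) : R :=
  N`!%:R^-1 * cos (c + N%:R * qpi) * mono N p.

Let wave_expansion c N (xi : R) p : E2 p -> 0 < xi < (6 * P)^-1 ->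
  `|wave xi c p - \sum_(j < N) wave_coef c j p * xi ^+ j| <= 1 * (xi / (6 * P)^-1) ^+ N.
Proof.
case: p => n x Ex /andP[xi0 xi1]; rewrite mul1r invrK /wave /=.
have sP := EsP Ex.
have xiP0 : 0 <= xi * P by rewrite mulr_ge0// ltW.
have P60 : 0 < 6 * P by rewrite mulr_gt0.
have xiP : xi * P <= 6^-1.
  by move: xi1; rewrite -[(_ * _)^-1]mul1r ltr_pdivlMr//; lra.
have [Nn|nN] := leqP N n.
  rewrite big1 ?subr0; last first.
    move=> j _; rewrite /wave_coef /mono /= leqNgt (leq_trans _ Nn)//=.
    by rewrite !(mul0r, mulr0).
  rewrite !normrM normfV normr_nat !normrX (ger0_norm (_ : 0 <= 2 * P)) ?mulr_ge0 ?(ltW P0)//.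
  rewrite (ger0_norm (ltW xi0)) mulrA mulrA -exprMn.
  apply: (@le_trans _ _ ((2 * P * xi) ^+ n)).
    rewrite -mulrA ler_piMr ?exprn_ge0 ?mulr_ge0 ?(ltW P0) ?(ltW xi0)//.
    rewrite -[leRHS]mulr1 ler_pM ?invr_ge0//; first by rewrite invf_le1 ?ler1n ?ltr0n fact_gt0.
    by rewrite ler_norml cos_geN1 cos_le1.
  apply: (@le_trans _ _ ((2 * P * xi) ^+ N)).
    apply: ler_wiXn2l => //; first by rewrite !mulr_ge0 ?(ltW P0) ?(ltW xi0).
    lra.
  rewrite lerXn2r ?nnegrE ?mulr_ge0 ?(ltW P0) ?(ltW xi0)//; lra.
have [J NJ] : exists J, N = (n + J)%N by exists (N - n)%N; rewrite subnKC// ltnW.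
have n0 : 0 < n`!%:R :> R by rewrite ltr0n fact_gt0.
have -> : \sum_(j < N) wave_coef c j (n, x) * xi ^+ j =
   (2 * P) ^+ n * (xi ^+ n / n`!%:R) *
     \sum_(j < J) j`!%:R^-1 * cos (c + n%:R * qpi + j%:R * qpi) * (xi * s x) ^+ j.
  rewrite NJ big_split_ord /= big1 ?add0r; last first.
    by move=> i _; rewrite /wave_coef /mono /= leqNgt ltn_ord !(mul0r, mulr0).
  rewrite mulr_sumr; apply: eq_bigr => j _.
  rewrite /wave_coef /mono /= leq_addr mul1r addKn natrD mulrDl addrA exprD [(xi * _) ^+ j]exprMn.
  have := bin_fact (leq_addr j n); rewrite addKn => /(congr1 (fun i => i%:R : R)).
  rewrite !natrM => <-.
  have j0 : 0 < j`!%:R :> R by rewrite ltr0n fact_gt0.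
  have C0 : 0 < 'C(n + j, n)%:R :> R by rewrite ltr0n bin_gt0 leq_addr.
  by field; rewrite !gt_eqF.
have -> : xi * s x + c + n%:R * qpi = xi * s x + (c + n%:R * qpi) by rewrite addrA.
rewrite [(2 * P) ^+ n * (_ / _ * cos _)]mulrA -mulrBr normrM; apply: le_trans (ler_wpM2l _ (cos_taylor _ _ _)) _ => //.
rewrite !normrM normfV !normrX normr_nat normrM (ger0_norm (ltW xi0)) (ger0_norm (ltW P0)) normr_nat.
apply: (@le_trans _ _ ((2 * (xi * P)) ^+ n * (2 * (xi * P)) ^+ J)); last first.
  rewrite -exprD -NJ lerXn2r ?nnegrE ?mulr_ge0 ?(ltW P0) ?(ltW xi0)//; lra.
apply: ler_pM; rewrite ?mulr_ge0 ?exprn_ge0 ?invr_ge0 ?mulr_ge0 ?(ltW P0) ?(ltW xi0)//.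
  have -> : 2 * (xi * P) = 2 * P * xi by ring.
  rewrite [leRHS]exprMn ler_wpM2l ?exprn_ge0 ?mulr_ge0 ?(ltW P0)// ler_piMr ?exprn_ge0 ?(ltW xi0)//.
  by rewrite invf_le1 ?ler1n ?ltr0n fact_gt0.
rewrite [leRHS]exprMn; apply: ler_pM; rewrite ?exprn_ge0 ?divr_ge0 ?mulr_ge0 ?(ltW xi0)//.
  apply: le_trans (succn_le_exp2 R J); rewrite ler_piMr// invf_le1 ?ler1n ?ltr0n fact_gt0//.
rewrite lerXn2r ?nnegrE ?mulr_ge0 ?(ltW P0) ?(ltW xi0)//.
by rewrite ler_wpM2l ?(ltW xi0).
Qed.

(** The coefficient of xi^N in cos (xi s + c) is s^N cos (c + N pi / 2) / N!, and the phase c = - N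
    pi / 2 makes the cosine equal to 1. Only small xi > 0 are needed, so plane waves suffice. *)
Let mono_S2 N : S2 (mono N).
Proof.
have P60 : 0 < (6 * P)^-1 by rewrite invr_gt0 mulr_gt0.
pose c : R := - (N%:R * qpi).
have t0 : 0 < Num.min k (6 * P)^-1 by rewrite lt_min k0.
have H : S2 (wave_coef c N).
  apply: (@power_series_coef _ _ E2 S2 S2_closed (wave_coef c) (fun xi => wave xi c) _ 1 P60 ler01 _ t0).
    move=> M t p Ep /andP[t0' ]; rewrite lt_min => /andP[_ t6].
    by apply: wave_expansion; rewrite ?t0'.
  by move=> t /andP[t0']; rewrite lt_min => /andP[tk _]; apply: wave_S2; rewrite t0' ltW.
apply: (ucl_ext S2_closed (S2_closed.1 _ _ N`!%:R 0 H H)) => p _.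
by rewrite /wave_coef /c addNr cos0 mul0r addr0 mulr1 mulrA divff ?mul1r.
Qed.

Hypothesis YP : 65 * P <= Y.

Let rpole (p : nat * 'rV[R]_d) : R := (2 * P) ^+ p.1 * axial_pole d k F0 F1 Y 0 p.1 (s p.2).

Let YP2 u : `|u| <= P -> 64 * P <= Y - u.
Proof. by rewrite ler_norml => /andP[_ uP]; have := YP; lra. Qed.

Let pole_bound : exists2 C : R, 0 <= C & forall n u, `|u| <= P ->
  `|axial_pole d k F0 F1 Y 0 n u| <= C * (8 / (64 * P)) ^+ n.
Proof.
have q10 : 0 < (64 * P) ^+ 2 by rewrite exprn_gt0// mulr_gt0.
have [C C0 hC] := radial_bound_on F01 ((Y + P) ^+ 2) d4 q10.
exists C => // n u uP; have Yu := YP2 uP.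
have P64 : 0 < 64 * P by rewrite mulr_gt0.
have Yu0 : 0 < Y - u by exact: lt_le_trans Yu.
have qE : Y ^+ 2 + -2 * Y * u + u ^+ 2 = (Y - u) ^+ 2 by ring.
have b1 : (-2 * Y) ^+ 2 <= 4 * Y ^+ 2 by rewrite exprMn; lra.
have q0 : 0 < Y ^+ 2 + -2 * Y * u + u ^+ 2 by rewrite qE exprn_gt0.
rewrite /axial_pole; apply: le_trans (quad_comp_bound n b1 q0 C0 _) _.
  move=> m; rewrite bin0 mul1r add0n; apply: hC.
  rewrite qE !lerXn2r ?nnegrE ?(ltW Yu0) ?(ltW P64)//=.
    by have := YP; have := P0; lra.
  by move: uP; rewrite ler_norml => /andP[? _]; lra.
rewrite qE sqrtr_sqr (ger0_norm (ltW Yu0)) ler_wpM2l// lerXn2r ?nnegrE ?divr_ge0 ?(ltW Yu0) ?(ltW P64)//.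
by rewrite ler_wpM2l// lef_pV2.
Qed.

(** The trace of the pole is expanded in powers of s around 0. As 65 P <= Y, the pole stays at
    distance 64 P from the segment |s| <= P; this beats the weight (2P)^n and the binomials, and the
    N-th remainder is at most C 2^-N. *)
Let rpole_S2 : S2 rpole.
Proof.
have [C C0 hC] := pole_bound.
pose c N p := axial_pole d k F0 F1 Y 0 N 0 * mono N p.
have Sc N : S2 (c N).
  apply: (ucl_ext S2_closed (S2_closed.1 _ _ (axial_pole d k F0 F1 Y 0 N 0) 0 (mono_S2 N) (mono_S2 N))) => p _.
  by rewrite mul0r addr0.
have r20 : 0 < 2 :> R by [].
have t12 : ((0 : R) <= 1) && ((1 : R) < 2) by rewrite ler01 (ltr_nat R 1 2).
have P64 : 0 < 64 * P by rewrite mulr_gt0.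
have P00 : `|0 : R| <= P by rewrite normr0 ltW.
have a8 : 0 <= 8 / (64 * P) by rewrite divr_ge0// ltW.
have P2r : 2 * P * (8 / (64 * P)) <= 2^-1.
  have -> : 2 * P * (8 / (64 * P)) = 16 / 64 by field; rewrite gt_eqF.
  lra.
(* The powers of s are already inside [mono], so the series is summed at t = 1, with radius 2. *)
apply: (@power_series_sum _ _ E2 S2 S2_closed c (fun _ => rpole) 2 C r20 C0 1 Sc t12).
move=> N [n x] Ex; rewrite div1r.
under eq_bigr do rewrite expr1n mulr1.
have sP := EsP Ex.
have [Nn|nN] := leqP N n.
  rewrite big1 ?subr0; last first.
    by move=> j _; rewrite /c /mono /= leqNgt (leq_trans _ Nn)//= !(mul0r, mulr0).
  rewrite /rpole /= normrM normrX ger0_norm ?mulr_ge0 ?(ltW P0)//.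
  apply: le_trans (ler_wpM2l _ (hC n _ sP)) _; first by rewrite exprn_ge0// mulr_ge0// ltW.
  rewrite mulrCA -exprMn ler_wpM2l//.
  apply: (@le_trans _ _ (2^-1 ^+ n)); first by rewrite lerXn2r ?nnegrE ?invr_ge0// mulr_ge0// mulr_ge0// ltW.
  by apply: ler_wiXn2l => //; rewrite ?invr_ge0// invf_le1// ler1n.
have [J NJ] : exists J, N = (n + J)%N by exists (N - n)%N; rewrite subnKC// ltnW.
pose T := axial_pole d k F0 F1 Y 0.
have TT : tower [set u | u < Y] (fun j u => 'C(n + j, n)%:R * T (n + j)%N u).
  exact: shifted_tower (axial_pole_tower F01 0).
have -> : \sum_(j < N) c j (n, x) =
    (2 * P) ^+ n * \sum_(j < J) 'C(n + j, n)%:R * T (n + j)%N 0 * (s x - 0) ^+ j.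
  rewrite NJ big_split_ord /= big1 ?add0r; last first.
    by move=> i _; rewrite /c /mono /= leqNgt ltn_ord !(mul0r, mulr0).
  rewrite mulr_sumr; apply: eq_bigr => j _.
  by rewrite /c /mono /= leq_addr mul1r addKn subr0 /T; ring.
rewrite /rpole /= -mulrBr normrM normrX ger0_norm ?mulr_ge0 ?(ltW P0)//.
have mM u : Num.min 0 (s x) <= u <= Num.max 0 (s x) -> `|u| <= P.
  move: sP; rewrite !ler_norml => /andP[s1 s2]; rewrite ge_min le_max => /andP[u1 u2].
  by apply/andP; split; [case/orP: u1|case/orP: u2]; have := P0; lra.
have := @tower_taylor R _ _ J 0 (s x) (2 ^+ N * (C * (8 / (64 * P)) ^+ N)) TT _ _.
rewrite addn0 binn mul1r => tay.
apply: le_trans (ler_wpM2l _ (tay _ _)) _.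
- by rewrite exprn_ge0// mulr_ge0// ltW.
- by move=> u /mM /YP2 Yu /=; rewrite -subr_gt0; apply: lt_le_trans Yu.
- move=> u /mM uP; rewrite -NJ normrM normr_nat ler_pM//; last exact: hC.
  by rewrite -natrX ler_nat bin_le_exp2.
rewrite subr0; apply: (@le_trans _ _ (C * ((2 * P) ^+ n * (2 * P) ^+ J * (2 * (8 / (64 * P))) ^+ N))).
  rewrite [(2 * (8 / _)) ^+ N]exprMn.
  have -> : (2 * P) ^+ n * (J.+1%:R * (2 ^+ N * (C * (8 / (64 * P)) ^+ N)) * `|s x| ^+ J) =
    C * ((2 * P) ^+ n * (J.+1%:R * `|s x| ^+ J) * (2 ^+ N * (8 / (64 * P)) ^+ N)) by ring.
  rewrite ler_wpM2l// ler_wpM2r ?mulr_ge0 ?exprn_ge0// ler_wpM2l ?exprn_ge0 ?mulr_ge0 ?(ltW P0)//.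
  rewrite [leRHS]exprMn ler_pM ?exprn_ge0// ?succn_le_exp2//.
  by rewrite lerXn2r ?nnegrE// ltW.
rewrite ler_wpM2l// -exprD -NJ -exprMn lerXn2r ?nnegrE ?mulr_ge0 ?(ltW P0) ?invr_ge0 ?(ltW P64)//.
have -> : 2 * P * (2 * (8 / (64 * P))) = 32 / 64 by field; rewrite gt_eqF.
lra.
Qed.

(** By [axial_pole_iter] the signs and [axial_coef] cancel, and the partial sums are the Taylor
    polynomials of [F0] from q = (Y - s x)^2 to q + h x = |x - y|^2. They converge geometrically
    because h <= P^2 and q >= (64 P)^2. *)
Lemma far_pole : S (pole F0 y).
Proof.
apply SE.2 => eps eps0.
have e20 : 0 < eps / 2 by rewrite divr_gt0.
have [M0 hM0] := rpole_S2 e20.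
have q10 : 0 < (64 * P) ^+ 2 by rewrite exprn_gt0// mulr_gt0.
have P64 : 0 < 64 * P by rewrite mulr_gt0.
have [C C0 hC] := radial_bound_on F01 ((Y + P) ^+ 2 + P ^+ 2) d4 q10.
have [||N0 hN0] := @geometric_small R 2^-1 (eps / 2 / (C + 1)).
- by rewrite invr_ge0 ler0n/= invf_lt1 ?ltr1n.
- by rewrite divr_gt0// ltr_wpDl.
pose M := maxn M0 N0.
have [g Sg hg] := hM0 M (leq_maxl _ _); exists g => // x Ex.
have -> : pole F0 y x - g x = (pole F0 y x - wsum rpole M x) - (g x - wsum rpole M x) by ring.
apply: le_trans (ler_normB _ _) _; rewrite [leRHS](splitr eps) lerD ?hg//.
have sP := EsP Ex; have Yu := YP2 sP.
have Yu0 : 0 < Y - s x by exact: lt_le_trans Yu.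
set q := (Y - s x) ^+ 2.
have q1 : (64 * P) ^+ 2 <= q by rewrite lerXn2r ?nnegrE ?(ltW P64) ?(ltW Yu0).
have q0 : 0 < q by exact: lt_le_trans q1.
have qQ : q <= (Y + P) ^+ 2.
  rewrite lerXn2r ?nnegrE ?(ltW Yu0)//.
    by have := YP; have := P0; lra.
  by move: sP; rewrite ler_norml => /andP[? _]; lra.
have hh := EhP Ex; have h0 := h_ge0 x.
have sE : wsum rpole M x = \sum_(m < M) radial d k F0 F1 m q * (q + h x - q) ^+ m.
  rewrite /wsum /axial_sum; apply: eq_bigr => m _.
  rewrite (@axial_op_ext _ k _ (fun n => axial_pole d k F0 F1 Y 0 n (s x))); last first.
    by move=> n; rewrite /rpole /= mulrAC divff// mul1r.
  rewrite (axial_pole_iter F01)//; last by rewrite -subr_gt0.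
  rewrite axial_pole00 -/q.
  have -> : q + h x - q = h x by ring.
  have := axial_coef_gt0 R d2 m; move: (axial_coef _ _ _) => a a0.
  have -> : (-1) ^+ m * a * h x ^+ m * ((-1) ^+ m / a * radial d k F0 F1 m q) =
    ((-1) ^+ m * (-1) ^+ m) * (radial d k F0 F1 m q * h x ^+ m) by field; rewrite gt_eqF.
  by rewrite -exprD addnn -mul2n exprM sqrrN expr1n expr1n mul1r.
have pE : pole F0 y x = radial d k F0 F1 0 (q + h x).
  by rewrite /pole /= /q /h dotvBl -/(s x) -/Y; congr F0; rewrite dotvBl -/(s x) -/(s y) -/Y; ring.
rewrite sE pE.
have qqh : q <= q + h x by rewrite lerDl.
have := @tower_taylor R _ _ M q (q + h x) (C / q ^+ M) (radial_tower F01) _ _.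
rewrite (min_idPl qqh) (max_idPr qqh) => tay.
apply: le_trans (tay _ _) _.
- by move=> u /andP[qu _]; apply: lt_le_trans qu.
- move=> u /andP[qu uq]; have u0 : 0 < u := lt_le_trans q0 qu.
  apply: le_trans (hC u M _) _.
    by rewrite (le_trans q1 qu) (le_trans uq)// lerD.
  by rewrite ler_wpM2l// lef_pV2 ?posrE ?exprn_gt0// lerXn2r ?nnegrE ?(ltW q0) ?(ltW u0).
have -> : q + h x - q = h x by ring.
rewrite (ger0_norm h0).
apply: (@le_trans _ _ (C * 2^-1 ^+ M)).
  have -> : M.+1%:R * (C / q ^+ M) * h x ^+ M = C * (M.+1%:R * (h x / q) ^+ M).
    by rewrite expr_div_n; ring.
  rewrite ler_wpM2l//; apply: le_trans (ler_wpM2r _ (succn_le_exp2 R M)) _.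
    by rewrite exprn_ge0// divr_ge0// ltW.
  rewrite -exprMn lerXn2r ?nnegrE ?mulr_ge0 ?invr_ge0 ?(ltW q0)//.
  rewrite mulrA ler_pdivrMr//.
  have : 4 * P ^+ 2 <= (64 * P) ^+ 2 by rewrite exprMn; have := sqr_ge0 P; lra.
  lra.
apply: (@le_trans _ _ ((C + 1) * 2^-1 ^+ N0)).
  rewrite ler_pM ?exprn_ge0 ?invr_ge0// ?lerDl//.
  by apply: ler_wiXn2l; rewrite ?invr_ge0 ?invf_le1 ?ler1n// leq_maxr.
by rewrite mulrC -ler_pdivlMr ?ltr_wpDl// ltW.
Qed.

End far_pole.

(** * Finite averages over directions orthogonal to the axis *)

Section cis.
Context (R : realType).
Implicit Types a b : R.

Lemma cisD a b : cis (a + b) = cis a * cis b.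
Proof. by rewrite /cis cosD sinD; apply/eqP; rewrite eq_complex /= eqxx/= addrC. Qed.

Lemma cis0 : cis (0 : R) = 1.
Proof. by rewrite /cis cos0 sin0. Qed.

Lemma cisX a n : cis a ^+ n = cis (n%:R * a).
Proof.
elim: n => [|n IH]; first by rewrite mul0r cis0.
by rewrite exprS IH -cisD -[n.+1]add1n natrD mulrDl mul1r.
Qed.

Lemma conjc_cis a : conjc (cis a) = cis (- a).
Proof. by rewrite /cis cosN sinN. Qed.

Lemma normc_cis a : Normc.normc (cis a) = 1.
Proof. by rewrite /Normc.normc /= cos2Dsin2 sqrtr1. Qed.

Lemma cis_neq1 a : 0 < `|a| < 2 * pi -> cis a != 1.
Proof.
move=> /andP[a0 a2]; apply/eqP => /(congr1 (fun z => complex.Re z)) /= c1.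
have : sin (a / 2) ^+ 2 = 0.
  have := cosD (a / 2) (a / 2); rewrite -splitr c1 -!expr2 => h.
  have := cos2Dsin2 (a / 2); lra.
move=> /eqP; rewrite sqrf_eq0 => /eqP.
wlog a_gt0 : a a0 a2 {c1} / 0 < a.
  move=> H; have [a1|a1|a1] := ltgtP a 0.
  - move=> s0; apply: (H (- a)); rewrite ?normrN ?oppr_gt0//.
    by rewrite mulNr sinN s0 oppr0.
  - exact: H.
  - by rewrite a1 normr0 ltxx in a0.
move: a2; rewrite (gtr0_norm a_gt0) => a2 s0.
have : 0 < sin (a / 2) by apply: sin_gt0_pi; apply/andP; split; lra.
by rewrite s0 ltxx.
Qed.

End cis.

Section transverse_designs.
Context (R : realType).

Lemma geometric_sum_unity (F : fieldType) (z : F) n : z ^+ n = 1 -> z != 1 ->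
  \sum_(j < n) z ^+ j = 0.
Proof.
move=> zn z1; have := subrX1 z n; rewrite zn subrr => /esym/eqP.
by rewrite mulf_eq0 subr_eq0 (negbTE z1) => /eqP.
Qed.

(** After binomial expansion only the middle term does not depend on j; any other term is a full
    geometric sum whose ratio is an n-th root of unity other than 1. *)
Lemma unity_moment (F : numFieldType) (w wb z zb : F) n m : (2 * m < n)%N ->
  z * zb = 1 -> z ^+ n = 1 ->
  (forall l, (l <= 2 * m)%N -> l <> m -> z ^+ (2 * m - l) * zb ^+ l != 1) ->
  \sum_(j < n) ((wb * z ^+ j + w * zb ^+ j) / 2) ^+ (2 * m) =
    n%:R * ('C(2 * m, m)%:R / 4 ^+ m * (wb * w) ^+ m).
Proof.
move=> mn zzb zn z1.
have zbn : zb ^+ n = 1 by rewrite -[LHS]mul1r -zn -exprMn zzb expr1n.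
under eq_bigr do rewrite expr_div_n exprDn mulr_suml.
rewrite exchange_big /=.
have mm : (m < (2 * m).+1)%N by lia.
rewrite (bigD1 (Ordinal mm))//= [X in _ + X]big1 ?addr0.
  have -> : (2 * m - m = m)%N by lia.
  transitivity (\sum_(j < n) ('C(2 * m, m)%:R / 4 ^+ m * (wb * w) ^+ m)).
    apply: eq_bigr => j _.
    have zj : z ^+ j * zb ^+ j = 1 by rewrite -exprMn zzb expr1n.
    have -> : (2 : F) ^+ (2 * m) = 4 ^+ m by rewrite exprM -natrX.
    rewrite -exprMn mulrACA zj mulr1 -mulr_natr; ring.
  by rewrite sumr_const card_ord -[LHS]mulr_natl.
move=> l /eqP lm.
pose zeta := z ^+ (2 * m - l) * zb ^+ l.
transitivity (\sum_(j < n) (wb ^+ (2 * m - l) * w ^+ l *+ 'C(2 * m, l) / 2 ^+ (2 * m)) * zeta ^+ j).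
  have E (A B X Y D : F) c : (A * X) * (B * Y) *+ c / D = (A * B *+ c / D) * (X * Y).
    by rewrite mulrACA -[_ *+ c]mulr_natr -[A * B *+ c]mulr_natr; move: c%:R D^-1 => c' D'; ring.
  apply: eq_bigr => j _; rewrite /zeta [(wb * _) ^+ _]exprMn [(w * _) ^+ l]exprMn E.
  by rewrite [(_ * _) ^+ j]exprMn -!exprM ![(j * _)%N]mulnC.
rewrite -mulr_sumr geometric_sum_unity ?mulr0//.
  by rewrite /zeta exprMn -!exprM ![(_ * n)%N]mulnC !exprM zn zbn !expr1n mulr1.
apply: z1; first by rewrite -ltnS.
by move=> h; apply: lm; apply: val_inj.
Qed.

(** The frequencies other than the middle one are nonzero and at most 2m in absolute value, so none
    is a multiple of the number 2M + 1 of vertices. *)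
Lemma polygon_moment (u v : R) M m : (m < M)%N ->
  let a (j : nat) : R := j%:R * (2 * pi / (2 * M).+1%:R) in
  \sum_(j < (2 * M).+1) (u * cos (a j) + v * sin (a j)) ^+ (2 * m) =
  (2 * M).+1%:R * ('C(2 * m, m)%:R / 4 ^+ m * (u ^+ 2 + v ^+ 2) ^+ m).
Proof.
move=> mM a; set n := (2 * M).+1; pose z : R[i] := cis (2 * pi / n%:R).
have n0 : 0 < n%:R :> R by rewrite ltr0n.
have zc : z * conjc z = 1 by rewrite conjc_cis -cisD subrr cis0.
have zn : z ^+ n = 1.
  rewrite cisX mulrC mulfVK ?gt_eqF//.
  rewrite mulr_natl mulr2n cisD /cis cospi sinpi.
  by apply/eqP; rewrite eq_complex /=; apply/andP; split; apply/eqP; ring.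
pose w : R[i] := Complex u v.
have term j : ((u * cos (a j) + v * sin (a j))%:C%C : R[i]) = (conjc w * z ^+ j + w * conjc z ^+ j) / 2.
  rewrite conjc_cis !cisX /a mulrN /cis cosN sinN.
  rewrite (_ : (2 : R[i]) = (2 : R)%:C%C); last by rewrite rmorph_nat.
  rewrite -fmorphV; apply/eqP; rewrite eq_complex /=; apply/andP; split; apply/eqP; by field.
have ww : conjc w * w = (u ^+ 2 + v ^+ 2)%:C%C.
  by apply/eqP; rewrite eq_complex /=; apply/andP; split; apply/eqP; ring.
apply: complexI; rewrite rmorph_sum.
transitivity (\sum_(j < n) ((conjc w * z ^+ j + w * conjc z ^+ j) / 2) ^+ (2 * m)).
  by apply: eq_bigr => j _; rewrite -term -rmorphXn.
rewrite (unity_moment w (conjc w) _ zc zn).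
- by rewrite ww !rmorphM !rmorphXn fmorphV rmorphXn !rmorph_nat.
- by rewrite /n ltnS leq_mul2l ltnW.
move=> l l2 lm.
have -> : z ^+ (2 * m - l) * conjc z ^+ l = cis (((2 * m - l)%:R - l%:R) * (2 * pi / n%:R)).
  by rewrite conjc_cis !cisX -cisD mulrN mulrBl.
have e1 : 1 <= `|(2 * m - l)%:R - l%:R : R|.
  have [h|h] := leqP l (2 * m - l)%N.
    by rewrite -natrB// normr_nat ler1n subn_gt0; lia.
  by rewrite distrC -natrB 1?ltnW// normr_nat ler1n subn_gt0; lia.
have e2 : `|(2 * m - l)%:R - l%:R : R| < n%:R.
  have [h|h] := leqP l (2 * m - l)%N.
    by rewrite -natrB// normr_nat ltr_nat /n; lia.
  by rewrite distrC -natrB 1?ltnW// normr_nat ltr_nat /n; lia.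
have pi0 := pi_gt0 R.
apply: cis_neq1; rewrite normrM [`|2 * pi / n%:R|]ger0_norm ?divr_ge0 ?mulr_ge0 ?(ltW pi0)//.
have p0 : 0 < 2 * pi / n%:R :> R by rewrite divr_gt0// mulr_gt0.
apply/andP; split; first by rewrite mulr_gt0// (lt_le_trans _ e1).
by rewrite -[ltRHS](mulfVK (lt0r_neq0 n0)) [ltRHS]mulrC ltr_pM2r.
Qed.

Lemma axial_coef2 m : axial_coef R 2 m * (2 * m)`!%:R = 1.
Proof.
elim: m => [|m IH]; first by rewrite muln0 mulr1.
rewrite /= addn1; have -> : (2 * m.+1 = (2 * m).+2)%N by lia.
rewrite !factS !natrM -[RHS]IH -[(2 * m).+2]/(2 + 2 * m)%N -mulnS natrM.
by have m0 := ler0n R m; field; field_side.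
Qed.

Lemma axial_coef3 m : axial_coef R 3 m * (2 * m)`!%:R = 'C(2 * m, m)%:R / 4 ^+ m.
Proof.
have : axial_coef R 3 m = (4 ^+ m * m`!%:R ^+ 2)^-1.
  elim: m => [|m IH]; first by rewrite /= expr0 fact0 expr1n mulr1 invr1.
  have f0 : 0 < m`!%:R :> R by rewrite ltr0n fact_gt0.
  rewrite /= IH addn2 factS natrM [4 ^+ m.+1]exprS -[(2 * m).+2]/(2 + 2 * m)%N -mulnS natrM.
  have m0 := ler0n R m.
  have p4 : 4 ^+ m != 0 :> R by rewrite expf_neq0.
  by field; rewrite p4 gt_eqF//=; field_side.
move=> ->.
have := bin_fact (_ : m <= 2 * m)%N; have -> : (2 * m - m = m)%N by lia.
move=> /(_ (leq_pmull m (ltn0Sn 1))) /(congr1 (fun i => i%:R : R)); rewrite !natrM => <-.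
have f0 : 0 < m`!%:R :> R by rewrite ltr0n fact_gt0.
by field; rewrite gt_eqF//= expf_neq0.
Qed.

Definition axis d : 'rV[R]_d.+1 := \row_j (j == ord0)%:R.

Lemma dotv_axis d (x : 'rV[R]_d.+1) : dotv x (axis d) = x 0 ord0.
Proof.
rewrite /dotv (bigD1 ord0)//= big1 ?addr0; first by rewrite mxE eqxx mulr1.
by move=> i /negbTE i0; rewrite mxE i0 mulr0.
Qed.

(** The transverse space is a line and only even moments are prescribed, so a single vector is
    enough. *)
Lemma transverse_design2 : transverse_design (axis 1).
Proof.
move=> M; exists 0%N, (fun _ => \row_j (j == ord_max)%:R); split=> [j|z m mM].
  by rewrite dotv_axis /dotv !big_ord_recr big_ord0 /= !mxE /= !mul0r !add0r mulr1.
rewrite big_ord1 invr1 mul1r axial_coef2 mul1r dotv_axis /dotv !big_ord_recr !big_ord0 /=.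
rewrite !mxE /= !add0r mul0r add0r mul1r.
have -> : widen_ord (leqnSn 1) ord_max = ord0 :> 'I_2 by apply: val_inj.
by rewrite -!expr2 addrC addrK exprM.
Qed.

Lemma transverse_design3 : transverse_design (axis 2).
Proof.
move=> M; pose a (j : nat) : R := j%:R * (2 * pi / (2 * M).+1%:R).
exists (2 * M)%N, (fun i => \row_j (if j == ord0 then 0 else if j == ord_max then sin (a i) else cos (a i))).
split=> [j|z m mM].
  rewrite dotv_axis /dotv !big_ord_recr big_ord0 /= !mxE /= add0r mul0r add0r; split=> //.
  by rewrite -!expr2 cos2Dsin2.
have := polygon_moment (z 0 (inord 1)) (z 0 ord_max) mM.
rewrite -/a => h; rewrite axial_coef3.
transitivity ((2 * M).+1%:R^-1 * \sum_(j < (2 * M).+1) (z 0 (inord 1) * cos (a j) + z 0 ord_max * sin (a j)) ^+ (2 * m)).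
  congr (_ * _); apply: eq_bigr => j _; congr (_ ^+ _).
  rewrite /dotv !big_ord_recr big_ord0 /= !mxE /= add0r mul0r add0r.
  have -> : widen_ord (leqnSn 2) ord_max = inord 1 :> 'I_3 by apply: val_inj; rewrite /= inordK.
  by rewrite mulrC [sin _ * _]mulrC.
rewrite h mulKf ?pnatr_eq0//; congr (_ * _ ^+ _).
rewrite dotv_axis /dotv !big_ord_recr big_ord0 /= add0r.
have -> : widen_ord (leqnSn 2) ord_max = inord 1 :> 'I_3 by apply: val_inj; rewrite /= inordK.
have -> : widen_ord (leqnSn 2) (widen_ord (leqnSn 1) ord_max) = ord0 :> 'I_3 by apply: val_inj.
by rewrite -!expr2; ring.
Qed.

End transverse_designs.

(** The squared distance from x to the line through the pole does not change when the pole slides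
    along the axis. Hence [P] depends on [Q] alone, [Y] can be chosen afterwards, and [far_pole]
    applies to every pole of a unit ball, as [good] demands. *)
Lemma far_good_pole (R : realType) (d : nat) (k : R) (F0 F1 : R -> R)
    (E : set 'rV[R]_d.+1) (S : set ('rV[R]_d.+1 -> R)) (Q R0 : R) :
  (1 <= d <= 3)%N -> transverse_design (axis R d) ->
  radial_solution d.+1 k F0 F1 -> 0 < k -> uniformly_closed E S ->
  (forall (theta : 'rV[R]_d.+1) (c : R), dotv theta theta = 1 ->
     S (fun x => cos (k * dotv theta x + c))) ->
  (forall x, E x -> enorm x <= Q) ->
  exists2 y : 'rV[R]_d.+1, R0 <= y 0 ord0 & good F0 S y.
Proof.
move=> /andP[d1 d3] AVG F01 k0 SE PW EQ.
pose P := `|Q| + 1.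
have P0 : 0 < P by rewrite ltr_wpDl.
have PE : P >= 1 by rewrite lerDr.
pose Y := 65 * P + `|R0| + 1.
set e := axis R d.
have e1 : dotv e e = 1 by rewrite dotv_axis mxE eqxx.
exists (Y *: e).
  by rewrite 2!mxE eqxx mulr1 /Y; have := ler_norm R0; lra.
exists 1 => // y yY.
have yY' : Y - 1 <= dotv y e.
  have := dotv_CS (y - Y *: e) e; rewrite dotvBl dotvZl e1 mulr1 {2}/enorm e1 sqrtr1 mulr1.
  move=> /le_lt_trans /(_ yY); rewrite ltr_norml => /andP[h _]; lra.
apply: (@far_pole _ _ _ _ _ F01 k0 _ _ _ _ e y P SE PW AVG) => //.
- move=> x Ex; rewrite -[leRHS]mulr1; apply: le_trans (dotv_CS _ _) _.
  rewrite {2}/enorm e1 sqrtr1 !mulr1 (le_trans (EQ _ Ex))// (le_trans (ler_norm Q))// lerDl//.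
- move=> x Ex; set z := x - (y - Y *: e).
  have -> : dotv (x - y) (x - y) - dotv (x - y) e ^+ 2 = dotv z z - dotv z e ^+ 2.
    by rewrite /z !(dotvBl, dotvBr, dotvZl, dotvZr) e1 !(dotvC e) (dotvC y x); ring.
  apply: (@le_trans _ _ (dotv z z)); first by rewrite gerBl sqr_ge0.
  rewrite -enorm_sq lerXn2r ?nnegrE ?enorm_ge0 ?(ltW P0)//.
  apply: le_trans (enormD _ _) _; rewrite enormN lerD ?(ltW yY)//.
  exact: le_trans (EQ _ Ex) (ler_norm Q).
- by apply: le_trans yY'; rewrite /Y; have := normr_ge0 R0; lra.
Qed.

(** * Moving the pole *)

Lemma norm_row_le (R : realType) d (x : 'rV[R]_d) c : 0 <= c ->
  (forall i, `|x 0 i| <= c) -> `|x| <= c.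
Proof.
move=> c0 h; rewrite /Num.Def.normr /= mx_normrE; apply: bigmax_le => // -[i j] _ /=.
by rewrite (ord1 i).
Qed.

Lemma norm_row_attained (R : realType) d (x : 'rV[R]_d) : 0 < `|x| ->
  exists i, `|x 0 i| = `|x|.
Proof.
move=> x0; have := @mx_norm_neq0 _ _ _ x; case=> [|[i j] h].
  by rewrite gt_eqF.
by exists j; rewrite {2}/Num.Def.normr /= h /= (ord1 i).
Qed.

Lemma open_norm_ball (R : realType) d (O : set 'rV[R]_d) x : open O -> O x ->
  exists2 r : R, 0 < r & forall y, `|y - x| < r -> O y.
Proof.
move=> Oo Ox; have /nbhs_ballP[r /= r0 h] : nbhs x O by exact: open_nbhs_nbhs.
by exists r => // y yx; apply: h; rewrite -ball_normE /= distrC.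
Qed.

Lemma norm_ball_open (R : realType) d (O : set 'rV[R]_d) :
  (forall x, O x -> exists2 r : R, 0 < r & forall y, `|y - x| < r -> O y) -> open O.
Proof.
move=> h; rewrite openE => x /h[r r0 hr]; apply/nbhs_ballP; exists r => // y.
by rewrite -ball_normE /= distrC => /hr.
Qed.

Lemma norm_row_convex (R : realType) d (u v : 'rV[R]_d) (p t : R) : 0 <= t <= 1 ->
  `|u| <= p -> `|v| <= p -> `|u + t *: (v - u)| <= p.
Proof.
move=> /andP[t0 t1] up vp.
have -> : u + t *: (v - u) = (1 - t) *: u + t *: v.
  by rewrite scalerBr scalerBl scale1r addrAC addrA.
apply: le_trans (ler_normD _ _) _; rewrite !normrZ !ger0_norm ?subr_ge0//.
apply: (@le_trans _ _ ((1 - t) * p + t * p)); last by rewrite -mulrDl subrK mul1r.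
by apply: lerD; apply: ler_wpM2l; rewrite ?subr_ge0.
Qed.

Section pole_pushing.
Context (R : realType) (d : nat) (k : R) (F0 F1 : R -> R).
Hypothesis F01 : radial_solution d.+1 k F0 F1.
Hypothesis d13 : (1 <= d <= 3)%N.
Variables (E Cl : set 'rV[R]_d.+1) (z0 : 'rV[R]_d.+1) (r R1 Q : R).
Variable S : set ('rV[R]_d.+1 -> R).
Hypothesis SE : uniformly_closed E S.
Hypotheses (closed_Cl : closed Cl) (connected_Cl : connected (~` Cl)).
Hypothesis E_Cl : forall x, E x -> Cl x \/ `|x - z0| <= r.
Hypothesis Cl_far : forall x, Cl x -> R1 <= `|x - z0|.
Hypothesis E_bounded : forall x, E x -> enorm x <= Q.
Hypotheses (r0 : 0 < r) (rR1 : r < R1).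

Let d4 : (d.+1 <= 4)%N.
Proof. by case/andP: d13. Qed.

Let separation y : ~ Cl y -> r < `|y - z0| ->
  exists2 s : R, 0 < s & forall x, E x -> s <= enorm (x - y).
Proof.
move=> nCy ry; have [s s0 hs] := open_norm_ball (closed_openC closed_Cl) nCy.
exists (Num.min s (`|y - z0| - r)); first by rewrite lt_min s0 subr_gt0.
move=> x /E_Cl[Cx|xr]; apply: le_trans (norm_le_enorm _); rewrite ge_min; apply/orP.
  by left; rewrite leNgt; apply/negP => /hs.
by right; have := ler_distD x y z0; rewrite [`|y - x|]distrC; lra.
Qed.

(** The complement of [Cl] is connected, but nothing is known of that of [E]. If the shell contained
    no good pole, the good poles outside [Cl] and outside the ball would all be at distance at least
    R1 from z0, hence limits of them would stay away from [E]. They would form an open and closed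
    part of the complement of [Cl], thus all of it, although z0 is not among them. *)
Lemma good_in_shell : (exists2 y, good F0 S y & ~ Cl y /\ r < `|y - z0|) ->
  exists2 y, good F0 S y & r < `|y - z0| < R1.
Proof.
move=> [y0 gy0 [nCy0 ry0]].
suff : ~ (forall y, good F0 S y -> r < `|y - z0| -> R1 <= `|y - z0|).
  move=> h; apply: contrapT => h'; apply: h => y gy ry; rewrite leNgt; apply/negP => yR.
  by apply: h'; exists y; rewrite ?ry.
move=> H; pose A := [set y | [/\ good F0 S y, ~ Cl y & r < `|y - z0|]].
suff : A = ~` Cl.
  move=> /seteqP[_ /(_ z0)]; rewrite /A /= subrr normr0 => h; case: h => [/Cl_far|_ _].
    by rewrite subrr normr0 leNgt (lt_trans r0).
  by rewrite ltNge (ltW r0).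
apply: connected_Cl; first by exists y0.
- exists A; last by apply/seteqP; split=> [y []|y []].
  apply: norm_ball_open => y [gy nCy ry].
  have [s s0 hs] := separation nCy ry.
  have [t t0 ht] := open_norm_ball (closed_openC closed_Cl) nCy.
  have D0 : 0 < d.+1%:R :> R by rewrite ltr0n.
  exists (Num.min t (Num.min (`|y - z0| - r) (s / 32 / d.+1%:R))).
    by rewrite !lt_min t0 subr_gt0 ry !divr_gt0.
  move=> y'; rewrite !lt_min => /and3P[yt yr ys]; split.
  + apply: (good_near F01 d4 E_bounded SE s0 hs gy).
    by apply: le_lt_trans (enorm_le_norm _) _; rewrite mulrC -ltr_pdivlMr.
  + exact: ht.
  + by have := ler_distD y' y z0; rewrite [`|y - y'|]distrC; lra.
- exists (closure A); first exact: closed_closure.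
  apply/seteqP; split=> [y Ay|y [nCy cAy]].
    by split; [case: Ay|exact: subset_closure].
  have approx (t : R) : 0 < t -> exists2 y', A y' & `|y' - y| < t.
    move=> t0; have [y' [Ay' yy']] := cAy _ (nbhsx_ballx y t t0).
    by exists y' => //; move: yy'; rewrite -ball_normE /= distrC.
  have yR : R1 <= `|y - z0|.
    rewrite leNgt; apply/negP => yR; have [|y' [gy' _ ry'] yy'] := approx (R1 - `|y - z0|).
      by rewrite subr_gt0.
    have := H _ gy' ry'; rewrite leNgt => /negP; apply.
    by have := ler_distD y y' z0; lra.
  have ry := lt_le_trans rR1 yR.
  have [s s0 hs] := separation nCy ry.
  have [|y' [gy' _ ry'] yy'] := approx (s / 64 / d.+1%:R); first by rewrite !divr_gt0.
  have ys : enorm (y' - y) < s / 64.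
    by apply: le_lt_trans (enorm_le_norm _) _; rewrite mulrC -ltr_pdivlMr.
  split=> //; apply: (good_near F01 d4 E_bounded SE (s := s / 2) _ _ gy').
  + by rewrite divr_gt0.
  + move=> x /hs; have := enormD (x - y') (y' - y); rewrite addrA subrK; lra.
  + by rewrite enormB; lra.
Qed.

(** Moves the pole inside one face of the sup-norm sphere of radius p. A face is convex, and all its
    points keep distance p - r from the ball and R1 - p from [Cl]. *)
Let good_edge p (u v : 'rV[R]_d.+1) i (sg : R) : r < p < R1 -> `|sg| = 1 ->
  `|u| <= p -> `|v| <= p -> u 0 i = sg * p -> v 0 i = sg * p ->
  good F0 S (z0 + u) -> good F0 S (z0 + v).
Proof.
move=> /andP[rp pR] sg1 up vp ui vi gu.
apply: (good_segment F01 d4 E_bounded SE (s := Num.min (p - r) (R1 - p)) _ gu).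
  by rewrite lt_min !subr_gt0 rp.
move=> t x /andP[t0 t1] Ex.
set w := u + t *: (v - u).
have -> : z0 + u + t *: (z0 + v - (z0 + u)) = z0 + w.
  by rewrite opprD addrACA subrr add0r addrA.
have wi : w 0 i = sg * p by rewrite !mxE ui vi subrr mulr0 addr0.
have wp : `|w| <= p by apply: norm_row_convex; rewrite ?t0.
apply: le_trans (norm_le_enorm _); rewrite opprD addrA ge_min; apply/orP.
case: (E_Cl Ex) => [/Cl_far xR|xr]; [right|left].
  by have := lerB_dist (x - z0) w; lra.
apply: le_trans (coord_le_norm _ i); rewrite [X in `|X|]mxE [(- w) 0 i]mxE wi.
have := coord_le_norm (x - z0) i; move: ((x - z0) 0 i) => a ax.
have p0 : 0 < p by exact: lt_trans rp.
by have := lerB_dist (sg * p) a; rewrite [`|_ - a|]distrC normrM sg1 mul1r (gtr0_norm p0); lra.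
Qed.

(** The path crosses faces one at a time through common edge points. From either face normal to the
    axis it first passes to the side face [j], which exists because there are at least two
    coordinates; thus the bottom face is also led to the top one. *)
Lemma good_axis_point y : good F0 S y -> r < `|y - z0| < R1 ->
  exists2 p, r < p < R1 & good F0 S (z0 + p *: axis R d).
Proof.
set u := y - z0 => gy hp; exists `|u| => //.
set p := `|u|; have p0 : 0 < p by case/andP: hp => /(lt_trans r0).
have gu : good F0 S (z0 + u) by rewrite /u addrC subrK.
have [i ui] := norm_row_attained p0.
have ax (a b : R) j : `|a| <= 1 -> `|b| <= 1 ->
    `|\row_l (if l == j then a * p else if l == ord0 then b * p else 0)| <= p.
  move=> a1 b1; apply: norm_row_le => [|l]; first exact: ltW.
  rewrite mxE; case: ifP => _; last case: ifP => _; rewrite ?normr0 ?normrM ?(gtr0_norm p0) ?(ltW p0)//.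
    by rewrite ler_piMl// ltW.
  by rewrite ler_piMl// ltW.
have axE : p *: axis R d = \row_l (if l == ord0 then 1 * p else if l == ord0 then 0 * p else 0).
  by apply/rowP => l; rewrite !mxE; case: eqP => _ /=; rewrite ?mulr0 ?mulr1 ?mul1r.
have from_side (j : 'I_d.+1) (sg : R) (w : 'rV[R]_d.+1) : j != ord0 -> `|sg| = 1 -> `|w| <= p ->
    w 0 j = sg * p -> good F0 S (z0 + w) -> good F0 S (z0 + p *: axis R d).
  move=> j0 sg1 wp wj gw; rewrite axE.
  apply: (@good_edge p (\row_l (if l == j then sg * p else if l == ord0 then 1 * p else 0)) _ ord0 1) => //.
  - by rewrite normr1.
  - by apply: ax; rewrite ?sg1 ?normr1.
  - by apply: ax; rewrite ?normr0 ?normr1.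
  - by rewrite mxE eq_sym (negbTE j0) eqxx.
  - by rewrite mxE eqxx.
  apply: (@good_edge p w _ j sg) => //.
  - by apply: ax; rewrite ?sg1 ?normr1.
  - by rewrite mxE eqxx.
have [sg [sg1 usg]] : exists sg : R, `|sg| = 1 /\ u 0 i = sg * p.
  case: (lerP 0 (u 0 i)) => h; move: ui; [rewrite ger0_norm//|rewrite ltr0_norm//] => ui.
    by exists 1; rewrite normr1 mul1r.
  by exists (- 1); rewrite normrN1 mulN1r /p -ui opprK.
have [i0|i0] := eqVneq i ord0; last exact: (from_side i sg u).
pose j : 'I_d.+1 := inord 1; have j0 : j != ord0.
  by case/andP: d13 => d1 _; rewrite -val_eqE /= inordK.
apply: (@from_side j 1 (\row_l (if l == j then 1 * p else if l == ord0 then sg * p else 0))) => //.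
- by rewrite normr1.
- by apply: ax; rewrite ?sg1 ?normr1.
- by rewrite mxE eqxx.
apply: (@good_edge p u _ i sg) => //.
- by apply: ax; rewrite ?sg1 ?normr1.
- by rewrite mxE i0 eq_sym (negbTE j0) eqxx.
Qed.

(** The pole descends into the ball from above. The part of [E] in the ball lies below the height h,
    and the segment from the top point stays above the height of [u]. *)
Lemma good_inside p (u : 'rV[R]_d.+1) h : r < p < R1 ->
  good F0 S (z0 + p *: axis R d) -> `|u| <= r -> h < u 0 ord0 ->
  (forall x, E x -> Cl x \/ (x - z0) 0 ord0 <= h) ->
  good F0 S (z0 + u).
Proof.
move=> /andP[rp pR] gp ur hu Eh.
apply: (good_segment F01 d4 E_bounded SE (s := Num.min (u 0 ord0 - h) (R1 - p)) _ gp).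
  by rewrite lt_min !subr_gt0 hu.
have p0 : 0 < p by exact: lt_trans rp.
have ap : `|p *: axis R d| = p.
  apply/eqP; rewrite eq_le; apply/andP; split.
    apply: norm_row_le => [|l]; first exact: ltW.
    by rewrite !mxE; case: eqP; rewrite ?mulr1 ?mulr0 ?normr0 ?(gtr0_norm p0)// ltW.
  have := coord_le_norm (p *: axis R d) ord0.
  by rewrite !mxE eqxx mulr1 (gtr0_norm p0).
move=> t x /andP[t0 t1] Ex.
set w := p *: axis R d + t *: (u - p *: axis R d).
have -> : z0 + p *: axis R d + t *: (z0 + u - (z0 + p *: axis R d)) = z0 + w.
  by rewrite opprD addrACA subrr add0r addrA.
have up : u 0 ord0 <= p.
  by apply: le_trans (ler_norm _) _; apply: le_trans (coord_le_norm _ _) _; rewrite (le_trans ur) ?ltW.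
apply: le_trans (norm_le_enorm _); rewrite opprD addrA ge_min; apply/orP.
case: (Eh _ Ex) => [/Cl_far xR|xr]; [right|left].
  have wp : `|w| <= p.
    by apply: norm_row_convex; rewrite ?t0 ?ap// (le_trans ur)// ltW.
  by have := lerB_dist (x - z0) w; lra.
apply: le_trans (coord_le_norm _ ord0); rewrite [X in `|X|]mxE [(- w) 0 ord0]mxE.
have -> : w 0 ord0 = u 0 ord0 + (1 - t) * (p - u 0 ord0).
  by rewrite !mxE eqxx /=; ring.
have : 0 <= (1 - t) * (p - u 0 ord0) by rewrite mulr_ge0// subr_ge0.
move: xr; move: ((x - z0) 0 ord0) => a xr h1.
rewrite ler0_norm; lra.
Qed.

End pole_pushing.

(** * Peaks on small cubes *)

Section pole_peaks.
Context (R : realType) (d : nat) (k : R) (F0 F1 : R -> R).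
Implicit Types x y v : 'rV[R]_d.

Lemma pole_coef2 y v x : let q := dotv (x - y) (x - y) in
  pole_coef k F0 F1 y v 2 x =
    F1 q + radial d k F0 F1 2 q * (4 * dotv (x - y) v ^+ 2).
Proof.
rewrite /pole_coef /quad_comp !big_ord_recr big_ord0 /= !binE /= !mulr0 !addr0 expr2 mulr0 addr0.
rewrite mul0r !add0r add0n bin0 -[(2 * 1 - 2)%N]/0%N -[(2 * 2 - 2)%N]/2%N expr0 !mulr1.
by congr (_ + _ * _); ring.
Qed.


Lemma pole_coef2_le (C s Q : R) y v x : dotv v v = 1 -> 0 < s -> s <= enorm (x - y) <= Q ->
  (forall q m, s ^+ 2 <= q <= Q ^+ 2 -> `|radial d k F0 F1 m q| <= C / q ^+ m) ->
  0 <= C -> `|pole_coef k F0 F1 y v 2 x| <= 5 * C / s ^+ 2.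
Proof.
move=> v1 s0 /andP[sx xQ] hC C0; rewrite pole_coef2; set q := dotv _ _.
have qE : q = enorm (x - y) ^+ 2 by rewrite enorm_sq.
have sq : s ^+ 2 <= q by rewrite qE lerXn2r ?nnegrE ?enorm_ge0 ?(ltW s0).
have qQ : q <= Q ^+ 2 by rewrite qE lerXn2r ?nnegrE ?enorm_ge0 ?(le_trans _ xQ) ?enorm_ge0.
have q0 : 0 < q by apply: lt_le_trans sq; rewrite exprn_gt0.
have vq : dotv (x - y) v ^+ 2 <= q.
  have := dotv_CS (x - y) v; rewrite {2}/enorm v1 sqrtr1 mulr1 => h.
  by rewrite qE -[leLHS](real_normK (num_real _)) lerXn2r ?nnegrE ?enorm_ge0.
have h1 : `|F1 q| <= C / q by have := hC q 1%N; rewrite sq qQ expr1; apply.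
have h2 : `|radial d k F0 F1 2 q| <= C / q ^+ 2 by apply: hC; rewrite sq.
apply: (@le_trans _ _ (5 * C / q)); last first.
  by rewrite ler_wpM2l ?mulr_ge0// lef_pV2 ?posrE ?exprn_gt0.
apply: le_trans (ler_normD _ _) _; rewrite normrM (ger0_norm (mulr_ge0 _ (sqr_ge0 _)))//.
have -> : 5 * C / q = C / q + C / q ^+ 2 * (4 * q) by field; rewrite gt_eqF.
apply: lerD => //; apply: ler_pM => //; first by rewrite mulr_ge0// sqr_ge0.
by rewrite ler_pM2l.
Qed.

(** Let P be the squared cosine of the angle between x - y and [v]. The radial equation gives the
    value F1 q (1 - d P) - (P / 2) k^2 F0 q. As P >= 9/10 and d >= 2, the factor 1 - d P is at most
    -8/10, so there is no cancellation and F1 dominates. *)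
Lemma pole_coef2_ge (c eta : R) y v x : (1 < d)%N -> radial_solution d k F0 F1 ->
  (forall q, 0 < q < eta ->
     c <= `|F1 q| * Num.sqrt q ^+ d /\ k ^+ 2 * `|F0 q| <= `|F1 q| / 8) ->
  dotv v v = 1 -> 0 < enorm (x - y) -> enorm (x - y) ^+ 2 < eta ->
  9 / 10 * enorm (x - y) ^+ 2 <= dotv (x - y) v ^+ 2 ->
  c / 2 <= `|pole_coef k F0 F1 y v 2 x| * enorm (x - y) ^+ d.
Proof.
move=> d1 F01 hc v1 e0 eeta h9; rewrite pole_coef2; set q := dotv _ _.
have qE : q = enorm (x - y) ^+ 2 by rewrite enorm_sq.
have q0 : 0 < q by rewrite qE exprn_gt0.
have [c1 c2] : c <= `|F1 q| * Num.sqrt q ^+ d /\ k ^+ 2 * `|F0 q| <= `|F1 q| / 8.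
  by apply: hc; rewrite q0 qE.
have vq : dotv (x - y) v ^+ 2 <= q.
  have := dotv_CS (x - y) v; rewrite {2}/enorm v1 sqrtr1 mulr1 => h.
  by rewrite qE -[leLHS](real_normK (num_real _)) lerXn2r ?nnegrE ?enorm_ge0.
rewrite radialSS muln0 addn0 !mulr1 -[radial _ _ _ _ 1 q]/(F1 q) -[radial _ _ _ _ 0 q]/(F0 q); rewrite -qE in h9.
move: h9 vq; set b := dotv _ _ ^+ 2 => h9 vq.
pose P := b / q; have P9 : 9 / 10 <= P by rewrite ler_pdivlMr.
have P1 : P <= 1 by rewrite ler_pdivrMr// mul1r.
have -> : F1 q + - ((2 * d)%:R * F1 q + k ^+ 2 * F0 q) / (4 * q * 2) * (4 * b) =
    F1 q * (1 - d%:R * P) - P / 2 * (k ^+ 2 * F0 q).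
  by rewrite /P natrM; field; rewrite gt_eqF.
suff : `|F1 q| / 2 <= `|F1 q * (1 - d%:R * P) - P / 2 * (k ^+ 2 * F0 q)|.
  rewrite /enorm -/q in e0 * => h; apply: (@le_trans _ _ (`|F1 q| / 2 * Num.sqrt q ^+ d)).
    by rewrite mulrAC ler_pM2r.
  by rewrite ler_wpM2r// exprn_ge0// sqrtr_ge0.
have d2 : 2 <= d%:R :> R by rewrite ler_nat.
have dP : 2 * (9 / 10) <= d%:R * P by apply: ler_pM => //; lra.
clearbody P; have P0 : 0 <= P by lra.
apply: le_trans (lerB_dist _ _); rewrite normrM [X in _ - X]normrM.
rewrite [`|k ^+ 2 * _|]normrM (ger0_norm (sqr_ge0 k)) (ger0_norm (divr_ge0 P0 (ler0n _ _))).
rewrite (ler0_norm (_ : 1 - d%:R * P <= 0)); last by lra.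
have F1g := normr_ge0 (F1 q).
have k2 : 0 <= k ^+ 2 * `|F0 q| by rewrite mulr_ge0 ?sqr_ge0.
have t1 : `|F1 q| * (8 / 10) <= `|F1 q| * - (1 - d%:R * P) by apply: ler_wpM2l => //; lra.
have t2 : P / 2 * (k ^+ 2 * `|F0 q|) <= 1 / 2 * (k ^+ 2 * `|F0 q|) by apply: ler_wpM2r => //; lra.
rewrite mulrN in t1; lra.
Qed.

End pole_peaks.

Definition cube (R : realType) d (z : 'rV[R]_d) (e : R) : set 'rV[R]_d :=
  [set x | `|x - z| <= e].

Lemma reached_pole (R : realType) (d : nat) (k : R) (F0 F1 : R -> R)
    (E Cl : set 'rV[R]_d.+1) (S : set ('rV[R]_d.+1 -> R))
    (z0 u : 'rV[R]_d.+1) (r R1 Q h : R) :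
  (1 <= d <= 3)%N -> transverse_design (axis R d) -> 0 < k ->
  radial_solution d.+1 k F0 F1 -> uniformly_closed E S ->
  (forall (theta : 'rV[R]_d.+1) (c : R), dotv theta theta = 1 ->
     S (fun x => cos (k * dotv theta x + c))) ->
  closed Cl -> connected (~` Cl) -> 0 < r -> r < R1 ->
  (forall x, Cl x -> R1 <= `|x - z0|) ->
  (forall x, E x -> enorm x <= Q) -> (forall x, Cl x -> enorm x <= Q) ->
  (forall x, E x -> Cl x \/ `|x - z0| <= r /\ (x - z0) 0 ord0 <= h) ->
  `|u| <= r -> h < u 0 ord0 ->
  forall n, S (pole_coef k F0 F1 (z0 + u) (axis R d) n).
Proof.
move=> d13 AVG k0 F01 SE PW Clc conn r0 rR1 Clfar EQ ClQ Eh ur hu.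
have d4 : (d.+1 <= 4)%N by case/andP: d13.
have ECl x : E x -> Cl x \/ `|x - z0| <= r by move=> /Eh[|[]]; [left|right].
have ECl0 x : E x -> Cl x \/ (x - z0) 0 ord0 <= h by move=> /Eh[|[]]; [left|right].
pose P0 := `|Q| + `|z0| + R1 + 1.
have [y0 y0P gy0] := @far_good_pole _ _ _ _ _ E S Q P0 d13 AVG F01 k0 SE PW EQ.
have y0n : P0 <= `|y0|.
  by apply: le_trans y0P _; apply: le_trans (ler_norm _) (coord_le_norm _ _).
have [|y1 gy1 y1R] := @good_in_shell _ _ _ _ _ F01 d13 E Cl z0 r R1 Q
    S SE Clc conn ECl Clfar EQ r0 rR1.
  exists y0 => //; split.
    move=> /ClQ; apply/negP; rewrite -ltNge; apply: lt_le_trans (norm_le_enorm _).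
    apply: lt_le_trans y0n; apply: (le_lt_trans (ler_norm Q)).
    by have := normr_ge0 z0; rewrite /P0; move: r0 rR1; clear; move: `|Q| `|z0| => a b; lra.
  apply: lt_le_trans (lerB_dist _ _); rewrite ltrBrDr; apply: lt_le_trans y0n.
  by have := normr_ge0 Q; rewrite /P0; move: r0 rR1; clear; move: `|Q| `|z0| => a b; lra.
have [p pR gp] := @good_axis_point _ _ _ _ _ F01 d13 E Cl z0 r R1 Q S SE ECl Clfar EQ r0 y1 gy1 y1R.
have gy : good F0 S (z0 + u).
  exact: (@good_inside _ _ _ _ _ F01 d13 E Cl z0 r R1 Q S SE Clfar EQ r0 p _ h pR gp ur hu ECl0).
have ax1 : dotv (axis R d) (axis R d) = 1 by rewrite dotv_axis mxE eqxx.
apply: (@good_coef _ _ _ _ _ F01 d4 E Q S EQ SE (z0 + u) (axis R d)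
  (Num.min (R1 - r) (u 0 ord0 - h))) => //; first by rewrite lt_min !subr_gt0 rR1.
move=> x Ex; apply: le_trans (norm_le_enorm _); rewrite opprD addrA ge_min; apply/orP.
case: (Eh _ Ex) => [/Clfar h1|[_ h1]]; [left|right].
  by have := lerB_dist (x - z0) u; move: h1 ur; clear; move: `|_| `|u| `|_| => a b c; lra.
apply: le_trans (coord_le_norm _ ord0); rewrite [X in `|X|]mxE [(- u) 0 _]mxE.
rewrite distrC; apply: le_trans (ler_norm _); exact: lerB.
Qed.

(** The pole is 10 e above the centre of a cube of half side e. The component of x - y along the
    axis is between 9 e and 11 e in absolute value, and the other coordinates, at most three, add at
    most 3 e^2 to the squared distance. So the distance is at most 12 e and the squared cosine
    exceeds 9/10. *)
Lemma pole_coef2_cube (R : realType) (d : nat) (k c eta : R) (F0 F1 : R -> R) (z x : 'rV[R]_d.+1) (e : R) :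
  (1 <= d <= 3)%N -> radial_solution d.+1 k F0 F1 ->
  (forall q, 0 < q < eta ->
     c <= `|F1 q| * Num.sqrt q ^+ d.+1 /\ k ^+ 2 * `|F0 q| <= `|F1 q| / 8) ->
  0 < e -> 144 * e ^+ 2 < eta -> cube z e x ->
  c / 2 / 12 ^+ d.+1 <=
    `|pole_coef k F0 F1 (z + (10 * e) *: axis R d) (axis R d) 2 x| * e ^+ d.+1.
Proof.
move=> d13 F01 hc e_gt0 eeta xj; set y := z + _.
have d1 : (1 < d.+1)%N by case/andP: d13.
have ax1 : dotv (axis R d) (axis R d) = 1 by rewrite dotv_axis mxE eqxx.
have xl l : `|(x - z) 0 l| <= e by apply: le_trans (coord_le_norm _ _) xj.
have xy l : (x - y) 0 l = (x - z) 0 l - (10 * e) * (l == ord0)%:R.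
  by rewrite /y !mxE opprD addrA.
have t9 : 81 * e ^+ 2 <= dotv (x - y) (axis R d) ^+ 2 <= 121 * e ^+ 2.
  rewrite dotv_axis xy mulr1; have := xl ord0.
  move: ((x - z) 0 ord0) => a; move: e_gt0; clear => e0 /ler_normlP[h1 h2].
  have -> : 121 * e ^+ 2 = (11 * e) ^+ 2 by ring.
  have -> : 81 * e ^+ 2 = (9 * e) ^+ 2 by ring.
  by rewrite -[(a - _) ^+ 2]sqrrN !lerXn2r ?nnegrE; lra.
have qle : enorm (x - y) ^+ 2 <= dotv (x - y) (axis R d) ^+ 2 + 3 * e ^+ 2.
  rewrite enorm_sq dotv_axis {1}/dotv (bigD1 ord0)//= -expr2 lerD2l.
  apply: (@le_trans _ _ (\sum_(l < d.+1 | l != ord0) e ^+ 2)).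
    apply: ler_sum => l l0; have := xl l.
    rewrite xy (negbTE l0) mulr0 subr0 -expr2 => h.
    rewrite -[leLHS](real_normK (num_real _)).
    by rewrite lerXn2r ?nnegrE// ltW.
  rewrite sumr_const -[leLHS]mulr_natl; apply: ler_wpM2r; first exact: sqr_ge0.
  have := cardC1 (ord0 : 'I_d.+1); rewrite card_ord /= => ->.
  by rewrite ler_nat; case/andP: d13.
have e20 : 0 < e ^+ 2 by rewrite exprn_gt0.
have qge : dotv (x - y) (axis R d) ^+ 2 <= enorm (x - y) ^+ 2.
  have := dotv_CS (x - y) (axis R d); rewrite {2}/enorm ax1 sqrtr1 mulr1 => h.
  by rewrite -[leLHS](real_normK (num_real _)) lerXn2r ?nnegrE ?enorm_ge0.
have [q1 q2 q3] : [/\ 0 < enorm (x - y) ^+ 2, enorm (x - y) ^+ 2 <= 144 * e ^+ 2 &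
    9 / 10 * enorm (x - y) ^+ 2 <= dotv (x - y) (axis R d) ^+ 2].
  move: t9 qle qge e20; clear; move: (enorm _ ^+ 2) (dotv _ _ ^+ 2) (e ^+ 2) => a b t.
  by move=> /andP[h1 h2] h3 h4 h5; split; lra.
have q0 : 0 < enorm (x - y).
  by rewrite lt_neqAle enorm_ge0 andbT eq_sym -sqrf_eq0 gt_eqF.
have h := @pole_coef2_ge _ _ k F0 F1 c eta y (axis R d) x d1 F01 hc ax1 q0 (le_lt_trans q2 eeta) q3.
have s12 : enorm (x - y) <= 12 * e.
  rewrite -ler_sqr ?nnegrE ?enorm_ge0 ?mulr_ge0 ?(ltW e_gt0)// exprMn.
  by have -> : 12 ^+ 2 = 144 :> R by ring.
rewrite ler_pdivrMr ?exprn_gt0//; apply: le_trans h _.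
rewrite -mulrA -exprMn [e * _]mulrC; apply: ler_wpM2l => //.
by rewrite lerXn2r ?nnegrE ?enorm_ge0// mulr_ge0// ltW.
Qed.

(** The cubes are lined up along the coordinate [i1] and the poles sit above them in the direction
    [ord0]. Each pole can thus be reached from above, and the coordinate [i1] alone keeps it tau / 2
    away from the other cubes, whatever its height. This is why [K] is fixed before e. *)
Lemma runge_peaks (R : realType) (d : nat) (k : R) (F0 F1 : R -> R)
    (S : set 'rV[R]_d.+1 -> set ('rV[R]_d.+1 -> R))
    (D : set 'rV[R]_d.+1) (z0 : 'rV[R]_d.+1) (R1 Q : R) (m : nat) :
  (1 <= d <= 3)%N -> transverse_design (axis R d) -> 0 < k ->
  radial_solution d.+1 k F0 F1 -> singular_at0 k d.+1 F0 F1 ->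
  (forall E, uniformly_closed E (S E)) ->
  (forall E Q (theta : 'rV[R]_d.+1) (c : R), (forall x, E x -> enorm x <= Q) ->
     dotv theta theta = 1 -> S E (fun x => cos (k * dotv theta x + c))) ->
  connected (~` closure D) -> (forall x, closure D x -> enorm x <= Q) ->
  0 < R1 -> (forall x, closure D x -> R1 <= `|x - z0|) ->
  exists (z : 'I_m -> 'rV[R]_d.+1) (c K e0 : R), [/\ 0 < c, 0 < e0,
    forall j e x, e < e0 -> cube (z j) e x -> `|x - z0| < R1 &
    forall e : R, 0 < e < e0 -> exists phi : 'I_m -> 'rV[R]_d.+1 -> R, forall j,
      [/\ S (D `|` \bigcup_i cube (z i) e) (phi j),
        forall x, cube (z j) e x -> c <= `|phi j x| * e ^+ d.+1,
        forall x, D x -> `|phi j x| <= K &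
        forall i x, i != j -> cube (z i) e x -> `|phi j x| <= K]].
Proof.
move=> d13 AVG k0 F01 sing SE PW conn ClQ R10 Clfar.
have d1 : (1 < d.+1)%N by case/andP: d13.
have d4 : (d.+1 <= 4)%N by case/andP: d13.
have [eta [c [eta0 c0 hc]]] := sing.
pose i1 : 'I_d.+1 := inord 1.
have i10 : i1 != ord0 by rewrite -val_eqE /= inordK.
(* With this spacing all the centres stay within R1 / 8 of z0. *)
pose tau := R1 / 8 / m.+1%:R; have tau0 : 0 < tau by rewrite !divr_gt0.
pose off (a b : R) : 'rV[R]_d.+1 := \row_l (if l == i1 then a else if l == ord0 then b else 0).
have off_norm a b r : `|a| <= r -> `|b| <= r -> `|off a b| <= r.
  move=> ar br; have r0 := le_trans (normr_ge0 _) ar.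
  by apply: norm_row_le => // l; rewrite mxE; do 2?case: ifP => // _; rewrite normr0.
pose z (j : 'I_m) := z0 + off (j%:R * tau) 0.
pose y (e : R) (j : 'I_m) := z0 + off (j%:R * tau) (10 * e).
have jtau (j : 'I_m) : 0 <= j%:R * tau <= R1 / 8.
  rewrite mulr_ge0 ?(ltW tau0)//= /tau mulrCA ger_pMr ?divr_gt0// ler_pdivrMr// mul1r.
  by rewrite ler_nat ltnW// ltnS ltnW.
pose T := enorm z0 + d.+1%:R * R1.
have Tball x : `|x - z0| <= R1 -> enorm x <= T.
  move=> xz; rewrite -(subrK z0 x) addrC; apply: le_trans (enormD _ _) _.
  by rewrite lerD2l; apply: le_trans (enorm_le_norm _) _; rewrite ler_pM2l.
have T0 : 0 <= T by rewrite addr_ge0 ?enorm_ge0// mulr_ge0// ltW.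
pose Q' := `|Q| + T.
pose Q'' := Q' + `|Q|.
have [C C_ge0 hC] := radial_bound_on F01 ((Q' + T) ^+ 2) d4 (exprn_gt0 2 (divr_gt0 tau0 (ltr0Sn R 1))).
(* The bound tau / 2 separates the cubes, R1 / 80 keeps the height 10 e of the poles below R1 / 8,
   and the last two bounds give 144 e^2 < eta. *)
pose e0 := Num.min (tau / 2) (Num.min (R1 / 80) (Num.min 1 (eta / 145))).
exists z, (c / 2 / 12 ^+ d.+1), (5 * C / (tau / 2) ^+ 2), e0.
have tauR : tau <= R1 / 8 by rewrite /tau ger_pMr ?divr_gt0// invf_le1// ler1n.
have zin j (e : R) x : e < e0 -> cube (z j) e x -> `|x - z0| <= R1 / 4.
  rewrite /e0 !lt_min => /and4P[_ e2 _ _] xz.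
  have : `|off (j%:R * tau) 0| <= R1 / 8.
    by have /andP[h1 h2] := jtau j; apply: off_norm; rewrite ?normr0 ?divr_ge0 ?(ltW R10)// ger0_norm.
  have := ler_normD (x - z j) (off (j%:R * tau) 0).
  have -> : x - z j + off (j%:R * tau) 0 = x - z0 by rewrite /z opprD addrA subrK.
  by move: xz; rewrite /cube /=; lra.
split.
- by rewrite !divr_gt0// exprn_gt0.
- by rewrite /e0 !lt_min !divr_gt0//= ltr01.
- by move=> j e x he /(zin j e x he); lra.
move=> e /andP[e_gt0 ee0].
exists (fun j => pole_coef k F0 F1 (y e j) (axis R d) 2) => j.
move: (ee0); rewrite /e0 !lt_min => /and4P[et eR e1 eeta].
pose E := D `|` \bigcup_i cube (z i) e.
have EQ x : E x -> enorm x <= Q'.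
  case=> [/(@subset_closure _ D) /ClQ h|[i _ /(zin i e x ee0) h]]; rewrite /Q'.
    by have := ler_norm Q; lra.
  apply: le_trans (Tball _ _) _; last by rewrite lerDr.
  by apply: le_trans h _; rewrite ler_piMr ?(ltW R10)// invf_le1// ler1n.
have ax1 : dotv (axis R d) (axis R d) = 1 by rewrite dotv_axis mxE eqxx.
have /andP[j0 jR] := jtau j.
have yz0 : `|y e j - z0| <= R1 / 4.
  have -> : y e j - z0 = off (j%:R * tau) (10 * e) by rewrite /y addrAC subrr add0r.
  apply: off_norm; first by rewrite ger0_norm//; apply: le_trans jR _; rewrite ler_pM2l// lef_pV2 ?posrE// ler_nat.
  by rewrite ger0_norm ?mulr_ge0 ?(ltW e_gt0)//; move: eR R10; clear; lra.
have xy_coord x l : (x - y e j) 0 l = (x - z0) 0 l - off (j%:R * tau) (10 * e) 0 l.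
  by rewrite /y opprD addrA [in LHS]mxE [X in _ + X]mxE.
have xz_coord i x l : (x - z i) 0 l = (x - z0) 0 l - off (i%:R * tau) 0 0 l.
  by rewrite /z opprD addrA [in LHS]mxE [X in _ + X]mxE.
have bounded x : tau / 2 <= enorm (x - y e j) -> enorm x <= Q' ->
    `|pole_coef k F0 F1 (y e j) (axis R d) 2 x| <= 5 * C / (tau / 2) ^+ 2.
  move=> h xQ; apply: (@pole_coef2_le _ _ _ _ _ C (tau / 2) (Q' + T)) => //.
    by rewrite divr_gt0.
  rewrite h /=; apply: le_trans (enormD _ _) _; rewrite enormN lerD//.
  by apply: Tball; lra.
have offE1 (a b : R) : off a b 0 i1 = a by rewrite mxE eqxx.
have offEl (a b : R) l : l != ord0 -> off a b 0 l = off a 0 0 l.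
  by move=> l0; rewrite !mxE (negbTE l0).
have offE0 (a b : R) : off a b 0 ord0 = b by rewrite mxE eq_sym (negbTE i10) eqxx.
split.
- have -> : y e j = z0 + off (j%:R * tau) (10 * e) by [].
  apply: (@reached_pole _ _ _ _ _ E (closure D) (S E) z0 _ (R1 / 2) R1 Q'' e) => //.
  + by move=> theta c1; exact: PW EQ.
  + exact: closed_closure.
  + by rewrite divr_gt0.
  + by rewrite ltr_pdivrMr// ltr_pMr// ltr1n.
  + by move=> x /EQ /le_trans; apply; rewrite /Q'' lerDl.
  + move=> x /ClQ /le_trans; apply; apply: (le_trans (ler_norm Q)).
    by rewrite /Q'' lerDr /Q' addr_ge0.
  + move=> x [/(@subset_closure _ D) ?|[i _ hi]]; [by left|right]; split.
      apply: le_trans (zin i e x ee0 hi) _; rewrite ler_pM2l// lef_pV2 ?posrE//.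
      by rewrite ler_nat.
    have := le_trans (coord_le_norm (x - z i) ord0) hi.
    by rewrite xz_coord offE0 subr0 => /(le_trans (ler_norm _)).
  + apply: off_norm; first by rewrite ger0_norm//; apply: le_trans jR _; rewrite ler_pM2l// lef_pV2 ?posrE// ler_nat.
    by rewrite ger0_norm ?mulr_ge0 ?(ltW e_gt0)//; move: eR R10; clear; lra.
  + by rewrite offE0 ltr_pMl// ltr1n.
- move=> x xj; have -> : y e j = z j + (10 * e) *: axis R d.
    rewrite /y /z -addrA; congr (_ + _); apply/rowP => l; rewrite !mxE.
    by case: eqP => [->|]; [rewrite (negbTE i10) mulr0 addr0|case: eqP; rewrite ?mulr0 ?mulr1 add0r].
  apply: (pole_coef2_cube d13 F01 hc e_gt0 _ xj).
  have ee : e ^+ 2 <= e by rewrite expr2 ger_pMr// ltW.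
  by move: ee eeta e_gt0; clear; lra.
- move=> x Dx; apply: bounded; last by apply: EQ; left.
  apply: le_trans (norm_le_enorm _).
  by have := Clfar _ (@subset_closure _ D _ Dx); have := ler_distD (y e j) x z0; lra.
- move=> i x ij xi; apply: bounded; last by apply: EQ; right; exists i.
  apply: le_trans (norm_le_enorm _); apply: le_trans (coord_le_norm _ i1).
  have := le_trans (coord_le_norm (x - z i) i1) xi; rewrite xz_coord xy_coord !offE1.
  have : tau <= `|i%:R * tau - j%:R * tau|.
    rewrite -mulrBl normrM (gtr0_norm tau0) ler_peMl ?(ltW tau0)//.
    have [h|h|h] := ltngtP i j.
    + by rewrite distrC -natrB 1?ltnW// normr_nat ler1n subn_gt0.
    + by rewrite -natrB 1?ltnW// normr_nat ler1n subn_gt0.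
    + by move: ij; rewrite (val_inj h) eqxx.
  move: ((x - z0) 0 i1) => a.
  by have := ler_distD a (i%:R * tau) (j%:R * tau); rewrite [`|_ - a|]distrC; lra.
Qed.

(** * Cubes, open sets and spherical caps *)

Section cubes.
Context (R : realType) (d : nat).
Implicit Types (z : 'rV[R]_d) (e : R).

Lemma cube_box z e : 0 <= e ->
  cube z e = [set x | forall i, `[z 0 i - e, z 0 i + e]%classic (x 0 i)].
Proof.
move=> e0; apply/seteqP; split=> [x xz i|x xz] /=.
  have := le_trans (coord_le_norm (x - z) i) xz; rewrite !mxE in_itv /= => /ler_normlP[h1 h2].
  by move: h1 h2; move: (x 0 i) (z 0 i) => a b h1 h2; apply/andP; split; lra.
apply: norm_row_le => // i; have := xz i; rewrite /= in_itv /= !mxE => /andP[h1 h2].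
by rewrite ler_norml lerBrDl h1 lerBlDl.
Qed.

Lemma measurable_cube z e : measurable (cube z e).
Proof.
have [e0|e0] := leP 0 e; last first.
  rewrite (_ : cube z e = set0)//; apply/seteqP; split=> // x; rewrite /cube /=.
  by move=> /(le_lt_trans)/(_ e0); rewrite normr_lt0.
have -> : cube z e = \bigcap_(i in [set: 'I_d])
    (fun x : 'rV[R]_d => x 0 i) @^-1` `[z 0 i - e, z 0 i + e]%classic.
  by rewrite cube_box//; apply/seteqP; split=> x /= H i; [move=> _; exact: H|exact: H].
apply: fin_bigcap_measurable; first exact: finite_finset.
by move=> i _; rewrite -[X in measurable X]setTI; apply: (measurable_coord i).
Qed.

Lemma cube_volume z e : 0 <= e -> lebesgue_rV R d (cube z e) = ((2 * e) ^+ d)%:E.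
Proof.
move=> e0; rewrite cube_box//.
have -> := @lebesgue_rV_box R d (fun i => `[z 0 i - e, z 0 i + e]%classic) (fun i => measurable_itv _).
under eq_bigr => i _.
  rewrite (_ : lebesgue_measure _ = (2 * e)%:E).
    over.
  rewrite lebesgue_measure_itv /= lte_fin.
  case: ltP => h; last first.
    by congr EFin; move: h e0; lra.
  by rewrite -EFinB; congr EFin; ring.
by rewrite prodEFin prodr_const card_ord.
Qed.

(** The sigma-algebra is the one generated by the coordinates, so an open set is written as a
    countable union of cubes with rational centres and half sides 1 / (m + 1). *)
Lemma open_measurable_rV (O : set 'rV[R]_d) : open O -> measurable O.
Proof.
move=> Oo.
pose c (p : 'rV[rat]_d * nat) := cube (map_mx ratr p.1) (p.2.+1%:R^-1 : R).
pose F n : set 'rV[R]_d := if (unpickle n : option ('rV[rat]_d * nat)) is Some p then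
  (if pselect (c p `<=` O) is left _ then c p else set0) else set0.
rewrite (_ : O = \bigcup_n F n); last first.
  apply/seteqP; split=> [x Ox|x [n _]]; last first.
    rewrite /F; case: unpickle => // p; case: pselect => //= h cx; exact: h.
  have [r r0 hr] := open_norm_ball Oo Ox.
  pose m := Num.trunc (2 / r).
  have m0 : 0 < m.+1%:R^-1 :> R by rewrite invr_gt0.
  have hm : m.+1%:R^-1 < r / 2.
    by rewrite -[ltRHS]invrK invf_div ltf_pV2 ?posrE// ?divr_gt0// truncnS_gt.
  have hp i : {p : rat | `|x 0 i - ratr p| <= m.+1%:R^-1}.
    apply: cid; have [|p] := @rat_in_itvoo R (x 0 i - m.+1%:R^-1) (x 0 i + m.+1%:R^-1).
      by rewrite ltrD2l gtrN.
    rewrite in_itv /= => /andP[h1 h2]; exists p.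
    by rewrite ler_norml; move: h1 h2; move: (x 0 i) (ratr p) (_^-1) => a b c' h1 h2; apply/andP; split; lra.
  pose p : 'rV[rat]_d * nat := (\row_i sval (hp i), m).
  have xc : `|x - map_mx ratr p.1| <= m.+1%:R^-1.
    apply: norm_row_le => [|i]; first exact: ltW.
    by rewrite !mxE; exact: (svalP (hp i)).
  exists (pickle p) => //; rewrite /F pickleK; case: pselect => [_|[]] //.
  move=> y yc; apply: hr; apply: le_lt_trans (ler_distD (map_mx ratr p.1) y x) _.
  rewrite (splitr r) (le_lt_trans (_ : _ <= m.+1%:R^-1 + m.+1%:R^-1)) ?ltrD//.
  by rewrite lerD// distrC.
apply: bigcupT_measurable => n; rewrite /F; case: unpickle => [p|] //.
by case: pselect => // h; exact: measurable_cube.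
Qed.

Lemma bounded_norm_le (A : set 'rV[R]_d) : bounded_set A ->
  exists2 M : R, 0 < M & forall x, A x -> `|x| <= M.
Proof.
move=> [M [_ h]]; exists (`|M| + 1) => [|x Ax]; first by rewrite ltr_wpDl.
by apply: (h (`|M| + 1)) => //; have := ler_norm M; lra.
Qed.

Lemma bounded_finite (A : set 'rV[R]_d) : measurable A -> bounded_set A ->
  (lebesgue_rV R d A < +oo)%E.
Proof.
move=> mA /bounded_norm_le[M M0 AM].
apply: (@le_lt_trans _ _ (lebesgue_rV R d (cube 0 M))); last by rewrite cube_volume ?ltW// ltry.
apply: le_measure; rewrite ?inE//; first exact: measurable_cube.
by move=> x /AM; rewrite /cube /= subr0.
Qed.

End cubes.

Section sphere.
Context (R : realType) (d : nat).

Lemma unit_ball_finite : (lebesgue_rV R d (@unit_ball R d) < +oo)%E.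
Proof.
apply: bounded_finite; first exact: measurable_unit_ball.
exists 1; split => // M M1 x /= x1; apply: le_trans (norm_le_enorm _) _.
exact: le_trans x1 (ltW M1).
Qed.

Lemma sphere_measureE (A : set 'rV[R]_d) :
  sphere_measure A = (d%:R%:E * lebesgue_rV R d (@normalize R d @^-1` A `&` @unit_ball R d))%E.
Proof. by []. Qed.

Lemma sphere_measure_finite : fin_num_fun (@sphere_measure R d).
Proof.
move=> A mA; rewrite sphere_measureE; apply: fin_numM => //.
rewrite ge0_fin_numE//; apply: le_lt_trans unit_ball_finite.
have mN : measurable (@normalize R d @^-1` A).
  by rewrite -[X in measurable X]setTI; apply: measurable_normalize.
have mB : measurable (@unit_ball R d) by exact: measurable_unit_ball.
by apply: le_measure; rewrite ?inE//; exact: measurableI.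
Qed.

(** A copy of [sphere_measure] that carries the structure of a finite measure, as Fubini's theorem
    requires a sigma-finite one. *)
Definition sphere_set_fun (A : set 'rV[R]_d) : \bar R := sphere_measure A.

HB.instance Definition _ := isMeasure.Build _ _ _ sphere_set_fun
  (measure0 (@sphere_measure R d)) (measure_ge0 (@sphere_measure R d))
  (@measure_semi_sigma_additive _ _ _ (@sphere_measure R d)).

HB.instance Definition _ := Measure_isFinite.Build _ _ _ sphere_set_fun
  sphere_measure_finite.

Lemma measurable_unit_sphere : measurable (@unit_sphere R d).
Proof.
rewrite (_ : unit_sphere = setT `&` @enorm R d @^-1` [set 1]).
  by apply: (@measurable_enorm R d).
by rewrite setTI.
Qed.

Lemma normalize_unit (x : 'rV[R]_d) : x != 0 -> unit_sphere (normalize x).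
Proof.
move=> x0; rewrite /unit_sphere /= /normalize enormZ.
have e0 : enorm x != 0 by apply: contra x0 => /eqP/enorm_eq0 ->.
by rewrite ger0_norm ?invr_ge0 ?enorm_ge0// mulVf.
Qed.

(** Radial projection maps a small cube around t / 2 into the cap, and this cube lies in the unit
    ball and has positive volume. *)
Lemma cap_gt0 (t : 'rV[R]_d) (r : R) : (0 < d)%N -> unit_sphere t -> 0 < r ->
  (0 < sphere_measure (cube t r `&` unit_sphere))%E.
Proof.
move=> d0 t1 r0; rewrite sphere_measureE.
apply: mule_gt0; first by rewrite lte_fin ltr0n.
have d1 : 1 <= d%:R :> R by rewrite ler1n.
pose s : R := Num.min (r / 4) (1 / 4) / d%:R.
have s0 : 0 < s by rewrite divr_gt0 ?lt_min ?divr_gt0// (lt_le_trans _ d1).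
have ds : d%:R * s = Num.min (r / 4) (1 / 4) by rewrite mulrC divfK// gt_eqF// (lt_le_trans _ d1).
have dsr : d%:R * s <= r / 4 by rewrite ds ge_min lexx.
have ds1 : d%:R * s <= 1 / 4 by rewrite ds ge_min lexx orbT.
have t1' : enorm t = 1 by [].
have sub : cube (2^-1 *: t) s `<=` @normalize R d @^-1` (cube t r `&` unit_sphere) `&` @unit_ball R d.
  move=> x xs.
  have hx : enorm (x - 2^-1 *: t) <= d%:R * s.
    by apply: le_trans (enorm_le_norm _) _; rewrite ler_wpM2l.
  have ht : enorm (2^-1 *: t) = 1 / 2 by rewrite enormZ t1' ger0_norm ?invr_ge0// mulr1 div1r.
  have h1 : enorm x <= 1 / 2 + d%:R * s.
    by have := enormD (x - 2^-1 *: t) (2^-1 *: t); rewrite subrK ht; move: hx; lra.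
  have h2 : 1 / 2 - d%:R * s <= enorm x.
    by have := enorm_dist (2^-1 *: t) x; rewrite ht enormB; move: hx; lra.
  have x0 : 0 < enorm x by lra.
  have xn0 : x != 0 by apply: contraTN x0 => /eqP ->; rewrite enorm0 ltxx.
  split; last by rewrite /unit_ball /=; lra.
  split; last exact: normalize_unit.
  rewrite /cube /=; apply: le_trans (norm_le_enorm _) _.
  have -> : normalize x - t = ((enorm x)^-1 - 2) *: x + 2 *: (x - 2^-1 *: t).
    by rewrite scalerBl scalerBr scalerA divff// scale1r addrA subrK.
  apply: le_trans (enormD _ _) _; rewrite !enormZ.
  have -> : `|(enorm x)^-1 - 2| * enorm x = `|1 - 2 * enorm x|.
    by rewrite -[in LHS](gtr0_norm x0) -normrM mulrBl (gtr0_norm x0) mulVf ?gt_eqF.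
  have -> : `|2| = 2 :> R by rewrite ger0_norm.
  have : `|1 - 2 * enorm x| <= 2 * (d%:R * s) by rewrite ler_norml; lra.
  by move: hx; lra.
apply: (@lt_le_trans _ _ (lebesgue_rV R d (cube (2^-1 *: t) s))).
  by rewrite cube_volume ?ltW// lte_fin exprn_gt0// mulr_gt0.
have mC : measurable (cube t r `&` unit_sphere).
  by apply: measurableI; [exact: measurable_cube|exact: measurable_unit_sphere].
apply: le_measure; rewrite ?inE//; first exact: measurable_cube.
apply: measurableI; last exact: measurable_unit_ball.
by rewrite -[X in measurable X]setTI; apply: measurable_normalize.
Qed.

End sphere.

(** * Complex square integrable functions *)

Section real_dot.
Context (R : realType).
Implicit Types (z w u : R[i]) (a : R).

(** The inner product of C as a real plane. Its integral is the real part of the L^2 inner product,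
    and multiplying the second argument by i yields the imaginary part, so every estimate concerns a
    real bilinear form. *)
Definition rdot z w : R := complex.Re z * complex.Re w + complex.Im z * complex.Im w.

Lemma ReD z w : complex.Re (z + w) = complex.Re z + complex.Re w.
Proof. by case: z w => [? ?] [? ?]. Qed.

Lemma ImD z w : complex.Im (z + w) = complex.Im z + complex.Im w.
Proof. by case: z w => [? ?] [? ?]. Qed.

Lemma ReN z : complex.Re (- z) = - complex.Re z.
Proof. by case: z. Qed.

Lemma ImN z : complex.Im (- z) = - complex.Im z.
Proof. by case: z. Qed.

Lemma ReM z w : complex.Re (z * w) = complex.Re z * complex.Re w - complex.Im z * complex.Im w.
Proof. by case: z w => [? ?] [? ?]. Qed.

Lemma ImM z w : complex.Im (z * w) = complex.Re z * complex.Im w + complex.Im z * complex.Re w.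
Proof. by case: z w => [? ?] [? ?]. Qed.

Lemma ReZ a z : complex.Re (a%:C%C * z) = a * complex.Re z.
Proof. by rewrite ReM /= mul0r subr0. Qed.

Lemma ImZ a z : complex.Im (a%:C%C * z) = a * complex.Im z.
Proof. by rewrite ImM /= mul0r addr0. Qed.

Lemma rdotC z w : rdot z w = rdot w z.
Proof. by rewrite /rdot mulrC [X in _ + X]mulrC. Qed.

Lemma rdotDl z w u : rdot (z + w) u = rdot z u + rdot w u.
Proof. by rewrite /rdot ReD ImD; ring. Qed.

Lemma rdotZl a z w : rdot (a%:C%C * z) w = a * rdot z w.
Proof. by rewrite /rdot ReZ ImZ; ring. Qed.

Lemma rdotNl z w : rdot (- z) w = - rdot z w.
Proof. by rewrite /rdot ReN ImN; ring. Qed.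

Lemma rdot_ge0 z : 0 <= rdot z z.
Proof. by rewrite /rdot addr_ge0// -expr2 sqr_ge0. Qed.

Lemma normc_sq z : Normc.normc z ^+ 2 = rdot z z.
Proof.
case: z => a b; rewrite /Normc.normc /rdot /= sqr_sqrtr ?expr2//.
by rewrite addr_ge0// sqr_ge0.
Qed.

Lemma normc_ge0 z : 0 <= Normc.normc z.
Proof. by case: z => a b; rewrite sqrtr_ge0. Qed.

Lemma normc_sqrt z : Normc.normc z = Num.sqrt (rdot z z).
Proof. by rewrite -normc_sq sqrtr_sqr ger0_norm// normc_ge0. Qed.

Lemma rdot_mulr z w u : rdot (z * w) u = rdot z (u * conjc w).
Proof. by case: z w u => [? ?] [? ?] [? ?]; rewrite /rdot /=; ring. Qed.

Lemma Re_mul_conjc z w : complex.Re (z * conjc w) = rdot z w.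
Proof. by case: z w => [? ?] [? ?]; rewrite /rdot /=; ring. Qed.

Lemma Im_mul_conjc z w : complex.Im (z * conjc w) = rdot z ('i%C * w).
Proof. by case: z w => [? ?] [? ?]; rewrite /rdot /=; ring. Qed.

Lemma rdot_le z w : `|rdot z w| <= rdot z z + rdot w w.
Proof.
have h (s t : R) : `|s * t| <= (s ^+ 2 + t ^+ 2) / 2.
  rewrite ler_norml; have h1 := sqr_ge0 (s - t); have h2 := sqr_ge0 (s + t).
  by move: h1 h2; rewrite sqrrB sqrrD; lra.
apply: le_trans (ler_normD _ _) _; rewrite /rdot -!expr2.
have h1 := h (complex.Re z) (complex.Re w); have h2 := h (complex.Im z) (complex.Im w).
have := sqr_ge0 (complex.Re z); have := sqr_ge0 (complex.Re w).
have := sqr_ge0 (complex.Im z); have := sqr_ge0 (complex.Im w); move: h1 h2; lra.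
Qed.

Lemma normc_ler_Re_Im z : Normc.normc z <= `|complex.Re z| + `|complex.Im z|.
Proof.
rewrite -ler_sqr ?nnegrE ?addr_ge0 ?normc_ge0// normc_sq /rdot sqrrD !real_normK ?num_real//.
by rewrite -!expr2 -addrA lerD2l lerDr mulrn_wge0// mulr_ge0.
Qed.

Lemma Re_le_normc z : `|complex.Re z| <= Normc.normc z.
Proof.
rewrite -ler_sqr ?nnegrE ?normc_ge0// normc_sq /rdot real_normK ?num_real//.
by rewrite -!expr2 lerDl sqr_ge0.
Qed.

Lemma Im_le_normc z : `|complex.Im z| <= Normc.normc z.
Proof.
rewrite -ler_sqr ?nnegrE ?normc_ge0// normc_sq /rdot real_normK ?num_real//.
by rewrite -!expr2 lerDr sqr_ge0.
Qed.

(** The modulus of a complex integral becomes a real pairing, to which Cauchy-Schwarz applies. *)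
Lemma normc_unit z : exists2 u : R[i], Normc.normc u = 1 & Normc.normc z = rdot z u.
Proof.
have [z0|z0] := eqVneq (Normc.normc z) 0.
  exists 1; first by rewrite /Normc.normc /= expr1n expr0n /= addr0 sqrtr1.
  rewrite z0 /rdot /= mulr1 mulr0 addr0; have := Re_le_normc z.
  by rewrite z0 normr_le0 => /eqP.
exists ((Normc.normc z)^-1%:C%C * z).
  rewrite normc_sqrt rdotZl rdotC rdotZl -normc_sq expr2 mulKf// mulVf// sqrtr1//.
by rewrite rdotC rdotZl -normc_sq expr2 mulKf.
Qed.

End real_dot.

Section complex_L2.
Context d (T : measurableType d) (R : realType) (mu : {measure set T -> \bar R}) (A : set T).
Hypothesis mA : measurable A.
Implicit Types (f g h : T -> R[i]) (a : R).

Local Notation L2 := (cLspace mu A 2%:E).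

Definition sqint f := mu.-integrable A (EFin \o (fun x => rdot (f x) (f x))).

Lemma cmeasurable_rdot f g : cmeasurable A f -> cmeasurable A g ->
  measurable_fun A (fun x => rdot (f x) (g x)).
Proof. by move=> [? ?] [? ?]; apply: measurable_funD; apply: measurable_funM. Qed.

Lemma cmeasurableD f g : cmeasurable A f -> cmeasurable A g ->
  cmeasurable A (fun x => f x + g x).
Proof.
move=> [? ?] [? ?]; split; under eq_fun do rewrite ?ReD ?ImD; exact: measurable_funD.
Qed.

Lemma cmeasurableM f g : cmeasurable A f -> cmeasurable A g ->
  cmeasurable A (fun x => f x * g x).
Proof.
move=> [? ?] [? ?]; split; under eq_fun do rewrite ?ReM ?ImM.
  by apply: measurable_funB; exact: measurable_funM.
by apply: measurable_funD; exact: measurable_funM.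
Qed.

Lemma cmeasurable_real (u : T -> R) : measurable_fun A u -> cmeasurable A (fun x => (u x)%:C%C).
Proof. by split. Qed.

Lemma cmeasurable_cst (z : R[i]) : cmeasurable A (fun=> z).
Proof. by split; exact: measurable_cst. Qed.

Lemma cmeasurable_ext f g : (forall x, A x -> f x = g x) -> cmeasurable A f -> cmeasurable A g.
Proof.
move=> fg [? ?]; split; [apply: (eq_measurable_fun (fun x => complex.Re (f x))) => //|
  apply: (eq_measurable_fun (fun x => complex.Im (f x))) => //] => x; rewrite inE => Ax; by rewrite fg.
Qed.

Lemma cmeasurableN f : cmeasurable A f -> cmeasurable A (fun x => - f x).
Proof.
move=> mf; apply: (@cmeasurable_ext (fun x => -1 * f x)); first by move=> x _; rewrite mulN1r.
by apply: cmeasurableM => //; exact: cmeasurable_cst.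
Qed.

Lemma measurable_normc f : cmeasurable A f -> measurable_fun A (fun x => Normc.normc (f x)).
Proof.
move=> mf; under eq_fun do rewrite normc_sqrt.
rewrite (_ : (fun _ => _) = (fun x => powR (rdot (f x) (f x)) 2^-1)).
  by apply: (measurableT_comp (measurable_powR _)); exact: cmeasurable_rdot.
by apply/funext => x; rewrite powR12_sqrt// rdot_ge0.
Qed.

Lemma cLnorm2_def f : cLnorm mu A 2%:E f =
  ((\int[mu]_(x in A) (rdot (f x) (f x))%:E) `^ 2^-1)%E.
Proof.
rewrite /cLnorm unlock /=; congr poweR; rewrite [RHS]integral_mkcond.
apply: eq_integral => x _; rewrite !patchE; case: ifP => _ /=.
  by rewrite ger0_norm ?normc_ge0// powR_mulrn ?normc_ge0// normc_sq.
by rewrite normr0 powR0// gt_eqF.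
Qed.

Lemma sqint_lty f : cmeasurable A f ->
  sqint f <-> (\int[mu]_(x in A) (rdot (f x) (f x))%:E < +oo)%E.
Proof.
move=> mf; rewrite /sqint; split=> [/integrableP[_]|h]; last apply/integrableP; try split.
- by under eq_integral do rewrite /= ger0_norm ?rdot_ge0//.
- by apply/measurable_EFinP; exact: cmeasurable_rdot.
- by under eq_integral do rewrite /= ger0_norm ?rdot_ge0//.
Qed.

Lemma L2P f : L2 f <-> cmeasurable A f /\ sqint f.
Proof.
split=> -[mf h]; split => //.
  apply/(sqint_lty mf); move: h; rewrite cLnorm2_def; case: (integral _ _ _) => [r|//|//].
    by move=> _; rewrite ltry.
  by rewrite poweRyr// invr_eq0 pnatr_eq0.
by rewrite cLnorm2_def poweR_lty//; exact/(sqint_lty mf).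
Qed.

Definition ip f g : R := \int[mu]_(x in A) rdot (f x) (g x).

Definition nrm f : R := Num.sqrt (ip f f).

Lemma L2_integrable f g : L2 f -> L2 g -> mu.-integrable A (EFin \o (fun x => rdot (f x) (g x))).
Proof.
move=> /L2P[mf sf] /L2P[mg sg].
apply: (le_integrable mA (g := EFin \o (fun x => rdot (f x) (f x) + rdot (g x) (g x)))) => //.
- by apply/measurable_EFinP; exact: cmeasurable_rdot.
- move=> x _; rewrite /= lee_fin [leRHS]ger0_norm ?(addr_ge0 (rdot_ge0 _) (rdot_ge0 _))//.
  exact: rdot_le.
- exact: (integrableD mA sf sg).
Qed.

Lemma cinnerE f g : cinner mu A f g = Complex (ip f g) (ip f (fun x => 'i%C * g x)).
Proof.
by congr Complex; apply: eq_Rintegral => x _; [exact: Re_mul_conjc|exact: Im_mul_conjc].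
Qed.

Lemma ipC f g : ip f g = ip g f.
Proof. by apply: eq_Rintegral => x _; exact: rdotC. Qed.

Lemma ip_ge0 f : 0 <= ip f f.
Proof. by apply: Rintegral_ge0 => x _; exact: rdot_ge0. Qed.

Lemma nrm_ge0 f : 0 <= nrm f.
Proof. exact: sqrtr_ge0. Qed.

Lemma nrm_sq f : nrm f ^+ 2 = ip f f.
Proof. by rewrite sqr_sqrtr// ip_ge0. Qed.

Lemma cLnormE f : L2 f -> cLnorm mu A 2%:E f = (nrm f)%:E.
Proof.
move=> /L2P[mf /(sqint_lty mf) h]; rewrite cLnorm2_def /nrm /ip /Rintegral.
have : (\int[mu]_(x in A) (rdot (f x) (f x))%:E)%E \is a fin_num.
  by rewrite ge0_fin_numE// integral_ge0// => x _; rewrite lee_fin rdot_ge0.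
move=> /fineK <-; rewrite poweR_EFin powR12_sqrt// fine_ge0// integral_ge0// => x _.
by rewrite lee_fin rdot_ge0.
Qed.

Lemma L2Z a f : L2 f -> L2 (fun x => a%:C%C * f x).
Proof.
move=> Lf; have /L2P[mf sf] := Lf; apply/L2P; split.
  by apply: cmeasurableM => //; exact: cmeasurable_cst.
rewrite /sqint (_ : EFin \o _ = (fun x => (a ^+ 2)%:E * (EFin \o (fun x => rdot (f x) (f x))) x)%E).
  exact: integrableZl.
by apply/funext => x /=; rewrite rdotZl rdotC rdotZl -EFinM expr2 mulrA.
Qed.

Lemma L2D f g : L2 f -> L2 g -> L2 (fun x => f x + g x).
Proof.
move=> Lf Lg; have /L2P[mf sf] := Lf; have /L2P[mg sg] := Lg; apply/L2P; split.
  exact: cmeasurableD.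
rewrite /sqint (_ : EFin \o _ = (((EFin \o (fun x => rdot (f x) (f x))) \+ (EFin \o (fun x => rdot (g x) (g x))))
   \+ ((EFin \o (fun x => rdot (f x) (g x))) \+ (EFin \o (fun x => rdot (f x) (g x)))))%E).
  by apply: integrableD => //; apply: integrableD => //; exact: L2_integrable.
apply/funext => x /=; rewrite -!EFinD; congr EFin.
by rewrite rdotDl !(rdotC _ (_ + _)) !rdotDl (rdotC (g x) (f x)); ring.
Qed.

Lemma L2N f : L2 f -> L2 (fun x => - f x).
Proof.
move=> Lf; rewrite (_ : (fun x => - f x) = (fun x => (-1)%:C%C * f x)); first exact: L2Z.
by apply/funext => x; rewrite rmorphN1 mulN1r.
Qed.

Lemma L2B f g : L2 f -> L2 g -> L2 (fun x => f x - g x).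
Proof. by move=> Lf Lg; apply: L2D => //; exact: L2N. Qed.

Lemma L2i f : L2 f -> L2 (fun x => 'i%C * f x).
Proof.
move=> /L2P[mf sf]; apply/L2P; split.
  by apply: cmeasurableM => //; exact: cmeasurable_cst.
rewrite /sqint (_ : EFin \o _ = (EFin \o (fun x => rdot (f x) (f x))))//.
by apply/funext => x /=; congr EFin; case: (f x) => s t; rewrite /rdot /=; ring.
Qed.

Lemma L2_ext f g : (forall x, A x -> f x = g x) -> L2 f -> L2 g.
Proof.
move=> fg /L2P[mf sf]; apply/L2P; split; first exact: cmeasurable_ext mf.
by apply: eq_integrable sf => // x; rewrite inE => Ax /=; rewrite fg.
Qed.

Lemma L2_dom (C : R) f g : cmeasurable A f -> L2 g ->
  (forall x, A x -> Normc.normc (f x) <= C * Normc.normc (g x)) -> L2 f.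
Proof.
move=> mf Lg h; have /L2P[_ sg] := L2Z C Lg; apply/L2P; split => //.
apply: (le_integrable mA _ _ sg) => [|x Ax].
  by apply/measurable_EFinP; exact: cmeasurable_rdot.
rewrite /= lee_fin !ger0_norm ?rdot_ge0// rdotZl rdotC rdotZl mulrA -!normc_sq -expr2 -exprMn.
by rewrite lerXn2r ?nnegrE ?normc_ge0 ?h// (le_trans _ (h _ Ax))// normc_ge0.
Qed.

Lemma L2_cst (z : R[i]) : (mu A < +oo)%E -> L2 (fun=> z).
Proof.
move=> fA; apply/L2P; split; first exact: cmeasurable_cst.
apply: (@measurable_bounded_integrable _ _ _ mu (fun=> rdot z z)) => //.
exact: bounded_cst.
Qed.

Lemma normc_cst1 : Normc.normc (1 : R[i]) = 1.
Proof. by rewrite /Normc.normc /= expr1n expr0n /= addr0 sqrtr1. Qed.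

Lemma L2_bounded (C : R) f : (mu A < +oo)%E -> cmeasurable A f ->
  (forall x, A x -> Normc.normc (f x) <= C) -> L2 f.
Proof.
move=> fA mf h; apply: (@L2_dom C f (fun=> 1)) => //; first exact: L2_cst.
by move=> x /h; rewrite normc_cst1 mulr1.
Qed.

Lemma ipDl f g h : L2 f -> L2 g -> L2 h -> ip (fun x => f x + g x) h = ip f h + ip g h.
Proof.
move=> Lf Lg Lh; rewrite /ip -RintegralD//; first by apply: eq_Rintegral => x _; exact: rdotDl.
- exact: L2_integrable.
- exact: L2_integrable.
Qed.

Lemma ipZl a f g : L2 f -> L2 g -> ip (fun x => a%:C%C * f x) g = a * ip f g.
Proof.
move=> Lf Lg; rewrite /ip -RintegralZl//; last exact: L2_integrable.
by apply: eq_Rintegral => x _; exact: rdotZl.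
Qed.

Lemma ipDr f g h : L2 f -> L2 g -> L2 h -> ip h (fun x => f x + g x) = ip h f + ip h g.
Proof. by move=> Lf Lg Lh; rewrite !(ipC h) ipDl. Qed.

Lemma ipZr a f g : L2 f -> L2 g -> ip g (fun x => a%:C%C * f x) = a * ip g f.
Proof. by move=> Lf Lg; rewrite !(ipC g) ipZl. Qed.

Lemma ip_ext f g f' g' : (forall x, A x -> f x = f' x) -> (forall x, A x -> g x = g' x) ->
  ip f g = ip f' g'.
Proof. by move=> h1 h2; apply: eq_Rintegral => x; rewrite inE => Ax; rewrite h1 ?h2. Qed.

Lemma ip_ae f f' g : cmeasurable A f -> cmeasurable A f' -> cmeasurable A g ->
  (\forall x \ae mu, A x -> f x = f' x) -> ip f g = ip f' g.
Proof.
move=> mf mf' mg ff; rewrite /ip /Rintegral; congr fine; apply: ae_eq_integral => //.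
- by apply/measurable_EFinP; exact: cmeasurable_rdot.
- by apply/measurable_EFinP; exact: cmeasurable_rdot.
by apply: filterS ff => x h Ax; rewrite h.
Qed.

Lemma ip_CS f g : L2 f -> L2 g -> ip f g ^+ 2 <= ip f f * ip g g.
Proof.
move=> Lf Lg.
have key a b : 0 <= a ^+ 2 * ip f f + 2 * a * b * ip f g + b ^+ 2 * ip g g.
  have := ip_ge0 (fun x => a%:C%C * f x + b%:C%C * g x).
  have La := L2Z a Lf; have Lb := L2Z b Lg.
  rewrite ipDl//; last exact: L2D.
  rewrite !ipDr// !ipZl// !ipZr// (ipC g f); congr (_ <= _); ring.
have f0 := ip_ge0 f; have g0 := ip_ge0 g.
have [g00|g00] := eqVneq (ip g g) 0.
  rewrite g00 mulr0; have [->|P0] := eqVneq (ip f g) 0; first by rewrite expr0n.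
  (* Without its quadratic term the form is affine in b, and this b would give it the value -1. *)
  have := key 1 (- (ip f f + 1) / (2 * ip f g)); rewrite g00 mulr0 addr0 expr1n mul1r mulr1.
  have -> : ip f f + 2 * (- (ip f f + 1) / (2 * ip f g)) * ip f g = -1 by field.
  by rewrite ler0N1.
have := key (ip g g) (- ip f g).
have -> : ip g g ^+ 2 * ip f f + 2 * ip g g * - ip f g * ip f g + (- ip f g) ^+ 2 * ip g g
  = ip g g * (ip f f * ip g g - ip f g ^+ 2) by ring.
by rewrite pmulr_rge0 ?subr_ge0// lt_neqAle eq_sym g00.
Qed.

Lemma ip_le_nrm f g : L2 f -> L2 g -> `|ip f g| <= nrm f * nrm g.
Proof.
move=> Lf Lg; rewrite -sqrtrM ?ip_ge0// -sqrtr_sqr; apply: ler_wsqrtr.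
exact: ip_CS.
Qed.

Lemma nrmD f g : L2 f -> L2 g -> nrm (fun x => f x + g x) <= nrm f + nrm g.
Proof.
move=> Lf Lg; rewrite -ler_sqr ?nnegrE ?addr_ge0 ?nrm_ge0// nrm_sq.
rewrite ipDl//; last exact: L2D.
rewrite !ipDr// (ipC g f) sqrrD !nrm_sq.
have := le_trans (ler_norm _) (ip_le_nrm Lf Lg); move: (nrm f * nrm g) => t; lra.
Qed.

Lemma nrmZ a f : L2 f -> nrm (fun x => a%:C%C * f x) = `|a| * nrm f.
Proof.
move=> Lf; rewrite /nrm ipZl//; last exact: L2Z.
by rewrite ipZr// mulrA -expr2 sqrtrM ?sqr_ge0// sqrtr_sqr.
Qed.

Lemma nrm_dom (C : R) f g : 0 <= C -> L2 f -> L2 g ->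
  (\forall x \ae mu, A x -> Normc.normc (f x) <= C * Normc.normc (g x)) ->
  nrm f <= C * nrm g.
Proof.
move=> C0 Lf Lg h; rewrite -(ger0_norm C0) -nrmZ//; apply: ler_wsqrtr.
have /L2P[mf /(sqint_lty mf) sf] := Lf; have /L2P[mg /(sqint_lty mg) sg] := L2Z C Lg.
rewrite /ip /Rintegral; apply: fine_le.
- by rewrite ge0_fin_numE// integral_ge0// => x _; rewrite lee_fin rdot_ge0.
- by rewrite ge0_fin_numE// integral_ge0// => x _; rewrite lee_fin rdot_ge0.
apply: ae_ge0_le_integral => //.
- by move=> x _; rewrite lee_fin rdot_ge0.
- by apply/measurable_EFinP; exact: cmeasurable_rdot.
- by move=> x _; rewrite lee_fin rdot_ge0.
- by apply/measurable_EFinP; exact: cmeasurable_rdot.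
apply: filterS h => x h Ax; rewrite lee_fin rdotZl rdotC rdotZl mulrA -!normc_sq -expr2 -exprMn.
by rewrite lerXn2r ?nnegrE ?normc_ge0 ?h// mulr_ge0// normc_ge0.
Qed.

Lemma nrm_bounded (C : R) f : (mu A < +oo)%E -> 0 <= C -> L2 f ->
  (forall x, A x -> Normc.normc (f x) <= C) -> nrm f <= C * Num.sqrt (fine (mu A)).
Proof.
move=> fA C0 Lf h.
have -> : Num.sqrt (fine (mu A)) = nrm (fun=> 1).
  rewrite /nrm /ip Rintegral_cst//; congr Num.sqrt.
  by rewrite /rdot /= mulr1 mul0r addr0 mul1r.
apply: nrm_dom => //; first exact: L2_cst.
by apply: aeW => x Ax; rewrite normc_cst1 mulr1 h.
Qed.

End complex_L2.

(** * Wave transforms *)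

Section trigonometric_bounds.
Context (R : realType).
Implicit Types a b : R.

Lemma cis_dist a b : Normc.normc (cis a - cis b) <= 2 * `|a - b|.
Proof.
have lip (f df : R -> R) : (forall x : R, is_derive x 1 f (df x)) -> (forall x, `|df x| <= 1) ->
    `|f a - f b| <= `|a - b|.
  move=> fd dfb; have h x y : x < y -> `|f y - f x| <= `|y - x|.
    move=> xy; have [z _ ->] := MVT xy (fun z _ => fd z)
      (continuous_subspaceT (fun z => dv_continuous (fd z))).
    by rewrite normrM ler_piMl.
  have [ab|ab|->] := ltgtP a b; last by rewrite !subrr.
    by rewrite distrC [leRHS]distrC h.
  exact: h.
apply: le_trans (normc_ler_Re_Im _) _; rewrite ReD ImD ReN ImN /= mulr2n mulrDl mul1r.
apply: lerD.
  apply: (lip (@cos R) (fun x => - sin x)) => x.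
  by rewrite normrN ler_norml sin_geN1 sin_le1.
apply: (lip (@sin R) cos) => x.
by rewrite ler_norml cos_geN1 cos_le1.
Qed.

Lemma normcM (z w : R[i]) : Normc.normc (z * w) = Normc.normc z * Normc.normc w.
Proof. exact: Normc.normcM. Qed.

Lemma normcN (z : R[i]) : Normc.normc (- z) = Normc.normc z.
Proof. by rewrite !normc_sqrt rdotNl rdotC rdotNl opprK. Qed.

Lemma normcD (z w : R[i]) : Normc.normc (z + w) <= Normc.normc z + Normc.normc w.
Proof. exact: le_normcD. Qed.

Lemma normc_real a : Normc.normc (a%:C%C : R[i]) = `|a|.
Proof. by rewrite /Normc.normc /= expr0n /= addr0 sqrtr_sqr. Qed.

End trigonometric_bounds.

Section measurable_waves.
Context (R : realType) (d : nat).

Lemma lipschitz_measurable (f : 'rV[R]_d -> R) (L : R) :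
  (forall x y, `|f x - f y| <= L * `|x - y|) -> measurable_fun setT f.
Proof.
move=> fL; apply: (measurability _ (RGenOInfty.measurableE R)) => //= _ [_ [c ->] <-].
rewrite setTI; apply: open_measurable_rV; apply: norm_ball_open => x.
rewrite /= in_itv /= andbT => cx.
have L0 : 0 < `|L| + 1 by rewrite ltr_wpDl.
exists ((f x - c) / (`|L| + 1)); first by rewrite divr_gt0 ?subr_gt0.
move=> y; rewrite ltr_pdivlMr// => yx; rewrite /= in_itv /= andbT.
have h : `|f x - f y| < f x - c.
  apply: le_lt_trans yx; apply: le_trans (fL x y) _; rewrite distrC mulrC.
  by rewrite ler_wpM2l// ler_wpDr// ler_norm.
by have := le_lt_trans (ler_norm _) h; rewrite ltrD2l ltrN2.
Qed.

Lemma measurable_dotv d1 (T : measurableType d1) (A : set T) (f g : T -> 'rV[R]_d) :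
  measurable_fun setT f -> measurable_fun setT g ->
  measurable_fun A (fun x => dotv (f x) (g x)).
Proof.
move=> mf mg; apply: measurable_sum => i; apply: measurable_funM; apply: measurable_funTS.
  exact: (measurableT_comp (measurable_coord i) mf).
exact: (measurableT_comp (measurable_coord i) mg).
Qed.

Lemma cmeasurable_cis d1 (T : measurableType d1) (A : set T) (f : T -> R) :
  measurable_fun A f -> cmeasurable A (fun x => cis (f x)).
Proof.
move=> mf; split; apply: measurableT_comp => //; apply: continuous_measurable_fun.
  exact: continuous_cos.
exact: continuous_sin.
Qed.

End measurable_waves.

(* The Herglotz operator and its adjoint are both of this form. *)
Definition wave_transform (R : realType) (d : nat) (mu : {measure set 'rV[R]_d -> \bar R})
    (A : set 'rV[R]_d) (s : R) (g : 'rV[R]_d -> R[i]) (x : 'rV[R]_d) : R[i] :=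
  cintegral mu A (fun y => g y * cis (s * dotv x y)).

Section wave_transform.
Context (R : realType) (d : nat) (mu : {measure set 'rV[R]_d -> \bar R}).
Variables (A : set 'rV[R]_d) (M s : R).
Hypotheses (mA : measurable A) (finA : (mu A < +oo)%E).
Hypotheses (M0 : 0 <= M) (AM : forall y, A y -> enorm y <= M).
Implicit Types (f g : 'rV[R]_d -> R[i]).

Local Notation L2 := (cLspace mu A 2%:E).
Local Notation W := (wave_transform mu A s).
Let wave (x y : 'rV[R]_d) : R[i] := cis (- (s * dotv x y)).

Lemma cmeasurable_wave (c : R) x : cmeasurable A (fun y => cis (c * dotv x y)).
Proof.
apply: cmeasurable_cis; apply: measurable_funM; first exact: measurable_cst.
by apply: measurable_dotv; [exact: measurable_cst|exact: measurable_id].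
Qed.

Let L2_wave (u : R[i]) x : L2 (fun y => u * wave x y).
Proof.
apply: (L2_bounded mA (C := Normc.normc u) finA).
  apply: cmeasurableM; first exact: cmeasurable_cst.
  by rewrite /wave; under eq_fun do rewrite -mulNr; exact: cmeasurable_wave.
by move=> y _; rewrite normcM normc_cis mulr1.
Qed.

Lemma rdot_wave_transform g x u : L2 g ->
  rdot (W g x) u = ip mu A g (fun y => u * wave x y).
Proof.
move=> Lg.
have -> : W g x = cinner mu A g (wave x).
  by rewrite /W /cinner; congr cintegral; apply/funext => y; rewrite conjc_cis opprK.
have L1 := L2_wave 1 x; have L1' : L2 (wave x) by apply: L2_ext L1 => // y _; rewrite mul1r.
rewrite cinnerE /rdot /= [X in X + _]mulrC [X in _ + X]mulrC.
have Li : L2 (fun y => 'i%C * wave x y) by exact: L2_wave.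
rewrite -(ipZr mA (complex.Re u) L1' Lg) -(ipZr mA (complex.Im u) Li Lg).
rewrite -(ipDr mA (L2Z mA _ L1') (L2Z mA _ Li) Lg).
apply: ip_ext => // y _; rewrite mulrA -mulrDl; congr (_ * _).
by case: u => a b; apply/eqP; rewrite eq_complex /=; apply/andP; split; apply/eqP; ring.
Qed.

Lemma wave_transformD f g x : L2 f -> L2 g -> W (fun y => f y + g y) x = W f x + W g x.
Proof.
move=> Lf Lg; have h u : rdot (W (fun y => f y + g y) x) u = rdot (W f x + W g x) u.
  by rewrite rdotDl !rdot_wave_transform ?ipDl//; exact: L2D.
have := h 1; have := h 'i%C; case: (W _ x) (W f x + W g x) => [a b] [a' b'].
rewrite /rdot /= !mulr0 !mulr1 !addr0 !add0r => -> ->//.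
Qed.

Lemma wave_transformZ (a : R) g x : L2 g -> W (fun y => a%:C%C * g y) x = a%:C%C * W g x.
Proof.
move=> Lg; have h u : rdot (W (fun y => a%:C%C * g y) x) u = rdot (a%:C%C * W g x) u.
  by rewrite rdotZl !rdot_wave_transform ?ipZl//; exact: L2Z.
have := h 1; have := h 'i%C; case: (W _ x) (a%:C%C * W g x) => [a1 b1] [a' b'].
rewrite /rdot /= !mulr0 !mulr1 !addr0 !add0r => -> ->//.
Qed.

Lemma wave_transform_bound g x : L2 g ->
  Normc.normc (W g x) <= Num.sqrt (fine (mu A)) * nrm mu A g.
Proof.
move=> Lg; have [u u1 ->] := normc_unit (W g x).
rewrite rdot_wave_transform// mulrC; apply: le_trans (ler_norm _) _.
apply: le_trans (ip_le_nrm mA Lg (L2_wave u x)) _; rewrite ler_wpM2l ?nrm_ge0//.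
rewrite -[leRHS]mul1r; apply: nrm_bounded => // y _.
by rewrite normcM normc_cis mulr1 u1.
Qed.

Lemma wave_transform_lipschitz g x y : L2 g ->
  Normc.normc (W g x - W g y) <=
    2 * `|s| * M * Num.sqrt (fine (mu A)) * nrm mu A g * enorm (x - y).
Proof.
move=> Lg; have [u u1 ->] := normc_unit (W g x - W g y).
have Lx := L2_wave u x; have Ly := L2_wave (- u) y.
have -> : rdot (W g x - W g y) u = ip mu A g (fun z => u * wave x z + (- u) * wave y z).
  rewrite ipDr// rdotDl rdotNl !rdot_wave_transform//; congr (_ + _).
  rewrite (_ : (fun z => - u * wave y z) = (fun z => (-1)%:C%C * (u * wave y z))).
    by rewrite ipZr// mulN1r.
  by apply/funext => z; rewrite rmorphN1 mulN1r mulNr.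
apply: le_trans (ler_norm _) _.
apply: le_trans (ip_le_nrm mA Lg (L2D mA Lx Ly)) _.
rewrite [leRHS]mulrAC [leRHS]mulrC; apply: ler_wpM2l; first exact: nrm_ge0.
rewrite mulrAC; apply: nrm_bounded => //.
- by rewrite !mulr_ge0// enorm_ge0.
- exact: L2D.
move=> z Az; rewrite mulNr -mulrBr normcM u1 mul1r; apply: le_trans (cis_dist _ _) _.
rewrite -!mulrA ler_pM2l// -opprD normrN -mulrN -mulrDr normrM ler_wpM2l//.
rewrite -dotvNl -dotvDl; apply: le_trans (dotv_CS _ _) _; rewrite mulrC.
by rewrite ler_wpM2r ?enorm_ge0// AM.
Qed.

Lemma cmeasurable_wave_transform g (B : set 'rV[R]_d) : L2 g -> cmeasurable B (W g).
Proof.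
move=> Lg; pose L := 2 * `|s| * M * Num.sqrt (fine (mu A)) * nrm mu A g * d%:R.
have h x y : Normc.normc (W g x - W g y) <= L * `|x - y|.
  apply: le_trans (wave_transform_lipschitz x y Lg) _; rewrite /L -[leRHS]mulrA.
  by rewrite ler_wpM2l ?enorm_le_norm// !mulr_ge0 ?sqrtr_ge0.
split; apply: measurable_funTS; apply: (@lipschitz_measurable _ _ _ L) => x y;
  apply: le_trans (h x y); rewrite -?ReN -?ImN -?ReD -?ImD.
  exact: Re_le_normc.
exact: Im_le_normc.
Qed.

End wave_transform.

Section cut.
Context d (T : measurableType d) (R : realType) (mu : {measure set T -> \bar R}) (A : set T).
Hypothesis mA : measurable A.

Definition cut (f : T -> R[i]) (x : T) : R[i] := if x \in A then f x else 0.

Lemma cut_in f x : A x -> cut f x = f x.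
Proof. by move=> Ax; rewrite /cut mem_set. Qed.

Lemma cmeasurable_cut f : cmeasurable A f -> cmeasurable setT (cut f).
Proof.
move=> [/(measurable_restrictT _ mA) m1 /(measurable_restrictT _ mA) m2]; split.
  rewrite (_ : (fun _ => _) = (fun x => complex.Re (f x)) \_ A)//.
  by apply/funext => x; rewrite patchE /cut; case: ifP.
rewrite (_ : (fun _ => _) = (fun x => complex.Im (f x)) \_ A)//.
by apply/funext => x; rewrite patchE /cut; case: ifP.
Qed.

Lemma ip_cut f g : ip mu A f g = ip mu setT (cut f) g.
Proof.
rewrite /ip Rintegral_mkcond; apply: eq_Rintegral => x _.
by rewrite patchE /cut; case: ifP => _ //; rewrite /rdot !mul0r addr0.
Qed.

Lemma L2_normc_integrable f : (mu A < +oo)%E -> cLspace mu A 2%:E f ->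
  mu.-integrable setT (EFin \o (fun x => Normc.normc (cut f x))).
Proof.
move=> fA Lf; have /L2P[mf _] := Lf.
have L1 := L2_cst mA 1 fA.
have Ln : cLspace mu A 2%:E (fun x => (Normc.normc (f x))%:C%C).
  apply: (L2_dom mA (C := 1) _ Lf); first by apply: cmeasurable_real; exact: measurable_normc.
  by move=> x _; rewrite normc_real mul1r ger0_norm// normc_ge0.
have := L2_integrable mA Ln L1; rewrite integrable_mkcond//; apply: eq_integrable => // x _.
rewrite patchE /= /cut; case: ifP => _; first by rewrite /= /rdot /= mulr1 mul0r addr0.
by rewrite /Normc.normc /= expr0n /= addr0 sqrtr0.
Qed.

End cut.

Lemma rdot_le_normc (R : realType) (z w : R[i]) : `|rdot z w| <= Normc.normc z * Normc.normc w.
Proof.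
rewrite -ler_sqr ?nnegrE ?mulr_ge0 ?normc_ge0// exprMn !normc_sq real_normK ?num_real//.
case: z w => [a b] [a' b']; rewrite /rdot /=; have := sqr_ge0 (a * b' - b * a').
by move=> h; rewrite -subr_ge0; apply: le_trans h _; rewrite le_eqVlt; apply/orP; left; apply/eqP; ring.
Qed.

(** Fubini for the real function rdot (phi y) (g t cis (s y . t)), dominated by |phi y| |g t|. This
    is integrable since both factors are square integrable on sets of finite measure. *)
Lemma wave_transform_adjoint (R : realType) (d : nat)
    (mu1 mu2 : {sigma_finite_measure set 'rV[R]_d -> \bar R}) (A1 A2 : set 'rV[R]_d)
    (s : R) (phi g : 'rV[R]_d -> R[i]) :
  measurable A1 -> measurable A2 -> (mu1 A1 < +oo)%E -> (mu2 A2 < +oo)%E ->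
  cLspace mu1 A1 2%:E phi -> cLspace mu2 A2 2%:E g ->
  ip mu2 A2 (wave_transform mu1 A1 (- s) phi) g = ip mu1 A1 phi (wave_transform mu2 A2 s g).
Proof.
move=> mA1 mA2 f1 f2 Lphi Lg.
have /L2P[mphi _] := Lphi; have /L2P[mg _] := Lg.
pose F (p : 'rV[R]_d * 'rV[R]_d) := rdot (cut A1 phi p.1) (cut A2 g p.2 * cis (s * dotv p.1 p.2)).
have mp : cmeasurable setT (fun p : 'rV[R]_d * 'rV[R]_d => cut A1 phi p.1).
  have [m1 m2] := cmeasurable_cut mA1 mphi.
  by split; [apply: (measurableT_comp m1)|apply: (measurableT_comp m2)].
have mq : cmeasurable setT (fun p : 'rV[R]_d * 'rV[R]_d => cut A2 g p.2).
  have [m1 m2] := cmeasurable_cut mA2 mg.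
  by split; [apply: (measurableT_comp m1)|apply: (measurableT_comp m2)].
have mF : measurable_fun setT F.
  apply: cmeasurable_rdot => //; apply: cmeasurableM => //; apply: cmeasurable_cis.
  apply: measurable_funM; first exact: measurable_cst.
  by apply: measurable_dotv.
have Fle p : `|F p| <= Normc.normc (cut A1 phi p.1) * Normc.normc (cut A2 g p.2).
  by apply: le_trans (rdot_le_normc _ _) _; rewrite normcM normc_cis mulr1.
have I1 := L2_normc_integrable mA1 f1 Lphi; have I2 := L2_normc_integrable mA2 f2 Lg.
have mFx y : measurable_fun setT (fun t => F (y, t)).
  by apply: measurableT_comp => //; exact: measurable_pair1.
have mFy t : measurable_fun setT (fun y => F (y, t)).
  by apply: measurableT_comp => //; exact: measurable_pair2.
have IFx y : mu2.-integrable setT (EFin \o (fun t => F (y, t))).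
  apply: (le_integrable measurableT _ _ (integrableZl measurableT (Normc.normc (cut A1 phi y)) I2)).
    by apply/measurable_EFinP; exact: mFx.
  by move=> t _; rewrite /= lee_fin (le_trans (Fle _)) ?ler_norm.
have IFy t : mu1.-integrable setT (EFin \o (fun y => F (y, t))).
  apply: (le_integrable measurableT _ _ (integrableZl measurableT (Normc.normc (cut A2 g t)) I1)).
    by apply/measurable_EFinP; exact: mFy.
  by move=> y _; rewrite /= lee_fin (le_trans (Fle _))// mulrC ler_norm.
have intF : (mu1 \x mu2)%E.-integrable setT (EFin \o F).
  apply/integrable12ltyP; first exact/measurable_EFinP.
  have [K K0 hK] : exists2 K : R, 0 <= K & (\int[mu2]_t (Normc.normc (cut A2 g t))%:E = K%:E)%E.
    exists (\int[mu2]_t Normc.normc (cut A2 g t)); first by apply: Rintegral_ge0 => t _; exact: normc_ge0.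
    rewrite /Rintegral fineK//; have /integrableP[_ h] := I2.
    rewrite ge0_fin_numE; last by apply: integral_ge0 => t _; rewrite lee_fin normc_ge0.
    apply: le_lt_trans h; apply: ge0_le_integral => //.
    - by move=> t _; rewrite lee_fin normc_ge0.
    - by apply/measurable_EFinP; apply: measurable_normc => //; exact: cmeasurable_cut.
    - by apply: measurableT_comp => //; exact: (measurable_int _ I2).
    - by move=> t _; rewrite lee_fin ler_norm.
  have mN : measurable_fun setT (fun y => (Normc.normc (cut A1 phi y))%:E).
    by apply/measurable_EFinP; apply: measurable_normc => //; exact: cmeasurable_cut.
  have /integrableP[_ fin1] := integrableZr measurableT K I1.
  apply: le_lt_trans fin1; apply: ge0_le_integral => //.
  - by move=> y _; apply: integral_ge0.
  - apply: (measurable_fun_fubini_tonelli_F (fun p => `|F p|%:E)%E).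
      by apply/measurable_EFinP; apply: measurableT_comp.
    by move=> p; rewrite lee_fin.
  - by apply: measurableT_comp => //; exact: emeasurable_funM.
  move=> y _; have n0 : 0 <= Normc.normc (cut A1 phi y) by exact: normc_ge0.
  rewrite /= ger0_norm ?mulr_ge0// EFinM -hK -ge0_integralZl_EFin//.
  - apply: ge0_le_integral => //.
    + by apply/measurable_EFinP; apply: measurableT_comp.
    + by apply: measurable_funeM; exact: (measurable_int _ I2).
    + by move=> t _; rewrite -EFinM lee_fin.
  - by move=> t _; rewrite lee_fin normc_ge0.
  - exact: (measurable_int _ I2).
transitivity (\int[mu2]_t \int[mu1]_y F (y, t)).
  rewrite ipC (ip_cut mu2); apply: eq_Rintegral => t _.
  rewrite rdotC rdot_wave_transform// (ip_cut mu1).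
  by apply: eq_Rintegral => y _; rewrite /F /= mulNr opprK dotvC.
transitivity (\int[mu1]_y \int[mu2]_t F (y, t)); last first.
  rewrite (ip_cut mu1); apply: eq_Rintegral => y _.
  rewrite rdotC rdot_wave_transform// (ip_cut mu2).
  apply: eq_Rintegral => t _; rewrite /F /= -conjc_cis [rdot (cut A1 _ _) _]rdotC rdot_mulr.
  by [].
rewrite /Rintegral; congr fine.
under eq_integral do rewrite fineK ?(integrable_fin_num _ (IFy _))//.
under [RHS]eq_integral do rewrite fineK ?(integrable_fin_num _ (IFx _))//.
by have := Fubini intF; move=> ->.
Qed.

(** * Localized Herglotz waves *)

Section linear_selection.
Context d (T : measurableType d) (R : realType) (mu : {measure set T -> \bar R}) (A : set T).
Hypothesis mA : measurable A.
Local Notation L2 := (cLspace mu A 2%:E).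
Implicit Types (f g : T -> R[i]).

Lemma L2_0 : L2 (fun=> 0).
Proof.
apply/L2P; split; first exact: cmeasurable_cst.
rewrite /sqint (_ : EFin \o _ = cst 0%E); first exact: integrable0.
by apply/funext => x /=; rewrite /rdot /= mulr0 addr0.
Qed.

Lemma L2_scale (z : R[i]) f : L2 f -> L2 (fun x => z * f x).
Proof.
move=> Lf; have mf := Lf.1; apply: (L2_dom mA (C := Normc.normc z) _ Lf).
  by apply: cmeasurableM => //; exact: cmeasurable_cst.
by move=> x _; rewrite normcM.
Qed.

Lemma L2_sum n (f : 'I_n -> T -> R[i]) : (forall i, L2 (f i)) -> L2 (fun x => \sum_i f i x).
Proof.
move=> Lf; elim: n f Lf => [|n IH] f Lf.
  by apply: L2_ext L2_0 => // x _; rewrite big_ord0.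
apply: (L2_ext mA (f := fun x => f ord0 x + \sum_i f (lift ord0 i) x)).
  by move=> x _; rewrite big_ord_recl.
by apply: L2D => //; exact: IH.
Qed.

Lemma ip_suml n (f : 'I_n -> T -> R[i]) g : (forall i, L2 (f i)) -> L2 g ->
  ip mu A (fun x => \sum_i f i x) g = \sum_i ip mu A (f i) g.
Proof.
move=> Lf Lg; elim: n f Lf => [|n IH] f Lf.
  rewrite big_ord0 -[RHS](mul0r (ip mu A (fun=> 0) g)) -(ipZl mA 0 L2_0 Lg).
  by apply: ip_ext => // x _; rewrite big_ord0 mulr0.
rewrite big_ord_recl -IH// -ipDl//; last exact: L2_sum.
by apply: ip_ext => // x _; rewrite big_ord_recl.
Qed.

Lemma ip_scaler (z : R[i]) f g : L2 f -> L2 g ->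
  ip mu A g (fun x => z * f x) =
    complex.Re z * ip mu A g f + complex.Im z * ip mu A g (fun x => 'i%C * f x).
Proof.
move=> Lf Lg; have Li := L2i Lf.
rewrite -(ipZr mA (complex.Re z) Lf Lg) -(ipZr mA (complex.Im z) Li Lg).
rewrite -(ipDr mA (L2Z mA _ Lf) (L2Z mA _ Li) Lg); apply: ip_ext => // x _.
rewrite mulrA -mulrDl; congr (_ * _).
by case: z => a b; apply/eqP; rewrite eq_complex /=; apply/andP; split; apply/eqP; ring.
Qed.

Lemma ortho_spanned (V : set (T -> R[i])) m (w : 'I_m -> T -> R[i]) g :
  (forall i, L2 (w i)) ->
  V = [set v | L2 v /\ exists c : 'I_m -> R[i], \forall x \ae mu, A x -> v x = \sum_(i < m) c i * w i x] ->
  L2 g -> (forall i, ip mu A g (w i) = 0) -> (forall i, ip mu A g (fun x => 'i%C * w i x) = 0) ->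
  L2_ortho mu A V g.
Proof.
move=> Lw -> Lg h1 h2; split => // v [Lv [c vc]].
have Lcw (c' : 'I_m -> R[i]) i : L2 (fun x => c' i * w i x) by exact: L2_scale.
have key (c' : 'I_m -> R[i]) : ip mu A g (fun x => \sum_i c' i * w i x) = 0.
  rewrite ipC ip_suml//; apply: big1 => i _.
  by rewrite ipC ip_scaler// h1 h2 !mulr0 addr0.
rewrite cinnerE; apply/eqP; rewrite eq_complex /=; apply/andP; split; apply/eqP.
  rewrite ipC (ip_ae mA (f' := fun x => \sum_i c i * w i x)) ?(ipC _ _ _ g)//.
  - by case: Lv.
  - by case: (L2_sum (Lcw c)).
  - by case: Lg.
rewrite ipC (ip_ae mA (f' := fun x => \sum_i ('i%C * c i) * w i x)) ?(ipC _ _ _ g)//.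
- by case: (L2i Lv).
- by case: (L2_sum (Lcw (fun i => 'i%C * c i))).
- by case: Lg.
apply: filterS vc => x h Ax; rewrite h// mulr_sumr; apply: eq_bigr => i _; exact: mulrA.
Qed.

Lemma spanned_ortho (V : set (T -> R[i])) m (w : 'I_m -> T -> R[i]) g i :
  (forall i, L2 (w i)) ->
  V = [set v | L2 v /\ exists c : 'I_m -> R[i], \forall x \ae mu, A x -> v x = \sum_(i < m) c i * w i x] ->
  L2_ortho mu A V g -> cinner mu A g (w i) = 0.
Proof.
move=> Lw -> [Lg h]; apply: h; split => //; exists (fun j => (j == i)%:R).
apply: aeW => x _; rewrite (bigD1 i)//= eqxx mul1r big1 ?addr0// => j /negbTE ->.
by rewrite mul0r.
Qed.

(** A kernel vector is divided by an entry of largest modulus. The entry 1 later selects the cube on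
    which the combined wave is large. *)
Lemma real_kernel_vector n m (B : 'M[R]_(n, m)) : (m < n)%N ->
  exists v : 'I_n -> R, [/\ exists j, v j = 1, forall j, `|v j| <= 1 &
    forall l, \sum_j v j * B j l = 0].
Proof.
move=> mn.
have : kermx B != 0.
  by rewrite -mxrank_eq0 mxrank_ker subn_eq0 -ltnNge (leq_ltn_trans (rank_leq_col B)).
move=> /rowV0Pn[v /sub_kermxP vB v0].
have [j0 vj0] : exists j, v 0 j != 0.
  apply/existsP; apply: contraNT v0; rewrite negb_exists => /forallP h.
  by apply/eqP/rowP => j; rewrite mxE; apply/eqP; rewrite -[_ == _]negbK h.
have [j _ jmax] := @arg_maxP _ R _ j0 predT (fun j => `|v 0 j|) isT.
have vj : 0 < `|v 0 j| by apply: lt_le_trans (jmax j0 isT); rewrite normr_gt0.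
exists (fun i => v 0 i / v 0 j); split.
- by exists j; rewrite divff// -normr_gt0.
- by move=> i; rewrite normrM normfV ler_pdivrMr// mul1r; exact: jmax.
move=> l; have /rowP/(_ l) := vB; rewrite !mxE => h.
under eq_bigr do rewrite mulrAC; by rewrite -mulr_suml h mul0r.
Qed.

(** Orthogonality to [m] complex functions is a system of [m + m] real linear equations, so real
    combinations of one more function suffice. *)
Lemma ortho_combination (V : set (T -> R[i])) : fin_dim_subspace mu A V ->
  exists n, forall g : 'I_n -> T -> R[i], (forall j, L2 (g j)) ->
    exists c : 'I_n -> R, [/\ exists j, c j = 1, forall j, `|c j| <= 1 &
      L2_ortho mu A V (fun x => \sum_j (c j)%:C%C * g j x)].
Proof.
move=> [m [w [Lw VE]]]; exists (m + m).+1 => g Lg.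
pose B := \matrix_(j < (m + m).+1, l < m + m) match fintype.split l with
  | inl i => ip mu A (g j) (w i) | inr i => ip mu A (g j) (fun x => 'i%C * w i x) end.
have [c [c1 cle cB]] := real_kernel_vector B (ltnSn _).
exists c; split => //.
have Lcg j : L2 (fun x => (c j)%:C%C * g j x) by exact: L2Z.
apply: (ortho_spanned Lw VE); first exact: L2_sum.
- move=> i; rewrite ip_suml// -[RHS](cB (lshift m i)); apply: eq_bigr => j _.
  by rewrite ipZl// mxE (unsplitK (inl i)).
- move=> i; have Li := L2i (Lw i).
  rewrite ip_suml// -[RHS](cB (rshift m i)); apply: eq_bigr => j _.
  by rewrite ipZl// mxE (unsplitK (inr i)).
Qed.

End linear_selection.

Section herglotz_density.
Context (R : realType) (d : nat) (k : R).
Hypotheses (d_gt0 : (0 < d)%N) (k_gt0 : 0 < k).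
Local Notation sphere := (@unit_sphere R d).
Local Notation L2 := (cLspace (@sphere_measure R d) sphere 2%:E).
Local Notation H := (herglotz k).
Implicit Types (g : 'rV[R]_d -> R[i]) (E : set 'rV[R]_d).

Let mS : measurable sphere := @measurable_unit_sphere R d.

Lemma sphere_finite : (sphere_measure sphere < +oo)%E.
Proof. by rewrite ltey_eq sphere_measure_finite. Qed.

Lemma herglotzE g x : H g x = wave_transform sphere_measure sphere k g x.
Proof. by []. Qed.

Lemma herglotzD f g x : L2 f -> L2 g -> H (fun y => f y + g y) x = H f x + H g x.
Proof. exact: (wave_transformD k mS sphere_finite). Qed.

Lemma herglotzZ (a : R) g x : L2 g -> H (fun y => a%:C%C * g y) x = a%:C%C * H g x.
Proof. exact: (wave_transformZ k mS sphere_finite). Qed.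

Lemma herglotz_sum n (f : 'I_n -> 'rV[R]_d -> R[i]) x : (forall i, L2 (f i)) ->
  H (fun y => \sum_i f i y) x = \sum_i H (f i) x.
Proof.
move=> Lf; elim: n f Lf => [|n IH] f Lf.
  have := herglotzZ 0 x (L2_0 sphere_measure sphere); rewrite (_ : 0%:C%C = 0 :> R[i])// !mul0r.
  move=> h; rewrite big_ord0 -[RHS]h; congr herglotz.
  by apply/funext => y; rewrite big_ord0.
rewrite big_ord_recl -IH// -herglotzD//; last exact: L2_sum.
by congr herglotz; apply/funext => y; rewrite big_ord_recl.
Qed.

Definition herglotz_limits E : set ('rV[R]_d -> R) :=
  [set phi | forall e : R, 0 < e -> exists2 g, L2 g &
     forall x, E x -> Normc.normc ((phi x)%:C%C - H g x) <= e].

Lemma herglotz_limits_closed E : uniformly_closed E (herglotz_limits E).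
Proof.
split=> [f g a b Sf Sg e e0|f Sf e e0].
  pose N := `|a| + `|b| + 1; have N0 : 0 < N by rewrite ltr_wpDl// addr_ge0.
  have [f' Lf hf] := Sf _ (divr_gt0 e0 N0); have [g' Lg hg] := Sg _ (divr_gt0 e0 N0).
  exists (fun x => a%:C%C * f' x + b%:C%C * g' x).
    by apply: L2D => //; exact: L2Z.
  move=> x Ex; rewrite herglotzD; [|exact: L2Z|exact: L2Z]; rewrite !herglotzZ//.
  have -> : (a * f x + b * g x)%:C%C - (a%:C%C * H f' x + b%:C%C * H g' x) =
     a%:C%C * ((f x)%:C%C - H f' x) + b%:C%C * ((g x)%:C%C - H g' x).
    by rewrite rmorphD !rmorphM; ring.
  apply: le_trans (normcD _ _) _; rewrite !normcM !normc_real.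
  apply: (@le_trans _ _ (`|a| * (e / N) + `|b| * (e / N))).
    by apply: lerD; apply: ler_wpM2l; rewrite ?hf ?hg.
  rewrite -mulrDl mulrCA ger_pMr// ler_pdivrMr// mul1r /N lerDl//.
have [g Sg fg] := Sf _ (divr_gt0 e0 (ltr0Sn R 1)).
have [h Lh gh] := Sg _ (divr_gt0 e0 (ltr0Sn R 1)).
exists h => // x Ex.
have -> : (f x)%:C%C - H h x = (f x - g x)%:C%C + ((g x)%:C%C - H h x).
  by rewrite rmorphB addrA subrK.
apply: le_trans (normcD _ _) _; rewrite normc_real [leRHS]splitr.
by apply: lerD; [exact: fg|exact: gh].
Qed.

Lemma ip_cut_sub (C : set 'rV[R]_d) f g : C `<=` sphere ->
  ip sphere_measure sphere (cut C f) g = ip sphere_measure C f g.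
Proof.
move=> CS; rewrite [RHS]ip_cut ip_cut; congr ip; apply/funext => x.
rewrite /cut; case: ifPn => // xS; rewrite ifF//; apply/negbTE; apply: contra xS.
by rewrite !inE => /CS.
Qed.

(** The density approximates a point mass at [t]: it is constant on a small cap around [t], with
    integral z. On the bounded set [E] a plane wave hardly changes when its direction varies in the
    cap. *)
Lemma herglotz_plane_wave E (Q : R) (t : 'rV[R]_d) (z : R[i]) (e : R) :
  (forall x, E x -> enorm x <= Q) -> sphere t -> 0 < e ->
  exists2 g, L2 g & forall x, E x -> Normc.normc (z * cis (k * dotv x t) - H g x) <= e.
Proof.
move=> EQ t1 e0; pose N := 2 * (Normc.normc z + 1) * k * (`|Q| + 1) * d%:R.
have d0 : 0 < d%:R :> R by rewrite ltr0n.
have z0 := normc_ge0 z.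
have N0 : 0 < N by rewrite !mulr_gt0// ltr_wpDl.
pose C := cube t (e / N) `&` sphere.
have mC : measurable C by apply: measurableI => //; exact: measurable_cube.
have finC : (sphere_measure C < +oo)%E by rewrite ltey_eq sphere_measure_finite.
have C0 : (0 < sphere_measure C)%E by apply: cap_gt0 => //; exact: divr_gt0.
pose s := fine (sphere_measure C); have s0 : 0 < s by rewrite fine_gt0// C0.
have CS : C `<=` sphere by move=> ? [].
pose g := cut C (fun=> s^-1%:C%C * z).
have Lg : L2 g.
  apply: (L2_bounded mS (C := `|s^-1| * Normc.normc z) sphere_finite).
    have [m1 m2] := cmeasurable_cut mC (cmeasurable_cst C (s^-1%:C%C * z)).
    by split; apply: measurable_funTS.
  move=> x _; rewrite /g /cut; case: ifP => _; first by rewrite normcM normc_real.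
  by rewrite /Normc.normc /= expr0n /= addr0 sqrtr0 mulr_ge0// normc_ge0.
exists g => // x Ex; have [u u1 ->] := normc_unit (z * cis (k * dotv x t) - H g x).
rewrite rdotDl rdotNl (rdot_wave_transform k mS sphere_finite x u Lg) ip_cut_sub//.
set a := k * dotv x t; have sn0 : s != 0 by rewrite gt_eqF.
have Lw v : cLspace sphere_measure C 2%:E (fun th => v * cis (- (k * dotv x th))).
  apply: (L2_bounded mC (C := Normc.normc v) finC).
    apply: cmeasurableM; first exact: cmeasurable_cst.
    by under eq_fun do rewrite -mulNr; exact: cmeasurable_wave.
  by move=> y _; rewrite normcM normc_cis mulr1.
have Lc v : cLspace sphere_measure C 2%:E (fun=> v) by exact: L2_cst.
have -> : rdot (z * cis a) u = ip sphere_measure C (fun=> s^-1%:C%C * z) (fun=> u * cis (- a)).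
  rewrite /ip Rintegral_cst// -/s rdot_mulr conjc_cis rdotZl mulrAC mulVf// mul1r.
  by [].
have -> : - ip sphere_measure C (fun=> s^-1%:C%C * z) (fun th => u * cis (- (k * dotv x th))) =
    ip sphere_measure C (fun=> s^-1%:C%C * z) (fun th => - u * cis (- (k * dotv x th))).
  rewrite -mulN1r -(ipZr mC _ (Lw u) (Lc _)); apply: ip_ext => // y _.
  by rewrite rmorphN1 mulN1r mulNr.
rewrite -(ipDr mC (Lc _) (Lw _) (Lc _)).
have L0 : 0 <= 2 * (k * ((`|Q| + 1) * (d%:R * (e / N)))).
  by rewrite !mulr_ge0 ?(ltW k_gt0) ?addr_ge0 ?(ltW e0) ?invr_ge0 ?(ltW N0).
apply: le_trans (ler_norm _) _; apply: le_trans (ip_le_nrm mC (Lc _) (L2D mC (Lc _) (Lw _))) _.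
apply: (@le_trans _ _ ((s^-1 * Normc.normc z * Num.sqrt s) *
   ((2 * (k * ((`|Q| + 1) * (d%:R * (e / N))))) * Num.sqrt s))).
  apply: ler_pM; rewrite ?nrm_ge0//.
    apply: (nrm_bounded mC finC _ (Lc _)); first by rewrite mulr_ge0 ?invr_ge0 ?(ltW s0).
    by move=> y _; rewrite normcM normc_real ger0_norm// invr_ge0 ltW.
  apply: (nrm_bounded mC finC L0 (L2D mC (Lc _) (Lw _))) => th [thc _].
  rewrite mulNr -mulrBr normcM u1 mul1r; apply: le_trans (cis_dist _ _) _.
  rewrite ler_pM2l// opprK addrC /a -mulrBr normrM (gtr0_norm k_gt0) ler_pM2l//.
  rewrite -dotvBr; apply: le_trans (dotv_CS _ _) _; apply: ler_pM; rewrite ?enorm_ge0//.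
    by apply: le_trans (EQ _ Ex) _; apply: le_trans (ler_norm Q) _; rewrite lerDl.
  by apply: le_trans (enorm_le_norm _) _; rewrite ler_wpM2l.
rewrite mulrACA -(mulrA s^-1) -[Num.sqrt s * Num.sqrt s]expr2 sqr_sqrtr ?(ltW s0)//.
have -> : s^-1 * (Normc.normc z * (2 * (k * ((`|Q| + 1) * (d%:R * (e / N)))))) * s =
    (Normc.normc z / (Normc.normc z + 1)) * e.
  by rewrite /N; field; rewrite !gt_eqF ?ltr_wpDl.
by rewrite ger_pMl// ler_pdivrMr ?ltr_wpDl// mul1r lerDl.
Qed.

Lemma herglotz_limits_cos E (Q : R) (t : 'rV[R]_d) (c : R) :
  (forall x, E x -> enorm x <= Q) -> dotv t t = 1 ->
  herglotz_limits E (fun x => cos (k * dotv t x + c)).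
Proof.
move=> EQ t1 e e0.
have t1' : sphere t by rewrite /unit_sphere /= /enorm t1 sqrtr1.
have t1n : sphere (- t) by rewrite /unit_sphere /= enormN.
have e2 : 0 < e / 2 by rewrite divr_gt0.
have [g Lg hg] := herglotz_plane_wave (2^-1%:C%C * cis c) EQ t1' e2.
have [h Lh hh] := herglotz_plane_wave (2^-1%:C%C * cis (- c)) EQ t1n e2.
exists (fun x => g x + h x) => [|x Ex]; first exact: L2D.
rewrite herglotzD//.
have -> : (cos (k * dotv t x + c))%:C%C = 2^-1%:C%C * cis c * cis (k * dotv x t) +
    2^-1%:C%C * cis (- c) * cis (k * dotv x (- t)) :> R[i].
  rewrite -!mulrA -!cisD dotvNr mulrN -opprD (dotvC t x) [c + _]addrC -mulrDr /cis cosN sinN.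
  by apply/eqP; rewrite eq_complex /=; apply/andP; split; apply/eqP; field.
rewrite opprD addrACA [leRHS]splitr; apply: le_trans (normcD _ _) _.
by apply: lerD; [exact: hg|exact: hh].
Qed.

End herglotz_density.

(** If a point x of [B] off [D] lies in the closure of [D], it is a boundary point with chart
    coordinates 0, so phi 0 >= 0. Moving x down the chart by a small s leaves the closure of [D],
    since the Lipschitz bound keeps a whole neighbourhood of the new point below the graph. *)
Lemma exterior_ball (R : realType) (d : nat) (D B : set 'rV[R]_d) :
  open D -> lipschitz_boundary D -> open B -> ~ B `<=` D ->
  exists (z : 'rV[R]_d) (r : R), [/\ 0 < r, forall x, `|x - z| < r -> B x &
    forall x, closure D x -> r <= `|x - z|].
Proof.
move=> Do lipD Bo /existsNP[x /not_implyP[Bx nDx]].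
suff [z [Bz nz]] : exists z, B z /\ ~ closure D z.
  have [r1 r10 h1] := open_norm_ball Bo Bz.
  have [r2 r20 h2] := open_norm_ball (closed_openC (@closed_closure _ D)) nz.
  exists z, (Num.min r1 r2); split; first by rewrite lt_min r10.
    by move=> y; rewrite lt_min => /andP[/h1].
  move=> y Dy; rewrite leNgt lt_min; apply/negP => /andP[_ /h2]; exact.
have [cDx|ncDx] := pselect (closure D x); last by exists x.
have [|Q [i [phi [r [Q1 lip r0 chart]]]]] := lipD x.
  by split => //; rewrite (interior_id D).1.
have QE (v : 'rV[R]_d) : enorm (v *m Q) = enorm v.
  have dotE (a b : 'rV[R]_d) : dotv a b = (a *m b^T) 0 0.
    by rewrite mxE; apply: eq_bigr => l _; rewrite mxE.
  by rewrite /enorm !dotE trmx_mul mulmxA -(mulmxA v) Q1 mulmx1.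
have [M M0 phiL] : exists2 M : R, 0 < M & forall a b, `|phi a - phi b| <= M * `|a - b|.
  have [M M0 hM] := pinfty_ex_gt0 lip; exists M => // a b.
  exact: (hM (a, b)).
have phi0 : 0 <= phi 0.
  have := chart x; rewrite subrr enorm0 => /(_ r0) /=; rewrite mul0mx mxE.
  have -> : col' i 0 = 0 :> 'rV[R]_d.-1 by apply/rowP => l; rewrite !mxE.
  by move=> h; rewrite leNgt; apply/negP => /h.
have [rB rB0 hB] := open_norm_ball Bo Bx.
pose s := Num.min (rB / 2) (r / 3).
have s0 : 0 < s by rewrite lt_min !divr_gt0.
pose w : 'rV[R]_d := (- s) *: delta_mx 0 i.
have Q1' : Q^T *m Q = 1%:M by exact: mulmx1C.
have wn : enorm w = s.
  rewrite enormZ normrN (gtr0_norm s0) /enorm.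
  suff -> : dotv (delta_mx 0 i) (delta_mx 0 i) = 1 :> R by rewrite sqrtr1 mulr1.
  rewrite /dotv (bigD1 i)//= mxE !eqxx mulr1 big1 ?addr0// => l /negbTE li.
  by rewrite mxE eqxx li mulr0.
pose y := x + w *m Q^T.
have yxQ : (y - x) *m Q = w by rewrite /y addrAC subrr add0r -mulmxA Q1' mulmx1.
have yx : enorm (y - x) = s by rewrite -QE yxQ.
have srB : s < rB by apply: (@le_lt_trans _ _ (rB / 2)); rewrite ?ge_min ?lexx// ltr_pdivrMr// ltr_pMr// ltr1n.
have sr : s <= r / 3 by rewrite ge_min lexx orbT.
exists y; split.
  by apply: hB; apply: le_lt_trans (norm_le_enorm _) _; rewrite yx.
(* A point of [D] at distance t from y has height at most t - s, whereas the graph there is at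
   height at least - M t; this forces s < (M + 1) t, which closeness s / N excludes. *)
move=> cDy; pose N := (M + 1) * d.+1%:R.
have N0 : 0 < N by rewrite mulr_gt0// addr_gt0.
have [y' [Dy' yy']] := cDy _ (nbhsx_ballx y (s / N) (divr_gt0 s0 N0)).
have {}yy' : `|y' - y| < s / N by move: yy'; rewrite -ball_normE /= distrC.
set t := enorm (y' - y).
have tN : (M + 1) * t < s.
  apply: (@le_lt_trans _ _ (N * `|y' - y|)); last by rewrite mulrC -ltr_pdivlMr.
  rewrite /N -mulrA ler_wpM2l ?addr_ge0 ?(ltW M0)//; apply: le_trans (enorm_le_norm _) _.
  by rewrite ler_wpM2r// ler_nat.
have t0 : 0 <= t := enorm_ge0 _.
have ts : t < s by apply: le_lt_trans tN; rewrite ler_peMl// lerDr ltW.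
have y'x : enorm (y' - x) < r.
  have := enormD (y' - y) (y - x); rewrite addrA subrK yx -/t.
  by move: ts sr r0; clear; lra.
have /= [h _] := chart y' y'x; have := h Dy'.
have zE : (y' - x) *m Q = (y' - y) *m Q + w by rewrite -yxQ -mulmxDl addrA subrK.
set v := (y' - y) *m Q in zE; have vt : `|v| <= t by apply: le_trans (norm_le_enorm _) _; rewrite QE.
rewrite zE.
have -> : col' i (v + w) = col' i v.
  by apply/rowP => l; rewrite !mxE eqxx eq_sym (negbTE (neq_lift i l)) mulr0 addr0.
have -> : (v + w) 0 i = v 0 i - s by rewrite !mxE !eqxx mulr1.
have := phiL (col' i v) 0; rewrite subr0.
have cv : `|col' i v| <= t.
  by apply: norm_row_le => // l; rewrite mxE; apply: le_trans (coord_le_norm _ _) vt.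
have vi : v 0 i <= t by apply: le_trans (ler_norm _) (le_trans (coord_le_norm _ _) vt).
move=> h1; have {}h1 := le_trans h1 (ler_wpM2l (ltW M0) cv).
move: h1; rewrite ler_norml => /andP[h1 _] h2.
by move: tN h1 h2 phi0 vi; clear; rewrite mulrDl mul1r; lra.
Qed.

Section localized_waves.
Context (R : realType) (d : nat) (k : R).
Hypotheses (d_gt0 : (0 < d)%N) (k_gt0 : 0 < k).
Local Notation sphere := (@unit_sphere R d).
Local Notation sigma := (@sphere_measure R d).
Local Notation L2 := (cLspace sigma sphere 2%:E).
Local Notation H := (herglotz k).
Local Notation leb := (lebesgue_rV R d).

Let mS : measurable sphere := @measurable_unit_sphere R d.

Lemma cmeasurable_herglotz A g : L2 g -> cmeasurable A (H g).
Proof.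
apply: (@cmeasurable_wave_transform _ _ sigma sphere 1 k) => //; first exact: sphere_finite.
by move=> y ->.
Qed.

Lemma herglotz_bound g x : L2 g ->
  Normc.normc (H g x) <= Num.sqrt (sphere_area R d) * nrm sigma sphere g.
Proof. exact: (wave_transform_bound k mS (sphere_finite R d)). Qed.

Lemma herglotz_L2 A g : measurable A -> (leb A < +oo)%E -> L2 g -> cLspace leb A 2%:E (H g).
Proof.
move=> mA fA Lg; apply: (L2_bounded mA (C := Num.sqrt (sphere_area R d) * nrm sigma sphere g)) => //.
  exact: cmeasurable_herglotz.
by move=> x _; exact: herglotz_bound.
Qed.

Lemma L2_orthoZ (V : set ('rV[R]_d -> R[i])) (a : R) g : fin_dim_subspace sigma sphere V ->
  L2_ortho sigma sphere V g -> L2_ortho sigma sphere V (fun x => a%:C%C * g x).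
Proof.
move=> [m [w [Lw ->]]] [Lg h]; split=> [|v Vv]; first exact: L2Z.
have [Lv _] := Vv; have := h v Vv; rewrite !cinnerE => /eqP; rewrite eq_complex /=.
move=> /andP[/eqP h1 /eqP h2]; have Liv := L2i Lv.
by rewrite !ipZl// h1 h2 mulr0.
Qed.

Lemma ip_subset (A A' : set 'rV[R]_d) f : measurable A -> measurable A' -> A `<=` A' ->
  cLspace leb A' 2%:E f -> ip leb A f f <= ip leb A' f f.
Proof.
move=> mA mA' AA Lf.
have /(L2P)[mf /(sqint_lty _ mf) fin'] := Lf.
have le : (\int[leb]_(x in A) (rdot (f x) (f x))%:E <= \int[leb]_(x in A') (rdot (f x) (f x))%:E)%E.
  apply: ge0_subset_integral => //; first by apply/measurable_EFinP; exact: cmeasurable_rdot.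
  by move=> x _; rewrite lee_fin rdot_ge0.
rewrite /ip /Rintegral; apply: fine_le => //.
- rewrite ge0_fin_numE; first exact: le_lt_trans le fin'.
  by apply: integral_ge0 => x _; rewrite lee_fin rdot_ge0.
- by rewrite ge0_fin_numE//; apply: integral_ge0 => x _; rewrite lee_fin rdot_ge0.
Qed.

Lemma L2_subset (A A' : set 'rV[R]_d) f : measurable A -> measurable A' -> A `<=` A' ->
  cLspace leb A' 2%:E f -> cLspace leb A 2%:E f.
Proof.
move=> mA mA' AA /L2P[[m1 m2] sf]; apply/L2P; split.
  by split; [exact: measurable_funS m1|exact: measurable_funS m2].
exact: (integrableS mA' mA AA sf).
Qed.

Lemma ip_lower (A : set 'rV[R]_d) f (t : R) : measurable A -> (leb A < +oo)%E ->
  cLspace leb A 2%:E f -> 0 <= t -> (forall x, A x -> t <= Normc.normc (f x)) ->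
  t ^+ 2 * fine (leb A) <= ip leb A f f.
Proof.
move=> mA fA Lf t0 h; rewrite -Rintegral_cst//; apply: le_Rintegral => //.
- have := L2_integrable mA (L2_cst mA t%:C%C fA) (L2_cst mA t%:C%C fA).
  by apply: eq_integrable => // x _ /=; rewrite /rdot /= mulr0 addr0 expr2.
- exact: L2_integrable.
by move=> x Ax; rewrite -normc_sq lerXn2r ?nnegrE ?normc_ge0 ?h.
Qed.

End localized_waves.

(** Approximating each peak up to an error 1 is enough. The combination is at most [K2] on [D],
    uniformly in e, and of order e^-(d+1) on the cube whose coefficient is 1. The volume of this
    cube is of order e^(d+1), so the square integral is still of order e^-(d+1). *)
Lemma localized_wave (R : realType) (d : nat) (k : R) (F0 F1 : R -> R)
    (D B : set 'rV[R]_d.+1) (z0 : 'rV[R]_d.+1) (r Lambda rhot : R) V :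
  (1 <= d <= 3)%N -> transverse_design (axis R d) -> 0 < k ->
  radial_solution d.+1 k F0 F1 -> singular_at0 k d.+1 F0 F1 ->
  open D -> bounded_set D -> connected (~` closure D) -> open B -> bounded_set B ->
  0 < r -> (forall x, `|x - z0| < r -> B x) -> (forall x, closure D x -> r <= `|x - z0|) ->
  fin_dim_subspace sphere_measure unit_sphere V -> 0 <= Lambda -> 0 < rhot ->
  exists g, [/\ L2_ortho sphere_measure unit_sphere V g, nrm sphere_measure unit_sphere g = rhot &
    Lambda * ip (lebesgue_rV R d.+1) D (herglotz k g) (herglotz k g) <
      ip (lebesgue_rV R d.+1) B (herglotz k g) (herglotz k g)].
Proof.
move=> d13 AVG k0 F01 sing Do Db conn Bo Bb r0 rB rD Vfin L0 rhot0.
have mD := open_measurable_rV Do; have mB := open_measurable_rV Bo.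
have fD := bounded_finite mD Db; have fB := bounded_finite mB Bb.
have mS := @measurable_unit_sphere R d.+1; have fS := sphere_finite R d.+1.
pose leb := lebesgue_rV R d.+1; pose H := @herglotz R d.+1 k.
have [Q0 Q00 DQ0] := bounded_norm_le Db.
have ClQ x : closure D x -> enorm x <= d.+1%:R * (Q0 + 1).
  move=> /(_ _ (nbhsx_ballx x 1 ltr01))[y [Dy]]; rewrite -ball_normE /= => xy.
  apply: le_trans (enorm_le_norm _) _; rewrite ler_wpM2l//.
  by have := lerB_dist x y; have := DQ0 _ Dy; move: xy; lra.
have [n comb] := ortho_combination mS Vfin.
have [z [c [K [e0 [c0 e00 zB peaks]]]]] := @runge_peaks _ d k F0 F1 (@herglotz_limits R d.+1 k)
  D z0 r _ n d13 AVG k0 F01 sing (herglotz_limits_closed k) (fun E Q t c => @herglotz_limits_cos R d.+1 k isT k0 E Q t c)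
  conn ClQ r0 rD.
pose K2 := n%:R * (`|K| + 1); have K20 : 0 <= K2 by rewrite mulr_ge0// addr_ge0.
pose mu := fine (leb D); have mu0 : 0 <= mu by rewrite fine_ge0.
pose P := Lambda * (K2 ^+ 2 * mu); have P0 : 0 <= P by rewrite !mulr_ge0// sqr_ge0.
(* The third bound makes the errors, at most 1 + K2, smaller than half of the peak; the fourth makes
   the integral over the cube exceed [P], which bounds Lambda times the integral over [D]. *)
pose e := Num.min (e0 / 2) (Num.min (1 / 2) (Num.min (c / (2 * (1 + K2))) (c ^+ 2 / (8 * (P + 1))))).
have K21 : 0 < 2 * (1 + K2) by rewrite mulr_gt0// ltr_wpDr.
have P1 : 0 < 8 * (P + 1) by rewrite mulr_gt0// ltr_wpDl.
have e_gt0 : 0 < e by rewrite !lt_min !divr_gt0// exprn_gt0.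
have ee0 : e < e0 by rewrite (le_lt_trans (_ : _ <= e0 / 2))// ?ge_min ?lexx// ltr_pdivrMr// ltr_pMr// ltr1n.
have e1 : e <= 1 / 2 by rewrite !ge_min lexx orbT.
have eK : e <= c / (2 * (1 + K2)) by rewrite !ge_min lexx !orbT.
have eP : e <= c ^+ 2 / (8 * (P + 1)) by rewrite !ge_min lexx !orbT.
have [phi hphi] := peaks e (introT andP (conj e_gt0 ee0)).
have hg j : exists g, cLspace sphere_measure unit_sphere 2%:E g /\
    forall x, (D `|` \bigcup_i cube (z i) e) x -> Normc.normc ((phi j x)%:C%C - H g x) <= 1.
  by have [/(_ 1 ltr01)[g Lg hg] _ _ _] := hphi j; exists g.
pose G j := sval (cid (hg j)).
have LG j : cLspace sphere_measure unit_sphere 2%:E (G j) by exact: (svalP (cid (hg j))).1.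
have GE j x : (D `|` \bigcup_i cube (z i) e) x -> Normc.normc ((phi j x)%:C%C - H (G j) x) <= 1.
  exact: (svalP (cid (hg j))).2.
have [a [[j aj] ale oG]] := comb G LG.
pose g x := \sum_j (a j)%:C%C * G j x; have Lg := oG.1.
have Hg x : H g x = \sum_i (a i)%:C%C * H (G i) x.
  rewrite /H /g herglotz_sum => [|i]; last exact: L2Z.
  by apply: eq_bigr => i _; rewrite herglotzZ.
have HG_small i x : (D `|` \bigcup_i cube (z i) e) x -> `|phi i x| <= K ->
    Normc.normc ((a i)%:C%C * H (G i) x) <= `|K| + 1.
  move=> Ex pK; rewrite normcM normc_real; apply: (@le_trans _ _ (Normc.normc (H (G i) x))).
    by rewrite ler_piMl ?normc_ge0.
  have -> : H (G i) x = (phi i x)%:C%C - ((phi i x)%:C%C - H (G i) x) by rewrite opprB addrC subrK.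
  apply: le_trans (normcD _ _) _; rewrite normc_real normcN.
  by apply: lerD; [exact: le_trans pK (ler_norm K)|exact: GE].
have sum_small (I : pred 'I_n) (x : 'rV[R]_d.+1) :
    (forall i, I i -> Normc.normc ((a i)%:C%C * H (G i) x) <= `|K| + 1) ->
    Normc.normc (\sum_(i | I i) (a i)%:C%C * H (G i) x) <= K2.
  move=> h; apply: (@le_trans _ _ (\sum_(i | I i) (`|K| + 1))).
    elim/big_ind2 : _ => //; first by rewrite normc_sqrt /rdot mulr0 addr0 sqrtr0.
    by move=> u1 v1 u2 v2 h1 h2; apply: le_trans (normcD _ _) _; exact: lerD.
  apply: (@le_trans _ _ (\sum_(i < n) (`|K| + 1))).
    rewrite big_mkcond; apply: ler_sum => i _; case: ifP => // _; exact: addr_ge0.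
  by rewrite sumr_const card_ord /K2 mulr_natl.
have onD x : D x -> Normc.normc (H g x) <= K2.
  move=> Dx; rewrite Hg; apply: sum_small => i _; apply: HG_small; first by left.
  by have [_ _ h _] := hphi i; exact: h.
have en0 : 0 < e ^+ d.+1 by rewrite exprn_gt0.
have ene : e ^+ d.+1 <= e by rewrite -[leRHS]expr1 ler_wiXn2l ?(ltW e_gt0)//; move: e1; clear; lra.
have onC x : cube (z j) e x -> c / e ^+ d.+1 / 2 <= Normc.normc (H g x).
  move=> Cx; have Ex : (D `|` \bigcup_i cube (z i) e) x by right; exists j.
  have [_ hj _ _] := hphi j.
  have h1 : c / e ^+ d.+1 <= `|phi j x| by rewrite ler_pdivrMr// hj.
  rewrite Hg (bigD1 j)//= aj mul1r; set T := \sum_(i < n | _) _.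
  have h2 : Normc.normc T <= K2.
    apply: sum_small => i ij; apply: HG_small => //.
    by have [_ _ _ h] := hphi i; apply: (h j) => //; rewrite eq_sym.
  have h3 : `|phi j x| <= Normc.normc (H (G j) x + T) + (1 + K2).
    rewrite -normc_real.
    have -> : (phi j x)%:C%C = (H (G j) x + T) + (((phi j x)%:C%C - H (G j) x) - T) by rewrite addrACA subrr addr0 addrC subrK.
    apply: le_trans (normcD _ _) _; rewrite lerD2l; apply: le_trans (normcD _ _) _.
    by rewrite normcN; apply: lerD => //; exact: GE.
  have h4 : 1 + K2 <= c / e ^+ d.+1 / 2.
    rewrite ler_pdivlMr// mulrC ler_pdivlMr//; apply: le_trans (ler_wpM2l (ltW K21) (le_trans ene eK)) _.
    by rewrite mulrC divfK// gt_eqF.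
  by move: h1 h3 h4; clear; move: (Normc.normc _) (c / _) `|_| => s1 s2 s3; lra.
have LD := herglotz_L2 k mD fD Lg; have LB := herglotz_L2 k mB fB Lg.
have CB : cube (z j) e `<=` B by move=> x Cx; apply: rB; exact: (zB j e).
have mC := @measurable_cube R d.+1 (z j) e.
have LC := L2_subset mC mB CB LB.
have fC : (leb (cube (z j) e) < +oo)%E by rewrite cube_volume ?ltry// ltW.
have main : Lambda * ip leb D (H g) (H g) < ip leb B (H g) (H g).
  apply: (@lt_le_trans _ _ (ip leb (cube (z j) e) (H g) (H g))); last exact: ip_subset.
  have t0 : 0 <= c / e ^+ d.+1 / 2 by rewrite !divr_ge0 ?(ltW c0) ?(ltW en0).
  apply: lt_le_trans (ip_lower mC fC LC t0 onC); rewrite cube_volume ?(ltW e_gt0)//=.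
  apply: (@le_lt_trans _ _ P).
    rewrite /P ler_wpM2l// -nrm_sq -[mu](sqr_sqrtr mu0) -exprMn.
    by rewrite lerXn2r ?nnegrE ?nrm_ge0 ?mulr_ge0 ?sqrtr_ge0//; exact: nrm_bounded.
  have -> : (c / e ^+ d.+1 / 2) ^+ 2 * (2 * e) ^+ d.+1 = 2 ^+ d.+1 * (c ^+ 2 / (4 * e ^+ d.+1)).
    by rewrite [(2 * e) ^+ _]exprMn; move: (e ^+ d.+1) (2 ^+ d.+1 : R) en0 => t s te; field; rewrite gt_eqF.
  apply: (@lt_le_trans _ _ (c ^+ 2 / (4 * e ^+ d.+1))); last first.
    by rewrite ler_peMl ?divr_ge0 ?sqr_ge0 ?mulr_ge0 ?(ltW en0)// exprn_ege1// ler1n.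
  rewrite ltr_pdivlMr ?mulr_gt0//; apply: le_lt_trans (_ : P * (4 * (c ^+ 2 / (8 * (P + 1)))) < _).
    by rewrite ler_wpM2l// ler_pM2l// (le_trans ene).
  have c20 : 0 < c ^+ 2 by rewrite exprn_gt0.
  have -> : P * (4 * (c ^+ 2 / (8 * (P + 1)))) = c ^+ 2 * (P / (P + 1)) / 2 by field; rewrite gt_eqF// ltr_wpDl.
  have : P / (P + 1) <= 1 by rewrite ler_pdivrMr ?ltr_wpDl// mul1r lerDl.
  by move=> h; have := ler_wpM2l (ltW c20) h; rewrite mulr1; move: c20; clear; move: (c ^+ 2) (_ * _) => s1 s2; lra.
(* A density of norm 0 would give the zero wave and contradict the strict inequality, so rescaling
   to the norm [rhot] is possible. *)
have N0 : 0 < nrm sphere_measure unit_sphere g.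
  rewrite lt_neqAle nrm_ge0 andbT eq_sym; apply/eqP => n0.
  have H0 x : Normc.normc (H g x) <= 0 by have := herglotz_bound k x Lg; rewrite n0 mulr0.
  move: main; rewrite ltNge => /negP; apply; apply: (@le_trans _ _ 0).
    rewrite -nrm_sq; have := nrm_bounded mB fB (lexx 0) LB (fun x _ => H0 x).
    by rewrite mul0r => h; rewrite (le_anti (introT andP (conj h (nrm_ge0 _ _ _)))) expr0n.
  by rewrite mulr_ge0// ip_ge0.
pose t := rhot / nrm sphere_measure unit_sphere g; have t0 : 0 < t by exact: divr_gt0.
exists (fun x => t%:C%C * g x); split; first exact: L2_orthoZ.
  by rewrite nrmZ// gtr0_norm// /t divfK// gt_eqF.
have Ht : H (fun x => t%:C%C * g x) = fun x => t%:C%C * H g x.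
  by apply/funext => x; exact: herglotzZ.
have E A : measurable A -> cLspace leb A 2%:E (H g) ->
    ip leb A (fun x => t%:C%C * H g x) (fun x => t%:C%C * H g x) = t ^+ 2 * ip leb A (H g) (H g).
  by move=> mA LA; rewrite ipZl ?ipZr//; [rewrite mulrA expr2|exact: L2Z].
by rewrite -/H Ht !E// mulrCA ltr_pM2l// exprn_gt0.
Qed.

(** * The volume potential *)

Section tame_profiles.
Context (R : realType).
Implicit Types (f g : R -> R) (r c : R).

(* Radial kernels [f r] with [f ^ 2 = O (r ^ - n)] at the origin; values at [r <= 0] are junk. *)
Definition tame n f : Prop := [/\ measurable_fun setT f,
  forall L : R, exists2 C : R, 0 <= C & forall r, 0 < r <= L -> f r ^+ 2 * r ^+ n <= C &
  forall e L : R, 0 < e -> exists2 K : R, 0 <= K & forall r r', e <= r <= L -> e <= r' <= L ->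
    `|f r - f r'| <= K * `|r - r'|].

Lemma tameZ n c f : tame n f -> tame n (fun r => c * f r).
Proof.
move=> [mf bf lf]; split.
- by apply: measurable_funM => //; exact: measurable_cst.
- move=> L; have [C C0 hC] := bf L; exists (c ^+ 2 * C) => [|r hr]; first by rewrite mulr_ge0 ?sqr_ge0.
  by rewrite exprMn -mulrA ler_wpM2l ?sqr_ge0 ?hC.
- move=> e L e0; have [K K0 hK] := lf e L e0; exists (`|c| * K) => [|r r' hr hr']; first exact: mulr_ge0.
  by rewrite -mulrBr normrM -mulrA ler_wpM2l ?hK.
Qed.

Lemma tameD n f g : tame n f -> tame n g -> tame n (fun r => f r + g r).
Proof.
move=> [mf bf lf] [mg bg lg]; split.
- exact: measurable_funD.
- move=> L; have [C C0 hC] := bf L; have [C' C'0 hC'] := bg L.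
  exists (2 * C + 2 * C') => [|r hr]; first by rewrite addr_ge0 ?mulr_ge0.
  have r0 : 0 <= r ^+ n by rewrite exprn_ge0//; case/andP: hr => /ltW.
  have h1 := hC r hr; have h2 := hC' r hr.
  have : 0 <= (f r - g r) ^+ 2 * r ^+ n by rewrite mulr_ge0 ?sqr_ge0.
  have -> : (f r + g r) ^+ 2 * r ^+ n =
    2 * (f r ^+ 2 * r ^+ n) + 2 * (g r ^+ 2 * r ^+ n) - (f r - g r) ^+ 2 * r ^+ n by ring.
  by move: h1 h2; clear; lra.
- move=> e L e0; have [K K0 hK] := lf e L e0; have [K' K'0 hK'] := lg e L e0.
  exists (K + K') => [|r r' hr hr']; first exact: addr_ge0.
  rewrite opprD addrACA mulrDl; apply: le_trans (ler_normD _ _) _.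
  by apply: lerD; [exact: hK|exact: hK'].
Qed.

Lemma sq_lipschitz e L r r' : 0 < e -> e <= r <= L -> e <= r' <= L ->
  `|r ^+ 2 - r' ^+ 2| <= 2 * L * `|r - r'|.
Proof.
move=> e0 /andP[h1 h2] /andP[h3 h4]; rewrite subr_sqr normrM mulrC ler_wpM2r//.
by rewrite ger0_norm; move: e0 h1 h2 h3 h4; clear; lra.
Qed.

Lemma tame_psum n a : entire_coef a -> tame n (fun r => psum a (r ^+ 2)).
Proof.
move=> ea; have ed := entire_diffs ea; split.
- apply: (measurableT_comp (f := psum a)); last exact: measurable_funX.
  apply: continuous_measurable_fun => x; exact: dv_continuous (psum_derive x ea).
- move=> L; have [M M0 hM] := psum_bounded (L ^+ 2) ea.
  exists (M ^+ 2 * `|L| ^+ n) => [|r /andP[r0 rL]]; first by rewrite mulr_ge0 ?exprn_ge0.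
  have L0 : 0 <= L by rewrite (le_trans (ltW r0)).
  apply: ler_pM; rewrite ?sqr_ge0 ?exprn_ge0 ?(ltW r0)//.
    rewrite -[leLHS]real_normK ?num_real// lerXn2r ?nnegrE//; apply: hM.
    by rewrite sqr_ge0/= lerXn2r ?nnegrE ?(ltW r0).
  by rewrite lerXn2r ?nnegrE ?(ltW r0)// ger0_norm.
- move=> e L e0; have [M M0 hM] := psum_bounded (L ^+ 2) ed.
  exists (M * (2 * `|L|)) => [|r r' hr hr']; first by rewrite !mulr_ge0.
  have /andP[er rL] := hr; have /andP[er' rL'] := hr'.
  have r0 := le_trans (ltW e0) er; have r0' := le_trans (ltW e0) er'.
  have L0 : 0 <= L by exact: le_trans rL.
  apply: (@le_trans _ _ (M * `|r ^+ 2 - r' ^+ 2|)); last first.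
    by rewrite -mulrA ler_wpM2l// (ger0_norm L0); exact: (sq_lipschitz e0).
  apply: (@MVT_bound R _ _ (r' ^+ 2) (r ^+ 2) M (fun u _ => psum_derive u ea)) => u /andP[h1 h2].
  apply: hM; apply/andP; split.
    by apply: le_trans h1; rewrite le_min !sqr_ge0.
  by apply: le_trans h2 _; rewrite ge_max !lerXn2r ?nnegrE.
Qed.


Lemma inv_lipschitz e r r' : 0 < e -> e <= r -> e <= r' ->
  `|r^-1 - r'^-1| <= (e ^+ 2)^-1 * `|r - r'|.
Proof.
move=> e0 er er'; have r0 := lt_le_trans e0 er; have r0' := lt_le_trans e0 er'.
have -> : r^-1 - r'^-1 = (r * r')^-1 * (r' - r) by field; rewrite !gt_eqF.
rewrite normrM distrC ler_wpM2r// ger0_norm ?invr_ge0 ?mulr_ge0 ?(ltW r0) ?(ltW r0')//.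
by rewrite lef_pV2 ?posrE ?exprn_gt0 ?mulr_gt0// expr2 ler_pM// ltW.
Qed.

Lemma tame_div (h : R -> R) (k : R) : measurable_fun setT h ->
  (forall r, `|h r| <= 1) -> (forall r r', `|h r - h r'| <= k * `|r - r'|) ->
  tame 2 (fun r => h r * powR r (-1)).
Proof.
move=> mh h1 hk; have k0 : 0 <= k by have := hk 1 0; rewrite subr0 normr1 mulr1; exact: le_trans.
split.
- by apply: measurable_funM => //; exact: measurable_powR.
- move=> L; exists 1 => // r /andP[r0 _]; rewrite powR_inv1 ?(ltW r0)// exprMn exprVn divfK ?gt_eqF ?exprn_gt0//.
  by rewrite -[leLHS]real_normK ?num_real// expr_le1.
- move=> e L e0; exists (k / e + (e ^+ 2)^-1) => [|r r' /andP[er _] /andP[er' _]].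
    by rewrite addr_ge0 ?divr_ge0 ?invr_ge0 ?exprn_ge0 ?(ltW e0).
  rewrite !powR_inv1 ?(le_trans (ltW e0))//.
  have -> : h r / r - h r' / r' = (h r - h r') / r + h r' * (r^-1 - r'^-1) by ring.
  apply: le_trans (ler_normD _ _) _; rewrite !normrM mulrDl; apply: lerD.
    rewrite [leRHS]mulrAC; apply: ler_pM => //.
    rewrite normfV ger0_norm ?(le_trans (ltW e0))// lef_pV2 ?posrE//.
    exact: lt_le_trans er.
  by apply: le_trans (ler_wpM2r _ (h1 _)) _ => //; rewrite mul1r; exact: inv_lipschitz.
Qed.

Lemma tame_radial2 (k : R) (e L : R) : 0 < e -> exists2 K : R, 0 <= K &
  forall r r', e <= r <= L -> e <= r' <= L ->
    `|radial2 k (r ^+ 2) - radial2 k (r' ^+ 2)| <= K * `|r - r'|.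
Proof.
move=> e0; have e20 : 0 < e ^+ 2 by rewrite exprn_gt0.
have sol := @radial2_solution R k.
have [C C0 hC] := radial_bound_on sol (L ^+ 2) (isT : (2 <= 4)%N) e20.
exists (C / e ^+ 2 * (2 * `|L|)) => [|r r' hr hr']; first by rewrite !mulr_ge0 ?invr_ge0 ?(ltW e20).
have /andP[er rL] := hr; have /andP[er' rL'] := hr'.
have r0 := le_trans (ltW e0) er; have r0' := le_trans (ltW e0) er'.
have L0 : 0 <= L by exact: le_trans rL.
apply: (@le_trans _ _ (C / e ^+ 2 * `|r ^+ 2 - r' ^+ 2|)); last first.
  rewrite -[leRHS]mulrA; apply: ler_wpM2l; first by rewrite divr_ge0 ?(ltW e20).
  by rewrite (ger0_norm L0); exact: (sq_lipschitz e0).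
have range u : Num.min (r' ^+ 2) (r ^+ 2) <= u <= Num.max (r' ^+ 2) (r ^+ 2) -> e ^+ 2 <= u <= L ^+ 2.
  move=> /andP[h1 h2]; apply/andP; split.
    by apply: le_trans h1; rewrite le_min !lerXn2r ?nnegrE ?(ltW e0).
  by apply: le_trans h2 _; rewrite ge_max !lerXn2r ?nnegrE.
have dd u : Num.min (r' ^+ 2) (r ^+ 2) <= u <= Num.max (r' ^+ 2) (r ^+ 2) ->
    is_derive u 1 (radial2 k) (radial2' k u).
  by move=> /range /andP[h1 _]; exact: (sol u (lt_le_trans e20 h1)).1.
apply: (MVT_bound dd) => u /range /andP[h1 h2].
have := hC u 1%N; rewrite h1 h2 expr1 => /(_ isT) h; apply: le_trans h _.
by rewrite ler_wpM2l// lef_pV2 ?posrE// (lt_le_trans e20).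
Qed.

(** Near 0, r (ln r)^2 is bounded because |ln t| <= 2 / sqrt t. Away from 0 the Lipschitz bound is
    inherited from [radial2], since 2 ln r times the J_0 series is [radial2 k (r ^+ 2)] minus a
    power series. *)
Lemma tame_ln (k : R) : 0 < k -> tame 1 (fun r => ln (k * r / 2) * psum (j0coef k) (r ^+ 2)).
Proof.
move=> k0; have ea := entire_j0coef k; have [mp bp lp] := @tame_psum 1 _ ea; split.
- apply: measurable_funM => //; apply: (measurableT_comp (@measurable_ln R)).
  by apply: measurable_funM; [apply: measurable_funM|exact: measurable_cst].
- move=> L; have [M M0 hM] := psum_bounded (L ^+ 2) ea.
  exists ((8 / k + (k * L / 2) ^+ 2 * `|L|) * M ^+ 2) => [|r /andP[r0 rL]].
    by rewrite mulr_ge0 ?sqr_ge0// addr_ge0 ?divr_ge0 ?(ltW k0)// mulr_ge0 ?sqr_ge0.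
  have L0 : 0 <= L by rewrite (le_trans (ltW r0)).
  rewrite exprMn mulrAC expr1; apply: ler_pM (mulr_ge0 (sqr_ge0 _) (ltW r0)) (sqr_ge0 _) _ _; last first.
    rewrite -[leLHS]real_normK ?num_real// lerXn2r ?nnegrE//; apply: hM.
    by rewrite sqr_ge0/= lerXn2r ?nnegrE ?(ltW r0).
  set t := k * r / 2; have t0 : 0 < t by rewrite divr_gt0// mulr_gt0.
  have [t1|t1] := leP t 1.
    apply: (@le_trans _ _ (8 / k)); last by rewrite lerDl mulr_ge0 ?sqr_ge0.
    have h : `|ln t| <= 2 / Num.sqrt t by apply: ln_sqrt_bound; rewrite t0.
    apply: (@le_trans _ _ (4 / t * r)); last first.
      rewrite le_eqVlt; apply/orP; left; apply/eqP; rewrite /t; field; rewrite !gt_eqF//.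
    rewrite ler_wpM2r ?(ltW r0)// -[leLHS]real_normK ?num_real//.
    apply: (@le_trans _ _ ((2 / Num.sqrt t) ^+ 2)); first by rewrite lerXn2r ?nnegrE ?divr_ge0 ?sqrtr_ge0.
    by rewrite exprMn exprVn sqr_sqrtr ?(ltW t0)// -natrX.
  apply: (@le_trans _ _ ((k * L / 2) ^+ 2 * `|L|)); last by rewrite lerDr divr_ge0 ?(ltW k0).
  have lt : ln t <= k * L / 2.
    by apply: le_trans (ltW (ln_sublinear t0)) _; rewrite ler_pM2r// ler_pM2l.
  have l0 : 0 <= ln t by apply: ln_ge0; exact: ltW.
  apply: ler_pM (sqr_ge0 _) (ltW r0) _ _; last by rewrite ger0_norm.
  by rewrite lerXn2r ?nnegrE// (le_trans l0).
- move=> e L e0; have [K K0 hK] := tame_radial2 k L e0; have [K' K'0 hK'] := lp e L e0.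
  have [_ _ ly] := @tame_psum 1 _ (entire_y0coef k); have [K2 K20 hK2] := ly e L e0.
  exists (`|ln (k / 2)| * K' + (K + K2) / 2) => [|r r' hr hr']; first by rewrite addr_ge0 ?mulr_ge0 ?invr_ge0 ?addr_ge0.
  have E t : e <= t <= L -> ln (k * t / 2) * psum (j0coef k) (t ^+ 2) =
      ln (k / 2) * psum (j0coef k) (t ^+ 2) + (radial2 k (t ^+ 2) - psum (y0coef k) (t ^+ 2)) / 2.
    move=> /andP[et _]; have t0 := lt_le_trans e0 et.
    have -> : ln (k * t / 2) = ln (k / 2) + ln t by rewrite -lnM ?posrE ?divr_gt0// mulrAC.
    rewrite /radial2 lnXn// mulr2n.
    by move: (ln (k / 2)) (ln t) (psum _ _) (psum _ _) => s1 s2 s3 s4; field.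
  rewrite !E//.
  have h1 := hK _ _ hr hr'; have h2 := hK' _ _ hr hr'; have h3 := hK2 _ _ hr hr'.
  move: h1 h2 h3; move: (radial2 _ _) (radial2 _ _) (psum _ _) (psum _ _) (psum _ _) (psum _ _).
  move=> a' a c' c b' b h1 h2 h3.
  have -> : ln (k / 2) * b + (a - c) / 2 - (ln (k / 2) * b' + (a' - c') / 2) =
    ln (k / 2) * (b - b') + ((a - a') - (c - c')) / 2 by ring.
  apply: le_trans (ler_normD _ _) _; rewrite !normrM mulrDl; apply: lerD.
    by rewrite -mulrA ler_wpM2l.
  rewrite (ger0_norm (_ : 0 <= 2^-1)) ?invr_ge0// [leRHS]mulrAC ler_pM2r ?invr_gt0//.
  by apply: le_trans (ler_normB _ _) _; rewrite mulrDl; apply: lerD.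
Qed.

Lemma besselJ0_psum k r : besselJ0 (k * r) = psum (j0coef k) (r ^+ 2).
Proof.
rewrite /besselJ0 /psum /pseries; congr (limn (series _)); apply/funext => m /=.
rewrite /j0coef !exprM.
have -> : (k * r / 2) ^+ 2 = k ^+ 2 / 4 * r ^+ 2 by field.
have -> : - (k ^+ 2 / 4) = -1 * (k ^+ 2 / 4) by ring.
by rewrite !exprMn; ring.
Qed.

Lemma besselY0_psum k r : besselY0 (k * r) =
  2 / pi * (ln (k * r / 2) * psum (j0coef k) (r ^+ 2)
    + (euler_gamma R * psum (j0coef k) (r ^+ 2) + 2^-1 * psum (y0coef k) (r ^+ 2))).
Proof.
rewrite /besselY0 besselJ0_psum; congr (_ * _); rewrite mulrDl -addrA; congr (_ + (_ + _)).
rewrite -psumZ; last exact: entire_y0coef.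
rewrite /psum /pseries; congr (limn (series _)); apply/funext => m /=.
rewrite /y0coef /j0coef !exprM.
have -> : (k * r / 2) ^+ 2 = k ^+ 2 / 4 * r ^+ 2 by field.
have -> : - (k ^+ 2 / 4) = -1 * (k ^+ 2 / 4) by ring.
rewrite !exprMn exprS; move: (series _ _) => s.
move: (m`!%:R ^+ 2)^-1 (4^-1 ^+ m) (k ^+ m) (r ^+ m) ((-1) ^+ m) => s1 s2 s3 s4 s5.
by field.
Qed.

(** The order d - 1 is sharp for d = 3 and generous for the logarithm when d = 2. It ensures local
    square integrability, as r^-(d-1) is integrable near 0 in dimension d. *)
Lemma fund_sol_tame (d : nat) (k : R) : d = 2%N \/ d = 3%N -> 0 < k ->
  exists f g, [/\ tame d.-1 f, tame d.-1 g &
    forall x : 'rV[R]_d, fund_sol k x = Complex (f (enorm x)) (g (enorm x))].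
Proof.
move=> hd k0; case: hd => ->.
  exists (fun r => - 4^-1 * (2 / pi * (ln (k * r / 2) * psum (j0coef k) (r ^+ 2)
    + (euler_gamma R * psum (j0coef k) (r ^+ 2) + 2^-1 * psum (y0coef k) (r ^+ 2))))).
  exists (fun r => 4^-1 * psum (j0coef k) (r ^+ 2)); split.
  - apply: tameZ; apply: tameZ; apply: tameD; first exact: tame_ln.
    by apply: tameD; apply: tameZ; apply: tame_psum; [exact: entire_j0coef|exact: entire_y0coef].
  - by apply: tameZ; apply: tame_psum; exact: entire_j0coef.
  - move=> x; rewrite /fund_sol /= /hankel0 besselY0_psum besselJ0_psum.
    by apply/eqP; rewrite eq_complex /=; apply/andP; split; apply/eqP; ring.
have lip (h : R -> R) : (forall a b, `|h a - h b| <= 2 * `|a - b|) ->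
    forall r r', `|h (k * r) - h (k * r')| <= 2 * k * `|r - r'|.
  by move=> hh r r'; apply: le_trans (hh _ _) _; rewrite -mulrBr normrM (gtr0_norm k0) mulrA.
have mk : measurable_fun setT (fun r : R => k * r) by apply: measurable_funM.
exists (fun r => (4 * pi)^-1 * (cos (k * r) * powR r (-1))).
exists (fun r => (4 * pi)^-1 * (sin (k * r) * powR r (-1))); split.
- apply: tameZ; apply: (@tame_div _ (2 * k)).
  + by apply: (measurableT_comp (f := cos)) => //; apply: continuous_measurable_fun; exact: continuous_cos.
  + by move=> r; rewrite ler_norml cos_geN1 cos_le1.
  + apply: lip => a b; apply: le_trans (cis_dist a b); apply: le_trans (Re_le_normc _).
    by rewrite ReD ReN.
- apply: tameZ; apply: (@tame_div _ (2 * k)).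
  + by apply: (measurableT_comp (f := sin)) => //; apply: continuous_measurable_fun; exact: continuous_sin.
  + by move=> r; rewrite ler_norml sin_geN1 sin_le1.
  + apply: lip => a b; apply: le_trans (cis_dist a b); apply: le_trans (Im_le_normc _).
    by rewrite ImD ImN.
- move=> x; rewrite /fund_sol /= invfM powR_inv1 ?enorm_ge0//.
  by apply/eqP; rewrite eq_complex /=; apply/andP; split; apply/eqP; ring.
Qed.

End tame_profiles.

Section radial_kernel.
Context (R : realType) (n : nat) (f g : R -> R).
Hypotheses (tf : tame n f) (tg : tame n g).
Local Notation X := 'rV[R]_n.+1.
Local Notation mu := (lebesgue_rV R n.+1).
Implicit Types x y : X.

Definition radial_kernel x : R[i] := Complex (f (enorm x)) (g (enorm x)).
Local Notation K := radial_kernel.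
Let kk x := rdot (K x) (K x).

Lemma measurable_sub x : measurable_fun setT (fun y => x - y).
Proof.
apply/measurable_fun_rVP => i; rewrite (_ : (fun _ => _) = fun y => x 0 i - y 0 i).
  by apply: measurable_funB; [exact: measurable_cst|exact: measurable_coord].
by apply/funext => y; rewrite !mxE.
Qed.

Lemma cmeasurable_kernel A x : cmeasurable A (fun y => K (x - y)).
Proof.
have [mf _ _] := tf; have [mg _ _] := tg.
have me : measurable_fun setT (fun y => enorm (x - y)).
  exact: (measurableT_comp (@measurable_enorm R n.+1) (measurable_sub x)).
by split; apply: measurable_funTS; [exact: (measurableT_comp mf me)|exact: (measurableT_comp mg me)].
Qed.

Let measurable_kk A x : measurable_fun A (fun y => kk (x - y)).
Proof. by apply: cmeasurable_rdot; exact: cmeasurable_kernel. Qed.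

Lemma kernel_decay (L : R) : exists2 C : R, 0 < C & forall x, 0 < enorm x <= L -> kk x * enorm x ^+ n <= C.
Proof.
have [_ bf _] := tf; have [_ bg _] := tg.
have [C C0 hC] := bf L; have [C' C'0 hC'] := bg L.
exists (C + C' + 1) => [|x hx]; first by rewrite ltr_wpDl// addr_ge0.
have h1 := hC _ hx; have h2 := hC' _ hx.
have -> : kk x * enorm x ^+ n = f (enorm x) ^+ 2 * enorm x ^+ n + g (enorm x) ^+ 2 * enorm x ^+ n.
  by rewrite /kk /rdot /= -!expr2 mulrDl.
by move: h1 h2; lra.
Qed.

(** On the dyadic shell of radius 2^-j the squared kernel is of order at most 2^(j n) and the volume
    of order 2^-(j (n+1)), so the integrals are dominated by a geometric series. The bounds depend
    on x - y only, hence a single eta for all x. *)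
Lemma kernel_small (e : R) : 0 < e -> exists2 eta : R, 0 < eta & forall x,
  (\int[mu]_(y in cube x eta) (kk (x - y))%:E <= e%:E)%E.
Proof.
move=> e0; have [C C0 hC] := kernel_decay n.+1%:R.
pose C' := C * 2 ^+ n * 2 ^+ n.+1 * 2.
have C'0 : 0 < C' by rewrite !mulr_gt0// exprn_gt0.
pose N := Num.trunc (C' / e).
have hN : C' / 2 ^+ N <= e.
  rewrite ler_pdivrMr ?exprn_gt0// mulrC -ler_pdivrMr//.
  apply: (@le_trans _ _ N.+1%:R); first by rewrite ltW// truncnS_gt.
  by rewrite -natrX ler_nat ltn_expl.
pose rad j : R := (2 ^+ (N + j))^-1.
have rad0 j : 0 < rad j by rewrite invr_gt0 exprn_gt0.
have radS j : rad j.+1 = rad j / 2 by rewrite /rad addnS exprS invfM mulrC.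
have rad_le i j : (i <= j)%N -> rad j <= rad i.
  by move=> ij; rewrite lef_pV2 ?posrE ?exprn_gt0// ler_weXn2l ?ler1n// leq_add2l.
have rad1 j : rad j <= 1 by rewrite invf_le1 ?exprn_gt0// exprn_ege1// ler1n.
exists (rad 0%N) => // x.
pose A j := cube x (rad j) `\` cube x (rad j.+1).
have mA j : measurable (A j) by apply: measurableD; exact: measurable_cube.
have mU : measurable (\bigcup_j A j) by exact: bigcupT_measurable.
have cubeE : cube x (rad 0%N) `\` cube x 0 = \bigcup_j A j.
  apply/seteqP; split=> [y [y0 yx]|y [j _ [yj yj1]]]; last first.
    split; first by apply: le_trans yj _; exact: rad_le.
    by move=> yx; apply: yj1; apply: le_trans yx _; exact: ltW.
  have {}yx : 0 < `|y - x| by rewrite ltNge; apply/negP.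
  have ex : exists m, rad m < `|y - x|.
    exists (Num.trunc `|y - x|^-1).+1; rewrite /rad invf_plt ?posrE ?exprn_gt0//.
    apply: (@lt_le_trans _ _ (Num.trunc `|y - x|^-1).+1%:R); first exact: truncnS_gt.
    by rewrite -natrX ler_nat (leq_trans (ltnW (ltn_expl _ (ltnSn 1))))// leq_exp2l// leq_addl.
  case: (ex_minnP ex) => -[|m] hm hmin.
    by move: y0; rewrite /cube /= leNgt hm.
  exists m => //; split; last by rewrite /cube /= => /(lt_le_trans hm); rewrite ltxx.
  by rewrite /cube /= leNgt; apply/negP => /hmin; rewrite ltnn.
have tA : trivIset setT A.
  have h i j : (i < j)%N -> A i `&` A j = set0.
    move=> ij; apply/seteqP; split=> // y [[_ h1] [h2 _]]; apply: h1.
    by apply: le_trans h2 _; exact: rad_le.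
  apply/trivIsetP => i j _ _; rewrite neq_ltn => /orP[/h//|/h]; by rewrite setIC.
have mk D : measurable_fun D (fun y => (kk (x - y))%:E).
  by apply/measurable_EFinP; exact: measurable_kk.
have k0 y : (0%:E <= (kk (x - y))%:E)%E by rewrite lee_fin rdot_ge0.
(* The centre, where the profiles take junk values, lies in no shell and is a null set. *)
have mu0 : mu (cube x 0) = 0%E by rewrite cube_volume// mulr0 expr0n.
have mc := @measurable_cube R n.+1 x; rewrite (ge0_negligible_integral (mc 0) (mc _) (mk _) _ mu0)//.
rewrite cubeE ge0_integral_bigcup//.
have e'0 : 0 <= C' / 2 ^+ N by rewrite divr_ge0 ?(ltW C'0)// exprn_ge0.
apply: (@le_trans _ _ (C' / 2 ^+ N)%:E); last by rewrite lee_fin.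
apply: le_trans _ (epsilon_trick0 xpredT e'0); apply: lee_nneseries => [j _ _|j _].
  exact: integral_ge0.
have cj : 0 <= C * 2 ^+ (N + j).+1 ^+ n by rewrite mulr_ge0 ?(ltW C0)// exprn_ge0// exprn_ge0.
apply: (@le_trans _ _ (\int[mu]_(y in A j) (C * 2 ^+ (N + j).+1 ^+ n)%:E)%E).
  apply: ge0_le_integral => //.
  move=> y [y1 y2]; rewrite lee_fin.
  have r1 : rad j.+1 <= enorm (x - y).
    apply: le_trans (norm_le_enorm _); rewrite distrC leNgt; apply/negP => h; apply: y2.
    exact: ltW.
  have r0 : 0 < enorm (x - y) by exact: lt_le_trans r1.
  have r2 : enorm (x - y) <= n.+1%:R.
    apply: le_trans (enorm_le_norm _) _; rewrite ger_pMr// distrC.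
    exact: le_trans y1 (rad1 j).
  have := hC (x - y); rewrite r0 r2 => /(_ isT) h.
  rewrite -(ler_pM2r (exprn_gt0 n r0)); apply: le_trans h _.
  rewrite -mulrA ler_peMr ?(ltW C0)// -exprMn exprn_ege1//.
  by rewrite -ler_pdivrMl ?exprn_gt0// mulr1 -addnS.
rewrite integral_cst//; apply: (@le_trans _ _ ((C * 2 ^+ (N + j).+1 ^+ n)%:E * mu (cube x (rad j)))%E).
  rewrite lee_pmul2l ?lte_fin ?mulr_gt0 ?exprn_gt0// ?exprn_gt0//.
  by apply: le_measure; rewrite ?inE//; exact: subDsetl.
rewrite cube_volume ?(ltW (rad0 j))// -EFinM lee_fin.
have -> : (2 * rad j) ^+ n.+1 = 2 ^+ n.+1 * (rad j ^+ n * rad j) by rewrite exprMn -[rad j ^+ n * _]exprSr.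
have -> : 2 ^+ (N + j).+1 ^+ n = 2 ^+ n * (2 ^+ (N + j)) ^+ n :> R by rewrite exprS exprMn.
have -> : C * (2 ^+ n * (2 ^+ (N + j)) ^+ n) * (2 ^+ n.+1 * (rad j ^+ n * rad j)) =
    C * 2 ^+ n * 2 ^+ n.+1 * ((2 ^+ (N + j)) ^+ n * rad j ^+ n) * rad j by ring.
rewrite -exprMn /rad divff ?expr1n ?mulr1 ?gt_eqF ?exprn_gt0// /C' natrX [2 ^+ j.+1]exprS exprD !invfM.
by rewrite le_eqVlt; apply/orP; left; apply/eqP; field; rewrite !gt_eqF ?exprn_gt0.
Qed.

Lemma kernel_far_bound (e L : R) : 0 < e -> exists2 C : R, 0 <= C & forall x, e <= enorm x <= L -> kk x <= C.
Proof.
move=> e0; have [C C0 hC] := kernel_decay L.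
exists (C / e ^+ n) => [|x /andP[ex xL]]; first by rewrite divr_ge0 ?(ltW C0)// exprn_ge0// ltW.
have x0 := lt_le_trans e0 ex; rewrite ler_pdivlMr ?exprn_gt0//.
apply: le_trans (hC x _); last by rewrite x0.
by rewrite ler_wpM2l ?rdot_ge0// lerXn2r ?nnegrE ?(ltW e0) ?(ltW x0).
Qed.

Lemma kernel_lipschitz (e L : R) : 0 < e -> exists2 C : R, 0 <= C & forall x y,
  e <= enorm x <= L -> e <= enorm y <= L -> rdot (K x - K y) (K x - K y) <= C * enorm (x - y) ^+ 2.
Proof.
move=> e0; have [_ _ lf] := tf; have [_ _ lg] := tg.
have [C C0 hC] := lf e L e0; have [C' C'0 hC'] := lg e L e0.
exists (C ^+ 2 + C' ^+ 2) => [|x y hx hy]; first by rewrite addr_ge0 ?sqr_ge0.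
have xy : `|enorm x - enorm y| <= enorm (x - y).
  rewrite ler_norml lerNl opprB enorm_dist andbT; rewrite enormB; exact: enorm_dist.
rewrite /rdot ReD ImD ReN ImN /= -!expr2 mulrDl -!exprMn; apply: lerD.
  rewrite -[leLHS]real_normK ?num_real// lerXn2r ?nnegrE ?mulr_ge0 ?enorm_ge0//.
  by apply: le_trans (hC _ _ hx hy) _; rewrite ler_wpM2l.
rewrite -[leLHS]real_normK ?num_real// lerXn2r ?nnegrE ?mulr_ge0 ?enorm_ge0//.
by apply: le_trans (hC' _ _ hx hy) _; rewrite ler_wpM2l.
Qed.

Section on_bounded_set.
Variables (A : set X) (M : R).
Hypotheses (mA : measurable A) (finA : (mu A < +oo)%E).
Hypotheses (AM : forall y, A y -> enorm y <= M).

Let k0 x y : (0%:E <= (kk (x - y))%:E)%E. Proof. by rewrite lee_fin rdot_ge0. Qed.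
Let mk D x : measurable_fun D (fun y => (kk (x - y))%:E).
Proof. by apply/measurable_EFinP; exact: measurable_kk. Qed.

Lemma kernel_L2 x : cLspace mu A 2%:E (fun y => K (x - y)).
Proof.
have mc := @measurable_cube R n.+1 x.
apply/L2P; split; first exact: cmeasurable_kernel.
apply/(sqint_lty _ (cmeasurable_kernel A x)).
have [eta eta0 hs] := kernel_small ltr01.
have [C C0 hC] := kernel_far_bound (enorm x + M) eta0.
apply: (@le_lt_trans _ _ (\int[mu]_(y in A) (((fun y => (kk (x - y))%:E) \_ (cube x eta)) y + C%:E))%E).
  apply: ge0_le_integral => //.
  - by move=> y _; rewrite lee_fin rdot_ge0.
  - exact: mk.
  - apply: emeasurable_funD; last exact: measurable_cst.
    by apply/(measurable_restrict _ (mc eta) mA); exact: mk.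
  move=> y Ay; rewrite patchE; case: ifPn => [_|]; first by rewrite leeDl ?lee_fin.
  rewrite notin_setE /cube /= => /negP; rewrite -ltNge => yx; rewrite add0e lee_fin; apply: hC.
  apply/andP; split; first by rewrite (le_trans (ltW yx))// distrC norm_le_enorm.
  by apply: le_trans (enormD _ _) _; rewrite enormN lerD2l AM.
rewrite ge0_integralD//.
- rewrite integral_cst// -integral_mkcondr lte_add_pinfty//; last first.
    by rewrite lte_mul_pinfty.
  apply: (@le_lt_trans _ _ 1%:E); last by rewrite ltry.
  by apply: le_trans _ (hs x); apply: ge0_subset_integral => //; exact: measurableI.
- by move=> y _; rewrite patchE; case: ifP.
- by apply/(measurable_restrict _ (mc eta) mA); exact: mk.
Qed.

(** Both kernels are small in L^2 near their singularities, and the kernel is Lipschitz elsewhere.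
    Of the allowance e^2, each singular part takes e^2 / 4 and the regular part e^2 / 2. *)
Lemma kernel_shift (e : R) : 0 < e -> exists2 tau : R, 0 < tau & forall x x',
  enorm x <= M -> enorm x' <= M -> `|x - x'| <= tau ->
  nrm mu A (fun y => K (x - y) - K (x' - y)) <= e.
Proof.
move=> e0; have e2 : 0 < e ^+ 2 by rewrite exprn_gt0.
have e8 : 0 < e ^+ 2 / 8 by rewrite divr_gt0.
(* With |x - x'| <= h, a point within 2 h = eta - h of x lies in both cubes of half side eta, and
   any other point is at distance at least h from x and from x'. *)
have [eta eta0 hs] := kernel_small e8; pose h := eta / 3; have h0 : 0 < h by rewrite divr_gt0.
have [C C0 hC] := kernel_lipschitz (M + M) h0.
pose V := fine (mu A); have V0 : 0 <= V by rewrite fine_ge0.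
pose c := C * n.+1%:R ^+ 2 * (V + 1); have c0 : 0 <= c by rewrite !mulr_ge0 ?addr_ge0 ?sqr_ge0.
pose tau := Num.min h (Num.min 1 (e ^+ 2 / (2 * (c + 1)))).
have tau0 : 0 < tau by rewrite !lt_min h0 ltr01 divr_gt0// mulr_gt0// ltr_wpDl.
have tauh : tau <= h by rewrite ge_min lexx.
have tauc : c * tau ^+ 2 <= e ^+ 2 / 2.
  apply: (@le_trans _ _ (c * tau)).
    by rewrite ler_wpM2l// expr2 ler_piMl ?(ltW tau0)// !ge_min lexx !orbT.
  apply: (@le_trans _ _ (c * (e ^+ 2 / (2 * (c + 1))))).
    by rewrite ler_wpM2l// !ge_min lexx !orbT.
  have -> : c * (e ^+ 2 / (2 * (c + 1))) = (e ^+ 2 / 2) * (c / (c + 1)) by field; rewrite gt_eqF// ltr_wpDl.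
  by rewrite ger_pMr ?divr_gt0// ler_pdivrMr ?ltr_wpDl// mul1r lerDl.
exists tau => // x x' xM x'M xx.
have mKd : cmeasurable A (fun y => K (x - y) - K (x' - y)).
  by apply: cmeasurableD; [|apply: cmeasurableN]; exact: cmeasurable_kernel.
have LD : cLspace mu A 2%:E (fun y => K (x - y) - K (x' - y)) by apply: L2B => //; exact: kernel_L2.
rewrite -ler_sqr ?nnegrE ?nrm_ge0 ?(ltW e0)// nrm_sq -lee_fin /ip /Rintegral fineK; last first.
  have /L2P[m1 /(sqint_lty _ m1) h1] := LD.
  by rewrite ge0_fin_numE// integral_ge0// => y _; rewrite lee_fin rdot_ge0.
pose G z y := (2%:E * (kk (z - y))%:E)%E.
have G0 z y : (0%:E <= G z y)%E by rewrite mule_ge0.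
have mG D z : measurable_fun D (G z) by apply: measurable_funeM.
have mc z := @measurable_cube R n.+1 z eta.
have mR z : measurable_fun A (G z \_ (cube z eta))%E by apply/(measurable_restrict _ (mc z) mA); exact: mG.
have R0 z y : (0%:E <= (G z \_ (cube z eta)) y)%E by rewrite patchE; case: ifP.
have IG z : (\int[mu]_(y in A) (G z \_ (cube z eta)) y <= (e ^+ 2 / 4)%:E)%E.
  rewrite -integral_mkcondr; apply: (@le_trans _ _ (\int[mu]_(y in cube z eta) G z y)%E).
    by apply: ge0_subset_integral => //; exact: measurableI.
  rewrite /G ge0_integralZl_EFin//; apply: le_trans (lee_wpmul2l _ (hs z)) _; first by rewrite lee_fin.
  by rewrite -EFinM lee_fin; move: (e ^+ 2) => t; lra.
apply: (@le_trans _ _ (\int[mu]_(y in A) (((G x \_ (cube x eta)) y + (G x' \_ (cube x' eta)) y) + (C * (n.+1%:R * tau) ^+ 2)%:E))%E).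
  apply: ge0_le_integral => //.
  - by move=> y _; rewrite lee_fin rdot_ge0.
  - by apply/measurable_EFinP; exact: cmeasurable_rdot.
  - by apply: emeasurable_funD; [exact: emeasurable_funD|exact: measurable_cst].
  move=> y Ay; have C'0 : 0 <= C * (n.+1%:R * tau) ^+ 2 by rewrite mulr_ge0 ?sqr_ge0.
  have [near|far] := leP `|y - x| (eta - h).
    have i1 : y \in cube x eta.
      by rewrite inE /cube /=; apply: le_trans near _; rewrite gerBl ltW.
    have i2 : y \in cube x' eta.
      rewrite inE /cube /=; have := ler_distD x y x'; move: near tauh xx; lra.
    rewrite !patchE i1 i2 /G -!EFinM -!EFinD lee_fin.
    apply: (@le_trans _ _ (2 * kk (x - y) + 2 * kk (x' - y))); last by rewrite lerDl.
    have := rdot_ge0 (K (x - y) + K (x' - y)); rewrite /kk /rdot !ReD !ImD ReN ImN.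
    move: (complex.Re (K _)) (complex.Im (K _)) (complex.Re (K _)) (complex.Im (K _)) => a b a' b'.
    by move=> q; rewrite -subr_ge0; apply: le_trans q _; rewrite le_eqVlt; apply/orP; left; apply/eqP; ring.
  apply: (@le_trans _ _ (C * (n.+1%:R * tau) ^+ 2)%:E); last first.
    by rewrite leeDr// adde_ge0.
  have far' : 2 * h < `|y - x| by move: far; rewrite /h; lra.
  rewrite lee_fin; apply: le_trans (hC (x - y) (x' - y) _ _) _.
  - apply/andP; split.
      apply: le_trans (norm_le_enorm _); rewrite distrC; move: far' h0; lra.
    by apply: le_trans (enormD _ _) _; rewrite enormN lerD// AM.
  - apply/andP; split.
      apply: le_trans (norm_le_enorm _); rewrite distrC; have := ler_distD x' y x.
      rewrite [`|x' - x|]distrC; move: far' tauh xx; lra.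
    by apply: le_trans (enormD _ _) _; rewrite enormN lerD// AM.
  rewrite ler_wpM2l// opprB addrA subrK lerXn2r ?nnegrE ?enorm_ge0 ?mulr_ge0 ?(ltW tau0)//.
  by apply: le_trans (enorm_le_norm _) _; rewrite ler_wpM2l.
rewrite ge0_integralD//; [|by move=> y _; rewrite adde_ge0|exact: emeasurable_funD|].
  2: by move=> y _; rewrite lee_fin mulr_ge0 ?sqr_ge0.
rewrite ge0_integralD// integral_cst//.
rewrite (_ : (e ^+ 2)%:E = ((e ^+ 2 / 4)%:E + (e ^+ 2 / 4)%:E + (e ^+ 2 / 2)%:E)%E); last first.
  by rewrite -!EFinD; congr EFin; move: (e ^+ 2) => t; field.
apply: leeD; first exact: leeD.
rewrite -[X in (_ * X)%E]fineK ?ge0_fin_numE// -EFinM lee_fin -/V.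
apply: le_trans tauc; rewrite /c exprMn.
have -> : C * (n.+1%:R ^+ 2 * tau ^+ 2) * V = C * n.+1%:R ^+ 2 * V * tau ^+ 2 by ring.
by rewrite ler_wpM2r ?sqr_ge0// ler_wpM2l ?mulr_ge0 ?sqr_ge0// lerDl.
Qed.

End on_bounded_set.
End radial_kernel.

Section L2_complements.
Context d (T : measurableType d) (R : realType) (mu : {measure set T -> \bar R}) (A : set T).
Hypothesis mA : measurable A.
Local Notation L2 := (cLspace mu A 2%:E).
Implicit Types (f g : T -> R[i]).

Lemma L2_dom_ae (C : R) f g : cmeasurable A f -> L2 g ->
  (\forall x \ae mu, A x -> Normc.normc (f x) <= C * Normc.normc (g x)) -> L2 f.
Proof.
move=> mf Lg h; have LC := L2Z mA C Lg.
have /L2P[mg /(sqint_lty _ mg) fin] := LC.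
apply/L2P; split => //; apply/(sqint_lty _ mf); apply: le_lt_trans fin.
apply: ae_ge0_le_integral => //.
- by move=> x _; rewrite lee_fin rdot_ge0.
- by apply/measurable_EFinP; exact: cmeasurable_rdot.
- by move=> x _; rewrite lee_fin rdot_ge0.
- by apply/measurable_EFinP; exact: cmeasurable_rdot.
apply: filterS h => x h Ax; rewrite lee_fin rdotZl rdotC rdotZl mulrA -!normc_sq -expr2 -exprMn.
by rewrite lerXn2r ?nnegrE ?normc_ge0 ?h// (le_trans _ (h Ax))// normc_ge0.
Qed.

Lemma rdot_cinner g w u : L2 g -> L2 w ->
  rdot (cinner mu A g w) u = ip mu A g (fun y => u * w y).
Proof.
move=> Lg Lw; rewrite cinnerE (ip_scaler mA u Lw Lg) /rdot /=.
by congr (_ + _); exact: mulrC.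
Qed.

Lemma cLnorm_oo_le (M : R) f : 0 <= M -> (forall x, A x -> Normc.normc (f x) <= M) ->
  (cLnorm mu A +oo f <= M%:E)%E.
Proof.
move=> M0 h; rewrite /cLnorm unlock /=; case: ifP => // _.
apply: ereal_inf_lbound; apply: aeW => x /=; rewrite patchE; case: ifPn => [|_].
  by rewrite inE => Ax; rewrite lee_fin ger0_norm ?normc_ge0// h.
by rewrite abse0 lee_fin.
Qed.

End L2_complements.

Lemma normc_conjc (R : realType) (z : R[i]) : Normc.normc (conjc z) = Normc.normc z.
Proof. by case: z => a b; rewrite !normc_sqrt /rdot /= mulrNN. Qed.

Lemma finite_cube_cover (R : realType) d (M t : R) : 0 < t -> exists (m : nat) (p : 'I_m -> 'rV[R]_d),
  forall x : 'rV[R]_d, `|x| <= M -> exists j, cube (p j) t x.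
Proof.
move=> t0; pose N := (Num.trunc ((M + M) / t)).+1.
pose q (c : {ffun 'I_d -> 'I_N}) : 'rV[R]_d := \row_i ((c i)%:R * t - M).
exists #|{: {ffun 'I_d -> 'I_N}}|, (fun j => q (enum_val j)) => x xM.
pose k i := Num.trunc ((x 0 i + M) / t).
have xi i : - M <= x 0 i <= M.
  by rewrite -ler_norml; exact: le_trans (coord_le_norm x i) xM.
have k0 i : 0 <= (x 0 i + M) / t.
  by rewrite divr_ge0 ?(ltW t0)// -lerBlDr sub0r; case/andP: (xi i).
have kN i : (k i < N)%N.
  rewrite ltnS /k; apply: le_truncn; rewrite ler_pM2r ?invr_gt0// lerD2r.
  by case/andP: (xi i).
exists (enum_rank [ffun i => Ordinal (kN i)]).
rewrite /cube /= enum_rankK; apply: norm_row_le => [|i]; first exact: ltW.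
rewrite !mxE ffunE /=; have /andP[h1 h2] := truncn_itv (k0 i).
rewrite -/(k i) in h1 h2.
have -> : x 0 i - ((k i)%:R * t - M) = ((x 0 i + M) / t - (k i)%:R) * t.
  by field; rewrite gt_eqF.
rewrite normrM (gtr0_norm t0) ger_pMl// ger0_norm ?subr_ge0//.
by rewrite lerBlDl -natr1 in h2 *; exact: ltW.
Qed.

Section potential.
Context (R : realType) (n : nat) (k : R) (D : set 'rV[R]_n.+1) (M : R).
Hypotheses (hd : n.+1 = 2%N \/ n.+1 = 3%N) (k0 : 0 < k).
Local Notation mu := (lebesgue_rV R n.+1).
Hypotheses (mD : measurable D) (finD : (mu D < +oo)%E) (DM : forall y, D y -> enorm y <= M).

(** Cauchy-Schwarz reduces this to [kernel_shift]. Uniformity in h is the form of compactness of the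
    potential that the cellwise approximation uses. *)
Lemma potential_shift (e : R) : 0 < e -> exists2 tau : R, 0 < tau & forall h x x',
  cLspace mu D 2%:E h -> enorm x <= M -> enorm x' <= M -> `|x - x'| <= tau ->
  Normc.normc (volume_potential k D h x - volume_potential k D h x') <= e * nrm mu D h.
Proof.
move=> e0; have [f [g [tf tg fE]]] := fund_sol_tame hd k0.
have KE (x : 'rV[R]_n.+1) : fund_sol k x = radial_kernel f g x by exact: fE.
have [tau tau0 htau] := kernel_shift tf tg mD finD DM e0.
exists tau => // h x x' Lh xM x'M xx.
have LK z : cLspace mu D 2%:E (fun y => conjc (fund_sol k (z - y))).
  have LKz := kernel_L2 tf tg mD finD DM z.
  apply: (L2_dom mD (C := 1) _ LKz).
    have [m1 m2] := LKz.1; split; under eq_fun do rewrite KE.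
      exact: m1.
    by under eq_fun do rewrite /= -mulN1r; apply: measurable_funM => //; exact: measurable_cst.
  by move=> y _; rewrite mul1r KE normc_conjc.
have VE z : volume_potential k D h z = cinner mu D h (fun y => conjc (fund_sol k (z - y))).
  by rewrite /volume_potential /cinner; congr cintegral; apply/funext => y; rewrite conjcK mulrC.
have [u u1 ->] := normc_unit (volume_potential k D h x - volume_potential k D h x').
have Lu z v : cLspace mu D 2%:E (fun y => v * conjc (fund_sol k (z - y))) by exact: L2_scale.
have RE z : rdot (volume_potential k D h z) u = ip mu D h (fun y => u * conjc (fund_sol k (z - y))).
  by rewrite VE; exact: (rdot_cinner mD u Lh (LK z)).
rewrite rdotDl rdotNl (RE x) (RE x').
have -> : - ip mu D h (fun y => u * conjc (fund_sol k (x' - y))) =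
    ip mu D h (fun y => - u * conjc (fund_sol k (x' - y))).
  rewrite -mulN1r -(ipZr mD _ (Lu _ _) Lh); apply: ip_ext => // y _.
  by rewrite rmorphN1 mulN1r mulNr.
rewrite -(ipDr mD (Lu _ _) (Lu _ _) Lh); apply: le_trans (ler_norm _) _.
apply: le_trans (ip_le_nrm mD Lh (L2D mD (Lu _ _) (Lu _ _))) _.
rewrite mulrC ler_wpM2r ?nrm_ge0//; apply: le_trans _ (htau x x' xM x'M xx).
have LKd : cLspace mu D 2%:E (fun y => radial_kernel f g (x - y) - radial_kernel f g (x' - y)).
  by apply: L2B => //; exact: (kernel_L2 tf tg mD finD DM).
rewrite -[leRHS]mul1r; apply: (nrm_dom mD ler01 (L2D mD (Lu _ _) (Lu _ _)) LKd).
apply: aeW => y _; rewrite mul1r -!KE mulNr -mulrBr normcM u1 mul1r -rmorphB.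
by rewrite normc_conjc.
Qed.

End potential.

Section far_field_form.
Context (R : realType) (n : nat) (k : R).
Local Notation mu := (lebesgue_rV R n.+1).
Local Notation sphere := (@unit_sphere R n.+1).
Local Notation sigma := (@sphere_measure R n.+1).
Local Notation L2S := (cLspace sigma sphere 2%:E).
Variables (A : set 'rV[R]_n.+1) (M : R).
Hypotheses (mA : measurable A) (finA : (mu A < +oo)%E).
Hypotheses (M0 : 0 <= M) (AM : forall y, A y -> enorm y <= M).

Lemma herglotz_adjE phi t : herglotz_adj k A phi t = wave_transform mu A (- k) phi t.
Proof.
by rewrite /herglotz_adj /wave_transform; congr cintegral; apply/funext => y; rewrite mulNr.
Qed.

Lemma herglotz_adj_L2 phi : cLspace mu A 2%:E phi -> L2S (herglotz_adj k A phi).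
Proof.
move=> Lphi; have mS := @measurable_unit_sphere R n.+1.
rewrite (_ : herglotz_adj k A phi = wave_transform mu A (- k) phi); last first.
  by apply/funext => t; exact: herglotz_adjE.
apply: (L2_bounded mS (C := Num.sqrt (fine (mu A)) * nrm mu A phi) (sphere_finite R n.+1)).
  exact: (cmeasurable_wave_transform (- k) mA finA M0 AM).
by move=> t _; exact: wave_transform_bound.
Qed.

Lemma herglotz_adjoint phi g : cLspace mu A 2%:E phi -> L2S g ->
  ip sigma sphere (herglotz_adj k A phi) g = ip mu A phi (herglotz k g).
Proof.
move=> Lphi Lg; have mS := @measurable_unit_sphere R n.+1.
have fS : (sphere_set_fun (@unit_sphere R n.+1) < +oo)%E by exact: sphere_finite.
rewrite (_ : herglotz_adj k A phi = wave_transform mu A (- k) phi); last first.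
  by apply/funext => t; exact: herglotz_adjE.
have Lg' : cLspace (@sphere_set_fun R n.+1) sphere 2%:E g by have /L2P[? ?] := Lg; apply/L2P.
have <- := wave_transform_adjoint k mA mS finA fS Lphi Lg'.
by rewrite /ip /Rintegral.
Qed.

Lemma probing_form g : L2S g ->
  complex.Re (cinner sigma sphere (probing k A g) g) =
    k ^+ 2 * ip mu A (herglotz k g) (herglotz k g).
Proof.
move=> Lg; have LH := herglotz_L2 k mA finA Lg.
rewrite cinnerE /= /probing (ipZl (@measurable_unit_sphere R n.+1) _ (herglotz_adj_L2 LH) Lg).
by rewrite herglotz_adjoint.
Qed.

End far_field_form.

(** * Bounds on the far field operator *)

Section operator_bounds.
Context (R : realType) (n : nat) (k : R).
Context (D : set 'rV[R]_n.+1) (q : 'rV[R]_n.+1 * R -> R) (q0 : 'rV[R]_n.+1 -> R).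
Context (alpha delta : R).
Local Notation mu := (lebesgue_rV R n.+1).
Local Notation L2 := (cLspace mu D 2%:E).
Hypotheses (mD : measurable D).
Implicit Types f v : 'rV[R]_n.+1 -> R[i].

Lemma poweR_bound (C : R) (l : \bar R) (M s : R) : 0 <= C -> 0 <= M -> 0 < alpha -> 0 <= s ->
  (0 <= l <= M%:E)%E -> (C%:E * l `^ alpha * s%:E <= (C * M `^ alpha * s)%:E)%E.
Proof.
move=> C0 M0 a0 s0 /andP[l0 lM]; rewrite !EFinM; apply: lee_wpmul2r; first by rewrite lee_fin.
apply: lee_wpmul2l; first by rewrite lee_fin.
rewrite -poweR_EFin; apply: (gt0_ler_poweR (ltW a0)) => //; rewrite in_itv /= ?l0 ?leey// lee_fin.
by rewrite M0.
Qed.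

Lemma cLnorm_oo_ge0 f : (0 <= cLnorm mu D +oo f)%E.
Proof. exact: Lnorm_ge0. Qed.

Lemma L2_of_cLnorm (s : R) f : cmeasurable D f -> (cLnorm mu D 2%:E f <= s%:E)%E ->
  L2 f /\ nrm mu D f <= s.
Proof.
move=> mf fs; have Lf : L2 f by split => //; apply: le_lt_trans fs _; exact: ltry.
by split => //; rewrite -lee_fin -(cLnormE Lf).
Qed.

Lemma cmeasurable_source f v : measurable_fun setT q -> cmeasurable D f -> cmeasurable D v ->
  cmeasurable D (nonlinear_source q f v).
Proof.
move=> mq mf mv; have mw := cmeasurableD mv mf; have mc := cmeasurable_cut mD mw.
pose w := cut D (fun x => v x + f x).
have mn : cmeasurable setT (fun y => (q (y, Normc.normc (w y)))%:C%C * w y).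
  apply: cmeasurableM => //; apply: cmeasurable_real; apply: (measurableT_comp mq).
  by apply: measurable_fun_pair => //; exact: measurable_normc.
apply: (@cmeasurable_ext _ _ _ _ (fun y => (q (y, Normc.normc (w y)))%:C%C * w y)).
  by move=> x Dx; rewrite /w cut_in.
by case: mn => m1 m2; split; apply: measurable_funS (measurableT) (@subsetT _ _) _.
Qed.


(** V0 f = V f - (V f - V0 f), and admissibility bounds both terms in L^2; in the second, |f|_oo is
    at most delta. This also gives the square integrability of V0 f. *)
Lemma admissible_V0 : admissible k D q q0 alpha delta -> 0 < alpha ->
  exists2 C2 : R, 0 <= C2 & forall f, Udelta D delta f -> L2 f ->
    [/\ cmeasurable D (op_V k D q q0 delta f), L2 (op_V0 k D q0 f) &
      nrm mu D (op_V0 k D q0 f) <= C2 * nrm mu D f].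
Proof.
move=> [d0 hex [C' C'0 hC']] a0; exists (C' + C' * delta `^ alpha).
  by rewrite addr_ge0 ?mulr_ge0 ?powR_ge0// ltW.
move=> f Uf Lf; have [_ h2 _ h4] := hC' f Uf.
have [[mv _] _ [[mvd _] _]] : nonlinear_solution k D q q0 delta f (op_V k D q q0 delta f).
  by apply: xgetPex; have [[v hv] _] := hex f Uf; exists v.
rewrite (cLnormE Lf) in h2 h4.
have [Lv nv] := L2_of_cLnorm mv h2.
have h4' := le_trans h4 (poweR_bound (ltW C'0) (ltW d0) a0 (nrm_ge0 mu D f) _).
have [|Lvd nvd] := L2_of_cLnorm mvd (h4' _); first by rewrite cLnorm_oo_ge0 Uf.2.
have LE x : D x -> op_V k D q q0 delta f x + - (op_V k D q q0 delta f x - op_V0 k D q0 f x) =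
  op_V0 k D q0 f x by move=> _; rewrite opprB addrC subrK.
have LN := L2N mD Lvd; have L0 := L2_ext mD LE (L2D mD Lv LN).
split => //; apply: (@le_trans _ _ (nrm mu D (fun x => op_V k D q q0 delta f x + -
    (op_V k D q q0 delta f x - op_V0 k D q0 f x)))).
  by rewrite /nrm (ip_ext mu LE LE).
apply: le_trans (nrmD mD Lv LN) _; rewrite mulrDl lerD//; apply: le_trans nvd.
rewrite -[leRHS]mul1r; apply: (nrm_dom mD ler01 LN Lvd).
by apply: aeW => x _; rewrite mul1r normcN.
Qed.

Section with_contrast.
Variable (Q : R).
Hypotheses (Q0 : 0 <= Q) (mq0 : measurable_fun setT q0).
Hypothesis q0Q : \forall x \ae mu, D x -> `|q0 x| <= Q.

Lemma L2_contrast f : L2 f ->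
  L2 (fun x => (q0 x)%:C%C * f x) /\ nrm mu D (fun x => (q0 x)%:C%C * f x) <= Q * nrm mu D f.
Proof.
move=> Lf.
have h : \forall x \ae mu, D x -> Normc.normc ((q0 x)%:C%C * f x) <= Q * Normc.normc (f x).
  apply: filterS q0Q => x + Dx => /(_ Dx) qx.
  by rewrite normcM normc_real ler_wpM2r// normc_ge0.
have mf : cmeasurable D (fun x => (q0 x)%:C%C * f x).
  apply: cmeasurableM; last exact: Lf.1.
  by apply: cmeasurable_real; exact: measurable_funS mq0.
have Lq := L2_dom_ae mD mf Lf h.
by split => //; exact: (nrm_dom mD Q0 Lq Lf).
Qed.

Lemma L2_op_T0 f : L2 f -> L2 (op_V0 k D q0 f) ->
  L2 (op_T0 k D q0 f) /\
  nrm mu D (op_T0 k D q0 f) <= k ^+ 2 * (Q * (nrm mu D f + nrm mu D (op_V0 k D q0 f))).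
Proof.
move=> Lf Lv; have Lw := L2D mD Lf Lv; have [Lq nq] := L2_contrast Lw.
have TE x : D x -> (k ^+ 2)%:C%C * ((q0 x)%:C%C * (f x + op_V0 k D q0 f x)) = op_T0 k D q0 f x.
  by move=> _; rewrite /op_T0 mulrA.
split; first exact: L2_ext TE (L2Z mD _ Lq).
rewrite /nrm -(ip_ext mu TE TE) -/(nrm mu D _) nrmZ// ger0_norm ?sqr_ge0//.
rewrite ler_wpM2l ?sqr_ge0//; apply: le_trans nq _.
by rewrite ler_wpM2l//; exact: nrmD.
Qed.

Lemma op_T_perturbation (C M : R) f : measurable_fun setT q -> 0 <= C -> 0 <= M -> 0 < alpha ->
  L2 f -> cmeasurable D (op_V k D q q0 delta f) -> L2 (op_V0 k D q0 f) ->
  (forall x, D x -> Normc.normc (f x) <= M) ->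
  (cLnorm mu D 2%:E (fun x => (op_T k D q q0 delta f x - op_T0 k D q0 f x)%R)
     <= C%:E * cLnorm mu D +oo f `^ alpha * cLnorm mu D 2%:E f)%E ->
  L2 (op_T k D q q0 delta f) /\
  `|ip mu D (op_T k D q q0 delta f) f - ip mu D (op_T0 k D q0 f) f| <=
    C * M `^ alpha * nrm mu D f ^+ 2.
Proof.
move=> mq C0 M0 a0 Lf mv Lv fM hC.
have [L0 _] := L2_op_T0 Lf Lv.
have mT : cmeasurable D (op_T k D q q0 delta f).
  by apply: cmeasurableM; [exact: cmeasurable_cst|exact: (cmeasurable_source mq Lf.1 mv)].
rewrite (cLnormE Lf) in hC.
have md := cmeasurableD mT (cmeasurableN L0.1).
have fb : (0 <= cLnorm mu D +oo f <= M%:E)%E by rewrite cLnorm_oo_ge0 cLnorm_oo_le.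
have [Ld nd] := L2_of_cLnorm md (le_trans hC (poweR_bound C0 M0 a0 (nrm_ge0 mu D f) fb)).
have TE x : D x -> (op_T k D q q0 delta f x - op_T0 k D q0 f x) + op_T0 k D q0 f x =
  op_T k D q q0 delta f x by move=> _; rewrite subrK.
split; first exact: L2_ext TE (L2D mD Ld L0).
rewrite -(ip_ext mu TE (fun=> fun=> erefl)) ipDl// addrK.
by apply: le_trans (ip_le_nrm mD Ld Lf) _; rewrite expr2 mulrA ler_wpM2r// nrm_ge0.
Qed.

(** V0 f is defined up to null sets, so it cannot be sampled at points. The potentials in its
    integral equation provide a representative with a modulus of continuity. *)
Lemma op_V0_shift (M e : R) : n.+1 = 2%N \/ n.+1 = 3%N -> 0 < k -> (mu D < +oo)%E ->
  (forall y, D y -> enorm y <= M) -> 0 < e ->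
  exists2 tau : R, 0 < tau & forall f, L2 f -> L2 (op_V0 k D q0 f) ->
    exists2 u, (\forall x \ae mu, D x -> op_V0 k D q0 f x = u x) &
      forall x x', D x -> D x' -> `|x - x'| <= tau ->
        Normc.normc (u x - u x') <= e * (nrm mu D f + nrm mu D (op_V0 k D q0 f)).
Proof.
move=> hd k0 finD DM e0.
pose e' := e / (k ^+ 2 * (Q + 1)); have Q1 : 0 < Q + 1 by rewrite ltr_wpDl.
have e'0 : 0 < e' by rewrite divr_gt0// mulr_gt0// exprn_gt0.
have [tau tau0 htau] := potential_shift hd k0 mD finD DM e'0.
exists tau => // f Lf Lv.
(* When the defining equation has no solution, [op_V0] is the default value 0 and the representative
   0 serves. *)
have [ex|nex] := pselect (exists v, [set v | cLspace mu D 2%:E v /\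
    \forall x \ae mu, D x -> v x - (k ^+ 2)%:C%C * volume_potential k D (fun y => (q0 y)%:C%C * v y) x
      = (k ^+ 2)%:C%C * volume_potential k D (fun y => (q0 y)%:C%C * f y) x] v); last first.
  exists (fun=> 0) => [|x x' _ _ _].
    apply: aeW => x _; rewrite /op_V0 xgetPN // => v hv; apply: nex; by exists v.
  by rewrite subrr normc_sqrt /rdot /= !mulr0 addr0 sqrtr0 mulr_ge0 ?addr_ge0 ?nrm_ge0// ltW.
have [_ hv] := xgetPex (cst 0) ex.
set v := op_V0 k D q0 f in Lv *.
pose P h := volume_potential k D (fun y => (q0 y)%:C%C * h y).
exists (fun x => (k ^+ 2)%:C%C * P f x + (k ^+ 2)%:C%C * P v x).
  by apply: filterS hv => x /[apply] <-; rewrite subrK.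
move=> x x' Dx Dx' xx.
have step h : L2 h -> Normc.normc ((k ^+ 2)%:C%C * P h x - (k ^+ 2)%:C%C * P h x') <= e * nrm mu D h.
  move=> Lh; have [Lq nq] := L2_contrast Lh.
  rewrite -mulrBr normcM normc_real ger0_norm ?sqr_ge0//.
  apply: (@le_trans _ _ (k ^+ 2 * (e' * (Q * nrm mu D h)))).
    rewrite ler_wpM2l ?sqr_ge0//; apply: le_trans (htau _ x x' Lq (DM _ Dx) (DM _ Dx') xx) _.
    by rewrite ler_wpM2l// ltW.
  rewrite !mulrA ler_wpM2r ?nrm_ge0//.
  rewrite (_ : k ^+ 2 * e / (k ^+ 2 * (Q + 1)) = e / (Q + 1)); last first.
    by field; rewrite !gt_eqF.
  by rewrite -mulrA ler_piMr ?(ltW e0)// mulrC ler_pdivrMr// mul1r lerDl.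
rewrite opprD addrACA mulrDr; apply: le_trans (normcD _ _) _.
by apply: lerD; exact: step.
Qed.

End with_contrast.
End operator_bounds.

Section far_field_bounds.
Context (R : realType) (n : nat) (k : R).
Context (D : set 'rV[R]_n.+1) (q : 'rV[R]_n.+1 * R -> R) (q0 : 'rV[R]_n.+1 -> R).
Context (alpha q0min delta C : R).
Local Notation mu := (lebesgue_rV R n.+1).
Local Notation sphere := (@unit_sphere R n.+1).
Local Notation sigma := (@sphere_measure R n.+1).
Local Notation H := (herglotz k).

Lemma scatterer_bounds : scatterer D -> [/\ measurable D, (mu D < +oo)%E &
  exists2 M : R, 0 <= M & forall y, D y -> enorm y <= M].
Proof.
move=> [oD bD _ _]; have mD := open_measurable_rV oD; split => //.
  exact: bounded_finite.
have [M M0 DM] := bounded_norm_le bD; exists (n.+1%:R * M).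
  by rewrite mulr_ge0// ltW.
by move=> y Dy; apply: le_trans (enorm_le_norm y) _; rewrite ler_wpM2l// DM.
Qed.

Lemma contrast_bounds : contrast D q q0 alpha q0min ->
  [/\ measurable_fun setT q, measurable_fun setT q0, 0 < alpha, 0 < q0min &
    exists2 Q : R, 0 < Q & \forall x \ae mu, D x -> q0min <= q0 x <= Q].
Proof.
move=> [[mq _] _ _ [[mq0 _] _ _ a0 _] [qm0 [Q hQ]]]; split => //.
exists (Num.max Q 1); first by rewrite lt_max ltr01 orbT.
apply: filterS hQ => x h Dx; have /andP[h1 h2] := h (subset_closure Dx).
by rewrite h1 le_max h2.
Qed.


Hypotheses (hD : scatterer D) (hq : contrast D q q0 alpha q0min).
Hypotheses (hdelta : admissible k D q q0 alpha delta) (C0 : 0 < C).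
Hypothesis hC : forall f, dom_T k D delta f ->
  (cLnorm mu D 2%:E (fun x => (op_T k D q q0 delta f x - op_T0 k D q0 f x)%R)
   <= C%:E * cLnorm mu D +oo f `^ alpha * cLnorm mu D 2%:E f)%E.
Local Notation radius := (delta / Num.sqrt (sphere_area R n.+1)).

(** [M] is left free: the upper bound takes it equal to delta, and the lower bound takes it small
    enough to absorb the superlinear part. *)
Lemma far_field_form : exists2 C2 : R, 0 <= C2 & forall (M : R) g,
  cLspace sigma sphere 2%:E g -> nrm sigma sphere g <= radius ->
  0 <= M <= delta -> (forall x, D x -> Normc.normc (H g x) <= M) ->
  [/\ cLspace mu D 2%:E (op_V0 k D q0 (H g)),
    nrm mu D (op_V0 k D q0 (H g)) <= C2 * nrm mu D (H g) &
    `|complex.Re (cinner sigma sphere (far_field k D q q0 delta g) g) -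
      ip mu D (op_T0 k D q0 (H g)) (H g)| <= C * M `^ alpha * nrm mu D (H g) ^+ 2].
Proof.
have [mD finD _] := scatterer_bounds hD.
have [mq mq0 a0 qm0 [Q Q0 hQ]] := contrast_bounds hq.
have [C2 C20 hV] := admissible_V0 mD hdelta a0; exists C2 => // M g Lg ng /andP[M0 Md] fM.
have Lf := herglotz_L2 k mD finD Lg; set f := H g in Lf fM *.
have Uf : Udelta D delta f.
  have fb := cLnorm_oo_le mu M0 fM.
  split; last by apply: le_trans fb _; rewrite lee_fin.
  by split; [exact: Lf.1|apply: le_lt_trans fb _; exact: ltry].
have [mv Lv nv] := hV f Uf Lf; split => //.
have df : dom_T k D delta f.
  split => // e e0; exists g; first by split => //; rewrite (cLnormE Lg) lee_fin.
  rewrite (_ : (fun x => f x - herglotz k g x) = fun=> 0); last by apply/funext => x; rewrite subrr.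
  rewrite (cLnormE (L2_0 mu D)) lte_fin /nrm /ip.
  by rewrite /Rintegral /rdot /= mulr0 addr0 integral0 sqrtr0.
have q0Q : \forall x \ae mu, D x -> `|q0 x| <= Q.
  apply: filterS hQ => x h /h /andP[h1 h2].
  by rewrite ger0_norm// (le_trans (ltW qm0)).
have [LT hT] := op_T_perturbation mD (ltW Q0) mq0 q0Q mq (ltW C0) M0 a0 Lf mv Lv fM (hC df).
by rewrite cinnerE /= /far_field -/f (herglotz_adjoint k mD finD LT Lg).
Qed.

Lemma herglotz_radius g x : cLspace sigma sphere 2%:E g -> nrm sigma sphere g <= radius ->
  Normc.normc (H g x) <= delta.
Proof.
move=> Lg ng; apply: le_trans (herglotz_bound k x Lg) _.
set s := Num.sqrt _ in ng *; have [s0|s0] := eqVneq s 0.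
  by rewrite s0 mul0r; case: hdelta => /ltW.
have sp : 0 < s by rewrite lt_neqAle eq_sym s0 sqrtr_ge0.
by rewrite mulrC -ler_pdivlMr.
Qed.

Lemma far_field_upper : exists2 K : R, 0 <= K & forall g, cLspace sigma sphere 2%:E g ->
  nrm sigma sphere g <= radius ->
  complex.Re (cinner sigma sphere (far_field k D q q0 delta g) g) <= K * ip mu D (H g) (H g).
Proof.
have [mD finD _] := scatterer_bounds hD.
have [_ mq0 a0 qm0 [Q Q0 hQ]] := contrast_bounds hq.
have [C2 C20 hF] := far_field_form; have [d0 _ _] := hdelta.
exists (k ^+ 2 * (Q * (1 + C2)) + C * delta `^ alpha).
  apply: addr_ge0; last by rewrite mulr_ge0 ?powR_ge0// ltW.
  by apply: mulr_ge0; rewrite ?sqr_ge0// mulr_ge0 ?addr_ge0// ltW.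
move=> g Lg ng; have dd : 0 <= delta <= delta by rewrite ltW/=.
have [Lv nv hT] := hF delta g Lg ng dd (fun x _ => herglotz_radius x Lg ng).
have Lf := herglotz_L2 k mD finD Lg.
have q0Q : \forall x \ae mu, D x -> `|q0 x| <= Q.
  apply: filterS hQ => x h /h /andP[h1 h2].
  by rewrite ger0_norm// (le_trans (ltW qm0)).
have [LT nT] := L2_op_T0 mD (ltW Q0) mq0 q0Q Lf Lv.
have hT' := le_trans (ler_norm _) hT; rewrite lerBlDr in hT'; apply: le_trans hT' _.
rewrite nrm_sq addrC mulrDl lerD2r; apply: le_trans (ler_norm _) _.
apply: le_trans (ip_le_nrm mD LT Lf) _; rewrite -nrm_sq [X in _ <= _ * X]expr2 [leRHS]mulrA ler_wpM2r ?nrm_ge0//.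
apply: le_trans nT _; rewrite -[leRHS]mulrA -[X in _ <= _ * X]mulrA; apply: ler_wpM2l; first exact: sqr_ge0.
apply: ler_wpM2l; first exact: ltW.
by rewrite mulrDl mul1r lerD2l.
Qed.

End far_field_bounds.

Lemma far_field_not_bounded_below (R : realType) (n : nat) (k : R)
    (D B : set 'rV[R]_n.+1) (q : 'rV[R]_n.+1 * R -> R) (q0 : 'rV[R]_n.+1 -> R)
    (alpha q0min delta C rhot beta : R) V :
  n.+1 = 2%N \/ n.+1 = 3%N -> 0 < k -> scatterer D -> contrast D q q0 alpha q0min ->
  admissible k D q q0 alpha delta -> 0 < C ->
  (forall f, dom_T k D delta f ->
    (cLnorm (lebesgue_rV R n.+1) D 2%:E
       (fun x => (op_T k D q q0 delta f x - op_T0 k D q0 f x)%R)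
     <= C%:E * cLnorm (lebesgue_rV R n.+1) D +oo f `^ alpha
        * cLnorm (lebesgue_rV R n.+1) D 2%:E f)%E) ->
  open B -> bounded_set B -> ~ B `<=` D ->
  0 < rhot -> rhot <= delta / Num.sqrt (sphere_area R n.+1) ->
  fin_dim_subspace sphere_measure unit_sphere V -> 0 < beta ->
  exists g, [/\ L2_ortho sphere_measure unit_sphere V g,
    cLnorm sphere_measure unit_sphere 2%:E g = rhot%:E &
    complex.Re (cinner sphere_measure unit_sphere (far_field k D q q0 delta g) g) <
    beta * complex.Re (cinner sphere_measure unit_sphere (probing k B g) g)].
Proof.
move=> hd k0 hD hq hdelta C0 hC oB bB nBD rt0 rtd hV b0.
have [oD bD lD cD] := hD.
have [z [r [r0 zB zD]]] := exterior_ball oD lD oB nBD.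
have [K K0 hK] := far_field_upper hD hq hdelta C0 hC.
have [F0 [F1 [n13 AX RS SG]]] : exists F0 F1 : R -> R, [/\ (1 <= n <= 3)%N,
    transverse_design (axis R n), radial_solution n.+1 k F0 F1 & singular_at0 k n.+1 F0 F1].
  case: hd => -[->].
    exists (radial2 k), (radial2' k); split => //; first exact: transverse_design2.
      exact: radial2_solution.
    exact: radial2_singular.
  exists (radial3 k), (radial3' k); split => //; first exact: transverse_design3.
    exact: radial3_solution.
  exact: radial3_singular.
have bk0 : 0 < beta * k ^+ 2 by rewrite mulr_gt0// exprn_gt0.
(* This localization factor makes K |H g|_D^2, the bound for the far field form, smaller than beta
   k^2 |H g|_B^2. *)
have L0 : 0 <= K / (beta * k ^+ 2) by rewrite divr_ge0// ltW.
have [g [Vg ng hg]] := localized_wave n13 AX k0 RS SG oD bD cD oB bB r0 zB zD hV L0 rt0.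
have Lg : cLspace sphere_measure unit_sphere 2%:E g by case: Vg.
have mB := open_measurable_rV oB; have fB := bounded_finite mB bB.
have [M M0 BM] := bounded_norm_le bB.
have BM' y : B y -> enorm y <= n.+1%:R * M.
  by move=> By; apply: le_trans (enorm_le_norm y) _; rewrite ler_wpM2l// BM.
exists g; split => //; first by rewrite (cLnormE Lg) ng.
have nM0 : 0 <= n.+1%:R * M by rewrite mulr_ge0// ltW.
rewrite (probing_form k mB fB nM0 BM' Lg) mulrA.
apply: le_lt_trans (hK g Lg _) _; first by rewrite ng.
by move: hg; rewrite mulrAC ltr_pdivrMr// [X in _ < X]mulrC.
Qed.

(** * Cells and the lower bound *)

Lemma finite_partition (R : realType) d (M t : R) : 0 < t ->
  exists (m : nat) (E : 'I_m -> set 'rV[R]_d), [/\ forall j, measurable (E j),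
    forall x, `|x| <= M -> exists2 j, E j x & forall i, E i x -> i = j &
    forall j x y, E j x -> E j y -> `|x - y| <= t].
Proof.
move=> t0; have h0 : 0 < t / 2 by rewrite divr_gt0.
have [m [p hp]] := finite_cube_cover d M h0.
pose E j := (cube (p j) (t / 2) `\` \bigcup_(i in [set i : 'I_m | (i < j)%N]) cube (p i) (t / 2))%classic.
exists m, E; split.
- move=> j; apply: measurableD; first exact: measurable_cube.
  apply: fin_bigcup_measurable; first exact: finite_finset.
  by move=> i _; exact: measurable_cube.
- move=> x /hp[j0 hj0].
  have Pj0 : `[< cube (p j0) (t / 2) x >] by apply/asboolP.
  case: (@arg_minnP _ j0 (fun j => `[< cube (p j) (t / 2) x >]) (fun j => j : nat) Pj0) => j /asboolP hj jmin.
  exists j; first by split => // -[i /= ij] /asboolP /jmin; rewrite leqNgt ij.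
  move=> i [hi ni]; apply/val_inj/eqP; rewrite eqn_leq jmin ?andbT; last exact/asboolP.
  by rewrite leqNgt; apply/negP => ji; apply: ni; exists j.
- move=> j x y [hx _] [hy _]; rewrite /cube /= in hx hy.
  rewrite (_ : x - y = (x - p j) - (y - p j)); last by rewrite opprB addrA subrK.
  by apply: le_trans (ler_normB _ _) _; apply: le_trans (lerD hx hy) _; rewrite -splitr.
Qed.

Section cells.
Context (R : realType) (n : nat) (k : R).
Local Notation mu := (lebesgue_rV R n.+1).
Local Notation sphere := (@unit_sphere R n.+1).
Local Notation sigma := (@sphere_measure R n.+1).
Local Notation L2S := (cLspace sigma sphere 2%:E).
Local Notation H := (herglotz k).
Variables (D : set 'rV[R]_n.+1) (K : R).
Hypotheses (mD : measurable D) (finD : (mu D < +oo)%E).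
Hypotheses (K0 : 0 <= K) (DK : forall y, D y -> enorm y <= K).

Lemma L2_cut (E : set 'rV[R]_n.+1) (phi : 'rV[R]_n.+1 -> R[i]) : measurable E ->
  cmeasurable setT phi -> cLspace mu D 2%:E phi -> cLspace mu D 2%:E (cut E phi).
Proof.
move=> mE mphi Lphi; apply: (L2_dom mD (C := 1) _ Lphi) => [|x _].
  have [m1 m2] : cmeasurable setT (cut E phi).
    apply: cmeasurable_cut => //; case: mphi => m1 m2.
    by split; apply: measurable_funS (measurableT) (@subsetT _ _) _.
  by split; apply: measurable_funS (measurableT) (@subsetT _ _) _.
rewrite mul1r /cut; case: ifP => // _.
by rewrite [leLHS]normc_sqrt /rdot /= !mulr0 addr0 sqrtr0 normc_ge0.
Qed.

Lemma herglotz_cinner g x : L2S g ->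
  H g x = cinner sigma sphere g (fun t => cis (- (k * dotv x t))).
Proof.
by move=> Lg; congr cintegral; apply/funext => t; rewrite conjc_cis opprK.
Qed.

(** The value of H g at a point and its pairing with a function on a cell are inner products of g
    with fixed densities, a plane wave and the image of that function under the adjoint. Pairing
    also with i times the function allows any complex constant z on the cell. *)
Lemma orthogonal_cells m (E : 'I_m -> set 'rV[R]_n.+1) (x : 'I_m -> 'rV[R]_n.+1) phi :
  (forall j, measurable (E j)) -> cmeasurable setT phi -> cLspace mu D 2%:E phi ->
  exists2 V, fin_dim_subspace sigma sphere V & forall g, L2_ortho sigma sphere V g ->
    forall j, H g (x j) = 0 /\ forall z, ip mu D (fun y => z * cut (E j) phi y) (H g) = 0.
Proof.
move=> mE mphi Lphi; have mS := @measurable_unit_sphere R n.+1.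
have Lcut j := L2_cut (mE j) mphi Lphi.
pose I := ('I_m + ('I_m + 'I_m))%type.
pose w (i : I) : 'rV[R]_n.+1 -> R[i] := match i with
  | inl j => fun t => cis (- (k * dotv (x j) t))
  | inr (inl j) => herglotz_adj k D (cut (E j) phi)
  | inr (inr j) => herglotz_adj k D (fun y => 'i%C * cut (E j) phi y) end.
have Lw i : L2S (w i).
  case: i => [j|[j|j]] /=.
  - apply: (L2_bounded mS (C := 1) (sphere_finite R n.+1)) => [|t _]; last by rewrite normc_cis.
    have := @cmeasurable_wave R n.+1 sphere (- k) (x j).
    by apply: cmeasurable_ext => t _; rewrite mulNr.
  - exact: (herglotz_adj_L2 k mD finD K0 DK).
  - by apply: (herglotz_adj_L2 k mD finD K0 DK); exact: L2i.
pose ww (i : 'I_#|{: I}|) := w (enum_val i).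
exists [set v | L2S v /\ exists c : 'I_#|{: I}| -> R[i],
    \forall t \ae sigma, sphere t -> v t = \sum_(i < #|{: I}|) c i * ww i t].
  by exists #|{: I}|, ww; split => // i; exact: Lw.
move=> g Vg j; have Lg : L2S g by case: Vg.
have ow i : cinner sigma sphere g (w i) = 0.
  have := spanned_ortho (enum_rank i) (fun i => Lw (enum_val i)) erefl Vg.
  by rewrite /ww enum_rankK.
split; first by rewrite herglotz_cinner//; exact: (ow (inl j)).
have LH := herglotz_L2 k mD finD Lg.
have o1 := ow (inr (inl j)); have o2 := ow (inr (inr j)).
rewrite cinnerE in o1; rewrite cinnerE in o2; case: o1 => o1 _; case: o2 => o2 _.
rewrite /= ipC (herglotz_adjoint k mD finD (Lcut j) Lg) in o1.
rewrite /= ipC (herglotz_adjoint k mD finD (L2i (Lcut j)) Lg) in o2.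
move=> z; rewrite ipC (ip_scaler mD z (Lcut j) LH).
by rewrite [X in _ * X + _]ipC o1 [X in _ + _ * X]ipC o2 !mulr0 addr0.
Qed.

End cells.

Lemma herglotz_lipschitz (R : realType) (n : nat) (k : R) g (x y : 'rV[R]_n.+1) :
  cLspace sphere_measure unit_sphere 2%:E g ->
  Normc.normc (herglotz k g x - herglotz k g y) <=
    2 * `|k| * Num.sqrt (sphere_area R n.+1) * nrm sphere_measure unit_sphere g * (n.+1%:R * `|x - y|).
Proof.
move=> Lg; rewrite !herglotzE; have mS := @measurable_unit_sphere R n.+1.
have S1 (t : 'rV[R]_n.+1) : unit_sphere t -> enorm t <= 1 by move=> /= ->.
apply: le_trans (wave_transform_lipschitz k mS (sphere_finite R n.+1) ler01 S1 x y Lg) _.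
rewrite mulr1 ler_wpM2l ?enorm_le_norm//.
by rewrite !mulr_ge0 ?sqrtr_ge0 ?nrm_ge0.
Qed.

Lemma ip_contrast_lower (R : realType) (n : nat) (D : set 'rV[R]_n.+1) (q0 : 'rV[R]_n.+1 -> R)
    (q0min : R) f : let mu := lebesgue_rV R n.+1 in
  measurable D -> measurable_fun setT q0 -> (\forall x \ae mu, D x -> q0min <= q0 x) ->
  cLspace mu D 2%:E f -> cLspace mu D 2%:E (fun x => (q0 x)%:C%C * f x) ->
  q0min * ip mu D f f <= ip mu D (fun x => (q0 x)%:C%C * f x) f.
Proof.
move=> mu mD mq0 hq Lf Lq.
rewrite -subr_ge0 -mulNr -(ipZl mD _ Lf Lf) -(ipDl mD Lq (L2Z mD _ Lf) Lf).
(* Equal to [q0 x - q0min] almost everywhere on [D] and nonnegative everywhere, so that the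
   integrand is nonnegative at every point. *)
pose p x := Num.max (q0 x - q0min) 0.
have mq : measurable_fun D q0 by exact: measurable_funS mq0.
have mp : measurable_fun D p.
  by apply: measurable_maxr => //; apply: measurable_funD => //; exact: measurable_cst.
rewrite (ip_ae (f' := fun x => (p x)%:C%C * f x) mD).
- by apply: Rintegral_ge0 => x _; rewrite rdotZl mulr_ge0 ?rdot_ge0// le_max lexx orbT.
- by apply: cmeasurableD; [exact: Lq.1|exact: (L2Z mD _ Lf).1].
- by apply: cmeasurableM; [exact: cmeasurable_real|exact: Lf.1].
- exact: Lf.1.
- apply: filterS hq => x h /h h'; rewrite -mulrDl -rmorphD /= /p; congr (_%:C%C * _).
  by rewrite max_l// subr_ge0.
Qed.

(** With f = H g, the main term is at least k^2 q0min |f|^2. The superlinear part and the error of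
    the cellwise approximation each lose at most k^2 (q0min / 4) |f|^2. *)
Lemma far_field_lower (R : realType) (n : nat) (k : R)
    (D : set 'rV[R]_n.+1) (q : 'rV[R]_n.+1 * R -> R) (q0 : 'rV[R]_n.+1 -> R)
    (alpha q0min delta C rhot : R) :
  n.+1 = 2%N \/ n.+1 = 3%N -> 0 < k -> scatterer D -> contrast D q q0 alpha q0min ->
  admissible k D q q0 alpha delta -> 0 < C ->
  (forall f, dom_T k D delta f ->
    (cLnorm (lebesgue_rV R n.+1) D 2%:E
       (fun x => (op_T k D q q0 delta f x - op_T0 k D q0 f x)%R)
     <= C%:E * cLnorm (lebesgue_rV R n.+1) D +oo f `^ alpha
        * cLnorm (lebesgue_rV R n.+1) D 2%:E f)%E) ->
  rhot <= delta / Num.sqrt (sphere_area R n.+1) ->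
  exists2 V, fin_dim_subspace sphere_measure unit_sphere V &
  forall g, L2_ortho sphere_measure unit_sphere V g -> nrm sphere_measure unit_sphere g = rhot ->
    k ^+ 2 * (q0min / 2) * ip (lebesgue_rV R n.+1) D (herglotz k g) (herglotz k g) <=
    complex.Re (cinner sphere_measure unit_sphere (far_field k D q q0 delta g) g).
Proof.
move=> hd k0 hD hq hdelta C0 hC rtd; set mu := lebesgue_rV R n.+1.
have [mD finD [K K0 DK]] := scatterer_bounds hD.
have [_ mq0 a0 qm0 [Q Q0 hQ]] := contrast_bounds hq.
have [C2 C20 hF] := far_field_form hD hq hdelta C0 hC; have [d0 _ _] := hdelta.
have q0Q : \forall x \ae mu, D x -> `|q0 x| <= Q.
  apply: filterS hQ => x h /h /andP[h1 h2].
  by rewrite ger0_norm// (le_trans (ltW qm0)).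
have k20 : 0 < k ^+ 2 by rewrite exprn_gt0.
(* The superlinear part of [op_T] is absorbed by making [herglotz k g] small on [D]. *)
pose X := k ^+ 2 * q0min / (4 * C).
have X0 : 0 < X by rewrite divr_gt0 ?mulr_gt0.
pose M1 := Num.min delta (X `^ alpha^-1).
have M10 : 0 < M1 by rewrite lt_min d0 powR_gt0.
have M1d : 0 <= M1 <= delta by rewrite ltW//= ge_min lexx.
have CM : C * M1 `^ alpha <= k ^+ 2 * q0min / 4.
  apply: (@le_trans _ _ (C * X)).
    rewrite ler_wpM2l ?(ltW C0)//; apply: (@le_trans _ _ ((X `^ alpha^-1) `^ alpha)).
      by rewrite ge0_ler_powR ?nnegrE ?(ltW a0) ?powR_ge0 ?(ltW M10)// ge_min lexx orbT.
    by rewrite -powRrM mulVf ?gt_eqF// powRr1// ltW.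
  by rewrite le_eqVlt; apply/orP; left; apply/eqP; rewrite /X; field; rewrite gt_eqF.
pose S := Num.sqrt (fine (mu D)); have S0 : 0 <= S by exact: sqrtr_ge0.
(* Here [Q] bounds q0, [S] is the L^2 norm of 1 on [D], and (1 + C2) |f| bounds |f| + |v|. The error
   of the cellwise approximation is then at most N e |f| = (q0min / 4) |f|. *)
pose N := Q * (S + 1) * (1 + C2).
have N0 : 0 < N by apply: mulr_gt0; [apply: mulr_gt0 => //; rewrite ltr_wpDl|rewrite ltr_pwDl].
pose e := q0min / (4 * N); have e0 : 0 < e by rewrite divr_gt0// mulr_gt0.
have [tau tau0 htau] := op_V0_shift mD (ltW Q0) mq0 q0Q hd k0 finD DK e0.
pose L := 2 * `|k| * Num.sqrt (sphere_area R n.+1) * `|rhot| * n.+1%:R.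
have L0 : 0 <= L by rewrite !mulr_ge0 ?sqrtr_ge0.
(* A cell diameter below [tau] makes V0 f almost constant on each cell. The second bound makes f,
   which has Lipschitz constant at most [L] and vanishes at a point of each cell that meets [D], at
   most [M1] on [D]. *)
pose t := Num.min tau (M1 / (L + 1)).
have L1 : 0 < L + 1 by rewrite ltr_wpDl.
have t0 : 0 < t by rewrite lt_min tau0 divr_gt0.
have [m [E [mE hE Et]]] := finite_partition n.+1 K t0.
have DE x : D x -> exists2 j, E j x & forall i, E i x -> i = j.
  by move=> /DK xK; apply: hE; exact: le_trans (norm_le_enorm x) xK.
(* A cell that misses [D] receives the default point 0, which is never consulted at points of
   [D]. *)
pose p j := xget 0 (D `&` E j)%classic.
have pP j x : D x -> E j x -> D (p j) /\ `|x - p j| <= t.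
  move=> Dx Ex; have [Dp Ep] : (D `&` E j)%classic (p j) by apply: xgetPex; exists x.
  by split => //; exact: Et Ex Ep.
have mphi : cmeasurable setT (fun x => (q0 x)%:C%C : R[i]) by exact: cmeasurable_real.
have Lphi : cLspace mu D 2%:E (fun x => (q0 x)%:C%C).
  have [L1' _] := L2_contrast mD (ltW Q0) mq0 q0Q (L2_cst mD (1 : R[i]) finD).
  by apply: (L2_ext mD _ L1') => x _; rewrite mulr1.
have [V fV hV] := orthogonal_cells k mD finD K0 DK p mE mphi Lphi.
exists V => // g Vg ng; have Lg : cLspace sphere_measure unit_sphere 2%:E g by case: Vg.
set f := herglotz k g; have Lf : cLspace mu D 2%:E f by exact: herglotz_L2.
have fM x : D x -> Normc.normc (f x) <= M1.
  move=> Dx; have [j Ex _] := DE x Dx; have [_ xp] := pP j x Dx Ex.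
  have := herglotz_lipschitz k x (p j) Lg; have [-> _] := hV g Vg j; rewrite subr0 => h.
  apply: le_trans h _; rewrite ng mulrA.
  apply: (@le_trans _ _ ((L + 1) * t)).
    apply: ler_pM => //.
      by rewrite !mulr_ge0 ?sqrtr_ge0// -ng nrm_ge0.
    apply: (@le_trans _ _ L); last by rewrite lerDl.
    rewrite /L; apply: ler_wpM2r => //; apply: ler_wpM2l; last exact: ler_norm.
    by rewrite !mulr_ge0 ?sqrtr_ge0.
  by rewrite mulrC -ler_pdivlMr// ge_min lexx orbT.
have ngr : nrm sphere_measure unit_sphere g <= delta / Num.sqrt (sphere_area R n.+1) by rewrite ng.
have [Lv nv hT] := hF M1 g Lg ngr M1d fM; rewrite -/f -/mu in Lv nv hT *.
have [u uv hu] := htau f Lf Lv; rewrite -/f in uv hu.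
set v := op_V0 k D q0 f in Lv nv hT uv hu *.
have [Lqf _] := L2_contrast mD (ltW Q0) mq0 q0Q Lf.
have [Lqv _] := L2_contrast mD (ltW Q0) mq0 q0Q Lv.
(* [G] is [q0] times the cellwise constant approximation of [v]; it is orthogonal to [f]. *)
pose G x := \sum_j u (p j) * cut (E j) (fun x => (q0 x)%:C%C) x.
have LGj j : cLspace mu D 2%:E (fun x => u (p j) * cut (E j) (fun x => (q0 x)%:C%C) x).
  by apply: L2_scale => //; exact: L2_cut.
have LG : cLspace mu D 2%:E G by exact: L2_sum.
have G0 : ip mu D G f = 0.
  rewrite (ip_suml mD LGj Lf) big1// => j _.
  by have [_ ->] := hV g Vg j.
have Lr : cLspace mu D 2%:E (fun x => (q0 x)%:C%C * v x - G x) by exact: L2B.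
have nr : nrm mu D (fun x => (q0 x)%:C%C * v x - G x) <= q0min / 4 * nrm mu D f.
  pose W := Q * (e * (nrm mu D f + nrm mu D v)).
  have W0 : 0 <= W by apply: mulr_ge0; [exact: ltW|apply: mulr_ge0; [exact: ltW|rewrite addr_ge0 ?nrm_ge0]].
  have L1c := L2_cst mD (1 : R[i]) finD.
  have h : \forall x \ae mu, D x ->
      Normc.normc ((q0 x)%:C%C * v x - G x) <= W * Normc.normc (1 : R[i]).
    apply: filterS2 q0Q uv => x qx ux Dx; rewrite normc_cst1 mulr1.
    have [j Ex Euniq] := DE x Dx; have [Dp xp] := pP j x Dx Ex.
    have -> : G x = (q0 x)%:C%C * u (p j).
      rewrite /G (bigD1 j)//= cut_in// big1 ?addr0; first exact: mulrC.
      move=> i ij; rewrite /cut; case: ifPn; rewrite ?mulr0// inE => Ei.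
      by move: ij; rewrite (Euniq i Ei) eqxx.
    rewrite (ux Dx) -mulrBr normcM normc_real; apply: ler_pM => //; first exact: normc_ge0.
      exact: qx.
    by apply: hu => //; apply: le_trans xp _; rewrite ge_min lexx.
  apply: le_trans (nrm_dom mD W0 Lr L1c h) _.
  apply: (@le_trans _ _ (W * (1 * S))).
    by rewrite ler_wpM2l//; apply: nrm_bounded => // x _; rewrite normc_cst1.
  apply: (@le_trans _ _ (Q * (e * ((1 + C2) * nrm mu D f)) * (S + 1))).
    rewrite mul1r; apply: ler_pM => //; last by rewrite lerDl.
    rewrite ler_wpM2l ?(ltW Q0)// ler_wpM2l ?(ltW e0)//.
    by rewrite mulrDl mul1r lerD2l.
  rewrite le_eqVlt; apply/orP; left; apply/eqP.
  rewrite (_ : _ * (S + 1) = N * e * nrm mu D f); last by rewrite /N; ring.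
  by congr (_ * _); rewrite /e; field; rewrite gt_eqF.
have TE : ip mu D (op_T0 k D q0 f) f = k ^+ 2 * (ip mu D (fun x => (q0 x)%:C%C * f x) f +
    ip mu D (fun x => (q0 x)%:C%C * v x - G x) f).
  rewrite -(addr0 (ip mu D (fun x => _ * v x - G x) f)) -G0 -!ipDl//; last first.
  - by apply: L2D.
  rewrite -ipZl//; last by apply: L2D => //; exact: L2D.
  by apply: ip_ext => // x _; rewrite /op_T0 -/v subrK -mulrDr -[LHS]mulrA.
have lowq : q0min * ip mu D f f <= ip mu D (fun x => (q0 x)%:C%C * f x) f.
  apply: ip_contrast_lower => //.
  by apply: filterS hQ => x h /h /andP[].
have lowr : - (q0min / 4 * ip mu D f f) <= ip mu D (fun x => (q0 x)%:C%C * v x - G x) f.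
  rewrite -nrm_sq expr2 mulrA.
  have := ip_le_nrm mD Lr Lf; rewrite ler_norml => /andP[h _]; apply: le_trans h.
  by rewrite lerN2 ler_wpM2r// nrm_ge0.
have FT : - (k ^+ 2 * q0min / 4 * ip mu D f f) <=
    complex.Re (cinner sphere_measure unit_sphere (far_field k D q q0 delta g) g) -
    ip mu D (op_T0 k D q0 f) f.
  move: hT; rewrite ler_norml => /andP[h _]; apply: le_trans h.
  by rewrite lerN2 nrm_sq ler_wpM2r// ip_ge0.
have low : k ^+ 2 * ((q0min - q0min / 4) * ip mu D f f) <= ip mu D (op_T0 k D q0 f) f.
  by rewrite TE ler_wpM2l ?(ltW k20)// mulrBl lerD.
rewrite lerBrDl in FT; apply: le_trans FT.
apply: le_trans (lerD low (lexx _)).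
by rewrite le_eqVlt; apply/orP; left; apply/eqP; field.
Qed.

Theorem theorem5p2 (R : realType) (d : nat) (hd : d = 2%N \/ d = 3%N)
  (k : R) (k_gt0 : 0 < k)
  (D : set 'rV[R]_d) (hD : scatterer D)
  (q : 'rV[R]_d * R -> R) (q0 : 'rV[R]_d -> R) (alpha q0min : R)
  (hq : contrast D q q0 alpha q0min)
  (delta : R) (hdelta : admissible k D q q0 alpha delta)
  (B : set 'rV[R]_d) (B_open : open B) (B_bounded : bounded_set B)
  (C : R) (C_gt0 : 0 < C)
  (hC : forall f, dom_T k D delta f ->
    (cLnorm (lebesgue_rV R d) D 2%:E
       (fun x => (op_T k D q q0 delta f x - op_T0 k D q0 f x)%R)
     <= C%:E * cLnorm (lebesgue_rV R d) D +oo f `^ alpha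
        * cLnorm (lebesgue_rV R d) D 2%:E f)%E)
  (rho : R)
  (hrho : rho = Num.min (delta / Num.sqrt (sphere_area R d))
    ((Num.sqrt (sphere_area R d))^-1 *
      (k ^+ 2 * q0min / (2 * C)) `^ (alpha^-1)))
  (rhot : R) (rhot_gt0 : 0 < rhot) (rhot_le : rhot <= rho) :
  let ineq (V : set ('rV[R]_d -> R[i])) (beta : R) :=
    forall g, L2_ortho sphere_measure unit_sphere V g ->
      cLnorm sphere_measure unit_sphere 2%:E g = rhot%:E ->
      beta * complex.Re (cinner sphere_measure unit_sphere (probing k B g) g) <=
      complex.Re (cinner sphere_measure unit_sphere (far_field k D q q0 delta g) g) in
  (B `<=` D ->
    exists2 V, fin_dim_subspace sphere_measure unit_sphere V &
      forall beta, beta <= q0min / 2 -> ineq V beta) /\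
  (~ B `<=` D ->
    ~ exists V beta,
        [/\ fin_dim_subspace sphere_measure unit_sphere V, 0 < beta &
            ineq V beta]).
Proof.
have [n dn] : exists n, d = n.+1 by case: hd => ->; [exists 1%N|exists 2%N].
subst d => ineq.
have rtd : rhot <= delta / Num.sqrt (sphere_area R n.+1).
  by apply: le_trans rhot_le _; rewrite hrho ge_min lexx.
have mB := open_measurable_rV B_open; have fB := bounded_finite mB B_bounded.
have [M M0 BM] := bounded_norm_le B_bounded.
have BM' y : B y -> enorm y <= n.+1%:R * M.
  by move=> By; apply: le_trans (enorm_le_norm y) _; rewrite ler_wpM2l// BM.
have nM0 : 0 <= n.+1%:R * M by rewrite mulr_ge0// ltW.
split => [BD|nBD [V [beta [hV beta0 hin]]]].
  have [mD finD _] := scatterer_bounds hD.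
  have [V hV low] := far_field_lower hd k_gt0 hD hq hdelta C_gt0 hC rtd.
  exists V => // beta hbeta g Vg; have Lg : cLspace sphere_measure unit_sphere 2%:E g by case: Vg.
  rewrite (cLnormE Lg) => -[ng]; apply: le_trans (low g Vg ng).
  rewrite (probing_form k mB fB nM0 BM' Lg) mulrA [beta * _]mulrC.
  rewrite -[leLHS]mulrA -[leRHS]mulrA; apply: ler_wpM2l; first exact: sqr_ge0.
  (* The integral over [B] is nonnegative, so the largest beta is the worst case and one subspace
     serves for all, negative values included. *)
  apply: (le_trans (ler_wpM2r (ip_ge0 _ _ _) hbeta)); apply: ler_wpM2l.
    by have [_ _ _ qm0 _] := contrast_bounds hq; rewrite divr_ge0// ltW.
  by apply: ip_subset => //; exact: herglotz_L2.
have [g [Vg ng]] := far_field_not_bounded_below hd k_gt0 hD hq hdelta C_gt0 hC B_open B_bounded nBD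
  rhot_gt0 rtd hV beta0.
by apply/negP; rewrite -leNgt; exact: hin.
Qed.
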